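(* Let $\mathfrak h$ be a finite dimensional complex vector space, $W\subset GL(\mathfrak h)$ a finite subgroup, $c$ a conjugation-invariant complex function on the set of reflections of $W$, $b\in\mathfrak h$, $W'=W_b$ its stabilizer, and $c'$ the restriction of $c$ to the reflections in $W'$. Let $\mathrm{Res}_b:\mathcal O_c(W,\mathfrak h)_0\to\mathcal O_{c'}(W',\mathfrak h/\mathfrak h^{W'})_0$ and $\mathrm{Ind}_b:\mathcal O_{c'}(W',\mathfrak h/\mathfrak h^{W'})_0\to\mathcal O_c(W,\mathfrak h)_0$ be the parabolic restriction and induction functors. Then: (i) The functors $\mathrm{Ind}_b$ and $\mathrm{Res}_b$ are exact. (ii) One has $\mathrm{Ind}_b(\mathrm{Res}_b(M))=E^b(\widehat M_b)$ for $M\in\mathcal O_c(W,\mathfrak h)_0$.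
   Context: A reflection in $W$ is an element $s\neq1$ with $\mathrm{rk}(s-1)=1$; $S$ is the set of reflections. For $s\in S$, $\alpha_s\in\mathfrak h^*$ and $\alpha_s^\vee\in\mathfrak h$ generate $\mathrm{Im}((s-1)|_{\mathfrak h^*})$ and $\mathrm{Im}((s-1)|_{\mathfrak h})$, with $(\alpha_s,\alpha_s^\vee)=2$; $\lambda_s$ is the nontrivial eigenvalue of $s$ in $\mathfrak h^*$. $H_c(W,\mathfrak h)$ is the quotient of $\mathbb C[W]\ltimes T(\mathfrak h\oplus\mathfrak h^* )$ by $[x,x']=0$, $[y,y']=0$, $[y,x]=(y,x)-\sum_{s\in S}c_s(y,\alpha_s)(x,\alpha_s^\vee)s$ ($x,x'\in\mathfrak h^*$, $y,y'\in\mathfrak h$). $\mathcal O_c(W,\mathfrak h)_0$ is the category of $H_c(W,\mathfrak h)$-modules finitely generated over $\mathbb C[\mathfrak h]$ and locally nilpotent under $\mathfrak h$. Completions. $\widehat{H_c}(W,\mathfrak h)_b=\widehat{\mathbb C[\mathfrak h]^W}\otimes_{\mathbb C[\mathfrak h]^W}H_c(W,\mathfrak h)$, with $\mathbb C[\mathfrak h]^W$ completed at the image of $b$ in $\mathfrak h/W$. $\widehat{\mathcal O}_c(W,\mathfrak h)^b$ is the category of $\widehat{H_c}(W,\mathfrak h)_b$-modules finitely generated over the algebra of functions on the formal neighborhood of the orbit $Wb$. For $M\in\mathcal O_c(W,\mathfrak h)_0$ put $\widehat M_b=\widehat{H_c}(W,\mathfrak h)_b\otimes_{H_c(W,\mathfrak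 h)}M$. For $N\in\widehat{\mathcal O}_c(W,\mathfrak h)^b$, $E^b(N)\in\mathcal O_c(W,\mathfrak h)_0$ is the space of $\mathfrak h$-nilpotent vectors in $N$. For $b=0$ write $E=E^0$. These notations apply also to $(W',\mathfrak h)$ with parameter $c'$. Centralizer algebra. For finite groups $G\supset H$ and an algebra $A\supset\mathbb C[H]$, let $P=\mathrm{Fun}_H(G,A)$ be the right $A$-module of functions $f:G\to A$ with $f(hg)=hf(g)$, and $Z(G,H,A)=\mathrm{End}_A(P)$. The functor $I(N)=P\otimes_AN=\mathrm{Fun}_H(G,N)$ is an equivalence from $A$-modules to $Z(G,H,A)$-modules. Isomorphism $\theta$. There is an isomorphism $\theta:\widehat{H_c}(W,\mathfrak h)_b\to Z(W,W_b,\widehat{H_{c'}}(W_b,\mathfrak h)_0)$ given, for $f\in\mathrm{Fun}_{W_b}(W,\widehat{H_{c'}}(W_b,\mathfrak h)_0)$ and $w\in W$, by $(\theta(u)f)(w)=f(wu)$ ($u\in W$); $(\theta(x_\alpha)f)(w)=(x^{(b)}_{w\alpha}+(w\alpha,b))f(w)$ ($\alpha\in\mathfrak h^*$); and $(\theta(y_a)f)(w)=y^{(b)}_{wa}f(w)+\sum_{s\in S,\,s\notin W_b}\frac{2c_s}{1-\lambda_s}\frac{\alpha_s(wa)}{x^{(b)}_{\alpha_s}+\alpha_s(b)}(f(sw)-f(w))$ ($a\in\mathfrak h$). Here $x_\alpha,y_a\in H_c(W,\mathfrak h)$ and $x^{(b)}_\alpha,y^{(b)}_a\in H_{c'}(W_b,\mathfrak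 h)$ are the generators attached to $\alpha,a$. Let $\theta_*$ be the induced equivalence from $\widehat{H_c}(W,\mathfrak h)_b$-modules to $Z(W,W_b,\widehat{H_{c'}}(W_b,\mathfrak h)_0)$-modules. The equivalence $\zeta:\mathcal O_{c'}(W',\mathfrak h)_0\to\mathcal O_{c'}(W',\mathfrak h/\mathfrak h^{W'})_0$ is $\zeta(M)=\{v\in M: yv=0\ \forall y\in\mathfrak h^{W'}\}$ (identifying $\mathfrak h/\mathfrak h^{W'}$ with the $W'$-stable complement of $\mathfrak h^{W'}$). Functors: $\mathrm{Res}_b(M)=(\zeta\circ E\circ I^{-1}\circ\theta_* )(\widehat M_b)$ and $\mathrm{Ind}_b(N)=(E^b\circ\theta_*^{-1}\circ I)(\widehat{\zeta^{-1}(N)}_0)$. *)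

(* Defs.v *)
From HB Require Import structures.
From mathcomp Require Import all_boot all_order all_algebra all_fingroup ring.
From mathcomp Require Import boolp classical_sets reals complex generic_quotient.

Set Implicit Arguments.
Unset Strict Implicit.
Unset Printing Implicit Defensive.

Import GRing.Theory Num.Theory.
Local Open Scope quotient_scope.
Local Open Scope ring_scope.

(* The associative unital F-algebra with generators X and relations r: formal
   expressions modulo the smallest congruence containing r and the axioms. *)

Section PresentedAlgebra.
Variables (F : comNzRingType) (X : Type).

Inductive pterm : Type :=
  | Scal of F
  | Gen of X
  | Sum of pterm & pterm
  | Prod of pterm & pterm.

HB.instance Definition _ := gen_eqMixin pterm.
HB.instance Definition _ := gen_choiceMixin pterm.

Definition psum (l : seq pterm) : pterm := foldr Sum (Scal 0) l.

Variable r : pterm -> pterm -> Prop.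

Inductive pcong : pterm -> pterm -> Prop :=
  | pc_rel t u of r t u : pcong t u
  | pc_refl t : pcong t t
  | pc_sym t u of pcong t u : pcong u t
  | pc_trans t u v of pcong t u & pcong u v : pcong t v
  | pc_Sum t t' u u' of pcong t t' & pcong u u' : pcong (Sum t u) (Sum t' u')
  | pc_Prod t t' u u' of pcong t t' & pcong u u' : pcong (Prod t u) (Prod t' u')
  | pc_addA t u v : pcong (Sum t (Sum u v)) (Sum (Sum t u) v)
  | pc_addC t u : pcong (Sum t u) (Sum u t)
  | pc_add0 t : pcong (Sum (Scal 0) t) t
  | pc_mulA t u v : pcong (Prod t (Prod u v)) (Prod (Prod t u) v)
  | pc_mul1 t : pcong (Prod (Scal 1) t) t
  | pc_mul0 t : pcong (Prod (Scal 0) t) (Scal 0)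
  | pc_mulDl t u v : pcong (Prod (Sum t u) v) (Sum (Prod t v) (Prod u v))
  | pc_mulDr t u v : pcong (Prod t (Sum u v)) (Sum (Prod t u) (Prod t v))
  | pc_scalD a b : pcong (Scal (a + b)) (Sum (Scal a) (Scal b))
  | pc_scalM a b : pcong (Scal (a * b)) (Prod (Scal a) (Scal b))
  | pc_scalC a t : pcong (Prod (Scal a) t) (Prod t (Scal a)).

Definition pcongb : rel pterm := fun t u => `[< pcong t u >].

Lemma pcongb_refl : reflexive pcongb.
Proof. by move=> t; apply/asboolP; exact: pc_refl. Qed.
Lemma pcongb_sym : symmetric pcongb.
Proof. by move=> t u; apply/asboolP/asboolP; exact: pc_sym. Qed.
Lemma pcongb_trans : transitive pcongb.
Proof. by move=> u t v /asboolP h /asboolP h'; apply/asboolP; exact: pc_trans h h'. Qed.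

Canonical pcong_equiv := EquivRel pcongb pcongb_refl pcongb_sym pcongb_trans.

Definition palg := {eq_quot pcong_equiv}.

HB.instance Definition _ := Choice.on palg.

Definition ppi (t : pterm) : palg := \pi_palg t.

Lemma ppiP t u : ppi t = ppi u <-> pcong t u.
Proof. by split => [/eqmodP/asboolP//|h]; apply/eqmodP/asboolP. Qed.

Lemma ppi_repr p : ppi (repr p) = p. Proof. exact: reprK. Qed.

Lemma repr_ppi t : pcong (repr (ppi t)) t.
Proof. by apply/ppiP; rewrite ppi_repr. Qed.

Definition padd (p q : palg) : palg := ppi (Sum (repr p) (repr q)).
Definition pmul (p q : palg) : palg := ppi (Prod (repr p) (repr q)).
Definition popp (p : palg) : palg := ppi (Prod (Scal (-1)) (repr p)).

Lemma paddE t u : padd (ppi t) (ppi u) = ppi (Sum t u).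
Proof. by apply/ppiP/pc_Sum; exact: repr_ppi. Qed.
Lemma pmulE t u : pmul (ppi t) (ppi u) = ppi (Prod t u).
Proof. by apply/ppiP/pc_Prod; exact: repr_ppi. Qed.
Lemma poppE t : popp (ppi t) = ppi (Prod (Scal (-1)) t).
Proof. by apply/ppiP/pc_Prod; [exact: pc_refl|exact: repr_ppi]. Qed.

Lemma palg_quotP (P : palg -> Prop) : (forall t, P (ppi t)) -> forall p, P p.
Proof. by move=> h p; rewrite -[p]ppi_repr. Qed.

Lemma paddA : associative padd.
Proof.
elim/palg_quotP=> t; elim/palg_quotP=> u; elim/palg_quotP=> v.
by rewrite !paddE; apply/ppiP; exact: pc_addA.
Qed.
Lemma paddC : commutative padd.
Proof.
by elim/palg_quotP=> t; elim/palg_quotP=> u; rewrite !paddE; apply/ppiP; exact: pc_addC.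
Qed.
Lemma padd0 : left_id (ppi (Scal 0)) padd.
Proof. by elim/palg_quotP=> t; rewrite !paddE; apply/ppiP; exact: pc_add0. Qed.
Lemma paddN : left_inverse (ppi (Scal 0)) popp padd.
Proof.
elim/palg_quotP=> t; rewrite poppE paddE; apply/ppiP.
apply: (@pc_trans _ (Sum (Prod (Scal (-1)) t) (Prod (Scal 1) t))).
  by apply: pc_Sum; [exact: pc_refl|apply: pc_sym; exact: pc_mul1].
apply: pc_trans (pc_sym (pc_mulDl _ _ _)) _.
apply: (@pc_trans _ (Prod (Scal 0) t)); last exact: pc_mul0.
apply: pc_Prod; last exact: pc_refl.
by apply: pc_sym; rewrite -[0](addNr 1); exact: pc_scalD.
Qed.
Lemma pmulA : associative pmul.
Proof.
elim/palg_quotP=> t; elim/palg_quotP=> u; elim/palg_quotP=> v.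
by rewrite !pmulE; apply/ppiP; exact: pc_mulA.
Qed.
Lemma pmul1 : left_id (ppi (Scal 1)) pmul.
Proof. by elim/palg_quotP=> t; rewrite !pmulE; apply/ppiP; exact: pc_mul1. Qed.
Lemma pmulr1 : right_id (ppi (Scal 1)) pmul.
Proof.
elim/palg_quotP=> t; rewrite !pmulE; apply/ppiP.
exact: pc_trans (pc_sym (pc_scalC _ _)) (pc_mul1 _).
Qed.
Lemma pmulDl : left_distributive pmul padd.
Proof.
elim/palg_quotP=> t; elim/palg_quotP=> u; elim/palg_quotP=> v.
by rewrite !(pmulE, paddE); apply/ppiP; exact: pc_mulDl.
Qed.
Lemma pmulDr : right_distributive pmul padd.
Proof.
elim/palg_quotP=> t; elim/palg_quotP=> u; elim/palg_quotP=> v.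
by rewrite !(pmulE, paddE); apply/ppiP; exact: pc_mulDr.
Qed.

HB.instance Definition _ := GRing.isZmodule.Build palg paddA paddC padd0 paddN.
HB.instance Definition _ :=
  GRing.Zmodule_isPzRing.Build palg pmulA pmul1 pmulr1 pmulDl pmulDr.

Definition pscal (a : F) : palg := ppi (Scal a).
Definition pgen (x : X) : palg := ppi (Gen x).

Lemma ppiD t u : ppi (Sum t u) = ppi t + ppi u. Proof. by rewrite -paddE. Qed.
Lemma ppiM t u : ppi (Prod t u) = ppi t * ppi u. Proof. by rewrite -pmulE. Qed.

Lemma pscal_zmod : zmod_morphism pscal.
Proof.
move=> a b; apply/(canRL (addrK _)); rewrite /pscal -ppiD; apply/ppiP.
by apply: pc_sym; rewrite -{1}(subrK b a); exact: pc_scalD.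
Qed.
Lemma pscal_monoid : monoid_morphism pscal.
Proof. by split=> // a b; rewrite /pscal -ppiM; apply/ppiP; exact: pc_scalM. Qed.

HB.instance Definition _ := GRing.isZmodMorphism.Build F palg pscal pscal_zmod.
HB.instance Definition _ := GRing.isMonoidMorphism.Build F palg pscal pscal_monoid.

Lemma pscalC a p : pscal a * p = p * pscal a.
Proof. by elim/palg_quotP: p => t; rewrite /pscal -!ppiM; apply/ppiP; exact: pc_scalC. Qed.

Lemma ppi_rel t u : r t u -> ppi t = ppi u.
Proof. by move=> h; apply/ppiP; exact: pc_rel. Qed.

Lemma ppi_psum l : ppi (psum l) = \sum_(t <- l) ppi t.
Proof. by elim: l => [|t l IH]; rewrite ?big_nil ?raddf0 // big_cons -IH -ppiD. Qed.

Lemma palg_ind (P : palg -> Prop) :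
  (forall a, P (pscal a)) -> (forall x, P (pgen x)) ->
  (forall p q, P p -> P q -> P (p + q)) ->
  (forall p q, P p -> P q -> P (p * q)) -> forall p, P p.
Proof.
move=> Ps Pg PD PM; elim/palg_quotP; elim=> // t ht u hu.
  by rewrite ppiD; exact: PD.
by rewrite ppiM; exact: PM.
Qed.

Section Lift.
Variables (B : pzRingType) (s : {rmorphism F -> B}) (g : X -> B).

Fixpoint peval (t : pterm) : B :=
  match t with
  | Scal a => s a
  | Gen x => g x
  | Sum t u => peval t + peval u
  | Prod t u => peval t * peval u
  end.

Hypothesis sC : forall a b, s a * b = b * s a.
Hypothesis gr : forall t u, r t u -> peval t = peval u.

Lemma peval_cong t u : pcong t u -> peval t = peval u.
Proof.
elim=> {t u} //=; try by move=> *; congruence.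
- by move=> *; exact: addrA.
- by move=> *; exact: addrC.
- by move=> *; rewrite rmorph0 add0r.
- by move=> *; exact: mulrA.
- by move=> *; rewrite rmorph1 mul1r.
- by move=> *; rewrite rmorph0 mul0r.
- by move=> *; exact: mulrDl.
- by move=> *; exact: mulrDr.
- by move=> *; exact: rmorphD.
- by move=> *; exact: rmorphM.
Qed.

Definition plift of (forall a b, s a * b = b * s a)
  & (forall t u, r t u -> peval t = peval u) :=
  fun p : palg => peval (repr p).

Local Notation L := (plift sC gr).

Lemma plift_pi t : L (ppi t) = peval t.
Proof. by apply: peval_cong; exact: repr_ppi. Qed.

Lemma plift_gen x : L (pgen x) = g x. Proof. exact: plift_pi. Qed.
Lemma plift_scal a : L (pscal a) = s a. Proof. exact: plift_pi. Qed.

Lemma plift_zmod : zmod_morphism L.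
Proof.
move=> p q; apply/(canRL (addrK _)).
have LD p' q' : L (p' + q') = L p' + L q'.
  elim/palg_quotP: p' => t; elim/palg_quotP: q' => u.
  by rewrite -ppiD !plift_pi.
by rewrite -LD subrK.
Qed.
Lemma plift_monoid : monoid_morphism L.
Proof.
split; first by rewrite plift_scal rmorph1.
by elim/palg_quotP=> t; elim/palg_quotP=> u; rewrite -ppiM !plift_pi.
Qed.

HB.instance Definition _ := GRing.isZmodMorphism.Build palg B L plift_zmod.
HB.instance Definition _ := GRing.isMonoidMorphism.Build palg B L plift_monoid.

End Lift.

End PresentedAlgebra.

Arguments Scal {F X}.
Arguments Gen {F X}.
Arguments Sum {F X}.
Arguments Prod {F X}.

(* The left B-module with generators X and relations r, by the same method. *)

Section PresentedModule.
Variables (B : pzRingType) (X : Type).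

Inductive mterm : Type :=
  | MZero
  | MGen of X
  | MSum of mterm & mterm
  | MScale of B & mterm.

HB.instance Definition _ := gen_eqMixin mterm.
HB.instance Definition _ := gen_choiceMixin mterm.

Variable r : mterm -> mterm -> Prop.

Inductive mcong : mterm -> mterm -> Prop :=
  | mc_rel t u of r t u : mcong t u
  | mc_refl t : mcong t t
  | mc_sym t u of mcong t u : mcong u t
  | mc_trans t u v of mcong t u & mcong u v : mcong t v
  | mc_Sum t t' u u' of mcong t t' & mcong u u' : mcong (MSum t u) (MSum t' u')
  | mc_Scale b t t' of mcong t t' : mcong (MScale b t) (MScale b t')
  | mc_addA t u v : mcong (MSum t (MSum u v)) (MSum (MSum t u) v)
  | mc_addC t u : mcong (MSum t u) (MSum u t)
  | mc_add0 t : mcong (MSum MZero t) t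
  | mc_scale0 t : mcong (MScale 0 t) MZero
  | mc_scale1 t : mcong (MScale 1 t) t
  | mc_scaleA a b t : mcong (MScale a (MScale b t)) (MScale (a * b) t)
  | mc_scaleDr a t u : mcong (MScale a (MSum t u)) (MSum (MScale a t) (MScale a u))
  | mc_scaleDl a b t : mcong (MScale (a + b) t) (MSum (MScale a t) (MScale b t)).

Definition mcongb : rel mterm := fun t u => `[< mcong t u >].

Lemma mcongb_refl : reflexive mcongb.
Proof. by move=> t; apply/asboolP; exact: mc_refl. Qed.
Lemma mcongb_sym : symmetric mcongb.
Proof. by move=> t u; apply/asboolP/asboolP; exact: mc_sym. Qed.
Lemma mcongb_trans : transitive mcongb.
Proof. by move=> u t v /asboolP h /asboolP h'; apply/asboolP; exact: mc_trans h h'. Qed.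

Canonical mcong_equiv := EquivRel mcongb mcongb_refl mcongb_sym mcongb_trans.

Definition pmod := {eq_quot mcong_equiv}.

HB.instance Definition _ := Choice.on pmod.

Definition mpi (t : mterm) : pmod := \pi_pmod t.

Lemma mpiP t u : mpi t = mpi u <-> mcong t u.
Proof. by split => [/eqmodP/asboolP//|h]; apply/eqmodP/asboolP. Qed.

Lemma mpi_repr p : mpi (repr p) = p. Proof. exact: reprK. Qed.

Lemma repr_mpi t : mcong (repr (mpi t)) t.
Proof. by apply/mpiP; rewrite mpi_repr. Qed.

Definition madd (p q : pmod) : pmod := mpi (MSum (repr p) (repr q)).
Definition mscale (b : B) (p : pmod) : pmod := mpi (MScale b (repr p)).
Definition mopp (p : pmod) : pmod := mscale (-1) p.

Lemma maddE t u : madd (mpi t) (mpi u) = mpi (MSum t u).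
Proof. by apply/mpiP/mc_Sum; exact: repr_mpi. Qed.
Lemma mscaleE b t : mscale b (mpi t) = mpi (MScale b t).
Proof. by apply/mpiP/mc_Scale; exact: repr_mpi. Qed.

Lemma pmod_quotP (P : pmod -> Prop) : (forall t, P (mpi t)) -> forall p, P p.
Proof. by move=> h p; rewrite -[p]mpi_repr. Qed.

Lemma maddA : associative madd.
Proof.
elim/pmod_quotP=> t; elim/pmod_quotP=> u; elim/pmod_quotP=> v.
by rewrite !maddE; apply/mpiP; exact: mc_addA.
Qed.
Lemma maddC : commutative madd.
Proof.
by elim/pmod_quotP=> t; elim/pmod_quotP=> u; rewrite !maddE; apply/mpiP; exact: mc_addC.
Qed.
Lemma madd0 : left_id (mpi MZero) madd.
Proof. by elim/pmod_quotP=> t; rewrite !maddE; apply/mpiP; exact: mc_add0. Qed.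
Lemma maddN : left_inverse (mpi MZero) mopp madd.
Proof.
elim/pmod_quotP=> t; rewrite /mopp mscaleE maddE; apply/mpiP.
apply: (@mc_trans _ (MSum (MScale (-1) t) (MScale 1 t))).
  by apply: mc_Sum; [exact: mc_refl|apply: mc_sym; exact: mc_scale1].
apply: mc_trans (mc_sym (mc_scaleDl _ _ _)) _.
by rewrite addNr; exact: mc_scale0.
Qed.

HB.instance Definition _ := GRing.isZmodule.Build pmod maddA maddC madd0 maddN.

Lemma mscaleA a b p : mscale a (mscale b p) = mscale (a * b) p.
Proof. by elim/pmod_quotP: p => t; rewrite !mscaleE; apply/mpiP; exact: mc_scaleA. Qed.
Lemma mscale1 : left_id 1 mscale.
Proof. by elim/pmod_quotP=> t; rewrite !mscaleE; apply/mpiP; exact: mc_scale1. Qed.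
Lemma mscaleDr : right_distributive mscale +%R.
Proof.
move=> a; elim/pmod_quotP=> t; elim/pmod_quotP=> u.
by rewrite /GRing.add /= !(maddE, mscaleE); apply/mpiP; exact: mc_scaleDr.
Qed.
Lemma mscaleDl p : {morph mscale^~ p : a b / a + b}.
Proof.
move=> a b; elim/pmod_quotP: p => t.
by rewrite [RHS]/GRing.add /= !(maddE, mscaleE); apply/mpiP; exact: mc_scaleDl.
Qed.

HB.instance Definition _ :=
  GRing.Zmodule_isLmodule.Build B pmod mscaleA mscale1 mscaleDr mscaleDl.

Definition mgen (x : X) : pmod := mpi (MGen x).

Lemma mpiD t u : mpi (MSum t u) = mpi t + mpi u. Proof. by rewrite -maddE. Qed.
Lemma mpiZ b t : mpi (MScale b t) = b *: mpi t. Proof. by rewrite -mscaleE. Qed.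
Lemma mpi0 : mpi MZero = 0. Proof. by []. Qed.
Lemma mpi_rel t u : r t u -> mpi t = mpi u.
Proof. by move=> h; apply/mpiP; exact: mc_rel. Qed.

Section Lift.
Variables (M : lmodType B) (g : X -> M).

Fixpoint meval (t : mterm) : M :=
  match t with
  | MZero => 0
  | MGen x => g x
  | MSum t u => meval t + meval u
  | MScale b t => b *: meval t
  end.

Hypothesis gr : forall t u, r t u -> meval t = meval u.

Lemma meval_cong t u : mcong t u -> meval t = meval u.
Proof.
elim=> {t u} //=; try by move=> *; congruence.
- by move=> *; exact: addrA.
- by move=> *; exact: addrC.
- by move=> *; exact: add0r.
- by move=> *; exact: scale0r.
- by move=> *; exact: scale1r.
- by move=> *; exact: scalerA.
- by move=> *; exact: scalerDr.
- by move=> *; exact: scalerDl.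
Qed.

Definition mlift of (forall t u, r t u -> meval t = meval u) :=
  fun p : pmod => meval (repr p).

Local Notation L := (mlift gr).

Lemma mlift_pi t : L (mpi t) = meval t.
Proof. by apply: meval_cong; exact: repr_mpi. Qed.

Lemma mlift_gen x : L (mgen x) = g x. Proof. exact: mlift_pi. Qed.

Lemma mlift_linear : linear L.
Proof.
move=> a; elim/pmod_quotP=> t; elim/pmod_quotP=> u.
by rewrite -mpiZ -mpiD !mlift_pi.
Qed.

HB.instance Definition _ := GRing.isLinear.Build B pmod M *:%R L mlift_linear.

End Lift.

End PresentedModule.

Arguments MZero {B X}.
Arguments MGen {B X}.
Arguments MSum {B X}.
Arguments MScale {B X}.


Record prefunctor (A B : pzRingType) := Prefunctor {
  fobj :> lmodType A -> lmodType B;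
  fmap : forall M N : lmodType A, {linear M -> N} -> {linear fobj M -> fobj N} }.
Arguments fmap {A B} p {M N}.

Definition functor_id (A : pzRingType) : prefunctor A A :=
  Prefunctor (fun (M N : lmodType A) (f : {linear M -> N}) => f).

Definition functor_comp (A B D : pzRingType)
    (G : prefunctor B D) (F : prefunctor A B) : prefunctor A D :=
  Prefunctor (fun M N (f : {linear M -> N}) => fmap G (fmap F f)).

(* P and Q stand for the full subcategories of the modules satisfying them. *)
Section FunctorProperties.
Variables (A B : pzRingType) (P : lmodType A -> Prop) (Q : lmodType B -> Prop).

Definition is_functor (F : prefunctor A B) : Prop :=
  [/\ forall M, P M -> Q (F M),
      forall M : lmodType A, P M -> fmap F (idfun : {linear M -> M}) =1 id
    & forall (M N K : lmodType A) (f : {linear M -> N}) (g : {linear N -> K}),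
        P M -> P N -> P K ->
        fmap F (g \o f : {linear M -> K}) =1 fmap F g \o fmap F f].

Definition short_exact (D : pzRingType) (M N K : lmodType D)
    (f : {linear M -> N}) (g : {linear N -> K}) : Prop :=
  [/\ injective f,
      forall v, g v = 0 <-> exists u, f u = v
    & forall w, exists v, g v = w].

(* When P and Q are closed under submodules and quotients, as category O is,
   this is exactness between the abelian categories P and Q. *)
Definition exact_functor (F : prefunctor A B) : Prop :=
  is_functor F /\
  forall (M N K : lmodType A) (f : {linear M -> N}) (g : {linear N -> K}),
    P M -> P N -> P K -> short_exact f g -> short_exact (fmap F f) (fmap F g).

Definition nat_isomorphic (F G : prefunctor A B) : Prop :=
  exists eta : forall M : lmodType A, {linear F M -> G M},
    (forall M, P M -> bijective (eta M)) /\
    (forall (M N : lmodType A) (f : {linear M -> N}), P M -> P N ->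
       eta N \o fmap F f =1 fmap G f \o eta M).

End FunctorProperties.

Definition quasi_inverse (A B : pzRingType)
    (P : lmodType A -> Prop) (Q : lmodType B -> Prop)
    (F : prefunctor A B) (G : prefunctor B A) : Prop :=
  [/\ is_functor P Q F, is_functor Q P G,
      nat_isomorphic P (functor_comp G F) (functor_id A)
    & nat_isomorphic Q (functor_comp F G) (functor_id B)].


Section Restriction.
Variables (A B : pzRingType) (phi : {rmorphism A -> B}).

Definition restr of {rmorphism A -> B} := fun M : lmodType B => (M : Type).
Local Notation rM M := (restr phi M).

Section Object.
Variable M : lmodType B.
HB.instance Definition _ := GRing.Zmodule.on (rM M).
Definition restr_scale (a : A) (v : rM M) : rM M := phi a *: (v : M).
Lemma restr_scaleA a b v : restr_scale a (restr_scale b v) = restr_scale (a * b) v.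
Proof. by rewrite /restr_scale rmorphM scalerA. Qed.
Lemma restr_scale1 : left_id 1 restr_scale.
Proof. by move=> v; rewrite /restr_scale rmorph1 scale1r. Qed.
Lemma restr_scaleDr : right_distributive restr_scale +%R.
Proof. by move=> a u v; exact: scalerDr. Qed.
Lemma restr_scaleDl v : {morph restr_scale^~ v : a b / a + b}.
Proof. by move=> a b; rewrite /restr_scale rmorphD scalerDl. Qed.
HB.instance Definition _ := GRing.Zmodule_isLmodule.Build A (rM M)
  restr_scaleA restr_scale1 restr_scaleDr restr_scaleDl.
Lemma restrZ a (v : rM M) : a *: v = phi a *: (v : M). Proof. by []. Qed.
End Object.

Definition restr_map (M N : lmodType B) (f : {linear M -> N}) : rM M -> rM N := f.
Lemma restr_map_linear (M N : lmodType B) (f : {linear M -> N}) : linear (restr_map f).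
Proof. by move=> a u v; rewrite /restr_map linearD linearZ. Qed.
HB.instance Definition _ (M N : lmodType B) (f : {linear M -> N}) :=
  GRing.isLinear.Build A (rM M) (rM N) *:%R (restr_map f) (restr_map_linear f).

Definition restr_functor : prefunctor B A :=
  @Prefunctor B A (fun M => rM M) (fun M N f => restr_map f).
End Restriction.

(* P (x)_A N as a left B-module, where P is a (B, A)-bimodule with left action la
   and right action ra: generated by the symbols p (x) n = (p, n). *)

Section Tensor.
Variables (B A : pzRingType) (P : zmodType) (la : B -> P -> P) (ra : P -> A -> P).

Section Object.
Variable N : lmodType A.

Inductive tens_rel : mterm B (P * N) -> mterm B (P * N) -> Prop :=
  | tens_addl p q n :
      tens_rel (MGen (p + q, n)) (MSum (MGen (p, n)) (MGen (q, n)))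
  | tens_addr p n m :
      tens_rel (MGen (p, n + m)) (MSum (MGen (p, n)) (MGen (p, m)))
  | tens_bal p a n : tens_rel (MGen (ra p a, n)) (MGen (p, a *: n))
  | tens_act b p n : tens_rel (MGen (la b p, n)) (MScale b (MGen (p, n))).

Definition tensor : lmodType B := pmod tens_rel.
Definition tens (p : P) (n : N) : tensor := mgen tens_rel (p, n).
End Object.

Section Map.
Variables (M N : lmodType A) (f : {linear M -> N}).
Let g (u : P * M) : tensor N := tens u.1 (f u.2).
Lemma tensor_map_rel t u : tens_rel t u -> meval g t = meval g u.
Proof.
case=> [p q n|p n m|p a n|b p n] /=; rewrite /g /= /tens /mgen.
- by rewrite -mpiD; apply: mpi_rel; exact: tens_addl.
- by rewrite linearD -mpiD; apply: mpi_rel; exact: tens_addr.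
- by rewrite linearZ; apply: mpi_rel; exact: tens_bal.
- by rewrite -mpiZ; apply: mpi_rel; exact: tens_act.
Qed.
Definition tensor_map : {linear tensor M -> tensor N} := mlift tensor_map_rel.
Lemma tensor_mapE p n : tensor_map (tens p n) = tens p (f n).
Proof. exact: mlift_gen. Qed.
End Map.

Definition tensor_functor : prefunctor A B := Prefunctor tensor_map.
End Tensor.

Definition extension_functor (A B : pzRingType) (phi : {rmorphism A -> B}) :
    prefunctor A B :=
  tensor_functor (P := B) (fun b p => b * p) (fun p a => p * phi a).


Section Submodule.
Variables (A : pzRingType) (M : lmodType A).

Record submodule := Submodule {
  sm_set :> M -> Prop;
  sm0 : sm_set 0;
  smD : forall u v, sm_set u -> sm_set v -> sm_set (u + v);
  smZ : forall a v, sm_set v -> sm_set (a *: v) }.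

Variable S : submodule.
Definition sm_pred : {pred M} := fun v => `[< S v >].
Lemma sm_predP v : reflect (S v) (v \in sm_pred). Proof. exact: asboolP. Qed.
Lemma sm_closed : subsemimod_closed sm_pred.
Proof.
split; first split; first exact/sm_predP/sm0.
  by move=> u v /sm_predP hu /sm_predP hv; apply/sm_predP/smD.
by move=> a v /sm_predP hv; apply/sm_predP/smZ.
Qed.

Definition smtype := {v : M | v \in sm_pred}.
HB.instance Definition _ := SubChoice.on smtype.
Lemma sm_zmod_closed : zmod_closed sm_pred.
Proof.
split; first exact/sm_predP/sm0.
move=> u v /sm_predP hu /sm_predP hv; apply/sm_predP/smD => //.
by rewrite -scaleN1r; exact: smZ.
Qed.
HB.instance Definition _ := GRing.SubChoice_isSubZmodule.Build M sm_pred smtype sm_zmod_closed.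
HB.instance Definition _ := GRing.SubZmodule_isSubLmodule.Build A M sm_pred smtype sm_closed.
End Submodule.

Section SubmoduleMap.
Variables (A : pzRingType) (M N : lmodType A) (S : submodule M) (T : submodule N).
Variables (f : {linear M -> N}) (fST : forall v, S v -> T (f v)).

Lemma sm_map_subproof (u : smtype S) : f (val u) \in sm_pred T.
Proof. by apply/sm_predP/fST/sm_predP; exact: valP. Qed.
Definition sm_map (u : smtype S) : smtype T := Sub (f (val u)) (sm_map_subproof u).
Lemma sm_map_linear : linear sm_map.
Proof. by move=> a u v; apply: val_inj; rewrite /= linearD linearZ. Qed.
HB.instance Definition _ :=
  GRing.isLinear.Build A (smtype S) (smtype T) *:%R sm_map sm_map_linear.
End SubmoduleMap.

(* hfun is Fun_H(G, A), a right A-module by hfun_act, and centr its ring of right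
   A-linear endomorphisms Z(G, H, A); iota gives the elements of H inside A. *)

Section Centralizer.
Variables (gT : finGroupType) (H : {group gT}) (A : pzRingType).
Variable iota : subg_of H -> A.

Record hfun := HFun {
  hfun_fun :> gT -> A;
  hfunP : forall (h : subg_of H) (g : gT),
    hfun_fun (sgval h * g)%g = iota h * hfun_fun g }.

HB.instance Definition _ := gen_eqMixin hfun.
HB.instance Definition _ := gen_choiceMixin hfun.

Lemma hfun_ext (f f' : hfun) : f =1 f' -> f = f'.
Proof.
case: f f' => f fP [f' f'P] /= /funext ff'; rewrite ff' in fP *.
by congr HFun; exact: Prop_irrelevance.
Qed.

Program Definition hfun0 : hfun := @HFun (fun=> 0) _.
Next Obligation. by rewrite mulr0. Qed.
Program Definition hfun_opp (f : hfun) : hfun := @HFun (fun g => - f g) _.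
Next Obligation. by rewrite hfunP mulrN. Qed.
Program Definition hfun_add (f f' : hfun) : hfun := @HFun (fun g => f g + f' g) _.
Next Obligation. by rewrite !hfunP mulrDr. Qed.
Program Definition hfun_act (f : hfun) (a : A) : hfun := @HFun (fun g => f g * a) _.
Next Obligation. by rewrite hfunP mulrA. Qed.

Lemma hfun_addA : associative hfun_add.
Proof. by move=> f f' f''; apply: hfun_ext => g; exact: addrA. Qed.
Lemma hfun_addC : commutative hfun_add.
Proof. by move=> f f'; apply: hfun_ext => g; exact: addrC. Qed.
Lemma hfun_add0 : left_id hfun0 hfun_add.
Proof. by move=> f; apply: hfun_ext => g; exact: add0r. Qed.
Lemma hfun_addN : left_inverse hfun0 hfun_opp hfun_add.
Proof. by move=> f; apply: hfun_ext => g; exact: addNr. Qed.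
HB.instance Definition _ :=
  GRing.isZmodule.Build hfun hfun_addA hfun_addC hfun_add0 hfun_addN.

Lemma hfunDE (f f' : hfun) g : (f + f') g = f g + f' g. Proof. by []. Qed.

Record centr := Centr {
  centr_fun :> hfun -> hfun;
  centrD : forall f f', centr_fun (f + f') = centr_fun f + centr_fun f';
  centrA : forall f a, centr_fun (hfun_act f a) = hfun_act (centr_fun f) a }.

HB.instance Definition _ := gen_eqMixin centr.
HB.instance Definition _ := gen_choiceMixin centr.

Lemma centr_ext (u v : centr) : u =1 v -> u = v.
Proof.
case: u v => u uD uA [v vD vA] /= /funext uv; rewrite uv in uD uA *.
by congr Centr; exact: Prop_irrelevance.
Qed.

Program Definition centr0 : centr := @Centr (fun=> 0) _ _.
Next Obligation. by rewrite addr0. Qed.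
Next Obligation. by apply: hfun_ext => g /=; rewrite mul0r. Qed.
Program Definition centr_opp (u : centr) : centr := @Centr (fun f => - u f) _ _.
Next Obligation. by rewrite centrD opprD. Qed.
Next Obligation. by rewrite centrA; apply: hfun_ext => g /=; rewrite mulNr. Qed.
Program Definition centr_add (u v : centr) : centr := @Centr (fun f => u f + v f) _ _.
Next Obligation. by rewrite !centrD addrACA. Qed.
Next Obligation. by rewrite !centrA; apply: hfun_ext => g /=; rewrite mulrDl. Qed.
Program Definition centr1 : centr := @Centr id _ _.
Program Definition centr_mul (u v : centr) : centr := @Centr (fun f => u (v f)) _ _.
Next Obligation. by rewrite !centrD. Qed.
Next Obligation. by rewrite !centrA. Qed.

Lemma centr_addA : associative centr_add.
Proof. by move=> u v w; apply: centr_ext => f; exact: addrA. Qed.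
Lemma centr_addC : commutative centr_add.
Proof. by move=> u v; apply: centr_ext => f; exact: addrC. Qed.
Lemma centr_add0 : left_id centr0 centr_add.
Proof. by move=> u; apply: centr_ext => f; exact: add0r. Qed.
Lemma centr_addN : left_inverse centr0 centr_opp centr_add.
Proof. by move=> u; apply: centr_ext => f; exact: addNr. Qed.
HB.instance Definition _ :=
  GRing.isZmodule.Build centr centr_addA centr_addC centr_add0 centr_addN.

Lemma centr_mulA : associative centr_mul.
Proof. by move=> u v w; exact: centr_ext. Qed.
Lemma centr_mul1 : left_id centr1 centr_mul.
Proof. by move=> u; exact: centr_ext. Qed.
Lemma centr_mulr1 : right_id centr1 centr_mul.
Proof. by move=> u; exact: centr_ext. Qed.
Lemma centr_mulDl : left_distributive centr_mul centr_add.
Proof. by move=> u v w; exact: centr_ext. Qed.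
Lemma centr_mulDr : right_distributive centr_mul centr_add.
Proof. by move=> u v w; apply: centr_ext => f; exact: centrD. Qed.
HB.instance Definition _ := GRing.Zmodule_isPzRing.Build centr
  centr_mulA centr_mul1 centr_mulr1 centr_mulDl centr_mulDr.

Definition Ifunctor : prefunctor A centr :=
  tensor_functor (P := hfun) (fun (u : centr) f => u f) hfun_act.

End Centralizer.

(* lim_k Z / m^k, with m^k = idealX k. *)

Section AdicCompletion.
Variables (Z : comPzRingType) (m : Z -> Prop).

Inductive idealX : nat -> Z -> Prop :=
  | idealX_top z : idealX 0 z
  | idealX_0 k : idealX k 0
  | idealX_add k z z' of idealX k z & idealX k z' : idealX k (z + z')
  | idealX_mul k a z of m a & idealX k z : idealX k.+1 (a * z).

Lemma idealX_scale k b z : idealX k z -> idealX k (b * z).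
Proof.
move=> h; elim: h b => {k z}.
- by move=> *; exact: idealX_top.
- by move=> k b; rewrite mulr0; exact: idealX_0.
- by move=> k z z' _ IH _ IH' b; rewrite mulrDr; apply: idealX_add.
- by move=> k a z ma _ IH b; rewrite mulrCA; apply: idealX_mul.
Qed.
Lemma idealX_opp k z : idealX k z -> idealX k (- z).
Proof. by rewrite -mulN1r; exact: idealX_scale. Qed.
Lemma idealX_sub k x y : idealX k x -> idealX k y -> idealX k (x - y).
Proof. by move=> hx hy; apply: idealX_add => //; exact: idealX_opp. Qed.

(* Compatible families of elements of the Z / m^k, by representatives. *)
Record cseq := CSeq {
  cseq_fun :> nat -> Z;
  cseqP : forall k, idealX k (cseq_fun k.+1 - cseq_fun k) }.

HB.instance Definition _ := gen_eqMixin cseq.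
HB.instance Definition _ := gen_choiceMixin cseq.

Definition ceq : rel cseq := fun x y => `[< forall k, idealX k (x k - y k) >].

Lemma ceq_refl : reflexive ceq.
Proof. by move=> x; apply/asboolP => k; rewrite subrr; exact: idealX_0. Qed.
Lemma ceq_sym : symmetric ceq.
Proof.
by move=> x y; apply/asboolP/asboolP => h k; rewrite -opprB; exact: idealX_opp.
Qed.
Lemma ceq_trans : transitive ceq.
Proof.
move=> y x z /asboolP h /asboolP h'; apply/asboolP => k.
by rewrite -(subrKA (y k)); exact: idealX_add.
Qed.
Canonical ceq_equiv := EquivRel ceq ceq_refl ceq_sym ceq_trans.

Definition completion := {eq_quot ceq_equiv}.
HB.instance Definition _ := Choice.on completion.

Definition cpi (x : cseq) : completion := \pi_completion x.
Lemma cpiP x y : cpi x = cpi y <-> forall k, idealX k (x k - y k).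
Proof. by split => [/eqmodP/asboolP//|h]; apply/eqmodP/asboolP. Qed.
Lemma cpi_repr p : cpi (repr p) = p. Proof. exact: reprK. Qed.
Lemma repr_cpi x k : idealX k (repr (cpi x) k - x k).
Proof. by move: k; apply/cpiP; rewrite cpi_repr. Qed.
Lemma cpi_ext (x y : cseq) : x =1 y -> cpi x = cpi y.
Proof. by move=> xy; apply/cpiP => k; rewrite xy subrr; exact: idealX_0. Qed.
Lemma completion_quotP (P : completion -> Prop) : (forall x, P (cpi x)) -> forall p, P p.
Proof. by move=> h p; rewrite -[p]cpi_repr. Qed.

Program Definition cseq_cst (z : Z) : cseq := @CSeq (fun=> z) _.
Next Obligation. by rewrite subrr; exact: idealX_0. Qed.
Program Definition cseq_opp (x : cseq) : cseq := @CSeq (fun k => - x k) _.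
Next Obligation. by rewrite -opprD; apply: idealX_opp; exact: cseqP. Qed.
Program Definition cseq_add (x y : cseq) : cseq := @CSeq (fun k => x k + y k) _.
Next Obligation. by rewrite opprD addrACA; apply: idealX_add; exact: cseqP. Qed.

Lemma mulr_sub2 (a b c d : Z) : a * b - c * d = b * (a - c) + c * (b - d).
Proof. by rewrite !mulrBr [b * a]mulrC [b * c]mulrC subrKA. Qed.

Program Definition cseq_mul (x y : cseq) : cseq := @CSeq (fun k => x k * y k) _.
Next Obligation.
by rewrite mulr_sub2; apply: idealX_add; apply: idealX_scale; exact: cseqP.
Qed.

Definition cadd (p q : completion) : completion := cpi (cseq_add (repr p) (repr q)).
Definition copp (p : completion) : completion := cpi (cseq_opp (repr p)).
Definition cmul (p q : completion) : completion := cpi (cseq_mul (repr p) (repr q)).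

Lemma caddE x y : cadd (cpi x) (cpi y) = cpi (cseq_add x y).
Proof.
by apply/cpiP => k /=; rewrite opprD addrACA; apply: idealX_add; exact: repr_cpi.
Qed.
Lemma coppE x : copp (cpi x) = cpi (cseq_opp x).
Proof. by apply/cpiP => k /=; rewrite -opprD; apply: idealX_opp; exact: repr_cpi. Qed.
Lemma cmulE x y : cmul (cpi x) (cpi y) = cpi (cseq_mul x y).
Proof.
apply/cpiP => k /=; rewrite mulr_sub2.
by apply: idealX_add; apply: idealX_scale; exact: repr_cpi.
Qed.

Lemma caddA : associative cadd.
Proof.
elim/completion_quotP=> x; elim/completion_quotP=> y; elim/completion_quotP=> z.
by rewrite !caddE; apply: cpi_ext => k; exact: addrA.
Qed.
Lemma caddC : commutative cadd.
Proof.
elim/completion_quotP=> x; elim/completion_quotP=> y.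
by rewrite !caddE; apply: cpi_ext => k; exact: addrC.
Qed.
Lemma cadd0 : left_id (cpi (cseq_cst 0)) cadd.
Proof. by elim/completion_quotP=> x; rewrite caddE; apply: cpi_ext => k; exact: add0r. Qed.
Lemma caddN : left_inverse (cpi (cseq_cst 0)) copp cadd.
Proof.
by elim/completion_quotP=> x; rewrite coppE caddE; apply: cpi_ext => k; exact: addNr.
Qed.
Lemma cmulA : associative cmul.
Proof.
elim/completion_quotP=> x; elim/completion_quotP=> y; elim/completion_quotP=> z.
by rewrite !cmulE; apply: cpi_ext => k; exact: mulrA.
Qed.
Lemma cmulC : commutative cmul.
Proof.
elim/completion_quotP=> x; elim/completion_quotP=> y.
by rewrite !cmulE; apply: cpi_ext => k; exact: mulrC.
Qed.
Lemma cmul1 : left_id (cpi (cseq_cst 1)) cmul.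
Proof. by elim/completion_quotP=> x; rewrite cmulE; apply: cpi_ext => k; exact: mul1r. Qed.
Lemma cmulDl : left_distributive cmul cadd.
Proof.
elim/completion_quotP=> x; elim/completion_quotP=> y; elim/completion_quotP=> z.
by rewrite !(cmulE, caddE); apply: cpi_ext => k; exact: mulrDl.
Qed.

HB.instance Definition _ := GRing.isZmodule.Build completion caddA caddC cadd0 caddN.
HB.instance Definition _ :=
  GRing.Zmodule_isComPzRing.Build completion cmulA cmulC cmul1 cmulDl.

Definition to_completion (z : Z) : completion := cpi (cseq_cst z).

Lemma to_completion_zmod : zmod_morphism to_completion.
Proof.
move=> x y; rewrite -[RHS]/(cadd (cpi (cseq_cst x)) (copp (cpi (cseq_cst y)))).
by rewrite coppE caddE; apply/cpiP => k /=; rewrite subrr; exact: idealX_0.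
Qed.
Lemma to_completion_monoid : monoid_morphism to_completion.
Proof.
split=> // x y; rewrite -[RHS]/(cmul (cpi (cseq_cst x)) (cpi (cseq_cst y))).
by rewrite cmulE; apply/cpiP => k /=; rewrite subrr; exact: idealX_0.
Qed.
HB.instance Definition _ :=
  GRing.isZmodMorphism.Build Z completion to_completion to_completion_zmod.
HB.instance Definition _ :=
  GRing.isMonoidMorphism.Build Z completion to_completion to_completion_monoid.

End AdicCompletion.


(* A finite subgroup of GL(V) is a linrep that is injective on W; products in W
   act by composition, the right factor first. *)
Record linrep (F : fieldType) (V : vectType F) (W : finGroupType) := LinRep {
  linrep_fun :> W -> 'End(V);
  linrep1 : linrep_fun 1%g = \1%VF;
  linrepM : forall g h : W, linrep_fun (g * h)%g = (linrep_fun g \o linrep_fun h)%VF }.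

Section Reflections.
Variables (F : fieldType) (V : vectType F) (W : finGroupType) (rho : linrep V W).
Implicit Types (s w g : W) (x : 'Hom(V, F^o)) (y v : V).

Lemma repM g h v : rho (g * h)%g v = rho g (rho h v).
Proof. by rewrite linrepM comp_lfunE. Qed.
Lemma rep1 v : rho 1%g v = v. Proof. by rewrite linrep1 id_lfunE. Qed.
Lemma repK g : cancel (rho g) (rho g^-1%g).
Proof. by move=> v; rewrite -repM mulVg rep1. Qed.
Lemma repVK g : cancel (rho g^-1%g) (rho g).
Proof. by move=> v; rewrite -repM mulgV rep1. Qed.

(* (w x)(v) = x(w^-1 v) *)
Definition dact w x : 'Hom(V, F^o) := (x \o rho w^-1%g)%VF.
Lemma dactE w x v : dact w x v = x (rho w^-1%g v). Proof. exact: comp_lfunE. Qed.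
Lemma dact_linear w : linear (dact w).
Proof. by move=> a x x'; rewrite /dact comp_lfunDl comp_lfunZl. Qed.
HB.instance Definition _ w :=
  GRing.isLinear.Build F 'Hom(V, F^o) 'Hom(V, F^o) *:%R (dact w) (dact_linear w).

Definition reflections : {set W} :=
  [set s | (s != 1%g) && (\dim (limg (rho s - \1%VF)) == 1%N)].

(* alpha and alphav are generators of the two lines, with alpha s (alphav s) = 2.
   The remaining freedom (rescaling by t and 1/t) does not affect what follows. *)
Definition alpha s : 'Hom(V, F^o) := vpick (limg (linfun (dact s) - \1%VF)).
Definition alphav s : V :=
  let v := vpick (limg (rho s - \1%VF)) in (2%:R / (alpha s v : F)) *: v.

Definition lambda s : F :=
  xget 0 (fun l => l <> 1 /\ exists2 x, x <> 0 & dact s x = l *: x).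

Lemma dual_separates v : v != 0 -> exists x : 'Hom(V, F^o), x v != 0.
Proof.
move=> v0; apply: contrapT => h; move/eqP: v0; apply.
rewrite (coord_vbasis (memvf v)) big1 // => i _.
have E : linfun (coord (vbasis {:V}) i : V -> F^o) v = coord (vbasis {:V}) i v.
  exact: lfunE.
have [->|c0] := eqVneq (coord (vbasis {:V}) i v) 0; first by rewrite scale0r.
by case: h; exists (linfun (coord (vbasis {:V}) i : V -> F^o)); rewrite E.
Qed.

Lemma rep_sub1E s v : (rho s - \1%VF) v = rho s v - v.
Proof. by rewrite add_lfunE opp_lfunE id_lfunE. Qed.

Lemma dact_sub1E s x : (linfun (dact s) - \1%VF) x = dact s x - x.
Proof. by rewrite add_lfunE opp_lfunE id_lfunE (lfunE (dact s)). Qed.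
Lemma dact_sub1_apply s x v : (linfun (dact s) - \1%VF) x v = (x (rho s^-1%g v) : F) - x v.
Proof. by rewrite dact_sub1E add_lfunE opp_lfunE dactE. Qed.

Lemma reflection_eigen s : s \in reflections ->
  exists mu : F, forall v, v \in limg (rho s - \1%VF) -> rho s v - v = mu *: v.
Proof.
rewrite inE => /andP[_ /eqP d1]; set U := limg _ in d1 *.
have v0 : vpick U != 0 by rewrite vpick0 -dimv_eq0 d1.
have Uv : U = <[vpick U]>%VS.
  apply/esym/eqP; rewrite eqEdim d1 dim_vline v0 andbT.
  by rewrite -memvE memv_pick.
have /vlineP[mu E] : rho s (vpick U) - vpick U \in <[vpick U]>%VS.
  by rewrite -Uv -rep_sub1E memv_img ?memvf.
exists mu => v; rewrite Uv => /vlineP[k ->].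
by rewrite linearZ -scalerBr E !scalerA mulrC.
Qed.

Lemma alpha_formE s mu x y : s \in reflections ->
  (forall v, v \in limg (rho s - \1%VF) -> rho s v - v = mu *: v) ->
  (alpha s y : F) * (x (alphav s) : F) = 2%:R / mu * (x (rho s y - y) : F).
Proof.
move=> sS hmu; rewrite /alphav; set v := vpick _.
have d1 : \dim (limg (rho s - \1%VF)) = 1%N by move: sS; rewrite inE => /andP[_ /eqP].
have v0 : v != 0 by rewrite vpick0 -dimv_eq0 d1.
have Uv : limg (rho s - \1%VF) = <[v]>%VS.
  by apply/esym/eqP; rewrite eqEdim d1 dim_vline v0 andbT -memvE memv_pick.
have img u : exists k : F, rho s u - u = k *: v.
  by apply/vlineP; rewrite -Uv -rep_sub1E memv_img ?memvf.
have a0 : alpha s != 0.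
  rewrite vpick0; apply/eqP => l0.
  have /memv_imgP[u _ uv] := memv_pick (limg (rho s - \1%VF)).
  have [x' x'v] := dual_separates v0.
  have : (linfun (dact s) - \1%VF) x' \in limg (linfun (dact s) - \1%VF).
    by rewrite memv_img ?memvf.
  rewrite l0 memv0 => /eqP/lfunP/(_ (rho s u)).
  rewrite dact_sub1_apply zero_lfunE repK => /eqP.
  rewrite -[_ - _](linearB x') -opprB linearN oppr_eq0 -rep_sub1E -uv.
  by rewrite (negPf x'v).
have /memv_imgP[x' _ ax'] := memv_pick (limg (linfun (dact s) - \1%VF)).
have aE u : alpha s u = - (x' (rho s^-1%g (rho s u - u))).
  have -> : rho s^-1%g (rho s u - u) = u - rho s^-1%g u by rewrite linearB /= repK.
  by rewrite /alpha ax' dact_sub1_apply linearB /= opprB.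
pose k : F := - (x' (rho s^-1%g v)).
have aE' u p : rho s u - u = p *: v -> alpha s u = p * k.
  by move=> E; rewrite aE E /k linearZ /= linearZ; exact: (esym (mulrN _ _)).
have k0 : k != 0.
  apply: contra_neq a0 => k0; apply/lfunP => u; rewrite zero_lfunE.
  by have [p /aE' ->] := img u; rewrite k0 mulr0.
have vE : alpha s v = mu * k.
  by apply: aE'; apply: hmu; rewrite Uv memv_line.
have [p E] := img y; rewrite (aE' _ _ E) vE E !linearZ /= /GRing.scale /=.
have -> : p * k * (2%:R / (mu * k) * x v) = k / k * (2%:R / mu * (p * x v)).
  rewrite invfM; ring.
by rewrite divff // mul1r.
Qed.

Lemma alpha_fixed s y : rho s y = y -> alpha s y = 0.
Proof.
move=> sy.
have /memv_imgP[x' _ ax'] := memv_pick (limg (linfun (dact s) - \1%VF)).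
rewrite /alpha ax' dact_sub1_apply.
by rewrite -{1}sy repK subrr.
Qed.

Lemma stab_group_set b : group_set [set w | rho w b == b].
Proof.
apply/group_setP; split; first by rewrite inE rep1.
by move=> g h; rewrite !inE repM => /eqP gb /eqP ->; rewrite gb.
Qed.
Definition stab b : {group W} := Group (stab_group_set b).

Section Subgroup.
Variable K : {group W}.
Lemma subrep1 : rho (sgval (1%g : subg_of K)) = \1%VF.
Proof. by rewrite linrep1. Qed.
Lemma subrepM (g h : subg_of K) :
  rho (sgval (g * h)%g) = (rho (sgval g) \o rho (sgval h))%VF.
Proof. by rewrite /= linrepM. Qed.
Definition subrep : linrep V (subg_of K) :=
  @LinRep F V (subg_of K) (fun k => rho (sgval k)) subrep1 subrepM.
End Subgroup.

End Reflections.

(* polyfun is C[h], presented as the symmetric algebra of h^*; polyinv is C[h]^W,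
   and hat_polyinv b its completion at the maximal ideal of the image of b. *)

Section Polynomials.
Variables (F : fieldType) (V : vectType F).

Inductive poly_rel : pterm F 'Hom(V, F^o) -> pterm F 'Hom(V, F^o) -> Prop :=
  | poly_lin a x x' :
      poly_rel (Gen (a *: x + x')) (Sum (Prod (Scal a) (Gen x)) (Gen x'))
  | poly_comm x x' : poly_rel (Prod (Gen x) (Gen x')) (Prod (Gen x') (Gen x)).

Definition polyfun := palg poly_rel.
HB.instance Definition _ := GRing.PzRing.on polyfun.

Lemma polyfun_mulC : commutative (@GRing.mul polyfun).
Proof.
move=> p q; elim/palg_ind: p => [a|x|p p' hp hp'|p p' hp hp'].
- exact: pscalC.
- elim/palg_ind: q => [a|x'|q q' hq hq'|q q' hq hq'].
  + by rewrite pscalC.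
  + by rewrite /pgen -!ppiM; apply: ppi_rel; exact: poly_comm.
  + by rewrite mulrDr mulrDl hq hq'.
  + by rewrite mulrA hq -!mulrA hq'.
- by rewrite mulrDr mulrDl hp hp'.
- by rewrite mulrA -hp -!mulrA hp'.
Qed.
HB.instance Definition _ :=
  GRing.PzRing_hasCommutativeMul.Build polyfun polyfun_mulC.

Definition xpoly (x : 'Hom(V, F^o)) : polyfun := pgen poly_rel x.

Lemma xpoly_lin a x x' : xpoly (a *: x + x') = pscal _ a * xpoly x + xpoly x'.
Proof. by rewrite /xpoly /pgen /pscal -ppiM -ppiD; apply: ppi_rel; exact: poly_lin. Qed.

Section Eval.
Variable b : V.
Let g (x : 'Hom(V, F^o)) : F := x b.
Lemma poly_eval_rel t u : poly_rel t u -> peval idfun g t = peval idfun g u.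
Proof.
case=> [a x x'|x x'] /=; last exact: mulrC.
by rewrite /g add_lfunE scale_lfunE.
Qed.
Lemma poly_eval_scalC (a d : F) : idfun a * d = d * idfun a. Proof. exact: mulrC. Qed.
Definition poly_eval : {rmorphism polyfun -> F} := plift poly_eval_scalC poly_eval_rel.
End Eval.

Variables (W : finGroupType) (rho : linrep V W).

Section Action.
Variable w : W.
Let g (x : 'Hom(V, F^o)) : polyfun := xpoly (dact rho w x).
Lemma poly_act_rel t u : poly_rel t u ->
  peval (pscal poly_rel) g t = peval (pscal poly_rel) g u.
Proof.
case=> [a x x'|x x'] /=; last exact: polyfun_mulC.
by rewrite /g linearD linearZ /= xpoly_lin.
Qed.
Definition poly_act : {rmorphism polyfun -> polyfun} :=
  plift (@pscalC _ _ poly_rel) poly_act_rel.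
End Action.

Definition inv_pred : {pred polyfun} := fun p => `[< forall w, poly_act w p = p >].
Lemma inv_subring : subring_closed inv_pred.
Proof.
split; first by apply/asboolP => w; exact: rmorph1.
  by move=> p q /asboolP hp /asboolP hq; apply/asboolP => w; rewrite rmorphB hp hq.
by move=> p q /asboolP hp /asboolP hq; apply/asboolP => w; rewrite rmorphM hp hq.
Qed.
Definition polyinv := {p : polyfun | p \in inv_pred}.
HB.instance Definition _ := SubChoice.on polyinv.
HB.instance Definition _ :=
  GRing.SubChoice_isSubComPzRing.Build polyfun inv_pred polyinv
    inv_subring.

Definition vanish_at (b : V) : polyinv -> Prop := fun z => poly_eval b (val z) = 0.

Definition hat_polyinv (b : V) := completion (vanish_at b).
HB.instance Definition _ b := GRing.ComPzRing.on (hat_polyinv b).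

End Polynomials.


Section Cherednik.
Variables (F : fieldType) (V : vectType F) (W : finGroupType) (rho : linrep V W).
Variable c : W -> F.
Implicit Types (w : W) (x : 'Hom(V, F^o)) (y : V).

Inductive cher_gen := Gw of W | Gx of 'Hom(V, F^o) | Gy of V.

(* The first six relations present C[W] |>< T(h (+) h^* ); the others are those
   of H_c(W, h), with (y, x) written x y. *)
Inductive cher_rel : pterm F cher_gen -> pterm F cher_gen -> Prop :=
  | cher_w1 : cher_rel (Gen (Gw 1%g)) (Scal 1)
  | cher_wM w w' : cher_rel (Gen (Gw (w * w')%g)) (Prod (Gen (Gw w)) (Gen (Gw w')))
  | cher_xlin a x x' :
      cher_rel (Gen (Gx (a *: x + x'))) (Sum (Prod (Scal a) (Gen (Gx x))) (Gen (Gx x')))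
  | cher_ylin a y y' :
      cher_rel (Gen (Gy (a *: y + y'))) (Sum (Prod (Scal a) (Gen (Gy y))) (Gen (Gy y')))
  | cher_wx w x : cher_rel (Prod (Gen (Gw w)) (Gen (Gx x)))
                           (Prod (Gen (Gx (dact rho w x))) (Gen (Gw w)))
  | cher_wy w y : cher_rel (Prod (Gen (Gw w)) (Gen (Gy y)))
                           (Prod (Gen (Gy (rho w y))) (Gen (Gw w)))
  | cher_xx x x' : cher_rel (Prod (Gen (Gx x)) (Gen (Gx x')))
                            (Prod (Gen (Gx x')) (Gen (Gx x)))
  | cher_yy y y' : cher_rel (Prod (Gen (Gy y)) (Gen (Gy y')))
                            (Prod (Gen (Gy y')) (Gen (Gy y)))
  | cher_yx y x : cher_rel
      (Prod (Gen (Gy y)) (Gen (Gx x)))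
      (Sum (Prod (Gen (Gx x)) (Gen (Gy y)))
           (Sum (Scal (x y))
                (Prod (Scal (-1))
                      (psum [seq Prod (Scal (c s * alpha rho s y * x (alphav rho s)))
                                      (Gen (Gw s)) | s <- enum (reflections rho)])))).

Definition cherednik := palg cher_rel.
HB.instance Definition _ := GRing.PzRing.on cherednik.

Definition hscal : {rmorphism F -> cherednik} := pscal cher_rel.
Definition hw w : cherednik := pgen cher_rel (Gw w).
Definition hx x : cherednik := pgen cher_rel (Gx x).
Definition hy y : cherednik := pgen cher_rel (Gy y).

Lemma hw1 : hw 1%g = 1. Proof. by apply: ppi_rel; exact: cher_w1. Qed.
Lemma hwM w w' : hw (w * w')%g = hw w * hw w'.
Proof. by rewrite /hw /pgen -ppiM; apply: ppi_rel; exact: cher_wM. Qed.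
Lemma hx_lin a x x' : hx (a *: x + x') = hscal a * hx x + hx x'.
Proof. by rewrite /hx /pgen /= /pscal -ppiM -ppiD; apply: ppi_rel; exact: cher_xlin. Qed.
Lemma hy_lin a y y' : hy (a *: y + y') = hscal a * hy y + hy y'.
Proof. by rewrite /hy /pgen /= /pscal -ppiM -ppiD; apply: ppi_rel; exact: cher_ylin. Qed.
Lemma hwx w x : hw w * hx x = hx (dact rho w x) * hw w.
Proof. by rewrite /hx /hw /pgen -!ppiM; apply: ppi_rel; exact: cher_wx. Qed.
Lemma hwy w y : hw w * hy y = hy (rho w y) * hw w.
Proof. by rewrite /hy /hw /pgen -!ppiM; apply: ppi_rel; exact: cher_wy. Qed.
Lemma hxx x x' : hx x * hx x' = hx x' * hx x.
Proof. by rewrite /hx /pgen -!ppiM; apply: ppi_rel; exact: cher_xx. Qed.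
Lemma hyy y y' : hy y * hy y' = hy y' * hy y.
Proof. by rewrite /hy /pgen -!ppiM; apply: ppi_rel; exact: cher_yy. Qed.
Lemma hyx y x : hy y * hx x = hx x * hy y + (hscal (x y)
  - \sum_(s in reflections rho) hscal (c s * alpha rho s y * x (alphav rho s)) * hw s).
Proof.
rewrite [LHS](_ : _ = ppi cher_rel (Prod (Gen (Gy y)) (Gen (Gx x)))); last by rewrite ppiM.
rewrite (ppi_rel (cher_yx y x)) 2!ppiD 2!ppiM ppi_psum big_map big_enum /=.
congr (_ + (_ + _)).
have -> : ppi cher_rel (Scal (-1)) = -1 by rewrite -[RHS](rmorphN1 hscal).
by rewrite mulN1r; congr (- _); apply: eq_bigr => s _; rewrite ppiM.
Qed.

Section PolyToCherednik.
Lemma poly_cher_rel t u : poly_rel t u -> peval hscal hx t = peval hscal hx u.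
Proof. by case=> [a x x'|x x'] /=; [exact: hx_lin | exact: hxx]. Qed.
Definition poly_cher : {rmorphism polyfun V -> cherednik} :=
  plift (@pscalC _ _ cher_rel) poly_cher_rel.
End PolyToCherednik.

(* A vector v is h-nilpotent when y_1 ... y_k v = 0 for some k and all y_i. *)
Section Nilpotent.
Variable M : lmodType cherednik.

Fixpoint killed (k : nat) (v : M) : Prop :=
  if k is k'.+1 then forall y, killed k' (hy y *: v) else v = 0.

Lemma killed0 k : killed k 0.
Proof. by elim: k => //= k IH y; rewrite scaler0. Qed.
Lemma killedS k v : killed k v -> killed k.+1 v.
Proof.
elim: k v => [v -> y|k IH v h y]; first exact: scaler0.
by apply: IH; exact: h.
Qed.
Lemma killed_leq k l v : (k <= l)%N -> killed k v -> killed l v.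
Proof.
move=> /subnKC <-; elim: (l - k)%N => [|n IH]; rewrite ?addn0 // addnS => h.
by apply: killedS; exact: IH.
Qed.
Lemma killedD k u v : killed k u -> killed k v -> killed k (u + v).
Proof.
elim: k u v => [u v -> ->|k IH u v hu hv y]; first exact: addr0.
by rewrite scalerDr; apply: IH; [exact: hu|exact: hv].
Qed.
Lemma killed_scal k a v : killed k v -> killed k (hscal a *: v).
Proof.
elim: k v => [v ->|k IH v h y]; first exact: scaler0.
by rewrite scalerA -pscalC -scalerA; apply: IH; exact: h.
Qed.
Lemma killed_w k w v : killed k v -> killed k (hw w *: v).
Proof.
elim: k v => [v ->|k IH v h y]; first exact: scaler0.
have -> : y = rho w (rho w^-1%g y) by rewrite repVK.
by rewrite scalerA -hwy -scalerA; apply: IH; exact: h.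
Qed.
Lemma killed_x k x v : killed k v -> killed k.+1 (hx x *: v).
Proof.
elim: k v => [v -> y|k IH v h y]; first by rewrite /= !scaler0.
have -> : hy y *: (hx x *: v) = hx x *: (hy y *: v)
    + (hscal (x y) - \sum_(s in reflections rho)
         hscal (c s * alpha rho s y * x (alphav rho s)) * hw s) *: v.
  by rewrite scalerA hyx scalerDl -scalerA.
apply: (@killedD k.+1); first by apply: IH; exact: h.
rewrite scalerBl; apply: (@killedD k.+1); first exact: killed_scal.
rewrite -scaleN1r -(rmorphN1 hscal); apply: killed_scal; rewrite scaler_suml.
elim/big_rec: _ => [|s u _ hu]; first exact: killed0.
by apply: killedD => //; rewrite -scalerA; apply: killed_scal; exact: killed_w.
Qed.

Definition h_nilpotent v : Prop := exists k, killed k v.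

Lemma h_nilpotentD u v : h_nilpotent u -> h_nilpotent v -> h_nilpotent (u + v).
Proof.
move=> [k hk] [l hl]; exists (maxn k l).
by apply: killedD; [apply: killed_leq hk; exact: leq_maxl
                   |apply: killed_leq hl; exact: leq_maxr].
Qed.

Lemma h_nilpotentZ p v : h_nilpotent v -> h_nilpotent (p *: v).
Proof.
elim/palg_ind: p v => [a|[w|x|y]|p q hp hq|p q hp hq] v [k hk].
- by exists k; exact: killed_scal.
- by exists k; exact: killed_w.
- by exists k.+1; exact: killed_x.
- by exists k; have /(_ y) := killedS hk.
- by rewrite scalerDl; apply: h_nilpotentD; [apply: hp|apply: hq]; exists k.
- by rewrite -scalerA; apply: hp; apply: hq; exists k.
Qed.

Lemma h_nilpotent0 : h_nilpotent 0. Proof. by exists 0%N. Qed.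

Definition nilp_submod : submodule M :=
  Submodule h_nilpotent0 h_nilpotentD h_nilpotentZ.
End Nilpotent.

Lemma nilp_map (M N : lmodType cherednik) (f : {linear M -> N}) v :
  nilp_submod M v -> nilp_submod N (f v).
Proof.
case=> k hk; exists k; elim: k v hk => [v /= ->|k IH v h y]; first exact: raddf0.
by rewrite -linearZ; apply: IH; exact: h.
Qed.

Definition nilp_functor : prefunctor cherednik cherednik :=
  @Prefunctor cherednik cherednik (fun M => smtype (nilp_submod M))
    (fun M N f => sm_map (@nilp_map M N f)).

Definition category_O (M : lmodType cherednik) : Prop :=
  (exists (n : nat) (e : 'I_n -> M), forall v, exists p : 'I_n -> polyfun V,
     v = \sum_(i < n) poly_cher (p i) *: e i) /\
  (forall v : M, h_nilpotent v).

End Cherednik.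


Section Completed.
Variables (F : fieldType) (V : vectType F) (W : finGroupType) (rho : linrep V W).
Variables (c : W -> F) (b : V).

Definition inv_cher : {rmorphism polyinv rho -> cherednik rho c} :=
  poly_cher rho c \o (val : polyinv rho -> polyfun V).

Definition to_hat : {rmorphism polyinv rho -> hat_polyinv rho b} :=
  @to_completion _ (vanish_at b).

Definition hat_tensor : lmodType (hat_polyinv rho b) :=
  extension_functor to_hat (restr inv_cher (cherednik rho c)^o).

(* The algebra structure on hat_tensor = C[h]^W^ (x)_{C[h]^W} H_c is the only one
   for which the two factors are subalgebras and p (x) h is the product of p and h;
   cc_ring is a ring identified by mu with hat_tensor under that structure. *)
Record completed_cherednik := CompletedCherednik {
  cc_ring :> pzRingType;
  cc_fun : {rmorphism hat_polyinv rho b -> cc_ring};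
  cc_alg : {rmorphism cherednik rho c -> cc_ring};
  cc_compat : forall z, cc_fun (to_hat z) = cc_alg (inv_cher z);
  cc_tensor : exists mu : {additive hat_tensor -> cc_ring},
    bijective mu /\
    forall (p : hat_polyinv rho b) (h : cherednik rho c),
      mu (@tens (hat_polyinv rho b) (polyinv rho) (hat_polyinv rho b)
            (fun q p => q * p) (fun p z => p * to_hat z)
            (restr inv_cher (cherednik rho c)^o) p h)
      = cc_fun p * cc_alg h }.

Variable Hb : completed_cherednik.

Definition completion_functor : prefunctor (cherednik rho c) Hb :=
  extension_functor (cc_alg Hb).

Definition E_functor : prefunctor Hb (cherednik rho c) :=
  functor_comp (nilp_functor rho c) (restr_functor (cc_alg Hb)).

End Completed.


Section Zeta.
Variables (F : numFieldType) (V : vectType F) (W : finGroupType) (rho : linrep V W).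
Variable c : W -> F.
Implicit Types (w : W) (y v : V).

Definition fixed_by_W v : Prop := forall w, rho w v = v.

Definition avg : 'End(V) := (#|W|%:R^-1 : F) *: \sum_(w : W) rho w.

(* avg is the projection onto h^W along its unique W-stable complement, which
   stands for h/h^W; repU below is the action of W on it. *)
Definition complementW : {vspace V} := lker avg.
Local Notation U := complementW.

Lemma avgE v : avg v = (#|W|%:R^-1 : F) *: \sum_(w : W) rho w v.
Proof. by rewrite scale_lfunE sum_lfunE. Qed.
Lemma avg_rep w v : avg (rho w v) = avg v.
Proof.
rewrite !avgE; congr (_ *: _).
rewrite [RHS](reindex_inj (mulIg w)) /=.
by apply: eq_bigr => g _; rewrite repM.
Qed.
Lemma rep_avg w v : rho w (avg v) = avg v.
Proof.
rewrite !avgE linearZ linear_sum /=; congr (_ *: _).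
rewrite [RHS](reindex_inj (mulgI w)) /=.
by apply: eq_bigr => g _; rewrite repM.
Qed.
Lemma avg_fixed v : fixed_by_W v -> avg v = v.
Proof.
move=> fv; rewrite avgE (eq_bigr (fun=> v)) => [|w _]; last exact: fv.
rewrite sumr_const cardT -cardE -scaler_nat scalerA mulVf ?scale1r //.
by rewrite pnatr_eq0 -lt0n; apply/card_gt0P; exists 1%g.
Qed.
Lemma memU v : (v \in U) = (avg v == 0). Proof. exact: memv_ker. Qed.
Lemma sub_avgU v : v - avg v \in U.
Proof.
by rewrite memU linearB /= [avg (avg v)]avg_fixed ?subrr // => w; exact: rep_avg.
Qed.

Definition projU : 'Hom(V, subvs_of U) := (linfun (vsproj U) \o (\1 - avg))%VF.
Lemma projUE v : vsval (projU v) = v - avg v.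
Proof.
by rewrite comp_lfunE lfunE /= add_lfunE opp_lfunE id_lfunE vsprojK ?sub_avgU.
Qed.
Lemma projUK (u : subvs_of U) : projU (vsval u) = u.
Proof.
apply: subvs_inj; rewrite projUE.
by have := subvsP u; rewrite memU => /eqP ->; rewrite subr0.
Qed.
Lemma projU_fixed v : fixed_by_W v -> projU v = 0.
Proof. by move=> fv; apply: subvs_inj; rewrite projUE avg_fixed ?subrr. Qed.

Definition repU_fun w : 'End(subvs_of U) := (projU \o rho w \o linfun vsval)%VF.
Lemma repUE w u : vsval (repU_fun w u) = rho w (vsval u).
Proof.
rewrite 2!comp_lfunE (lfunE (vsval : subvs_of U -> V)) projUE avg_rep.
by have := subvsP u; rewrite memU => /eqP ->; rewrite subr0.
Qed.
Lemma repU1 : repU_fun 1%g = \1%VF.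
Proof. by apply/lfunP => u; apply: subvs_inj; rewrite repUE rep1 id_lfunE. Qed.
Lemma repUM (g h : W) : repU_fun (g * h)%g = (repU_fun g \o repU_fun h)%VF.
Proof. by apply/lfunP => u; apply: subvs_inj; rewrite comp_lfunE !repUE repM. Qed.
Definition repU : linrep (subvs_of U) W := @LinRep F (subvs_of U) W repU_fun repU1 repUM.

Lemma val_repU w u : vsval (repU w u) = rho w (vsval u). Proof. exact: repUE. Qed.
Lemma val_subB (u v : subvs_of U) : vsval (u - v) = vsval u - vsval v.
Proof. exact: linearB. Qed.
Lemma lfun_vsval (u : subvs_of U) : linfun (vsval : subvs_of U -> V) u = vsval u.
Proof. exact: lfunE. Qed.

Lemma projU_rep w v : projU (rho w v) = repU w (projU v).
Proof. by apply: subvs_inj; rewrite val_repU !projUE avg_rep linearB /= rep_avg. Qed.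

Lemma limg_repU w :
  (linfun (vsval : subvs_of U -> V) @: limg (repU w - \1%VF))%VS = limg (rho w - \1%VF).
Proof.
apply/vspaceP => v; apply/memv_imgP/memv_imgP => -[u hu ->].
  have /memv_imgP[u' _ ->] := hu; exists (vsval u'); first exact: memvf.
  by rewrite lfun_vsval !rep_sub1E val_subB val_repU.
exists (repU w (projU u) - projU u).
  by rewrite -rep_sub1E memv_img ?memvf.
rewrite rep_sub1E lfun_vsval val_subB val_repU projUE linearB /= rep_avg.
by rewrite opprB addrA subrK.
Qed.

Lemma reflections_repU : reflections repU = reflections rho.
Proof.
apply/setP => s; rewrite !inE -limg_repU [in RHS]limg_dim_eq //.
apply/eqP; rewrite -subv0; apply/subvP => u.
by rewrite memv_cap memv_ker lfun_vsval memv0 => /andP[_ /eqP u0]; apply/eqP/subvs_inj.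
Qed.

Lemma coef_repU s (x : 'Hom(subvs_of U, F^o)) (u : subvs_of U) : s \in reflections rho ->
  (alpha repU s u : F) * (x (alphav repU s) : F) =
  (alpha rho s (vsval u) : F) * ((x \o projU)%VF (alphav rho s) : F).
Proof.
move=> sS; have [mu hmu] := reflection_eigen sS.
rewrite (alpha_formE _ _ sS hmu) (@alpha_formE _ _ _ repU s mu).
- by rewrite [(x \o projU)%VF _]comp_lfunE (linearB projU) /= projU_rep projUK.
- by rewrite reflections_repU.
move=> v hv; apply: subvs_inj; rewrite val_subB val_repU hmu //.
rewrite -limg_repU -lfun_vsval.
exact: memv_img.
Qed.

(* The algebra map H_c(W, h/h^W) -> H_c(W, h) through which the subspace zeta(M)
   of M is a module; a functional on the complement is extended by 0 on h^W. *)
Definition zeta_gen (t : cher_gen (subvs_of U) W) : cherednik rho c :=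
  match t with
  | Gw w => hw rho c w
  | Gx x => hx rho c (x \o projU)%VF
  | Gy u => hy rho c (vsval u)
  end.

Lemma peval_psum (F' : comNzRingType) (X : Type) (B : pzRingType)
    (s : {rmorphism F' -> B}) (g : X -> B) l :
  peval s g (psum l) = \sum_(t <- l) peval s g t.
Proof. by elim: l => [|t l IH]; rewrite ?big_nil /= ?rmorph0 // big_cons IH. Qed.

Lemma zeta_rel t u : cher_rel repU c t u ->
  peval (hscal rho c) zeta_gen t = peval (hscal rho c) zeta_gen u.
Proof.
case=> [|w w'|a x x'|a y y'|w x|w y|x x'|y y'|y x] /=.
- by rewrite hw1 rmorph1.
- exact: hwM.
- by rewrite comp_lfunDl -comp_lfunZl hx_lin.
- exact: hy_lin.
- rewrite hwx; congr (hx _ _ _ * _); apply/lfunP => v.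
  by rewrite [RHS]comp_lfunE !dactE [LHS]comp_lfunE projU_rep.
- by rewrite repUE hwy.
- exact: hxx.
- exact: hyy.
- rewrite hyx comp_lfunE projUK rmorphN1 mulN1r peval_psum big_map big_enum /=.
  congr (_ + (_ - _)); rewrite reflections_repU; apply: eq_bigr => s sS /=.
  by rewrite -!mulrA coef_repU.
Qed.

Definition zeta_hom : {rmorphism cherednik repU c -> cherednik rho c} :=
  plift (@pscalC _ _ (cher_rel rho c)) zeta_rel.

Lemma zeta_hom_scal a : zeta_hom (hscal repU c a) = hscal rho c a.
Proof. exact: plift_scal. Qed.
Lemma zeta_hom_gen t : zeta_hom (pgen _ t) = zeta_gen t.
Proof. exact: plift_gen. Qed.

Section Object.
Variable M : lmodType (cherednik rho c).
Local Notation rM := (restr zeta_hom M).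

Definition zeta_set (v : rM) : Prop :=
  forall y, fixed_by_W y -> hy rho c y *: (v : M) = 0.

Lemma zeta0 : zeta_set 0. Proof. by move=> y _; exact: scaler0. Qed.
Lemma zetaD (u v : rM) : zeta_set u -> zeta_set v -> zeta_set (u + v).
Proof. by move=> hu hv y fy; rewrite scalerDr hu // hv // addr0. Qed.
Lemma zetaZ p (v : rM) : zeta_set v -> zeta_set (p *: v).
Proof.
elim/palg_ind: p v => [a|t|p q hp hq|p q hp hq] v hv.
- move=> y fy; rewrite restrZ [zeta_hom _]zeta_hom_scal.
  by rewrite scalerA -pscalC -scalerA hv // scaler0.
- move=> y fy; rewrite restrZ zeta_hom_gen; case: t => [w|x|u] /=; rewrite scalerA.
  + by rewrite -{1}(fy w) -hwy -scalerA hv // scaler0.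
  + rewrite hyx scalerDl -scalerA hv // scaler0 add0r.
    rewrite comp_lfunE projU_fixed // linear0 rmorph0 sub0r big1 ?oppr0 ?scale0r //.
    by move=> s _; rewrite alpha_fixed // mulr0 mul0r rmorph0 mul0r.
  + by rewrite hyy -scalerA hv // scaler0.
- by rewrite scalerDl; apply: zetaD; [exact: hp|exact: hq].
- by rewrite -scalerA; apply: hp; exact: hq.
Qed.

Definition zeta_submod : submodule rM := Submodule zeta0 zetaD zetaZ.
End Object.

Lemma zeta_map (M N : lmodType (cherednik rho c)) (f : {linear M -> N}) (v : M) :
  zeta_submod M v -> zeta_submod N (@restr_map _ _ zeta_hom M N f v).
Proof. by move=> hv y fy; rewrite /restr_map -linearZ hv // linear0. Qed.

Definition zeta_functor : prefunctor (cherednik rho c) (cherednik repU c) :=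
  @Prefunctor (cherednik rho c) (cherednik repU c) (fun M => smtype (zeta_submod M))
    (fun M N f => @sm_map _ _ _ (zeta_submod M) (zeta_submod N)
       (@restr_map _ _ zeta_hom M N f) (@zeta_map M N f)).

End Zeta.


(* The two-sided inverse of u in a ring; 0 when u is not invertible. *)
Definition ring_inv (A : pzRingType) (u : A) : A :=
  xget 0 (fun r => u * r = 1 /\ r * u = 1).

Section Parabolic.
Variables (F : numFieldType) (V : vectType F) (W : finGroupType) (rho : linrep V W).
Variables (c : W -> F) (b : V).

Local Notation W' := (stab rho b).
Definition par_rep : linrep V (subg_of W') := subrep rho W'.
Definition par_c : subg_of W' -> F := fun s => c (sgval s).

Variables (Hb : completed_cherednik rho c b) (H0 : completed_cherednik par_rep par_c 0).

Local Notation scal0 := (hscal par_rep par_c).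
Local Notation x0 := (hx par_rep par_c).
Local Notation y0 := (hy par_rep par_c).

Definition par_iota (h : subg_of W') : H0 := cc_alg H0 (hw par_rep par_c h).

Definition par_centr : pzRingType := centr par_iota.

(* The first formula is C-linearity of theta. *)
Definition theta_formulas (th : Hb -> par_centr) : Prop :=
  [/\ forall (a : F) (f : hfun par_iota) (w : W),
        th (cc_alg Hb (hscal rho c a)) f w = cc_alg H0 (scal0 a) * f w,
      forall (u : W) (f : hfun par_iota) (w : W),
        th (cc_alg Hb (hw rho c u)) f w = f (w * u)%g,
      forall (x : 'Hom(V, F^o)) (f : hfun par_iota) (w : W),
        th (cc_alg Hb (hx rho c x)) f w =
        cc_alg H0 (x0 (dact rho w x) + scal0 (dact rho w x b)) * f w
    & forall (y : V) (f : hfun par_iota) (w : W),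
        th (cc_alg Hb (hy rho c y)) f w =
        cc_alg H0 (y0 (rho w y)) * f w +
        \sum_(s in reflections rho | s \notin W')
           cc_alg H0 (scal0 (2%:R * c s / (1 - lambda rho s) * alpha rho s (rho w y)))
           * ring_inv (cc_alg H0 (x0 (alpha rho s) + scal0 (alpha rho s b)))
           * (f (s * w)%g - f w)].

Record theta_iso := ThetaIso {
  theta :> {rmorphism Hb -> par_centr};
  theta_inv : {rmorphism par_centr -> Hb};
  thetaK : cancel theta theta_inv;
  theta_invK : cancel theta_inv theta;
  thetaE : theta_formulas theta }.

Variables (th : theta_iso).
Variables (Iinv : prefunctor par_centr H0).
Variables (zinv : prefunctor (cherednik (repU par_rep) par_c) (cherednik par_rep par_c)).

Definition Res_functor : prefunctor (cherednik rho c) (cherednik (repU par_rep) par_c) :=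
  functor_comp (zeta_functor par_rep par_c)
    (functor_comp (E_functor H0)
      (functor_comp Iinv
        (functor_comp (restr_functor (theta_inv th)) (completion_functor Hb)))).

Definition Ind_functor : prefunctor (cherednik (repU par_rep) par_c) (cherednik rho c) :=
  functor_comp (E_functor Hb)
    (functor_comp (restr_functor th)
      (functor_comp (Ifunctor par_iota)
        (functor_comp (completion_functor H0) zinv))).

End Parabolic.

Arguments category_O {F V W} rho c M.
Arguments par_rep {F V W} rho b.
Arguments par_c {F V W} rho c b _.

(* Main.v *)
Require Import Defs.
From HB Require Import structures.
From mathcomp Require Import all_boot all_order all_algebra all_fingroup ring.
From mathcomp Require Import boolp classical_sets functions reals complex generic_quotient.

Set Implicit Arguments.
Unset Strict Implicit.
Unset Printing Implicit Defensive.

Import GRing.Theory Num.Theory.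
Local Open Scope ring_scope.

(* Completion at b is exact on category O by Artin-Rees, I is an equivalence, and zeta
   is exact because the vectors of h^W' commute with everything up to a Weyl algebra.
   What remains is the exactness of E and E^b.  The element eu = sum x_i y_i + eps of
   the Cherednik algebra satisfies eu x = x (eu + 1) and eu y = y (eu - 1), and eps is
   algebraic.  Hence a module on which h is locally nilpotent lies in category O as soon
   as its socle is finite dimensional, and on a module complete for the powers of (x)
   the spectral projections of eu converge, so that the h-nilpotent vectors are dense
   and lift along surjections.  This gives the exactness of Res_b, and that N is the
   completion of E(N), whence Ind_b Res_b.  For b <> 0 there is no Euler element on the
   modules to which E^b is applied.  There one uses that for large k a vector v of
   (x)^k with y v in (x)^k for all y lies in (x)^(k+1): the continuous dual is then
   finitely generated over C[y], and the Artin-Rees lemma for this dual lifts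
   h-nilpotent vectors. *)

(** * Operators on abelian groups: noetherianity and the Artin-Rees lemma *)

(** The Euler element used for [Res_b] is that of the algebra of W_b, whereas completions at b are
    filtered by the maximal ideal m of the image of b in h/W. Under theta an invariant p acts on
    values as p(x^(b) + b), and x^(b) + t is invertible for t <> 0; so the filtration by m is
    cofinal with the one by the powers of the x^(b), and separatedness, completeness and finiteness
    can be transferred. The completed algebra is given only as a tensor product; membership in m^k
    of a completed module is therefore tested by linear functionals extended from M. Spectral
    arguments are Bezout identities: the eigenvalues of eu modulo (x)^k, or on vectors killed by all
    words of length k in the y, are of the form a + j with j < k and a a root of a polynomial
    annihilating eps. Differences of two such roots contain finitely many natural numbers; [gap]
    exceeds them, and this is what large k means. On Fun_{W_b}(W, N) each y acts on values as a y of
    the algebra of W_b plus reflection terms preserving (x)^k. Hence the property of vectors of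
    (x)^k survives there although eu does not. *)

Section OperatorModules.
Variable V : zmodType.
Implicit Types (A B C G : V -> Prop) (Om : {additive V -> V} -> Prop).
Implicit Types (x y : {additive V -> V}) (ys : seq {additive V -> V}).

Definition subgroup C : Prop := C 0 /\ forall u v, C u -> C v -> C (u - v).

Definition submod Om C : Prop :=
  subgroup C /\ forall f, Om f -> forall v, C v -> C (f v).

(* Noetherianity is expressed for additive subgroups stable under a set of
   operators, so that adjoining an operator never changes the ambient type. *)
Definition noeth Om G : Prop :=
  forall C : nat -> V -> Prop,
    (forall n, submod Om (C n)) -> (forall n v, C n v -> G v) ->
    (forall n v, C n v -> C n.+1 v) ->
  exists N, forall n v, C n v -> C N v.

Lemma sgN C u : subgroup C -> C u -> C (- u).
Proof. by move=> [C0 CB] Cu; rewrite -sub0r; apply: CB. Qed.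

Lemma sgD C u v : subgroup C -> C u -> C v -> C (u + v).
Proof. by move=> sC Cu Cv; rewrite -(opprK v); apply: sC.2 => //; exact: sgN. Qed.

Lemma sg_sum C (I : Type) (r : seq I) (P : pred I) (F : I -> V) :
  subgroup C -> (forall i, P i -> C (F i)) -> C (\sum_(i <- r | P i) F i).
Proof.
move=> sC h; elim/big_rec: _ => [|i u Pi Cu]; first exact: sC.1.
by apply: sgD => //; exact: h.
Qed.

Lemma chain_le (C : nat -> V -> Prop) :
  (forall n v, C n v -> C n.+1 v) ->
  forall m n v, (m <= n)%N -> C m v -> C n v.
Proof.
move=> CS m n v /subnKC <-; elim: (n - m)%N => [|k IH] Cv; first by rewrite addn0.
by rewrite addnS; apply/CS/IH.
Qed.

Lemma noeth_sub Om (Om' : {additive V -> V} -> Prop) G (G' : V -> Prop) :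
  (forall f, Om f -> Om' f) -> (forall v, G' v -> G v) ->
  noeth Om G -> noeth Om' G'.
Proof.
move=> sO sG nG C Cs CG CS; apply: nG => // [n|n v /CG /sG //].
by split; [exact: (Cs n).1|move=> f /sO; exact: (Cs n).2].
Qed.

(** If no member of [Q] were maximal, choice iterated from [C0] would produce a strictly increasing
    chain. *)
Lemma noeth_max Om G (Q : (V -> Prop) -> Prop) C0 :
  noeth Om G -> (forall C, Q C -> submod Om C /\ forall v, C v -> G v) -> Q C0 ->
  exists2 C, Q C & forall C', Q C' -> (forall v, C v -> C' v) -> forall v, C' v -> C v.
Proof.
move=> nG QG Q0; apply: contrapT => hno.
have next (C : {C | Q C}) : exists C' : {C | Q C},
    (forall v, sval C v -> sval C' v) /\ exists2 v, sval C' v & ~ sval C v.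
  apply: contrapT => hC; apply: hno; exists (sval C); first exact: svalP.
  move=> C' QC' CC' v C'v; apply: contrapT => Cv; apply: hC.
  by exists (exist _ C' QC'); split=> //; exists v.
pose nx (C : {C | Q C}) := sval (cid (next C)).
have nxP (C : {C | Q C}) := svalP (cid (next C)).
pose S n := sval (iter n nx (exist _ C0 Q0)).
have [n||n v|N hN] := nG S.
- by have [] := QG _ (svalP (iter n nx (exist _ C0 Q0))).
- by move=> n v; have [_ h] := QG _ (svalP (iter n nx (exist _ C0 Q0))); exact: h.
- by have [h _] := nxP (iter n nx (exist _ C0 Q0)); exact: h.
have [_ [v h nv]] := nxP (iter N nx (exist _ C0 Q0)).
by apply: nv; apply: (hN N.+1 v); exact: h.
Qed.

(** Take a maximal submodule among those generated by finite lists from [C]: adjoining one more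
    element of [C] to the list cannot enlarge it, so it is all of [C]. *)
Lemma noeth_fg Om G C : noeth Om G -> submod Om C -> (forall v, C v -> G v) ->
  exists2 s : seq V, (forall v, v \in s -> C v) &
    forall C', submod Om C' -> (forall v, v \in s -> C' v) -> forall v, C v -> C' v.
Proof.
move=> nG sC CG.
pose gen (s : seq V) v :=
  forall C', submod Om C' -> (forall u, u \in s -> C' u) -> C' v.
have gen_sub s : submod Om (gen s).
  split=> [|f Of v hv C' sC' h]; last by apply: sC'.2 => //; exact: hv.
  split=> [C' sC' _|u v hu hv C' sC' h]; first exact: sC'.1.1.
  by apply: sC'.1.2; [exact: hu|exact: hv].
pose Q D := exists2 s : seq V, (forall v, v \in s -> C v) & D = gen s.
have [||D1 [s sC' ->] hmax] := @noeth_max Om G Q (gen [::]) nG.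
- by move=> D1 [s sCs ->]; split=> // v /(_ C sC sCs); exact: CG.
- by exists [::].
exists s => // C' hC' hs v Cv.
suff : gen s v by apply.
have Qv : Q (gen (v :: s)).
  by exists (v :: s) => // u; rewrite inE => /orP[/eqP->|/sC'].
apply: (hmax _ Qv) => [u hu D sD hD|D sD hD].
  by apply: hu => // t ts; apply: hD; rewrite inE ts orbT.
by apply: hD; rewrite inE eqxx.
Qed.

(** * Hilbert's basis theorem for one commuting operator *)

Section HilbertBasis.
Variables (Om : {additive V -> V} -> Prop) (G : V -> Prop) (y : {additive V -> V}).
Hypothesis yOm : forall f, Om f -> forall v, f (y v) = y (f v).
Hypothesis sG : submod Om G.

(** A polynomial in [y] with coefficient list [s], constant term first, evaluated inside [V]. An
    element may have several such expressions, so degree arguments are made on the lists. *)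
Fixpoint horn (s : seq V) : V := if s is g :: s' then g + y (horn s') else 0.

Definition adjoin v : Prop := exists2 s : seq V, (forall g, g \in s -> G g) & v = horn s.

Lemma hornB s t : size s = size t ->
  horn s - horn t = horn [seq p.1 - p.2 | p <- zip s t].
Proof.
elim: s t => [|g s IH] [|h t] //= => [_|[st]]; first by rewrite subrr.
by rewrite -IH // raddfB opprD addrACA.
Qed.

Lemma horn_zip_rcons s t g : size s = size t ->
  horn (rcons s g) - horn (rcons t g) = horn [seq p.1 - p.2 | p <- zip s t].
Proof.
move=> st; rewrite hornB ?size_rcons ?st // zip_rcons // map_rcons /= subrr.
by elim: (map _ _) => [|a l IH] /=; rewrite ?raddf0 ?addr0 // IH.
Qed.

Lemma horn_map f s : Om f -> f (horn s) = horn (map f s).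
Proof. by move=> Of; elim: s => [|g s IH] /=; rewrite ?raddf0 // raddfD yOm // IH. Qed.

Lemma zip_G (s t : seq V) : (forall g, g \in s -> G g) -> (forall g, g \in t -> G g) ->
  forall g, g \in [seq p.1 - p.2 | p <- zip s t] -> G g.
Proof.
elim: s t => [|a s IH] [|d t] //= hs ht g; rewrite inE => /orP[/eqP->|].
  by apply: sG.1.2; [apply: hs|apply: ht]; rewrite inE eqxx.
by apply: IH => h hh; [apply: hs|apply: ht]; rewrite inE hh orbT.
Qed.

Lemma mem_adjoin v : G v -> adjoin v.
Proof.
move=> Gv; exists [:: v] => [g|]; first by rewrite inE => /eqP ->.
by rewrite /= raddf0 addr0.
Qed.

Lemma adjoin_submod : submod (fun f => Om f \/ f =1 y) adjoin.
Proof.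
split=> [|f [Of|fy] v [s sGs ->]].
- split=> [|u v [s hs ->] [t ht ->]]; first by exists [::].
  have pad (r : seq V) k : (forall g, g \in r -> G g) ->
      exists r', [/\ forall g, g \in r' -> G g, horn r' = horn r & size r' = (size r + k)%N].
    move=> hr; exists (r ++ nseq k 0); split.
    + by move=> g; rewrite mem_cat mem_nseq => /orP[/hr //|/andP[_ /eqP->]]; exact: sG.1.1.
    + by elim: r {hr} => [|a r IH] /=; [elim: k => //= k ->; rewrite raddf0 addr0|rewrite IH].
    + by rewrite size_cat size_nseq.
  have [s' [hs' <- ss]] := pad s (size t) hs.
  have [t' [ht' <- st]] := pad t (size s) ht.
  have E : size s' = size t' by rewrite ss st addnC.
  by rewrite (hornB E); eexists; last reflexivity; exact: zip_G.
- rewrite horn_map //; eexists; last reflexivity.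
  by move=> g /mapP[a /sGs Ga ->]; exact: sG.2.
- rewrite fy; exists (0 :: s); last by rewrite /= add0r.
  by move=> g; rewrite inE => /orP[/eqP->|/sGs //]; exact: sG.1.1.
Qed.

(** [g] is the coefficient of [y ^ i] in some expression of a member of [C] with i + 1 coefficients;
    [g] may vanish, which makes these coefficients a submodule. *)
Definition leadc (C : V -> Prop) i g : Prop :=
  G g /\ exists s : seq V, [/\ size s = i, forall h, h \in s -> G h & C (horn (rcons s g))].

Lemma leadc_submod C i : submod (fun f => Om f \/ f =1 y) C -> submod Om (leadc C i).
Proof.
move=> [sC CO]; split=> [|f Of g [Gg [s [<- sGs Cs]]]].
- split=> [|g h [Gg [s [ss sGs Cs]]] [Gh [t [st tG Ct]]]].
    split; first exact: sG.1.1.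
    exists (nseq i 0); rewrite size_nseq; split=> //.
      by move=> h; rewrite mem_nseq => /andP[_ /eqP->]; exact: sG.1.1.
    rewrite (_ : horn _ = 0); first exact: sC.1.
    by elim: i => [|i IH] /=; rewrite ?raddf0 ?addr0 ?IH ?raddf0 ?addr0.
  split; first exact: sG.1.2.
  exists [seq p.1 - p.2 | p <- zip s t]; split.
  + by rewrite size_map size_zip ss st minnn.
  + exact: zip_G.
  + rewrite -(map_rcons (fun p : V * V => p.1 - p.2) (zip s t) (g, h)).
    rewrite -zip_rcons ?ss ?st // -hornB ?size_rcons ?ss ?st //.
    exact: sC.2.
- split; first exact: sG.2.
  exists (map f s); rewrite size_map; split=> //.
    by move=> h /mapP[a /sGs Ga ->]; exact: sG.2.
  by rewrite -map_rcons -horn_map //; apply: CO => //; left.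
Qed.

Lemma leadcS C i g : submod (fun f => Om f \/ f =1 y) C -> leadc C i g -> leadc C i.+1 g.
Proof.
move=> [sC CO] [Gg [s [<- sGs Cs]]]; split=> //; exists (0 :: s); split=> //.
  by move=> h; rewrite inE => /orP[/eqP->|/sGs //]; exact: sG.1.1.
by rewrite /= add0r; apply: CO => //; right.
Qed.

(** Subtract from an element of [C'] an element of [C] with the same top coefficient: the difference
    is still in [C'] and has a shorter coefficient list. *)
Lemma leadc_inj C C' : submod (fun f => Om f \/ f =1 y) C ->
  submod (fun f => Om f \/ f =1 y) C' -> (forall v, C v -> C' v) ->
  (forall i g, leadc C' i g -> leadc C i g) ->
  forall v, C' v -> adjoin v -> C v.
Proof.
move=> [sC _] [sC' _] CC' LL v C'v [s sGs vs]; rewrite {v}vs in C'v *.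
have [k] := ubnP (size s); elim: k s sGs C'v => // k IH s.
case/lastP: s => [|s g]; first by move=> *; exact: sC.1.
rewrite size_rcons ltnS => sGs C'v sk.
have sG' h : h \in s -> G h by move=> hs; apply: sGs; rewrite mem_rcons inE hs orbT.
have Lg : leadc C' (size s) g.
  by split; [apply: sGs; rewrite mem_rcons inE eqxx|exists s].
have [_ [t [ts tG Ct]]] := LL _ _ Lg.
rewrite -(subrK (horn (rcons t g)) (horn (rcons s g))); apply: sgD => //.
rewrite horn_zip_rcons //; apply: IH.
- exact: zip_G.
- by rewrite -(horn_zip_rcons g) //; apply: sC'.2 => //; exact: CC'.
- by rewrite size_map size_zip ts minnn.
Qed.

Lemma noeth_adjoin : noeth Om G -> noeth (fun f => Om f \/ f =1 y) adjoin.
Proof.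
move=> nG C sC CA CS.
have Cle := chain_le CS.
have Lsub i n m g : (n <= m)%N -> leadc (C n) i g -> leadc (C m) i g.
  by move=> nm [Gg [s [ss sGs Cs]]]; split=> //; exists s; split=> //; exact: (Cle n).
have Lle n i j g : (i <= j)%N -> leadc (C n) i g -> leadc (C n) j g.
  by move=> ij; apply: (chain_le (C := leadc (C n))) ij => k v; exact: leadcS.
have [n||n v|N0 hN0] := nG (fun n => leadc (C n) n).
- exact: leadc_submod.
- by move=> n v [].
- by move=> /(Lsub _ _ n.+1 _ (leqnSn n)); exact: leadcS.
have hi i : exists N, forall n g, leadc (C n) i g -> leadc (C N) i g.
  apply: nG => [n|n v []//|n v]; first exact: leadc_submod.
  exact: Lsub.
pose Ni i := sval (cid (hi i)); have NiP i := svalP (cid (hi i)).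
(* The diagonal chain, stationary from [N0] on, settles all degrees i >= N0, because [leadc] grows
   in both indices; the finitely many smaller degrees are settled one by one. *)
pose N := maxn N0 (\max_(i < N0) Ni i).
exists N => n v Cv; apply: (@leadc_inj (C N) (C (maxn n N))) => //.
- by move=> u; apply: Cle; exact: leq_maxr.
- move=> i g; set m := maxn n N => Lg; case: (ltnP i N0) => iN.
    apply: (Lsub i (Ni i)); last exact: NiP Lg.
    rewrite leq_max; apply/orP; right.
    exact: (@leq_bigmax _ (fun i : 'I_N0 => Ni i) (Ordinal iN)).
  apply: (Lle _ N0) => //; apply: (Lsub N0 N0); first exact: leq_maxl.
  apply: (hN0 (maxn m i)); apply: (Lle _ i); first exact: leq_maxr.
  by apply: Lsub Lg; exact: leq_maxl.
- by apply: Cle Cv; exact: leq_maxl.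
- exact: CA Cv.
Qed.

End HilbertBasis.

Definition adj_ops Om ys (f : {additive V -> V}) := Om f \/ List.Exists (fun g : {additive V -> V} => f =1 g) ys.

Lemma noeth_adjoins Om G ys :
  (forall f y, Om f -> List.In y ys -> forall v, f (y v) = y (f v)) ->
  (forall x y, List.In x ys -> List.In y ys -> forall v, x (y v) = y (x v)) ->
  submod Om G -> noeth Om G ->
  exists G', [/\ forall v, G v -> G' v, submod (adj_ops Om ys) G'
               & noeth (adj_ops Om ys) G'].
Proof.
elim: ys => [|y ys IH] Oy yy sG nG.
  exists G; split=> //; last by apply: noeth_sub nG => // f; left.
  by split=> [|f [Of|/List.Exists_nil//]]; [exact: sG.1|exact: sG.2].
have [f z Of zy|x z xy zy|||G' [GG' sG' nG']] := IH => //.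
- by apply: Oy => //; right.
- by apply: yy; right.
have yO f : adj_ops Om ys f -> forall v, f (y v) = y (f v).
  case=> [Of v|/List.Exists_exists[g [gy fg]] v]; first by apply: Oy => //; left.
  by rewrite !fg; apply: yy; [right|left].
have E f : adj_ops Om (y :: ys) f <-> adj_ops Om ys f \/ f =1 y.
  split=> [[Of|/List.Exists_cons[fy|hf]]|[[Of|hf]|fy]].
  + by left; left.
  + by right.
  + by left; right.
  + by left.
  + by right; apply: List.Exists_cons_tl.
  + by right; apply: List.Exists_cons_hd.
exists (adjoin G' y); split.
- by move=> v /GG'; exact: mem_adjoin.
- have [h1 h2] := adjoin_submod yO sG'; split=> // f /E; exact: h2.
- apply: noeth_sub (noeth_adjoin yO sG' nG') => // f /E //.
Qed.

Lemma noeth_gen Om G B ys :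
  (forall f y, Om f -> List.In y ys -> forall v, f (y v) = y (f v)) ->
  (forall x y, List.In x ys -> List.In y ys -> forall v, x (y v) = y (x v)) ->
  submod Om G -> noeth Om G ->
  (forall C, submod (adj_ops Om ys) C -> (forall v, G v -> C v) -> forall v, B v -> C v) ->
  noeth (adj_ops Om ys) B.
Proof.
move=> h1 h2 sG nG hB; have [G' [GG' sG' nG']] := noeth_adjoins h1 h2 sG nG.
by apply: noeth_sub nG' => //; exact: hB.
Qed.

(** * The Artin-Rees lemma for commuting operators *)

Section ArtinRees.

Section Powers.
Variables (xs : seq {additive V -> V}) (A : V -> Prop).
(** The product (xs)^k A, spanned by words of length exactly [k] applied to [A]. It decreases with
    [k] once [A] is a subgroup stable under [xs]. *)
Inductive pw : nat -> V -> Prop :=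
  | pw_top v of A v : pw 0 v
  | pw_0 k : pw k 0
  | pw_add k u v of pw k u & pw k v : pw k (u + v)
  | pw_mul k x v of List.In x xs & pw k v : pw k.+1 (x v).
End Powers.

Lemma pw_subgroup xs A k : subgroup A -> subgroup (pw xs A k).
Proof.
move=> sA; split=> [|u v hu hv]; first exact: pw_0.
apply: pw_add => //; elim: {u hu} hv => {k v}.
- by move=> v Av; apply: pw_top; exact: sgN.
- by move=> k; rewrite oppr0; exact: pw_0.
- by move=> k u v _ hu _ hv; rewrite opprD; exact: pw_add.
- by move=> k x v hx _ hv; rewrite -raddfN; exact: pw_mul.
Qed.

Lemma pw_stable xs A k (f : {additive V -> V}) : (forall v, A v -> A (f v)) ->
  (forall x, List.In x xs -> forall v, f (x v) = x (f v)) ->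
  forall v, pw xs A k v -> pw xs A k (f v).
Proof.
move=> fA fx v; elim=> {k v}.
- by move=> v Av; apply: pw_top; exact: fA.
- by move=> k; rewrite raddf0; exact: pw_0.
- by move=> k u v _ hu _ hv; rewrite raddfD; exact: pw_add.
- by move=> k x v hx _ hv; rewrite fx //; exact: pw_mul.
Qed.

Lemma pw_sub xs A k v : subgroup A ->
  (forall x, List.In x xs -> forall v, A v -> A (x v)) -> pw xs A k v -> A v.
Proof.
move=> sA xA; elim=> {k v} //.
- by move=> k; exact: sA.1.
- by move=> k u v _ hu _ hv; exact: sgD.
- by move=> k x v hx _; exact: xA.
Qed.

Lemma pw_pw xs A B p q v : (forall v, pw xs B q v -> A v) ->
  pw xs B (p + q) v -> pw xs A p v.
Proof.
move=> hA; move E : (p + q)%N => m h; elim: h p E => {m v}.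
- move=> v Bv [|p] // E; apply: pw_top; apply: hA.
  by move: E; rewrite add0n => ->; exact: pw_top.
- by move=> k p _; exact: pw_0.
- by move=> k u v _ hu _ hv p E; apply: pw_add; [exact: hu|exact: hv].
- move=> k x v hx hv IH [|p] E.
    by apply: pw_top; apply: hA; rewrite add0n in E; rewrite E; exact: pw_mul.
  by apply: pw_mul => //; apply: IH; move: E; rewrite addSn => -[].
Qed.

Lemma pw_leq xs A p q v : subgroup A ->
  (forall x, List.In x xs -> forall v, A v -> A (x v)) -> (p <= q)%N ->
  pw xs A q v -> pw xs A p v.
Proof.
move=> sA xA /subnKC <-; apply: pw_pw => w; exact: pw_sub.
Qed.

Lemma pw_split x xs A k v : subgroup A ->
  (forall y, List.In y xs -> forall v, x (y v) = y (x v)) ->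
  pw (x :: xs) A k v ->
  exists2 u : nat -> V, (forall i, (i <= k)%N -> pw xs A (k - i) (u i)) &
    v = \sum_(i < k.+1) iter i x (u i).
Proof.
move=> sA xy.
have iterD i (a d : V) : iter i x (a + d) = iter i x a + iter i x d.
  by elim: i => //= i ->; rewrite raddfD.
have iter0 i : iter i x 0 = 0 by elim: i => //= i ->; rewrite raddf0.
elim=> {k v}.
- move=> v Av; exists (fun=> v) => [i|]; last by rewrite big_ord1.
  by rewrite leqn0 => /eqP->; exact: pw_top.
- move=> k; exists (fun=> 0) => [i _|]; first exact: pw_0.
  by rewrite big1.
- move=> k u v _ [a ha ->] _ [d hd ->]; exists (fun i => a i + d i) => [i ik|].
    by apply: pw_add; [exact: ha|exact: hd].
  by rewrite -big_split; apply: eq_bigr => i _; rewrite iterD.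
- move=> k y v [<-|hy] _ [a ha ->].
    exists (fun i => if i is i'.+1 then a i' else 0) => [[|i] ik|].
    + exact: pw_0.
    + by rewrite subSS; exact: ha.
    + by rewrite [RHS]big_ord_recl /= add0r raddf_sum.
  exists (fun i => if (i <= k)%N then y (a i) else 0) => [i ik|].
    case: leqP => ik'; last exact: pw_0.
    by rewrite subSn //; apply: pw_mul => //; exact: ha.
  rewrite raddf_sum [RHS]big_ord_recr /= ltnn iter0 raddf0 addr0.
  apply: eq_bigr => i _; rewrite -ltnS ltn_ord.
  by elim: (nat_of_ord i) (a i) => //= j IH w; rewrite -IH xy.
Qed.

(** If [x ^ n] maps [A] into [C], and so do words of length L in the other operators, then a word of
    length n + L contains [x] at least n times or the others at least L times. *)
Lemma pw_nil xs A C : subgroup A -> subgroup C ->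
  (forall x, List.In x xs -> forall v, C v -> C (x v)) ->
  (forall x y, List.In x xs -> List.In y xs -> forall v, x (y v) = y (x v)) ->
  (forall x, List.In x xs -> exists n, forall v, A v -> C (iter n x v)) ->
  (forall x, List.In x xs -> forall v, A v -> A (x v)) ->
  exists L, forall v, pw xs A L v -> C v.
Proof.
move=> sA sC; elim: xs => [|x xs IH] xC xx xn xA.
  exists 1%N => v; move E : 1%N => m h; elim: h E => {m v} //.
  - by move=> *; exact: sC.1.
  - by move=> k u v _ hu _ hv E; apply: sgD => //; [exact: hu|exact: hv].
have [||||L hL] := IH.
- by move=> y hy; apply: xC; right.
- by move=> y z hy hz; apply: xx; right.
- by move=> y hy; apply: xn; right.
- by move=> y hy; apply: xA; right.
have [|n hn] := xn x; first by left.
have Cit i w : C w -> C (iter i x w).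
  by move=> Cw; elim: i => //= i; apply: xC; left.
exists (n + L)%N => v /pw_split[//||u hu ->].
  by move=> y hy; apply: xx; [left|right].
apply: sg_sum => // i _; case: (ltnP i n) => ni.
- apply: Cit; apply: hL.
  apply: (@pw_leq _ _ _ (n + L - i)) => //.
  + by move=> y hy; apply: xA; right.
  + by rewrite -addnBAC ?leq_addl // ltnW.
  + by apply: hu; rewrite -ltnS.
- have Aui : A (u i).
    have := hu i; rewrite -ltnS ltn_ord => /(_ isT); apply: pw_sub => // y hy.
    by apply: xA; right.
  rewrite (_ : iter i x (u i) = iter (i - n) x (iter n x (u i))); last first.
    by rewrite -iterD subnK.
  by apply: Cit; exact: hn.
Qed.

Variables (Om : {additive V -> V} -> Prop) (xs : seq {additive V -> V}) (B : V -> Prop).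
Hypothesis xsO : forall x, List.In x xs -> Om x.
Hypothesis Oxs : forall f x, Om f -> List.In x xs -> forall v, f (x v) = x (f v).
Hypothesis sB : submod Om B.
Hypothesis nB : noeth Om B.

(* C maximal with [C /\ A <= A'] absorbs a power of each x: if the kernels of
   [x^n : B -> B/C] are stationary from N on, then [x^N B + C] meets A inside A'. *)
Lemma artin_rees_step A A' : submod Om A -> submod Om A' -> (forall v, A v -> B v) ->
  (forall v, A' v -> A v) ->
  (forall x, List.In x xs -> forall v, A v -> A' (x v)) ->
  exists q, forall v, pw xs B q v -> A v -> A' v.
Proof.
move=> sA sA' AB A'A xA.
pose Q C := [/\ submod Om C, forall v, C v -> B v, forall v, A' v -> C v
             & forall v, C v -> A v -> A' v].
have [||C [sC CB A'C CA] hmax] := @noeth_max Om B Q A' nB.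
- by move=> C [].
- by split=> // v /A'A /AB.
have itD x i (a d : V) : iter i x (a - d) = iter i x a - iter i x d.
  by elim: i => //= i ->; rewrite raddfB.
have it0 x i : iter i x 0 = 0 by elim: i => //= i ->; rewrite raddf0.
have itO x i f v : List.In x xs -> Om f -> f (iter i x v) = iter i x (f v).
  by move=> hx Of; elim: i => //= i <-; rewrite Oxs.
have itB x i v : List.In x xs -> B v -> B (iter i x v).
  by move=> hx Bv; elim: i => //= i; apply: sB.2; exact: xsO.
suff xC x : List.In x xs -> exists n, forall v, B v -> C (iter n x v).
  have [||||||L hL] := @pw_nil xs B C => //; try exact: sB.1; try exact: sC.1.
  - by move=> x /xsO; exact: sC.2.
  - by move=> x y /xsO Ox hy; exact: Oxs.
  - by move=> x /xsO; exact: sB.2.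
  - by exists L => v /hL; exact: CA.
move=> hx.
have [n||n v [Bv Cv]|N hN] := nB (C := fun n v => B v /\ C (iter n x v)).
+ split=> [|f Of v [Bv Cv]].
    split=> [|u v [Bu Cu] [Bv Cv]].
      by split; [exact: sB.1.1|rewrite it0; exact: sC.1.1].
    by split; [exact: sB.1.2|rewrite itD; exact: sC.1.2].
  by split; [exact: sB.2|rewrite -itO //; exact: sC.2].
+ by move=> n v [].
+ by split=> //=; apply: sC.2 => //; exact: xsO.
exists N => b Bb.
pose C2 v := exists u w, [/\ B u, C w & v = iter N x u + w].
apply: (hmax C2); last 1 first.
+ by exists b, 0; rewrite addr0; split=> //; exact: sC.1.1.
+ split.
  * split=> [|f Of v [u [w [Bu Cw ->]]]].
      split=> [|v v' [u [w [Bu Cw ->]]] [u' [w' [Bu' Cw' ->]]]].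
        by exists 0, 0; rewrite it0 addr0; split=> //; [exact: sB.1.1|exact: sC.1.1].
      exists (u - u'), (w - w'); rewrite itD opprD addrACA; split=> //.
        exact: sB.1.2.
      exact: sC.1.2.
    exists (f u), (f w); rewrite raddfD itO //; split=> //.
      exact: sB.2.
    exact: sC.2.
  * move=> v [u [w [Bu Cw ->]]]; apply: sgD; [exact: sB.1|exact: itB|exact: CB].
  * move=> v /A'C Cv; exists 0, v; rewrite it0 add0r; split=> //; exact: sB.1.1.
  * move=> v [u [w [Bu Cw ->]]] Aa; apply: CA => //; apply: sgD => //; first exact: sC.1.
    suff [] : B u /\ C (iter N x u) by [].
    apply: (hN N.+1); split=> //=.
    rewrite -[iter N x u](addrK w) raddfB; apply: sC.1.2.
      by apply: A'C; exact: xA.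
    by apply: sC.2 => //; exact: xsO.
+ by move=> v Cv; exists 0, v; rewrite it0 add0r; split=> //; exact: sB.1.1.
Qed.

(** Induction on [p]: the step is applied to (xs)^p A and (xs)^(p+1) A, and the larger of the two
    exponents serves both purposes. *)
Lemma artin_rees A : submod Om A -> (forall v, A v -> B v) ->
  forall p, exists q, forall v, pw xs B q v -> A v -> pw xs A p v.
Proof.
move=> sA AB.
have spw p : submod Om (pw xs A p).
  split=> [|f Of]; first by apply: pw_subgroup; exact: sA.1.
  by apply: pw_stable => [v|x hx v]; [exact: sA.2|exact: Oxs].
have pwA p v : pw xs A p v -> A v.
  by apply: pw_sub => [|x /xsO]; [exact: sA.1|exact: sA.2].
elim=> [|p [q hq]].
  by exists 0%N => v _ Av; exact: pw_top.
have [|||||r hr] := @artin_rees_step (pw xs A p) (pw xs A p.+1) => //.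
- by move=> v /pwA/AB.
- move=> v; apply: pw_leq => //; first exact: sA.1.
  by move=> x /xsO; exact: sA.2.
- by move=> x hx v; exact: pw_mul.
have le k l v : (k <= l)%N -> pw xs B l v -> pw xs B k v.
  by apply: pw_leq; [exact: sB.1|move=> x /xsO; exact: sB.2].
exists (maxn q r) => v hv Av; apply: hr.
  by apply: le hv; exact: leq_maxr.
by apply: hq => //; apply: le hv; exact: leq_maxl.
Qed.

End ArtinRees.

End OperatorModules.

(** * Spans and finite dimension *)

Section Spans.
Variable (R : pzRingType).

(** With these operators [submod] means submodule and [noeth] is the ascending chain condition on
    submodules, so ordinary modules fall under the operator version. *)
Definition scalops (V : lmodType R) (f : {additive V -> V}) : Prop :=
  exists r : R, f =1 *:%R r.

Lemma scalops_submod (V : lmodType R) (C : V -> Prop) :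
  C 0 -> (forall u v : V, C u -> C v -> C (u + v)) ->
  (forall (r : R) (v : V), C v -> C (r *: v)) ->
  submod (@scalops V) C.
Proof.
move=> C0 CD CZ; split=> [|f [r fr] v Cv]; last by rewrite fr; exact: CZ.
by split=> // u v Cu Cv; apply: CD => //; rewrite -scaleN1r; exact: CZ.
Qed.

Lemma submodZ (V : lmodType R) (C : V -> Prop) (r : R) (v : V) :
  submod (@scalops V) C -> C v -> C (r *: v).
Proof. by move=> [_ h]; apply: (h (GRing.scale r : {additive V -> V})); exists r. Qed.

Section Span.
Variable V : lmodType R.
Implicit Types (s : seq V) (C : V -> Prop).

Fixpoint lspan s v : Prop :=
  if s is e :: s' then exists r, exists2 u, lspan s' u & v = r *: e + u else v = 0.

Lemma lspan0 s : lspan s 0.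
Proof. by elim: s => //= e s IH; exists 0, 0; rewrite // scale0r addr0. Qed.

Lemma lspanD s u v : lspan s u -> lspan s v -> lspan s (u + v).
Proof.
elim: s u v => [u v -> ->|e s IH u v] /=; first exact: addr0.
move=> [r [u' hu ->]] [t [v' hv ->]]; exists (r + t), (u' + v'); first exact: IH.
by rewrite scalerDl addrACA.
Qed.

Lemma lspanZ s r v : lspan s v -> lspan s (r *: v).
Proof.
elim: s v => [v ->|e s IH v] /=; first exact: scaler0.
move=> [t [v' hv ->]]; exists (r * t), (r *: v'); first exact: IH.
by rewrite scalerDr scalerA.
Qed.

Lemma lspan_submod s : submod (@scalops V) (lspan s).
Proof. by apply: scalops_submod; [exact: lspan0|exact: lspanD|exact: lspanZ]. Qed.

Lemma lspan_cons e s v : lspan s v -> lspan (e :: s) v.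
Proof. by exists 0, v => //; rewrite scale0r add0r. Qed.

Lemma mem_lspan s e : e \in s -> lspan s e.
Proof.
elim: s => // a s IH; rewrite inE => /orP[/eqP->|/IH]; last exact: lspan_cons.
by exists 1, 0; [exact: lspan0|rewrite scale1r addr0].
Qed.

Lemma lspan_sub C s v : submod (@scalops V) C -> (forall e, e \in s -> C e) ->
  lspan s v -> C v.
Proof.
move=> sC; elim: s v => [v _ ->|e s IH v hs [r [u hu ->]]]; first exact: sC.1.1.
apply: sgD; [exact: sC.1|apply: submodZ => //; apply: hs; rewrite inE eqxx //|].
by apply: (IH u _ hu) => a ha; apply: hs; rewrite inE ha orbT.
Qed.

Lemma lspan_incl s t v : (forall e, e \in s -> e \in t) -> lspan s v -> lspan t v.
Proof.
by move=> st; apply: lspan_sub => [|e /st]; [exact: lspan_submod|exact: mem_lspan].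
Qed.

Lemma lspan_nth s v : lspan s v ->
  exists a : 'I_(size s) -> R, v = \sum_(i < size s) a i *: s`_i.
Proof.
elim: s v => [v ->|e s IH v [r [u /IH[a ->] ->]]].
  by exists (fun=> 0); rewrite big_ord0.
exists (fun i => oapp a r (unlift ord0 i)).
rewrite big_ord_recl unlift_none /=; congr (_ + _); apply: eq_bigr => i _.
by rewrite liftK.
Qed.

Lemma lspan_tuple n (e : 'I_n -> V) (a : 'I_n -> R) :
  lspan [seq e i | i <- enum 'I_n] (\sum_(i < n) a i *: e i).
Proof.
apply: sg_sum => [|i _]; first by have [] := lspan_submod [seq e i | i <- enum 'I_n].
by apply: lspanZ; apply: mem_lspan; apply: map_f; rewrite mem_enum.
Qed.

Hypothesis nR : noeth (@scalops R^o) (fun=> True).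

(** A chain in the span of [e :: s] is controlled by the left ideals of coefficients of [e], taken
    modulo the span of [s], and by its intersections with the span of [s]. *)
Lemma noeth_lspan s : noeth (@scalops V) (lspan s).
Proof.
elim: s => [|e s IH] C sC CG CS.
  by exists 0%N => n v /CG /= ->; exact: (sC _).1.1.
have Cle := chain_le CS.
pose I n (r : R^o) := exists2 u, lspan s u & C n ((r : R) *: e + u).
have [n|//|n r|N1 hN1] := nR (C := I).
- apply: scalops_submod => [|r t [u su Cu] [v sv Cv]|a r [u su Cu]].
  + by exists 0; [exact: lspan0|rewrite scale0r addr0; exact: (sC _).1.1].
  + exists (u + v); first exact: lspanD.
    by rewrite scalerDl addrACA; apply: sgD => //; exact: (sC _).1.
  + exists (a *: u); first exact: lspanZ.
    rewrite (_ : _ + _ = a *: ((r : R) *: e + u)); first exact: submodZ.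
    by rewrite scalerDr scalerA.
- by move=> [u su Cu]; exists u => //; exact: CS.
have [n||n v|N2 hN2] := IH (fun n v => lspan s v /\ C n v).
- split=> [|f Of v [sv Cv]]; last by split; [exact: (lspan_submod s).2|exact: (sC n).2].
  split; first by split; [exact: lspan0|exact: (sC n).1.1].
  by move=> u v [su Cu] [sv Cv]; split; [exact: (lspan_submod s).1.2|exact: (sC n).1.2].
- by move=> n v [].
- by move=> [sv Cv]; split=> //; exact: CS.
exists (maxn N1 N2) => n v Cv.
have [r [u su vE]] := CG _ _ Cv.
have [|u' su' Cu'] := hN1 n r; first by exists u => //; rewrite -vE.
have C1 : C (maxn N1 N2) (r *: e + u') by apply: Cle Cu'; exact: leq_maxl.
rewrite -(subrK (r *: e + u') v); apply: sgD => //; first exact: (sC _).1.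
have [|su2] := hN2 (maxn n N1) (v - (r *: e + u')).
  split; last by apply: (sC _).1.2; [apply: Cle Cv; exact: leq_maxl|
                                     apply: Cle Cu'; exact: leq_maxr].
  rewrite vE opprD addrACA subrr add0r; exact: (lspan_submod s).1.2.
by apply: Cle; exact: leq_maxr.
Qed.

End Span.
End Spans.

(** * Finite dimension and separating functionals over a field *)

Section FiniteDimension.
Variable F : fieldType.

Lemma noeth_field : noeth (@scalops F F^o) (fun=> True).
Proof.
move=> C sC _ CS; case: (pselect (exists n a, C n a /\ a != 0)) => [[n [a [Ca a0]]]|h].
  exists n => m v _; rewrite (_ : v = (v / a : F) *: a); first exact: submodZ.
  by rewrite /GRing.scale /= mulfVK.
exists 0%N => n v Cv; have [->|v0] := eqVneq v 0; first exact: (sC _).1.1.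
by case: h; exists n, v.
Qed.

Definition fdim (V : lmodType F) (C : V -> Prop) : Prop :=
  exists s : seq V, forall v, C v -> lspan s v.

Lemma fdim_noeth (V : lmodType F) (C : V -> Prop) : fdim C -> noeth (@scalops F V) C.
Proof.
by move=> [s Cs]; apply: (noeth_sub _ Cs (noeth_lspan (s := s) noeth_field)).
Qed.

Lemma fdim_basis (V : lmodType F) (C : V -> Prop) : submod (@scalops F V) C -> fdim C ->
  exists2 s : seq V, (forall v, v \in s -> C v) & forall v, C v -> lspan s v.
Proof.
move=> sC /fdim_noeth nC; have [s sCs h] := noeth_fg nC sC (fun v => id).
by exists s => // v; apply: h => [|u]; [exact: lspan_submod|exact: mem_lspan].
Qed.

(** The image of [C] in V'/X and the kernel of [C -> V'/X] are finite dimensional; lifts of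
    generators of the former together with generators of the latter span [C]. Working modulo [X]
    avoids forming the quotient. *)
Lemma fdim_ker (V V' : lmodType F) (T : {linear V -> V'}) (C : V -> Prop)
    (X : V' -> Prop) (e : seq V') :
  submod (@scalops F V) C -> submod (@scalops F V') X ->
  (forall c, C c -> exists2 u, lspan e u & X (T c - u)) ->
  fdim (fun v => C v /\ X (T v)) -> fdim C.
Proof.
move=> sC sX hC [s0 hs0].
pose D u := lspan e u /\ exists2 c, C c & X (T c - u).
have sD : submod (@scalops F V') D.
  apply: scalops_submod => [|u v [su [c Cc Xc]] [sv [d Cd Xd]]|r u [su [c Cc Xc]]].
  - split; first exact: lspan0.
    by exists 0; [exact: sC.1.1|rewrite raddf0 subr0; exact: sX.1.1].
  - split; first exact: lspanD.
    exists (c + d); first by apply: sgD => //; exact: sC.1.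
    by rewrite linearD opprD addrACA; apply: sgD => //; exact: sX.1.
  - split; first exact: lspanZ.
    by exists (r *: c); [exact: submodZ|rewrite linearZ -scalerBr; exact: submodZ].
have [s sDs hs] := noeth_fg (noeth_lspan (s := e) noeth_field) sD (fun v h => h.1).
have hch u : exists c, u \in s -> C c /\ X (T c - u).
  have [/sDs[_ [c Cc Xc]]|us] := boolP (u \in s); first by exists c.
  by exists 0.
pose ch u := sval (cid (hch u)); have chP u := svalP (cid (hch u)).
pose cs := map ch s.
have sCs c : lspan cs c -> C c.
  by apply: lspan_sub => // c' /mapP[u us ->]; have [] := chP u us.
have hD u : D u -> exists2 w, lspan cs w & X (T w - u).
  apply: (hs (fun u => exists2 w, lspan cs w & X (T w - u))) => [|v vs].
    apply: scalops_submod => [|a a' [w sw Xw] [w' sw' Xw']|r a [w sw Xw]].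
    - by exists 0; [exact: lspan0|rewrite raddf0 subr0; exact: sX.1.1].
    - exists (w + w'); first exact: lspanD.
      by rewrite linearD opprD addrACA; apply: sgD => //; exact: sX.1.
    - by exists (r *: w); [exact: lspanZ|rewrite linearZ -scalerBr; exact: submodZ].
  by exists (ch v); [apply: mem_lspan; exact: map_f|have [] := chP v vs].
exists (cs ++ s0) => c Cc; have [u su Xu] := hC c Cc.
have [|w sw Xw] := hD u; first by split=> //; exists c.
rewrite -(subrK w c); apply: lspanD; last first.
  by apply: lspan_incl sw => v; rewrite mem_cat => ->.
apply: (@lspan_incl _ _ s0) => [v|]; first by rewrite mem_cat orbC => ->.
apply: hs0; split; first by apply: sC.1.2 => //; exact: sCs.
rewrite linearB (_ : _ - _ = (T c - u) - (T w - u)); first exact: sX.1.2.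
by rewrite opprB addrA subrK.
Qed.

(** By Zorn, a subspace maximal among those that contain [A] and avoid [v] is a complement of the
    line of [v]; [phi] is the coordinate along [v]. *)
Lemma separation (V : lmodType F) (A : V -> Prop) v :
  submod (@scalops F V) A -> ~ A v ->
  exists phi : {linear V -> F^o}, (forall a, A a -> phi a = 0) /\ phi v = 1.
Proof.
move=> sA nAv.
pose T := {X : V -> Prop | [/\ submod (@scalops F V) X, forall a, A a -> X a & ~ X v]}.
pose le (X Y : T) := `[< forall a, sval X a -> sval Y a >].
have [|||[X [sX AX nXv]] hmax] := @ZL_preorder T (exist _ A (And3 sA (fun a => id) nAv)) le.
- by move=> X; apply/asboolP.
- by move=> X Y Z /asboolP h /asboolP h'; apply/asboolP => a /h /h'.
- move=> S tot.
  case: (pselect (exists X, S X)) => [[X0 SX0]|nS]; last first.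
    exists (exist _ A (And3 sA (fun a => id) nAv)) => X SX; case: nS; by exists X.
  pose U a := exists2 X : T, S X & sval X a.
  have sU : submod (@scalops F V) U.
    apply: scalops_submod => [|a a' [X SX Xa] [Y SY Ya]|r a [X SX Xa]].
    - by exists X0 => //; have [h _ _] := svalP X0; exact: h.1.1.
    - have [/asboolP XY|/asboolP YX] := tot X Y SX SY.
        exists Y => //; have [h _ _] := svalP Y; apply: sgD => //; [exact: h.1|exact: XY].
      exists X => //; have [h _ _] := svalP X; apply: sgD => //; [exact: h.1|exact: YX].
    - by exists X => //; have [h _ _] := svalP X; exact: submodZ.
  have AU a : A a -> U a by exists X0 => //; have [_ h _] := svalP X0; exact: h.
  have nUv : ~ U v by case=> X SX; have [_ _] := svalP X.
  by exists (exist _ U (And3 sU AU nUv)) => X SX; apply/asboolP => a Xa; exists X.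
have dec a : exists r, X (a - r *: v).
  apply: contrapT => hn.
  pose Y u := exists r, X (u - r *: a).
  have sY : submod (@scalops F V) Y.
    apply: scalops_submod => [|u u' [r hr] [r' hr']|t u [r hr]].
    - by exists 0; rewrite scale0r subr0; exact: sX.1.1.
    - exists (r + r'); rewrite scalerDl opprD addrACA; apply: sgD => //; exact: sX.1.
    - by exists (t * r); rewrite -scalerA -scalerBr; exact: submodZ.
  have XY u : X u -> Y u by exists 0; rewrite scale0r subr0.
  have nYv : ~ Y v.
    case=> r hr; have [r0|r0] := eqVneq r 0.
      by apply: (nXv); move: hr; rewrite r0 scale0r subr0.
    apply: hn; exists r^-1.
    have := submodZ (- r^-1) sX hr.
    by rewrite scaleNr scalerBr scalerA mulVf // scale1r opprB.
  have /asboolP h := hmax (exist _ Y (And3 sY (fun a h => XY a (AX a h)) nYv)) (asboolT XY).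
  apply: hn; exists 0; rewrite scale0r subr0; apply: h.
  by exists 1; rewrite scale1r subrr; exact: sX.1.1.
have uniq r : X (r *: v) -> r = 0.
  move=> h; apply: contrapT => /eqP r0; apply: (nXv).
  by rewrite -[v]scale1r -(mulVf r0) -scalerA; exact: submodZ.
pose phi a : F^o := sval (cid (dec a)); have phiP a := svalP (cid (dec a)).
have phiE a r : X (a - r *: v) -> phi a = r.
  move=> h; apply/eqP; rewrite -subr_eq0; apply/eqP/uniq.
  have := sX.1.2 _ _ h (phiP a).
  by rewrite opprB addrC addrA subrK scalerBl.
have phi_lin : linear phi.
  move=> r a a'; apply: phiE; rewrite scalerDl -scalerA opprD addrACA -scalerBr.
  by apply: sgD; [exact: sX.1|apply: submodZ|]; rewrite ?phiP //; exact: phiP.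
pose L := GRing.isLinear.Build F V F^o *:%R phi phi_lin.
pose psi : {linear V -> F^o} := HB.pack phi L.
exists psi; split=> [a Aa|].
  by apply: phiE; rewrite scale0r subr0; exact: (AX).
by apply: phiE; rewrite scale1r subrr; exact: sX.1.1.
Qed.

End FiniteDimension.

(** * Tensor products and operator filtrations *)

Section TensorTheory.
Variables (B A : pzRingType) (P : zmodType) (la : B -> P -> P) (ra : P -> A -> P).
Variable N : lmodType A.
Local Notation T := (tensor la ra N).
Local Notation tn := (@tens B A P la ra N).

Lemma tensDl p q n : tn (p + q) n = tn p n + tn q n.
Proof. by rewrite /tens /mgen -mpiD; apply: mpi_rel; exact: tens_addl. Qed.
Lemma tensDr p n m : tn p (n + m) = tn p n + tn p m.
Proof. by rewrite /tens /mgen -mpiD; apply: mpi_rel; exact: tens_addr. Qed.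
Lemma tensA p a n : tn (ra p a) n = tn p (a *: n).
Proof. by apply: mpi_rel; exact: tens_bal. Qed.
Lemma tensZ b p n : b *: tn p n = tn (la b p) n.
Proof. by rewrite /tens /mgen -mpiZ; apply: esym; apply: mpi_rel; exact: tens_act. Qed.
Lemma tens0l n : tn 0 n = 0.
Proof. by apply: (@addrI _ (tn 0 n)); rewrite -tensDl !addr0. Qed.
Lemma tens0r p : tn p 0 = 0.
Proof. by apply: (@addrI _ (tn p 0)); rewrite -tensDr !addr0. Qed.

Lemma tens_sum (t : T) : exists s : seq (P * N), t = \sum_(u <- s) tn u.1 u.2.
Proof.
elim/pmod_quotP: t; elim=> [|[p n]|t [s hs] u [r hr]|b t [s hs]].
- by exists [::]; rewrite big_nil.
- by exists [:: (p, n)]; rewrite big_seq1.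
- by exists (s ++ r); rewrite mpiD hs hr big_cat.
- exists [seq (la b u.1, u.2) | u <- s].
  by rewrite mpiZ hs scaler_sumr big_map; apply: eq_bigr => u _; exact: tensZ.
Qed.

Lemma tens_ind (Q : T -> Prop) : Q 0 -> (forall t u, Q t -> Q u -> Q (t + u)) ->
  (forall p n, Q (tn p n)) -> forall t, Q t.
Proof.
move=> Q0 QD Qt t; have [s ->] := tens_sum t.
by elim: s => [|u s IH]; rewrite ?big_nil ?big_cons //; exact: QD.
Qed.

Section Coinduced.
Variable S : zmodType.

(* Additive maps from a B-module to S are the linear maps to this coinduced module. *)
Record coind := Coind { coind_fun :> B -> S;
  coindD : forall a b, coind_fun (a + b) = coind_fun a + coind_fun b }.
HB.instance Definition _ := gen_eqMixin coind.
HB.instance Definition _ := gen_choiceMixin coind.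

Lemma coind_ext (f g : coind) : f =1 g -> f = g.
Proof.
case: f g => f fD [g gD] /= /funext fg; rewrite fg in fD *.
by congr Coind; exact: Prop_irrelevance.
Qed.

Program Definition coind0 : coind := @Coind (fun=> 0) _.
Next Obligation. by rewrite addr0. Qed.
Program Definition coind_opp (f : coind) : coind := @Coind (fun b => - f b) _.
Next Obligation. by rewrite coindD opprD. Qed.
Program Definition coind_add (f g : coind) : coind := @Coind (fun b => f b + g b) _.
Next Obligation. by rewrite !coindD addrACA. Qed.
Program Definition coind_scale (a : B) (f : coind) : coind := @Coind (fun b => f (b * a)) _.
Next Obligation. by rewrite mulrDl coindD. Qed.

Lemma coind_addA : associative coind_add.
Proof. by move=> f g h; apply: coind_ext => b; exact: addrA. Qed.
Lemma coind_addC : commutative coind_add.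
Proof. by move=> f g; apply: coind_ext => b; exact: addrC. Qed.
Lemma coind_add0 : left_id coind0 coind_add.
Proof. by move=> f; apply: coind_ext => b; exact: add0r. Qed.
Lemma coind_addN : left_inverse coind0 coind_opp coind_add.
Proof. by move=> f; apply: coind_ext => b; exact: addNr. Qed.
HB.instance Definition _ :=
  GRing.isZmodule.Build coind coind_addA coind_addC coind_add0 coind_addN.

Lemma coind_scaleA a b f : coind_scale a (coind_scale b f) = coind_scale (a * b) f.
Proof. by apply: coind_ext => d /=; rewrite mulrA. Qed.
Lemma coind_scale1 : left_id 1 coind_scale.
Proof. by move=> f; apply: coind_ext => d /=; rewrite mulr1. Qed.
Lemma coind_scaleDr : right_distributive coind_scale +%R.
Proof. by move=> a f g; exact: coind_ext. Qed.
Lemma coind_scaleDl f : {morph coind_scale^~ f : a b / a + b}.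
Proof. by move=> a b; apply: coind_ext => d /=; rewrite mulrDr coindD. Qed.
HB.instance Definition _ := GRing.Zmodule_isLmodule.Build B coind
  coind_scaleA coind_scale1 coind_scaleDr coind_scaleDl.

Hypothesis la1 : forall p, la 1 p = p.
Hypothesis laM : forall a b p, la (a * b) p = la a (la b p).
Hypothesis laDl : forall a b p, la (a + b) p = la a p + la b p.
Hypothesis laDr : forall a p q, la a (p + q) = la a p + la a q.
Hypothesis la_ra : forall b p a, la b (ra p a) = ra (la b p) a.
Variable beta : P -> N -> S.
Hypothesis betaDl : forall p q n, beta (p + q) n = beta p n + beta q n.
Hypothesis betaDr : forall p n m, beta p (n + m) = beta p n + beta p m.
Hypothesis beta_bal : forall p a n, beta (ra p a) n = beta p (a *: n).

Lemma tens_universal : exists phi : {additive T -> S}, forall p n, phi (tn p n) = beta p n.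
Proof.
have gD (u : P * N) a b : beta (la (a + b) u.1) u.2 = beta (la a u.1) u.2 + beta (la b u.1) u.2.
  by rewrite laDl betaDl.
pose g (u : P * N) : coind := Coind (gD u).
have gr t u : tens_rel la ra t u -> meval g t = meval g u.
  case=> [p q n|p n m|p a n|b p n] /=; apply: coind_ext => d /=.
  - by rewrite laDr betaDl.
  - by rewrite betaDr.
  - by rewrite la_ra beta_bal.
  - by rewrite laM.
pose L := mlift gr; pose f (t : T) : S := L t 1.
have fB : zmod_morphism f by move=> t u; rewrite /f /L raddfB.
pose phi : {additive T -> S} := HB.pack f (GRing.isZmodMorphism.Build T S f fB).
by exists phi => p n; rewrite /phi /= /f /L mlift_gen /= la1.
Qed.

End Coinduced.
End TensorTheory.

(** * Extension of scalars *)

Section Extension.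
Variables (B A : pzRingType) (phi : {rmorphism A -> B}).

Definition eunit (M : lmodType A) (m : M) : extension_functor phi M :=
  @tens B A B (fun b p => b * p) (fun p a => p * phi a) M 1 m.

Lemma eunit_tens (M : lmodType A) (b : B) (m : M) :
  @tens B A B (fun b p => b * p) (fun p a => p * phi a) M b m = b *: eunit m.
Proof. by rewrite /eunit tensZ mulr1. Qed.

Section Object.
Variable M : lmodType A.
Local Notation u := (@eunit M).

Lemma eunitZ a m : u (a *: m) = phi a *: u m.
Proof. by rewrite -eunit_tens /eunit -(mul1r (phi a)) tensA. Qed.

Lemma eunit_linear : linear (@eunit M : M -> restr phi (extension_functor phi M)).
Proof. by move=> a m n; rewrite /eunit tensDr -/(eunit _) eunitZ. Qed.
HB.instance Definition _ := GRing.isLinear.Build A M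
  (restr phi (extension_functor phi M)) *:%R
  (@eunit M : M -> restr phi (extension_functor phi M)) eunit_linear.

Lemma eunitD m n : u (m + n) = u m + u n. Proof. exact: tensDr. Qed.
Lemma eunit0 : u 0 = 0. Proof. exact: tens0r. Qed.

Lemma ext_ind (Q : extension_functor phi M -> Prop) : Q 0 ->
  (forall t t', Q t -> Q t' -> Q (t + t')) -> (forall b m, Q (b *: u m)) -> forall t, Q t.
Proof. by move=> Q0 QD Qu; apply: tens_ind => // b m; rewrite eunit_tens. Qed.

Lemma ext_universal (S : zmodType) (beta : B -> M -> S) :
  (forall b b' m, beta (b + b') m = beta b m + beta b' m) ->
  (forall b m m', beta b (m + m') = beta b m + beta b m') ->
  (forall b a m, beta (b * phi a) m = beta b (a *: m)) ->
  exists f : {additive extension_functor phi M -> S}, forall b m, f (b *: u m) = beta b m.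
Proof.
move=> h1 h2 h3; have [|||||f hf] := @tens_universal B A B (fun b p => b * p)
  (fun p a => p * phi a) M S _ _ _ _ _ beta h1 h2 h3.
- exact: mul1r.
- by move=> a b p; rewrite mulrA.
- exact: mulrDl.
- exact: mulrDr.
- by move=> b p a /=; rewrite mulrA.
by exists f => b m; rewrite -eunit_tens hf.
Qed.

Lemma ext_lift (L : lmodType B) (f : {linear M -> restr phi L}) :
  exists g : {linear extension_functor phi M -> L}, forall b m, g (b *: u m) = b *: (f m : L).
Proof.
pose g (p : B * M) : L := p.1 *: (f p.2 : L).
have gr t t' : tens_rel (fun b p => b * p) (fun p a => p * phi a) t t' ->
    meval g t = meval g t'.
  case=> [p q n|p n m|p a n|b p n] /=; rewrite /g /=.
  - exact: scalerDl.
  - by rewrite raddfD scalerDr.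
  - by rewrite linearZ -scalerA.
  - by rewrite scalerA.
by exists (mlift gr) => b m; rewrite -eunit_tens; exact: (mlift_gen gr (b, m)).
Qed.
End Object.

Lemma ext_mapE (M N : lmodType A) (f : {linear M -> N}) (b : B) (m : M) :
  fmap (extension_functor phi) f (b *: eunit m) = b *: eunit (f m).
Proof. by rewrite -!eunit_tens; exact: tensor_mapE. Qed.

Lemma ext_map_unit (M N : lmodType A) (f : {linear M -> N}) (m : M) :
  fmap (extension_functor phi) f (eunit m) = eunit (f m).
Proof. exact: tensor_mapE. Qed.
End Extension.

Lemma In_map (T S : Type) (f : T -> S) (s : seq T) x :
  List.In x (map f s) <-> exists2 a, List.In a s & f a = x.
Proof.
elim: s => [|a s IH] /=; first by split=> // -[].
split=> [[ax|h]|[d [->|ds] dx]].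
- by exists a => //; left.
- by have [d ds dx] := IH.1 h; exists d => //; right.
- by left.
- by right; apply: IH.2; exists d.
Qed.

Lemma In_mem (T : eqType) (s : seq T) x : List.In x s <-> x \in s.
Proof.
elim: s => [|a s IH] //=; rewrite inE; split=> [[->|h]|/orP[/eqP->|h]].
- by rewrite eqxx.
- by rewrite IH.1 ?orbT.
- by left.
- by right; apply: IH.2.
Qed.

(** * Filtrations by powers of a family of operators *)

Section Filtered.
Variables (V : zmodType) (xs : seq {additive V -> V}).

Definition filt k v := pw xs (fun=> True) k v.

Definition separated := forall v, (forall k, filt k v) -> v = 0.
Definition complete := forall s : nat -> V, (forall k, filt k (s k.+1 - s k)) ->
  exists v, forall k, filt k (v - s k).

Lemma filt_sg k : subgroup (filt k). Proof. exact: pw_subgroup. Qed.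
Lemma filt0 k : filt k 0. Proof. exact: pw_0. Qed.
Lemma filtD k u v : filt k u -> filt k v -> filt k (u + v). Proof. exact: pw_add. Qed.
Lemma filtB k u v : filt k u -> filt k v -> filt k (u - v).
Proof. exact: (filt_sg k).2. Qed.
Lemma filtN k v : filt k v -> filt k (- v). Proof. exact: sgN (filt_sg k). Qed.
Lemma filt_top v : filt 0 v. Proof. exact: pw_top. Qed.
Lemma filt_leq k l v : (k <= l)%N -> filt l v -> filt k v.
Proof. exact: pw_leq. Qed.

Lemma filt_chain (s : nat -> V) k l : (forall k, filt k (s k.+1 - s k)) -> (k <= l)%N ->
  filt k (s l - s k).
Proof.
move=> hs /subnKC <-; elim: (l - k)%N => [|n IH]; first by rewrite addn0 subrr; exact: filt0.
rewrite addnS -(subrK (s (k + n)%N) (s (k + n).+1)) -addrA; apply: filtD => //.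
by apply: filt_leq (hs _); exact: leq_addr.
Qed.

(** For sequences that are Cauchy with a modulus [h], as Artin-Rees provides them. [h] need not
    increase, so the subsequence is taken along its running maxima. *)
Lemma filt_sub_le (s : nat -> V) (h : nat -> nat) : (forall k, k <= h k)%N ->
  (forall k l, (h k <= l)%N -> filt k (s l - s (h k))) -> complete ->
  exists v, forall k, filt k (v - s (h k)).
Proof.
move=> hk hs cV.
pose H k := (\max_(i < k.+1) h i)%N.
have hH k : (h k <= H k)%N by exact: (@leq_bigmax _ (fun i : 'I_k.+1 => h i) ord_max).
have HS k : (H k <= H k.+1)%N by rewrite /H [leqRHS]big_ord_recr leq_maxl.
have [k|v hv] := cV (fun k => s (H k)).
  rewrite -(subrKA (s (h k))) -(opprB _ (s (h k))) -[_ - s (h k)]/(_ - s (h k)).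
  apply: filtB; apply: hs => //; exact: leq_trans (HS k).
exists v => k; rewrite -(subrKA (s (H k))); apply: filtD => //.
exact: hs.
Qed.

End Filtered.

Section IdealFiltration.
Variables (Z : comPzRingType) (m : Z -> Prop) (ms : seq Z).
Hypothesis msP : forall a, m a <-> lspan (ms : seq Z^o) a.

Definition mops (M : lmodType Z) : seq {additive M -> M} :=
  [seq (GRing.scale a : {additive M -> M}) | a <- ms].

Lemma mops_In (M : lmodType Z) x : List.In x (mops M) -> exists2 a, m a & x = GRing.scale a.
Proof.
move=> /In_map[a /In_mem ha <-]; exists a => //; apply/msP.
exact: (mem_lspan (V := Z^o)).
Qed.

Lemma pw_scale (M : lmodType Z) (A : M -> Prop) k z v : submod (@scalops Z M) A ->
  pw (mops M) A k v -> pw (mops M) A k (z *: v).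
Proof.
move=> sA; apply: (pw_stable (f := GRing.scale z : {additive M -> M})).
  by move=> w; exact: submodZ.
by move=> x /mops_In[a _ ->] w /=; rewrite !scalerA mulrC.
Qed.

Lemma pw_submod (M : lmodType Z) (A : M -> Prop) k : submod (@scalops Z M) A ->
  submod (@scalops Z M) (pw (mops M) A k).
Proof.
move=> sA; apply: scalops_submod; first exact: pw_0.
  by move=> u v; exact: pw_add.
by move=> r v; exact: pw_scale.
Qed.

Lemma pw_m (M : lmodType Z) (A : M -> Prop) k a v : submod (@scalops Z M) A -> m a ->
  pw (mops M) A k v -> pw (mops M) A k.+1 (a *: v).
Proof.
move=> sA /msP ha hv; have sP := pw_submod k.+1 sA.
pose C (r : Z^o) := pw (mops M) A k.+1 ((r : Z) *: v).
apply: (@lspan_sub Z Z^o C ms a) => // [|e he].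
  apply: scalops_submod => [|r s hr hs|r s hs]; rewrite /C.
  - by rewrite scale0r; exact: pw_0.
  - by rewrite scalerDl; exact: pw_add.
  - by rewrite -scalerA; exact: submodZ.
apply: (pw_mul (x := GRing.scale e : {additive M -> M})) => //.
by apply/In_map; exists e => //; apply/In_mem.
Qed.

Lemma pw_idealX (M : lmodType Z) (A : M -> Prop) k z v : submod (@scalops Z M) A ->
  idealX m k z -> A v -> pw (mops M) A k (z *: v).
Proof.
move=> sA hz Av; elim: hz => {k z}.
- by move=> z; apply: pw_top; exact: submodZ.
- by move=> k; rewrite scale0r; exact: pw_0.
- by move=> k z z' _ hz _ hz'; rewrite scalerDl; exact: pw_add.
- by move=> k a z ma _ hz; rewrite -scalerA; exact: pw_m.
Qed.

(** Coefficients are recorded to lie in the ideal: expanding increments of a Cauchy sequence with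
    coefficients in m^k gives convergent series of coefficients. *)
Fixpoint ispan (M : lmodType Z) (I : Z -> Prop) (s : seq M) v : Prop :=
  if s is e :: s' then exists2 r, I r & exists2 u, ispan I s' u & v = r *: e + u
  else v = 0.

Lemma ispan0 (M : lmodType Z) k (s : seq M) : ispan (idealX m k) s 0.
Proof.
by elim: s => //= e s IH; exists 0; [exact: idealX_0|exists 0; rewrite // scale0r addr0].
Qed.

Lemma ispanD (M : lmodType Z) k (s : seq M) u v : ispan (idealX m k) s u ->
  ispan (idealX m k) s v -> ispan (idealX m k) s (u + v).
Proof.
elim: s u v => [u v -> ->|e s IH u v] /=; first exact: addr0.
move=> [r hr [u' hu ->]] [t ht [v' hv ->]].
exists (r + t); first exact: idealX_add.
by exists (u' + v'); [exact: IH|rewrite scalerDl addrACA].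
Qed.

Lemma ispanZ (M : lmodType Z) k l (s : seq M) z v :
  (forall r, idealX m k r -> idealX m l (z * r)) ->
  ispan (idealX m k) s v -> ispan (idealX m l) s (z *: v).
Proof.
move=> hz; elim: s v => [v ->|e s IH v] /=; first exact: scaler0.
move=> [r hr [u hu ->]]; exists (z * r); first exact: hz.
by exists (z *: u); [exact: IH|rewrite scalerDr scalerA].
Qed.

Lemma pw_ispan (M : lmodType Z) k (s : seq M) v :
  pw (mops M) (lspan s) k v -> ispan (idealX m k) s v.
Proof.
elim=> {k v}.
- elim: s => [v ->|e s IH v [r [u su ->]]] //=.
  by exists r; [exact: idealX_top|exists u => //; exact: IH].
- by move=> k; exact: ispan0.
- by move=> k u v _ hu _ hv; exact: ispanD.
- move=> k x v /mops_In[a ma ->] _ /=; apply: ispanZ => r; exact: idealX_mul.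
Qed.

Lemma ispan_nth (M : lmodType Z) (I : Z -> Prop) (s : seq M) v : ispan I s v ->
  exists2 a : 'I_(size s) -> Z, (forall i, I (a i)) & v = \sum_(i < size s) a i *: s`_i.
Proof.
elim: s v => [v ->|e s IH v [r hr [u /IH[a ha ->] ->]]].
  by exists (fun=> 0) => [[]|]; rewrite ?big_ord0.
exists (fun i => oapp a r (unlift ord0 i)) => [i|]; first by case: unlift.
rewrite big_ord_recl unlift_none /=; congr (_ + _); apply: eq_bigr => i _.
by rewrite liftK.
Qed.

Lemma idealX_pw k z : idealX m k z <-> pw (mops Z^o) (fun=> True) k z.
Proof.
split=> [h|].
  by rewrite -[z]mulr1; apply: (@pw_idealX Z^o) => //; exact: scalops_submod.
elim=> {k z}.
- by move=> v _; exact: idealX_top.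
- by move=> k; exact: idealX_0.
- by move=> k u v _ hu _ hv; exact: idealX_add.
- by move=> k x v /mops_In[a ma ->] _; exact: idealX_mul.
Qed.

Lemma idealX_leq k l z : (k <= l)%N -> idealX m l z -> idealX m k z.
Proof. by move=> kl /idealX_pw h; apply/idealX_pw; apply: filt_leq h. Qed.

End IdealFiltration.

(** * Adic completions of modules *)

Lemma choice2 (T S : Type) (P Q : T -> S -> Prop) :
  (forall x, exists2 y, P x y & Q x y) ->
  exists f, (forall x, P x (f x)) /\ forall x, Q x (f x).
Proof.
move=> h; have [x|f hf] := choice (P := fun x y => P x y /\ Q x y).
  by have [y Py Qy] := h x; exists y.
by exists f; split=> x; have [] := hf x.
Qed.

Lemma pw_mono (V : zmodType) (xs : seq {additive V -> V}) (A A' : V -> Prop) k v :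
  (forall v, A v -> A' v) -> pw xs A k v -> pw xs A' k v.
Proof.
move=> AA'; elim=> {k v}.
- by move=> v /AA'; exact: pw_top.
- by move=> k; exact: pw_0.
- by move=> k u v _ hu _ hv; exact: pw_add.
- by move=> k x v hx _; exact: pw_mul.
Qed.

Section CompletionElements.
Variables (Z : comPzRingType) (m : Z -> Prop).
Local Notation ZH := (completion m).
Local Notation tc := (@to_completion Z m).

(** [z] represents the class of [q] in Z / m^k. Identities in the completion are checked on such
    representatives, one [k] at a time. *)
Definition appr (q : ZH) k z := idealX m k (repr q k - z).

Lemma appr_repr q k : appr q k (repr q k).
Proof. by rewrite /appr subrr; exact: idealX_0. Qed.

Lemma appr_cpi x k : appr (cpi x) k (x k). Proof. exact: repr_cpi. Qed.

Lemma appr_tc z k : appr (tc z) k z. Proof. exact: (repr_cpi (cseq_cst m z)). Qed.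

Lemma idealXC k y z : idealX m k (y - z) -> idealX m k (z - y).
Proof. by rewrite -(opprB z); move/idealX_opp; rewrite opprK. Qed.

Lemma appr_eq q k y z : appr q k y -> idealX m k (y - z) -> appr q k z.
Proof. by rewrite /appr => h1 h2; rewrite -(subrKA y); exact: idealX_add. Qed.

Lemma appr_idealX q k z : appr q k z -> idealX m k z -> idealX m k (repr q k).
Proof. by move=> h hz; rewrite -(subrK z (repr q k)); exact: idealX_add. Qed.

Lemma appr_uniq q k y z : appr q k y -> appr q k z -> idealX m k (y - z).
Proof.
by rewrite /appr => h1 h2; rewrite -(subrKA (repr q k)); apply: idealX_add => //; exact: idealXC.
Qed.

Lemma appr_ext p q : (forall k, exists2 z, appr p k z & appr q k z) -> p = q.
Proof.
move=> h; rewrite -(cpi_repr p) -(cpi_repr q); apply/cpiP => k.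
by have [z hp hq] := h k; rewrite -(subrKA z); apply: idealX_add => //; exact: idealXC.
Qed.

Lemma apprD p q k y z : appr p k y -> appr q k z -> appr (p + q) k (y + z).
Proof.
move=> hp hq; have := appr_cpi (cseq_add (repr p) (repr q)) k => /= h.
apply: (appr_eq h); rewrite opprD addrACA; exact: idealX_add.
Qed.

Lemma apprM p q k y z : appr p k y -> appr q k z -> appr (p * q) k (y * z).
Proof.
move=> hp hq; have := appr_cpi (cseq_mul (repr p) (repr q)) k => /= h.
apply: (appr_eq h); rewrite mulr_sub2; apply: idealX_add; exact: idealX_scale.
Qed.

Lemma appr0 k : appr 0 k 0. Proof. exact: (appr_tc 0). Qed.

Lemma apprN p k y : appr p k y -> appr (- p) k (- y).
Proof.
move=> hp; have := appr_cpi (cseq_opp (repr p)) k => /= h.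
by apply: (appr_eq h); rewrite -opprD; exact: idealX_opp.
Qed.

Lemma apprB p q k y z : appr p k y -> appr q k z -> appr (p - q) k (y - z).
Proof. by move=> hp hq; apply: apprD => //; exact: apprN. Qed.

Lemma apprB0 p q k z : appr p k z -> appr q k z -> appr (p - q) k 0.
Proof. by move=> hp hq; rewrite -(subrr z); exact: apprB. Qed.

Lemma appr_sum k (I : Type) (r : seq I) (F : I -> ZH) (G : I -> Z) :
  (forall i, appr (F i) k (G i)) -> appr (\sum_(i <- r) F i) k (\sum_(i <- r) G i).
Proof.
move=> h; elim: r => [|i r IH]; rewrite ?big_nil ?big_cons; first exact: appr0.
exact: apprD.
Qed.

Program Definition cseries (d : nat -> Z) (hd : forall k, idealX m k (d k)) : cseq m :=
  @CSeq _ m (fun k => \sum_(j < k) d j) _.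
Next Obligation. by rewrite big_ord_recr /= addrAC subrr add0r. Qed.

Variable ms : seq Z.
Hypothesis msP : forall a, m a <-> lspan (ms : seq Z^o) a.
Hypothesis nZ : noeth (@scalops Z Z^o) (fun=> True).

Lemma cseq_chain (x : cseq m) k l : (k <= l)%N -> idealX m k (x l - x k).
Proof.
move=> kl; apply/(idealX_pw msP).
by apply: (filt_chain (s := x)) kl => j; apply/(idealX_pw msP); exact: cseqP.
Qed.

Lemma appr_leq q k l z : (k <= l)%N -> appr q l z -> appr q k z.
Proof.
move=> kl h; apply: (appr_eq (appr_repr q k)); rewrite -(subrKA (repr q l)).
apply: idealX_add; last by apply: (idealX_leq msP) h.
by apply: idealXC; exact: cseq_chain.
Qed.

(** With [s] generating m^k, the product m^(l+k) = m^l m^k expands in [s] with coefficients in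
    m^l. *)
Lemma idealX_fg k : exists2 s : seq Z^o, (forall a, a \in s -> idealX m k a) &
  forall l z, idealX m (l + k) z -> ispan (idealX m l) s z.
Proof.
have sI : submod (@scalops Z Z^o) (idealX m k).
  apply: scalops_submod; first exact: idealX_0.
    by move=> u v; exact: idealX_add.
  by move=> r v; exact: idealX_scale.
have [s sI' hs] := noeth_fg nZ sI (fun _ _ => I).
exists s => // l z /(idealX_pw msP) h; apply: (pw_ispan msP).
apply: pw_pw h => v /(idealX_pw msP); apply: hs => [|a]; first exact: lspan_submod.
exact: mem_lspan.
Qed.

(** The increments of [q] beyond stage k are expanded in fixed generators of m^k; by [idealX_fg] the
    coefficients of the l-th increment lie in m^l, so they sum to elements of the completion. *)
Lemma completion_ideal k : exists2 s : seq Z, (forall a, a \in s -> idealX m k a) &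
  forall q : ZH, appr q k 0 -> exists a : 'I_(size s) -> ZH, q = \sum_(i < size s) a i * tc s`_i.
Proof.
have [s hs hsp] := idealX_fg k; exists s => // q q0.
have q0' : idealX m (0 + k) (repr q k) by move: q0; rewrite /appr subr0.
have [c0 _ c0E] := ispan_nth (hsp 0%N _ q0').
have hd l : idealX m (l + k) (repr q (l + k).+1 - repr q (l + k)%N) by exact: cseqP.
have /choice2[c [cI cE]] l : exists2 c : 'I_(size s) -> Z, (forall i, idealX m l (c i)) &
    repr q (l + k).+1 - repr q (l + k)%N = \sum_(i < size s) c i * s`_i.
  by have [c h1 h2] := ispan_nth (hsp l _ (hd l)); exists c.
exists (fun i => tc (c0 i) + cpi (cseries (fun l => cI l i))).
apply: appr_ext => l; exists (repr q (l + k)%N).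
  by apply: (appr_leq (leq_addr k l)); exact: appr_repr.
have -> : repr q (l + k)%N = \sum_(i < size s) (c0 i + \sum_(j < l) c j i) * s`_i.
  elim: l => [|l IH].
    by rewrite add0n c0E; apply: eq_bigr => i _; rewrite big_ord0 addr0.
  rewrite addSn -(subrK (repr q (l + k)%N) (repr q (l + k).+1)) cE IH -big_split /=.
  apply: eq_bigr => i _; rewrite -mulrDl big_ord_recr /=; congr (_ * _).
  by rewrite addrCA [c l i + _]addrC.
apply: appr_sum => i; apply: apprM; last exact: appr_tc.
by apply: apprD; [exact: appr_tc|exact: (appr_cpi (cseries (fun l => cI l i)))].
Qed.

Section Module.
Variables (M : lmodType Z) (es : seq M) (N : lmodType ZH) (u : M -> N).
Hypothesis esP : forall v, lspan es v.
Hypothesis uD : forall v w, u (v + w) = u v + u w.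
Hypothesis uZ : forall z v, u (z *: v) = tc z *: u v.
Hypothesis uP : forall n, lspan (map u es) n.

Local Notation rN := (restr tc N).
Local Notation FM k v := (filt (mops ms M) k v).
Local Notation FN k n := (filt (mops ms rN) k (n : rN)).

(** The injectivity of M / m^k M -> N / m^k N, in terms of coefficients. It is not automatic for a
    tensor product given by generators and relations; [cm_filt_repr] establishes it for modules over
    the completed algebra. *)
Hypothesis filt_repr : forall k (p : 'I_(size es) -> ZH),
  FN k (\sum_(i < size es) p i *: u es`_i) ->
  FM k (\sum_(i < size es) repr (p i) k *: es`_i).

Lemma sT (L : lmodType Z) : submod (@scalops Z L) (fun=> True).
Proof. exact: scalops_submod. Qed.

Lemma uE0 : u 0 = 0.
Proof. by apply: (@addrI _ (u 0)); rewrite -uD !addr0. Qed.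
Lemma uEsum (I : Type) (r : seq I) (F : I -> M) :
  u (\sum_(i <- r) F i) = \sum_(i <- r) u (F i).
Proof. by elim: r => [|i r IH]; rewrite ?big_nil ?uE0 // !big_cons uD IH. Qed.
Lemma uEB v w : u (v - w) = u v - u w.
Proof.
by rewrite uD; congr (_ + _); apply: (@addrI _ (u w)); rewrite -uD !subrr uE0.
Qed.

Lemma filtM_coef k v : FM k v ->
  exists2 a : 'I_(size es) -> Z, (forall i, idealX m k (a i)) & v = \sum_(i < size es) a i *: es`_i.
Proof.
move=> h; apply: ispan_nth; apply: (pw_ispan msP).
by apply: pw_mono h => w _; exact: esP.
Qed.

Lemma filt_appr0 k (q : ZH) n : appr q k 0 -> FN k (q *: n).
Proof.
have [s sI hs] := completion_ideal k => /hs[a ->]; rewrite scaler_suml.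
apply: sg_sum => [|i _]; first exact: filt_sg.
rewrite mulrC -scalerA; apply: (@pw_idealX _ _ _ msP rN) => //.
by apply: sI; apply: mem_nth.
Qed.

Lemma elt_coef n : exists p : 'I_(size es) -> ZH, n = \sum_(i < size es) p i *: u es`_i.
Proof.
have [p ->] := lspan_nth (uP n); move: p; rewrite size_map => p; exists p.
by apply: eq_bigr => i _; rewrite (nth_map 0).
Qed.

Lemma completion_dense n k : exists v, FN k (n - u v).
Proof.
have [p ->] := elt_coef n; exists (\sum_(i < size es) repr (p i) k *: es`_i).
rewrite uEsum -sumrB; apply: sg_sum => [|i _]; first exact: filt_sg.
rewrite uZ -scalerBl; apply: filt_appr0.
by apply: apprB0; [exact: appr_repr|exact: appr_tc].
Qed.

Lemma completion_unit k v : FN k (u v) -> FM k v.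
Proof.
have [a ->] := lspan_nth (esP v); rewrite uEsum => h.
have /filt_repr : FN k (\sum_(i < size es) tc (a i) *: u es`_i).
  by rewrite (eq_bigr (fun i => u (a i *: es`_i))) // => i _; rewrite uZ.
rewrite -(subrK (\sum_(i < size es) repr (tc (a i)) k *: es`_i) (\sum_(i < size es) a i *: _)).
move=> h'; apply: filtD => //; rewrite -sumrB; apply: sg_sum => [|i _]; first exact: filt_sg.
rewrite -scalerBl; apply: (pw_idealX msP) => //.
by apply: idealXC; exact: appr_tc.
Qed.

(** Approximate [s k] by [u (v k)]. By [completion_unit] the increments of [v] lie in m^k M, hence
    expand in [es] with coefficients in m^k, and these series converge in the completion of [Z]. *)
Lemma completion_complete : complete (mops ms rN).
Proof.
move=> s hs.
have [v vP] := choice (fun k => completion_dense (s k) k).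
have hd k : FM k (v k.+1 - v k).
  apply: completion_unit; rewrite uEB.
  rewrite (_ : _ - _ = (s k.+1 - s k) - (s k.+1 - u (v k.+1)) + (s k - u (v k))).
    apply: filtD => //; apply: filtB; first exact: hs.
    exact: filt_leq (vP k.+1).
  by rewrite opprB [s k.+1 - s k + _]addrC !addrA !subrK.
have /choice2[c [cI cE]] k := filtM_coef (hd k).
have vE k : v k = v 0%N + \sum_(i < size es) (\sum_(j < k) c j i) *: es`_i.
  elim: k => [|k IH].
    by rewrite big1 ?addr0 // => i _; rewrite big_ord0 scale0r.
  rewrite -(subrK (v k) (v k.+1)) cE IH addrCA -big_split /=; congr (_ + _).
  by apply: eq_bigr => i _; rewrite -scalerDl big_ord_recr /= addrC.
pose q i := cpi (cseries (fun k => cI k i)).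
exists (u (v 0%N) + \sum_(i < size es) q i *: u es`_i) => k.
rewrite -(subrKA (u (v k))); apply: filtD; last first.
  by rewrite -opprB; apply: filtN; exact: vP.
rewrite (vE k) uD opprD addrACA subrr add0r uEsum -sumrB.
apply: sg_sum => [|i _]; first exact: filt_sg.
rewrite uZ -scalerBl; apply: filt_appr0; apply: (@apprB0 _ _ _ (\sum_(j < k) c j i)); last exact: appr_tc.
exact: (appr_cpi (cseries (fun k => cI k i))).
Qed.

(* If [sum p_i u(e_i)] lies in all the N_k, then p is congruent modulo m^k to a
   relation between the e_i; by Artin-Rees these relations converge to a
   combination of finitely many relations, which kills [sum p_i u(e_i)]. *)
Lemma completion_separated : separated (mops ms rN).
Proof.
move=> n hn; have [p nE] := elt_coef n; pose d := size es.
have /choice2[a [aI aE]] k : exists2 a : 'I_d -> Z, (forall i, idealX m k (a i)) &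
    \sum_(i < d) repr (p i) k *: es`_i = \sum_(i < d) a i *: es`_i.
  by apply: filtM_coef; apply: filt_repr; rewrite -nE.
pose L := 'rV[Z]_d; pose K (z : L) := \sum_(i < d) z 0 i *: es`_i = 0.
pose ka k : L := \row_i (repr (p i) k - a k i).
have Kka k : K (ka k).
  rewrite /K (eq_bigr (fun i => repr (p i) k *: es`_i - a k i *: es`_i)).
    by rewrite sumrB aE subrr.
  by move=> i _; rewrite mxE scalerBl.
have sK : submod (@scalops Z L) K.
  apply: scalops_submod; rewrite /K.
  - by rewrite big1 // => i _; rewrite mxE scale0r.
  - move=> x y hx hy; rewrite (eq_bigr (fun i => x 0 i *: es`_i + y 0 i *: es`_i)).
      by rewrite big_split /= hx hy addr0.
    by move=> i _; rewrite mxE scalerDl.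
  - move=> r x hx; rewrite (eq_bigr (fun i => r *: (x 0 i *: es`_i))).
      by rewrite -scaler_sumr hx scaler0.
    by move=> i _; rewrite mxE scalerA.
have Lspan (z : L) : lspan [seq (delta_mx 0 i : L) | i <- enum 'I_d] z.
  rewrite [z]row_sum_delta.
  by apply: (lspan_tuple (fun i => (delta_mx 0 i : L)) (fun i => z 0 i)).
have nL : noeth (@scalops Z L) (fun=> True).
  apply: (noeth_sub _ _ (noeth_lspan (s := [seq (delta_mx 0 i : L) | i <- enum 'I_d]) nZ)) => //.
have pwL k (z : L) : (forall i, idealX m k (z 0 i)) -> pw (mops ms L) (fun=> True) k z.
  move=> hz; rewrite [z]row_sum_delta; apply: sg_sum => [|i _]; first exact: filt_sg.
  by apply: (pw_idealX msP) => //; exact: sT.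
have /choice[g gP] j : exists q, forall z : L, pw (mops ms L) (fun=> True) q z -> K z ->
    pw (mops ms L) K j z.
  apply: (@artin_rees L (@scalops Z L)) => //.
  - by move=> x /(mops_In msP)[r _ ->]; exists r.
  - move=> f x [r fr] /(mops_In msP)[t _ ->] w /=.
    by rewrite !fr !scalerA mulrC.
have [sk skK hsk] := noeth_fg nL sK (fun _ _ => I).
(* The summand [g i] reaches the Artin-Rees exponent, and the summand [i] ensures [h j >= j]; as
   partial sums these indices increase. *)
pose h j := (\sum_(i < j.+1) (g i + i))%N.
have hE j : h j.+1 = (h j + (g j.+1 + j.+1))%N by rewrite /h big_ord_recr.
have hg j : (g j + j <= h j)%N by rewrite /h big_ord_recr leq_addl.
have hj j : (j <= h j)%N by apply: leq_trans (hg j); exact: leq_addl.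
have Kspan z : K z -> lspan sk z.
  by apply: hsk => [|x]; [exact: lspan_submod|exact: mem_lspan].
have kaI k l i : (k <= l)%N -> idealX m k (ka l 0 i - repr (p i) k).
  move=> kl; rewrite mxE addrAC; apply: idealX_sub; first exact: cseq_chain.
  exact: (idealX_leq msP kl).
have hdel j : pw (mops ms L) K j (ka (h j.+1) - ka (h j)).
  apply: gP; last exact: sK.1.2.
  apply: (filt_leq (l := h j)); first by apply: leq_trans (hg j); exact: leq_addr.
  apply: pwL => i; rewrite mxE [(- _ : L) 0 i]mxE -(subrKA (repr (p i) (h j))).
  apply: idealX_add; first by apply: kaI; rewrite hE leq_addr.
  by apply: idealXC; exact: kaI.
have /choice2[c [cI cE]] j : exists2 c : 'I_(size sk) -> Z, (forall i, idealX m j (c i)) &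
    ka (h j.+1) - ka (h j) = \sum_(i < size sk) c i *: sk`_i.
  apply: ispan_nth; apply: (pw_ispan msP).
  exact: pw_mono Kspan (hdel j).
have [c0 c0E] := lspan_nth (Kspan _ (Kka (h 0%N))).
have kaE j : ka (h j) = \sum_(t < size sk) (c0 t + \sum_(i < j) c i t) *: sk`_t.
  elim: j => [|j IH].
    by rewrite c0E; apply: eq_bigr => t _; rewrite big_ord0 addr0.
  rewrite -(subrK (ka (h j)) (ka (h j.+1))) cE IH -big_split /=; apply: eq_bigr => t _.
  by rewrite -scalerDl big_ord_recr /= addrCA [c j t + _]addrC.
pose q t := tc (c0 t) + cpi (cseries (fun j => cI j t)).
have pE i : p i = \sum_(t < size sk) q t * tc (sk`_t 0 i).
  apply: appr_ext => j; exists (ka (h j) 0 i).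
    apply: (appr_eq (appr_repr _ _)); apply: idealXC; exact: kaI.
  rewrite kaE summxE; apply: appr_sum => t; rewrite mxE; apply: apprM; last exact: appr_tc.
  by apply: apprD; [exact: appr_tc|exact: (appr_cpi (cseries (fun j => cI j t)))].
rewrite nE (eq_bigr (fun i : 'I_(size es) =>
    \sum_(t < size sk) q t *: (u (sk`_t 0 i *: es`_i)))); last first.
  by move=> i _; rewrite pE scaler_suml; apply: eq_bigr => t _; rewrite uZ scalerA.
rewrite exchange_big big1 //= => t _; rewrite -scaler_sumr -uEsum.
by have -> : \sum_(i < d) sk`_t 0 i *: es`_i = 0; [apply: skK; exact: mem_nth|rewrite uE0 scaler0].
Qed.

End Module.
End CompletionElements.

(** * Polynomial functions and invariants *)

Section CompletionExactness.
Variables (M1 M2 M3 N1 N2 N3 : zmodType).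
Variables (x1 : seq {additive M1 -> M1}) (x2 : seq {additive M2 -> M2})
  (x3 : seq {additive M3 -> M3}) (y1 : seq {additive N1 -> N1})
  (y2 : seq {additive N2 -> N2}) (y3 : seq {additive N3 -> N3}).
Variables (f : {additive M1 -> M2}) (g : {additive M2 -> M3}).
Variables (fh : {additive N1 -> N2}) (gh : {additive N2 -> N3}).
Variables (u1 : {additive M1 -> N1}) (u2 : {additive M2 -> N2}) (u3 : {additive M3 -> N3}).
Hypothesis fu : forall v, fh (u1 v) = u2 (f v).
Hypothesis gu : forall v, gh (u2 v) = u3 (g v).
Hypothesis fh_filt : forall k n, filt y1 k n -> filt y2 k (fh n).
Hypothesis gh_filt : forall k n, filt y2 k n -> filt y3 k (gh n).
Hypothesis u1_filt : forall k v, filt x1 k v -> filt y1 k (u1 v).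
Hypothesis u2_filt : forall k v, filt x2 k v -> filt y2 k (u2 v).
Hypothesis u2_inv : forall k v, filt y2 k (u2 v) -> filt x2 k v.
Hypothesis u3_inv : forall k v, filt y3 k (u3 v) -> filt x3 k v.
Hypothesis g_lift : forall k v, filt x3 k v -> exists2 v', filt x2 k v' & g v' = v.
Hypothesis AR : forall p, exists q, forall v, filt x2 q (f v) -> filt x1 p v.
Hypothesis dense1 : forall n k, exists v, filt y1 k (n - u1 v).
Hypothesis dense2 : forall n k, exists v, filt y2 k (n - u2 v).
Hypothesis sep1 : separated y1.
Hypothesis sep2 : separated y2.
Hypothesis comp1 : complete y1.
Hypothesis fg_exact : forall v, g v = 0 -> exists a, f a = v.

(** Let [u1 a] approximate [n]. As [fh n = 0], the element [f a] is deep in the filtration, hence so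
    is [a] by [AR], and then [n] itself. *)
Lemma completion_inj n : fh n = 0 -> n = 0.
Proof.
move=> n0; apply: sep1 => p; have [q hq] := AR p.
have [a ha] := dense1 n (maxn p q).
have : filt x2 (maxn p q) (f a).
  apply: u2_inv; rewrite -fu -[fh _]opprK -[- fh _]add0r -n0 -raddfB.
  exact/filtN/fh_filt.
move/(filt_leq (leq_maxr p q))/hq/u1_filt => h; rewrite -(subrK (u1 a) n).
by apply: filtD => //; exact: filt_leq (leq_maxl p q) ha.
Qed.

(** [n] is a limit of elements [u2 (f (a k))], the error in the kernel being corrected by [g_lift].
    Convergence of the [f (a k)] gives, through [AR], convergence of a subsequence of the
    [u1 (a k)]. *)
Lemma completion_ker n : gh n = 0 -> exists t, fh t = n.
Proof.
move=> n0.
have /choice[a ha] k : exists a, filt y2 k (n - u2 (f a)).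
  have [b hb] := dense2 n k.
  have /u3_inv/g_lift[b' hb' gb] : filt y3 k (u3 (g b)).
    by rewrite -gu -[gh _]opprK -[- gh _]add0r -n0 -raddfB; exact/filtN/gh_filt.
  have [a fa] : exists a, f a = b - b' by apply: fg_exact; rewrite raddfB gb subrr.
  exists a; rewrite fa raddfB opprB addrCA addrC; apply: filtD => //.
  exact: u2_filt.
have haa k l : (k <= l)%N -> filt x2 k (f (a l - a k)).
  move=> kl; apply: u2_inv; rewrite 2!raddfB.
  rewrite (_ : _ - _ = (n - u2 (f (a k))) - (n - u2 (f (a l)))); last first.
    by rewrite opprB [RHS]addrC addrA subrK.
  by apply: filtB => //; exact: filt_leq (ha l).
have [h hh] := choice AR.
have [|t ht] := @filt_sub_le _ y1 (fun k => u1 (a k)) (fun k => maxn k (h k))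
  (fun k => leq_maxl _ _) _ comp1.
  move=> k l kl /=; rewrite -raddfB; apply/u1_filt/hh.
  by apply: filt_leq (haa _ _ kl); exact: leq_maxr.
exists t; apply/eqP; rewrite -subr_eq0; apply/eqP/sep2 => k.
rewrite -(subrKA (fh (u1 (a (maxn k (h k)))))) -raddfB; apply: filtD.
  exact: fh_filt.
rewrite fu -opprB; apply: filtN; apply: filt_leq (ha _); exact: leq_maxl.
Qed.

End CompletionExactness.

Lemma pw_lift (V V' : zmodType) (xs : seq {additive V -> V}) (xs' : seq {additive V' -> V'})
    (g : {additive V -> V'}) :
  (forall v', exists v, g v = v') ->
  (forall x', List.In x' xs' -> exists2 x : {additive V -> V}, List.In x xs &
     forall v, g (x v) = x' (g v)) ->
  forall k v', filt xs' k v' -> exists2 v, filt xs k v & g v = v'.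
Proof.
move=> gs gx k v'; elim=> {k v'}.
- by move=> v' _; have [v <-] := gs v'; exists v => //; exact: filt_top.
- by move=> k; exists 0; [exact: filt0|rewrite raddf0].
- by move=> k u' v' _ [u hu <-] _ [v hv <-]; exists (u + v); [exact: filtD|rewrite raddfD].
- move=> k x' v' hx' _ [v hv <-]; have [x hx gxv] := gx x' hx'.
  by exists (x v); [exact: pw_mul|exact: gxv].
Qed.

Lemma pw_hom (V V' : zmodType) (xs : seq {additive V -> V}) (xs' : seq {additive V' -> V'})
    (g : {additive V -> V'}) (A : V -> Prop) (A' : V' -> Prop) :
  (forall x, List.In x xs -> exists2 x' : {additive V' -> V'}, List.In x' xs' &
     forall v, g (x v) = x' (g v)) ->
  (forall v, A v -> A' (g v)) ->
  forall k v, pw xs A k v -> pw xs' A' k (g v).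
Proof.
move=> gx gA k v; elim=> {k v}.
- by move=> v /gA; exact: pw_top.
- by move=> k; rewrite raddf0; exact: pw_0.
- by move=> k u v _ hu _ hv; rewrite raddfD; exact: pw_add.
- by move=> k x v hx _ hv; have [x' hx' ->] := gx x hx; exact: pw_mul.
Qed.

(** * Noetherianity of C[h] and of its ring of invariants *)

Section Coordinates.
Variables (F : fieldType) (V : vectType F).
Local Notation d := (\dim {:V}).

Definition bvec (i : 'I_d) : V := (vbasis {:V})`_i.
Definition bform (i : 'I_d) : 'Hom(V, F^o) := linfun (coord (vbasis {:V}) i : V -> F^o).

Lemma bvec_coord v : v = \sum_(i < d) (bform i v : F) *: bvec i.
Proof.
rewrite {1}(coord_vbasis (memvf v)); apply: eq_bigr => i _.
by rewrite /bform lfunE.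
Qed.

Lemma bform_coord (x : 'Hom(V, F^o)) : x = \sum_(i < d) (x (bvec i) : F) *: bform i.
Proof.
apply/lfunP => v; rewrite sum_lfunE {1}(bvec_coord v) linear_sum; apply: eq_bigr => i _.
by rewrite linearZ scale_lfunE; exact: mulrC.
Qed.
End Coordinates.

Section PolynomialFunctions.
Variables (F : numFieldType) (V : vectType F).
Local Notation P := (polyfun V).
Local Notation sc := (pscal (@poly_rel F V)).

Implicit Types (b : V) (a : F) (x : 'Hom(V, F^o)).

Lemma poly_eval_scal b a : poly_eval b (sc a) = a.
Proof. exact: plift_scal. Qed.
Lemma poly_eval_x b x : poly_eval b (xpoly x) = (x b : F).
Proof. exact: plift_gen. Qed.

Lemma polyfun_neq0 : (1 : P) != 0.
Proof.
apply/eqP => h; have := oner_neq0 F; have := congr1 (poly_eval 0) h.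
by rewrite rmorph1 rmorph0 => ->; rewrite eqxx.
Qed.
HB.instance Definition _ := GRing.PzSemiRing_isNonZero.Build (polyfun V) polyfun_neq0.

Lemma xpoly_coord x : xpoly x = \sum_(i < \dim {:V}) sc (x (bvec i)) * xpoly (bform i).
Proof.
have x0 : xpoly (0 : 'Hom(V, F^o)) = 0.
  have := xpoly_lin 1 (0 : 'Hom(V, F^o)) 0.
  by rewrite scaler0 addr0 rmorph1 mul1r -{1}[xpoly 0]addr0 => /addrI.
rewrite {1}(bform_coord x); elim/big_rec2: _ => // i u v _ <-.
exact: xpoly_lin.
Qed.

Lemma polyfun_stable (C : P -> Prop) : (forall u v, C u -> C v -> C (u + v)) ->
  (forall a v, C v -> C (sc a * v)) -> (forall i v, C v -> C (xpoly (bform i) * v)) ->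
  C 0 -> forall p v, C v -> C (p * v).
Proof.
move=> CD Cs Cx C0; elim/palg_ind=> [a|x|p q hp hq|p q hp hq] v Cv.
- exact: Cs.
- rewrite -/(xpoly x) xpoly_coord mulr_suml; elim/big_rec: _ => // i u _ Cu.
  by apply: CD => //; rewrite -mulrA; apply/Cs/Cx.
- by rewrite mulrDl; apply: CD; [exact: hp|exact: hq].
- by rewrite -mulrA; apply/hp/hq.
Qed.

(** C[h] arises from the line spanned by 1 by adjoining the multiplications by the coordinate
    functions, so [noeth_gen] applies over the field; multiplications by all polynomials are then
    further operators. *)
Lemma noeth_polyfun : noeth (@scalops P P^o) (fun=> True).
Proof.
pose FP : lmodType F := restr sc P^o.
pose ys : seq {additive FP -> FP} :=
  [seq (GRing.scale (xpoly (bform i)) : {additive P^o -> P^o}) | i <- enum 'I_(\dim {:V})].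
have ysE f : List.In f ys -> exists p : P, f =1 *%R p.
  by move=> /In_map[i _ <-]; exists (xpoly (bform i)).
have h : noeth (adj_ops (@scalops F FP) ys) (fun=> True).
  apply: (@noeth_gen FP (@scalops F FP) (lspan [:: (1 : P) : FP])).
  - move=> f y [a fa] /ysE[p yp] v; rewrite !(fa, yp) /GRing.scale /= /restr_scale.
    by rewrite /GRing.scale /= mulrCA.
  - by move=> x y /ysE[p xp] /ysE[q yq] v; rewrite !(yq, xp) mulrCA.
  - exact: lspan_submod.
  - by have := noeth_lspan (V := FP) (s := [:: (1 : P) : FP]) (@noeth_field F).
  - move=> C sC C1 v _; rewrite -[v]mulr1; apply: (@polyfun_stable C).
    + by move=> u w; apply: sgD; exact: sC.1.
    + move=> a w Cw.
      by apply: (sC.2 (GRing.scale a : {additive FP -> FP})) => //; left; exists a.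
    + move=> i w Cw.
      apply: (sC.2 (GRing.scale (xpoly (bform i)) : {additive P^o -> P^o})) => //; right.
      apply/List.Exists_exists.
      exists (GRing.scale (xpoly (bform i)) : {additive P^o -> P^o}); split=> //.
      by apply/In_map; exists i => //; apply/In_mem; rewrite mem_enum.
    + exact: sC.1.1.
    + by apply: C1; exact: mem_lspan (mem_head _ _).
apply: (@noeth_sub P^o _ _ (fun=> True) (fun=> True) _ _ h) => // f [[a fa]|].
  by exists (sc a).
by move=> /List.Exists_exists[g [/ysE[p gp] fg]]; exists p => v; exact: etrans (fg v) (gp v).
Qed.

Variables (W : finGroupType) (rho : linrep V W).
Local Notation Z := (polyinv rho).
Local Notation act := (poly_act rho).

Lemma poly_act_scal w a : act w (sc a) = sc a. Proof. exact: plift_scal. Qed.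
Lemma poly_act_x w x : act w (xpoly x) = xpoly (dact rho w x). Proof. exact: plift_gen. Qed.

Lemma poly_actM w w' p : act w (act w' p) = act (w * w')%g p.
Proof.
elim/palg_ind: p => [a|x|p q hp hq|p q hp hq]; rewrite ?rmorphD ?rmorphM ?hp ?hq //.
  by rewrite !poly_act_scal.
rewrite -/(xpoly x) !poly_act_x; congr xpoly; apply/lfunP => v.
by rewrite !dactE invMg repM.
Qed.

Lemma poly_act1 p : act 1%g p = p.
Proof.
elim/palg_ind: p => [a|x|p q hp hq|p q hp hq]; rewrite ?rmorphD ?rmorphM ?hp ?hq //.
  by rewrite !poly_act_scal.
rewrite -/(xpoly x) !poly_act_x; congr xpoly; apply/lfunP => v.
by rewrite !dactE invg1 rep1.
Qed.

Lemma invP (z : Z) w : act w (val z) = val z.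
Proof. by have /asboolP := valP z; exact. Qed.

Lemma inv_ex p : (forall w, act w p = p) -> exists z : Z, val z = p.
Proof. by move=> h; exists (exist (fun p => p \in inv_pred rho) p (asboolT h : p \in inv_pred rho)). Qed.

Lemma reynolds_subproof p : sc (#|W|%:R^-1) * (\sum_(w : W) act w p) \in inv_pred rho.
Proof.
apply/asboolP => w; rewrite rmorphM poly_act_scal rmorph_sum; congr (_ * _).
rewrite [RHS](reindex_inj (mulgI w)) /=.
by apply: eq_bigr => g _; rewrite poly_actM.
Qed.
Definition reynolds p : Z := exist (fun p => p \in inv_pred rho) _ (reynolds_subproof p) .

Lemma reynoldsM (z : Z) p : reynolds (val z * p) = z * reynolds p.
Proof.
apply: val_inj; rewrite rmorphM /= mulrCA; congr (_ * _).
by rewrite mulr_sumr; apply: eq_bigr => w _; rewrite rmorphM invP.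
Qed.

Lemma reynolds_sum (I : Type) (r : seq I) (G : I -> P) :
  reynolds (\sum_(i <- r) G i) = \sum_(i <- r) reynolds (G i).
Proof.
apply: val_inj; rewrite rmorph_sum /= -mulr_sumr exchange_big /=; congr (_ * _).
by apply: eq_bigr => w _; rewrite rmorph_sum.
Qed.

Lemma reynolds1 : reynolds 1 = 1.
Proof.
apply: val_inj; rewrite rmorph1 /= (eq_bigr (fun=> 1)) => [|w _]; last exact: rmorph1.
rewrite sumr_const -(rmorph1 sc) -rmorphMn -rmorphM cardT -cardE -[1 *+ _]/(_%:R) mulVf //.
by rewrite pnatr_eq0 -lt0n; apply/card_gt0P; exists 1%g.
Qed.

(** The Reynolds operator recovers an ideal of invariants from its extension to C[h], so a chain of
    ideals is stationary as soon as the extended chain is. *)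
Lemma noeth_polyinv : noeth (@scalops Z Z^o) (fun=> True).
Proof.
move=> C sC _ CS.
pose D n (p : P^o) := exists2 s : seq (Z * P), (forall u, u \in s -> C n u.1) &
  p = \sum_(u <- s) val u.1 * u.2.
have [n||n p [s hs ->]|N hN] := noeth_polyfun (C := D) => //.
- apply: scalops_submod.
  + by exists [::]; rewrite ?big_nil.
  + move=> p q [s hs ->] [t ht ->]; exists (s ++ t); last by rewrite big_cat.
    by move=> u; rewrite mem_cat => /orP[/hs|/ht].
  + move=> r p [s hs ->]; exists [seq (u.1, r * u.2) | u <- s].
      by move=> u /mapP[v /hs vs ->].
    rewrite big_map /GRing.scale /= mulr_sumr.
    by apply: eq_bigr => u _; rewrite mulrCA.
- by exists s => // u /hs; exact: CS.
exists N => n z Cz; have [|s hs zE] := hN n (val z : P).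
  by exists [:: (z, 1)] => [u|]; [rewrite inE => /eqP->|rewrite big_seq1 mulr1].
rewrite -[z]mulr1 -reynolds1 -reynoldsM mulr1 zE reynolds_sum big_seq.
apply: sg_sum => [|u us]; first exact: (sC N).1.
by rewrite reynoldsM mulrC; apply: (submodZ (V := Z^o)) (hs u us).
Qed.

(* The coefficients of prod_w (T - w p) are invariant. *)
Lemma integral_polyinv p : exists a : nat -> Z,
  [/\ a #|W| = 1, \sum_(j < #|W|.+1) val (a j) * p ^+ j = 0
    & forall b, \sum_(j < #|W|.+1) sc (poly_eval b (val (a j))) * p ^+ j =
                \prod_(w : W) (p - sc (poly_eval b (act w p)))].
Proof.
pose chi : {poly P} := \prod_(w : W) ('X - (act w p)%:P).
have chi_inv j w : act w chi`_j = chi`_j.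
  have E : map_poly (act w) chi = chi.
    rewrite rmorph_prod [RHS](reindex_inj (mulgI w)) /=; apply: eq_bigr => g _.
    by rewrite rmorphB /= map_polyX map_polyC /= poly_actM.
  by rewrite -{2}E coef_map.
pose a j : Z := sval (cid (inv_ex (chi_inv j))).
have aE j : val (a j) = chi`_j := svalP (cid (inv_ex (chi_inv j))).
have schi : size chi = #|W|.+1 by rewrite size_prod_XsubC /index_enum -enumT cardE.
exists a; split.
- apply: val_inj; rewrite aE rmorph1; have := monic_prod_XsubC (index_enum W) predT (act^~ p).
  by rewrite monicE lead_coefE -/chi schi => /eqP.
- transitivity chi.[p].
    by rewrite horner_coef schi; apply: eq_bigr => j _; rewrite aE.
  rewrite horner_prod (bigD1 1%g) //= poly_act1.
  by rewrite hornerD hornerN hornerX hornerC subrr mul0r.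
- move=> b; pose ev : {rmorphism P -> P} :=
    (pscal (@poly_rel F V) : {rmorphism F -> P}) \o poly_eval b.
  transitivity (map_poly ev chi).[p].
    rewrite horner_coef.
    have -> : size (map_poly ev chi) = #|W|.+1.
      rewrite rmorph_prod /= (eq_bigr (fun w => 'X - (ev (act w p))%:P)).
        by rewrite size_prod_XsubC /index_enum -enumT cardE.
      by move=> w _; rewrite rmorphB /= map_polyX map_polyC.
    by apply: eq_bigr => j _; rewrite coef_map /= aE.
  rewrite rmorph_prod horner_prod; apply: eq_bigr => w _.
  by rewrite rmorphB /= map_polyX map_polyC /= hornerD hornerN hornerX hornerC.
Qed.

Local Notation zval := (val : Z -> P).

(** Coordinates are adjoined one by one; each is a root of a monic polynomial of degree |W| over the
    invariants, so its powers below |W| suffice. *)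
Lemma polyfun_fg : exists s : seq P, forall p, lspan (s : seq (restr zval P^o)) p.
Proof.
pose L : lmodType Z := restr zval P^o.
have main (xs : seq P) : exists s : seq P, lspan (s : seq L) (1 : P) /\
    forall y : P, y \in xs -> forall p : P, lspan (s : seq L) p -> lspan (s : seq L) (y * p).
  elim: xs => [|x xs [s [s1 hs]]].
    by exists [:: 1]; split=> //; exact: mem_lspan (mem_head _ _).
  have [a [a1 a0 _]] := integral_polyinv x.
  pose s' := [seq x ^+ j * g | j <- iota 0 #|W|, g <- s].
  have sL := lspan_submod (s' : seq L).
  have xj j p : (j < #|W|)%N -> lspan (s : seq L) p -> lspan (s' : seq L) (x ^+ j * p).
    move=> jW; apply: (@lspan_sub _ L (fun p => lspan (s' : seq L) (x ^+ j * p))) => [|g gs].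
      apply: scalops_submod => [|u v|r v]; rewrite ?mulr0 ?mulrDl ?mulrDr.
      - exact: sL.1.1.
      - by apply: sgD; exact: sL.1.
      - move=> h; rewrite (_ : _ * _ = (r : Z) *: (x ^+ j * v : L)); first exact: submodZ.
        exact: mulrCA.
    by apply: mem_lspan; apply/allpairsP; exists (j, g); rewrite mem_iota.
  have W0 : (0 < #|W|)%N by apply/card_gt0P; exists 1%g.
  exists s'; split=> [|y hy p]; first by rewrite -[1]mulr1 -(expr0 x); exact: xj.
  apply: (@lspan_sub _ L (fun p => lspan (s' : seq L) (y * p))) => [|q].
    apply: scalops_submod => [|u v|r v]; rewrite ?mulr0 ?mulrDr.
    - exact: sL.1.1.
    - by apply: sgD; exact: sL.1.
    - move=> h; rewrite (_ : _ * _ = (r : Z) *: (y * v : L)); first exact: submodZ.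
      exact: mulrCA.
  move=> /allpairsP[[j g] /= [jW gs ->]]; rewrite mem_iota add0n /= in jW.
  move: hy; rewrite inE => /orP[/eqP->|hy]; last first.
    by rewrite mulrCA; apply: xj => //; apply: hs => //; exact: mem_lspan.
  rewrite mulrA -exprS.
  have [jd|] := ltnP j.+1 #|W|; first by apply: xj => //; exact: mem_lspan.
  rewrite leq_eqVlt ltnNge jW orbF => /eqP <-.
  have -> : x ^+ #|W| = - \sum_(i < #|W|) val (a i) * x ^+ i.
    by apply/eqP; rewrite -addr_eq0 addrC -[x ^+ _]mul1r -(rmorph1 zval) -a1
      -(big_ord_recr _ (fun i => val (a i) * x ^+ i)) a0.
  rewrite mulNr mulr_suml; apply: sgN; first exact: sL.1.
  apply: sg_sum => [|i _]; first exact: sL.1.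
  rewrite -mulrA; apply: (submodZ (V := L) (a i)) => //.
  by apply: xj => //; exact: mem_lspan.
have [s [s1 hs]] := main [seq xpoly (bform i) | i <- enum 'I_(\dim {:V})].
exists s => p; rewrite -[p]mulr1; apply: (@polyfun_stable (fun p => lspan (s : seq L) p)).
- by move=> u v; exact: (@lspanD _ L).
- move=> c v hv; have [z zE] : exists z : Z, val z = sc c.
    by apply: inv_ex => w; exact: poly_act_scal.
  by rewrite -zE; exact: (@lspanZ _ L).
- by move=> i v; apply: hs; apply: map_f; rewrite mem_enum.
- exact: (@lspan0 _ L).
- exact: s1.
Qed.

Lemma vanish_fg b : exists ms : seq Z, forall z : Z, vanish_at b z <-> lspan (ms : seq Z^o) z.
Proof.
have sm : submod (@scalops Z Z^o) (@vanish_at _ _ _ rho b).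
  apply: scalops_submod => [|u v hu hv|r v hv]; rewrite /vanish_at.
  - exact: raddf0.
  - by rewrite rmorphD [X in X + _]hu [X in _ + X]hv addr0.
  - by rewrite rmorphM [X in _ * X]hv mulr0.
have [s hs hsp] := noeth_fg noeth_polyinv sm (fun _ _ => I).
exists s => a; split; last exact: lspan_sub.
by apply: hsp => [|v]; [exact: lspan_submod|exact: mem_lspan].
Qed.

End PolynomialFunctions.

(** * Completion at b of modules in category O *)

Section InvariantFiltration.
Variables (F : numFieldType) (V : vectType F) (W : finGroupType) (rho : linrep V W).
Variable c : W -> F.
Local Notation H := (cherednik rho c).
Local Notation Z := (polyinv rho).
Local Notation zval := (val : Z -> polyfun V).

Lemma poly_cher_scal a : poly_cher rho c (pscal _ a) = hscal rho c a.
Proof. exact: plift_scal. Qed.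
Lemma poly_cher_x x : poly_cher rho c (xpoly x) = hx rho c x.
Proof. exact: plift_gen. Qed.

Definition vgens b : seq Z := sval (cid (vanish_fg rho b)).
Lemma vgensP b z : vanish_at b z <-> lspan (vgens b : seq Z^o) z.
Proof. exact: (svalP (cid (vanish_fg rho b))). Qed.

(** The powers of these operators filter [M] by m^k M, where m is the maximal ideal of the image of
    [b] in C[h]^W, given by finitely many generators. *)
Definition zops b (M : lmodType H) : seq {additive M -> M} :=
  mops (vgens b) (restr (inv_cher rho c) M).

Lemma zops_hom b (M N : lmodType H) (f : {linear M -> N}) x : List.In x (zops b M) ->
  exists2 x' : {additive N -> N}, List.In x' (zops b N) & forall v, f (x v) = x' (f v).
Proof.
move=> /In_map[z hz <-].
exists (GRing.scale z : {additive restr (inv_cher rho c) N -> restr (inv_cher rho c) N}).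
  by apply/In_map; exists z.
by move=> v; exact: linearZ.
Qed.

Lemma zops_filt b (M N : lmodType H) (f : {linear M -> N}) k v :
  filt (zops b M) k v -> filt (zops b N) k (f v).
Proof. by apply: pw_hom => // x; exact: zops_hom. Qed.

Lemma zops_lift b (M N : lmodType H) (f : {linear M -> N}) :
  (forall w, exists v, f v = w) -> forall k w, filt (zops b N) k w ->
  exists2 v, filt (zops b M) k v & f v = w.
Proof.
move=> fs; apply: pw_lift => // x' /In_map[z hz <-].
exists (GRing.scale z : {additive restr (inv_cher rho c) M -> restr (inv_cher rho c) M}).
  by apply/In_map; exists z.
by move=> v; exact: linearZ.
Qed.

Lemma category_O_fg (M : lmodType H) : category_O rho c M ->
  exists es : seq M, forall v, lspan (es : seq (restr (inv_cher rho c) M)) v.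
Proof.
case=> -[n [e he]] _; have [s hs] := polyfun_fg rho.
pose L : lmodType Z := restr (inv_cher rho c) M.
pose es : seq M := [seq poly_cher rho c g *: e i | i <- enum 'I_n, g <- s].
exists es => v; have [p ->] := he v.
apply: sg_sum => [|i _]; first by have [] := lspan_submod (es : seq L).
apply: (@lspan_sub _ (restr zval (polyfun V)^o)
  (fun q => lspan (es : seq L) (poly_cher rho c q *: e i)) s) => [|g gs|]; last exact: hs.
  apply: scalops_submod => [|q q'|z q]; rewrite ?rmorph0 ?scale0r ?rmorphD ?scalerDl.
  - exact: (@lspan0 _ L).
  - exact: (@lspanD _ L).
  - move=> h; rewrite (_ : _ *: e i = (z *: (poly_cher rho c q *: e i : L))).
      exact: (@lspanZ _ L).
    by rewrite [RHS]scalerA; congr (_ *: _); exact: (rmorphM (poly_cher rho c)).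
apply: (@mem_lspan _ L); apply/allpairsP; exists (i, g) => /=; split=> //.
by rewrite mem_enum.
Qed.

End InvariantFiltration.

Lemma filt_restr_eq (Z : comPzRingType) (A1 A2 A : pzRingType) (f1 : {rmorphism Z -> A1})
    (g1 : {rmorphism A1 -> A}) (f2 : {rmorphism Z -> A2}) (g2 : {rmorphism A2 -> A})
    (N : lmodType A) (ms : seq Z) k (n : N) : (forall z, g1 (f1 z) = g2 (f2 z)) ->
  filt (mops ms (restr f1 (restr g1 N))) k n -> filt (mops ms (restr f2 (restr g2 N))) k n.
Proof.
move=> fg; apply: (@pw_hom _ _ _ _ (idfun : {additive restr f1 (restr g1 N) -> restr f2 (restr g2 N)})) => //.
move=> x /In_map[z hz <-].
exists (GRing.scale z : {additive restr f2 (restr g2 N) -> restr f2 (restr g2 N)}).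
  by apply/In_map; exists z.
move=> v; change (g1 (f1 z) *: (v : N) = g2 (f2 z) *: (v : N)); by rewrite fg.
Qed.

Section CompletedModule.
Variables (F : numFieldType) (V : vectType F) (W : finGroupType) (rho : linrep V W).
Variables (c : W -> F) (b : V) (Hb : completed_cherednik rho c b).
Local Notation H := (cherednik rho c).
Local Notation Z := (polyinv rho).
Local Notation ZH := (hat_polyinv rho b).
Local Notation m := (@vanish_at _ _ _ rho b).
Local Notation tc := (@to_completion Z m).
Local Notation ic := (inv_cher rho c).
Local Notation msP := (@vgensP _ _ _ rho b).

Lemma cc_elt (h : Hb) : exists s : seq (ZH * H), h = \sum_(u <- s) cc_fun Hb u.1 * cc_alg Hb u.2.
Proof.
have [mu [mu_bij muE]] := cc_tensor Hb; have [mu' _ mu'K] := mu_bij.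
rewrite -(mu'K h); have [s ->] := tens_sum (mu' h); exists s.
by rewrite raddf_sum; apply: eq_bigr => u _; exact: muE.
Qed.

Section Module.
Variable M : lmodType H.
Local Notation N := (completion_functor Hb M).
Local Notation MZ := (restr ic M).
Local Notation NH := (restr (cc_fun Hb) N : lmodType ZH).
Local Notation u := (@eunit _ _ (cc_alg Hb) M : MZ -> NH).
Local Notation NZ := (restr (cc_alg Hb) N : lmodType H).
Variable es : seq M.
Hypothesis esP : forall v, lspan (es : seq MZ) v.

Lemma cm_uD v w : u (v + w) = u v + u w. Proof. exact: eunitD. Qed.
Lemma cm_uZ z v : u (z *: v) = tc z *: u v.
Proof.
transitivity (cc_alg Hb (ic z) *: u v : N); first exact: eunitZ.
by rewrite -(cc_compat Hb z).
Qed.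
Lemma cm_uP n : lspan (map u es) n.
Proof.
elim/ext_ind: n => [|t t'|h v]; [exact: lspan0|exact: lspanD|].
have [s ->] := cc_elt h; rewrite scaler_suml; apply: sg_sum => [|[p h'] _ /=].
  by have [] := lspan_submod (map u es).
rewrite -scalerA -eunitZ; apply: (lspanZ (V := NH) p); move: (h' *: v) => w.
apply: (@lspan_sub _ MZ (fun w => lspan (map u es) (u w)) es) => // [|e ees].
  apply: scalops_submod => [|x y|z x]; rewrite ?cm_uD ?cm_uZ.
  - by rewrite (_ : u 0 = 0); [exact: lspan0|exact: eunit0].
  - exact: lspanD.
  - exact: lspanZ.
by apply: mem_lspan; exact: map_f.
Qed.

Lemma filt_hscal k a v : filt (zops b M) k v -> filt (zops b M) k (hscal rho c a *: v).
Proof.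
have [z zE] : exists z : Z, val z = pscal _ a by apply: inv_ex => w; exact: poly_act_scal.
have -> : hscal rho c a *: v = (z *: (v : MZ) : MZ).
  by rewrite -poly_cher_scal -zE.
by apply: (@pw_scale _ _ _ msP MZ) => //; exact: scalops_submod.
Qed.

Lemma filt_idealX k z v : idealX m k z -> filt (zops b M) k (z *: (v : MZ) : MZ).
Proof. by move=> hz; apply: (@pw_idealX _ _ _ msP MZ) => //; exact: scalops_submod. Qed.

(** On [p (x) v] the value is that of [phi] on (p mod m^k) v, well defined because [phi] kills m^k
    M. For fixed [v] it is first defined on [hat_tensor], carried to [Hb] by the inverse of [mu],
    and only then checked to be balanced over the Cherednik algebra. *)
Lemma completion_functional k (phi : {linear restr (hscal rho c) M -> F^o}) :
  (forall v, filt (zops b M) k v -> phi v = 0) ->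
  exists f : {additive N -> F^o}, forall p v,
    f (cc_fun Hb p *: u v) = phi (repr p k *: (v : MZ) : MZ).
Proof.
move=> phi0.
have phiI y z v : idealX m k (y - z) -> phi (y *: (v : MZ) : MZ) = phi (z *: (v : MZ) : MZ).
  move=> /(filt_idealX v)/phi0; rewrite scalerBl => h.
  by apply/eqP; rewrite -subr_eq0 -raddfB; apply/eqP.
have [mu [mu_bij muE]] := cc_tensor Hb; have [mu' muK mu'K] := mu_bij.
have mu'B : zmod_morphism mu'.
  by move=> x y; apply: (can_inj muK); rewrite raddfB !mu'K.
pose nu : {additive Hb -> hat_tensor rho c b} :=
  HB.pack mu' (GRing.isZmodMorphism.Build Hb (hat_tensor rho c b) mu' mu'B).
have nuK : cancel mu nu := muK; have muK' : cancel nu mu := mu'K.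
have /choice[ga gaE] (v : M) : exists g : {additive hat_tensor rho c b -> F^o},
    forall p h, g (p *: eunit (to_hat rho b) (h : restr ic H^o)) = phi (repr p k *: (h *: v : MZ) : MZ).
  apply: ext_universal => [p q h|p h h'|p z h].
  - transitivity (phi ((repr p k + repr q k) *: (h *: v : MZ) : MZ)); last first.
      rewrite -raddfD; exact: (congr1 phi (@scalerDl Z MZ (h *: v) _ _)).
    apply: phiI.
    by apply: (appr_uniq (q := p + q)); [exact: appr_repr|apply: apprD; exact: appr_repr].
  - by rewrite scalerDl -raddfD; exact: (congr1 phi (@scalerDr Z MZ _ _ _)).
  - rewrite (_ : (z *: h) *: v = (z *: (h *: v : MZ) : MZ)); last by rewrite [RHS]scalerA.
    rewrite scalerA; apply: phiI.
    apply: (appr_uniq (q := p * tc z)); first exact: appr_repr.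
    by apply: apprM; [exact: appr_repr|exact: appr_tc].
have muE' p h : mu (p *: eunit (to_hat rho b) (h : restr ic H^o)) = cc_fun Hb p * cc_alg Hb h.
  by rewrite -eunit_tens; exact: muE.
have [h h' v|h v v'|h h' v|f hf] := @ext_universal Hb H (cc_alg Hb) M F^o (fun h v => ga v (nu h)).
- by rewrite !raddfD.
- elim/ext_ind: (nu h) => [|t t' ht ht'|p h']; first by rewrite !raddf0 addr0.
    by rewrite !raddfD ht ht' addrACA.
  rewrite !gaE scalerDr -(raddfD phi).
  exact: (congr1 phi (@scalerDr Z MZ (repr p k) (h' *: v) (h' *: v'))).
- rewrite -{1}(muK' h); elim/ext_ind: (nu h) => [|t t' ht ht'|p h''].
  + by rewrite raddf0 mul0r !raddf0.
  + by rewrite raddfD mulrDl !raddfD ht ht'.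
  + by rewrite muE' -mulrA -rmorphM -muE' nuK !gaE scalerA.
exists f => p v; rewrite hf -[cc_fun Hb p]mulr1 -(rmorph1 (cc_alg Hb)) -muE' nuK gaE.
by rewrite scale1r.
Qed.

(** Otherwise some functional [phi] kills m^k M and takes the value 1 on the vector of the
    conclusion. Its extension [f] to [N] kills m^k N, yet on the given sum it also takes that
    value. *)
Lemma cm_filt_repr (k : nat) (p : 'I_(size es) -> ZH) :
  filt (mops (vgens rho b) (restr tc NH)) k (\sum_(i < size es) p i *: u es`_i) ->
  filt (mops (vgens rho b) MZ) k (\sum_(i < size es) repr (p i) k *: (es`_i : MZ)).
Proof.
move=> hN; apply: contrapT.
move=> /(@separation F (restr (hscal rho c) M) (filt (zops b M) k)) [|phi [phi0 phi1]].
  by apply: scalops_submod; [exact: filt0|exact: filtD|exact: filt_hscal].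
have [f hf] := completion_functional phi0.
have fI z n : idealX m k z -> f (tc z *: (n : NH)) = 0.
  move=> hz; have [q ->] := lspan_nth (cm_uP n).
  rewrite scaler_sumr raddf_sum big1 // => i _.
  have iM : (i < size es)%N by rewrite -(size_map u) ltn_ord.
  rewrite scalerA (nth_map 0) // hf; apply/phi0/filt_idealX.
  apply: (appr_idealX (apprM (appr_tc m z k) (appr_repr (q i) k))).
  by rewrite mulrC; exact: idealX_scale.
have f0 j l n : (l + j = k)%N -> filt (mops (vgens rho b) (restr tc NH)) j n ->
    forall z, idealX m l z -> f (tc z *: (n : NH)) = 0.
  move=> lj hn; elim: hn l lj => {j n}.
  - by move=> n _ l; rewrite addn0 => -> z; exact: fI.
  - by move=> j l _ z _; rewrite scaler0 raddf0.
  - by move=> j n n' _ hn _ hn' l lj z hz; rewrite scalerDr raddfD (hn l) // (hn' l) // addr0.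
  - move=> j x n /(mops_In msP)[a ma ->] _ IH l lj z hz.
    rewrite (_ : tc z *: _ = tc (a * z) *: (n : NH)).
      by apply: (IH l.+1); [rewrite addSnnS|exact: idealX_mul].
    by rewrite [LHS]scalerA -rmorphM mulrC.
have /eqP := phi1; rewrite (_ : phi _ = 0) ?[0 == 1]eq_sym ?oner_eq0 //.
have := f0 k 0%N _ (add0n _) hN 1 (idealX_top _ _).
rewrite (rmorph1 tc) scale1r raddf_sum => E; rewrite -[RHS]E raddf_sum.
by apply: eq_bigr => i _; rewrite hf.
Qed.

Lemma cm_zopsE (k : nat) (n : N) : filt (mops (vgens rho b) (restr tc NH)) k n <-> filt (zops b NZ) k n.
Proof.
have e z : cc_fun Hb (to_hat rho b z) = cc_alg Hb (ic z) by exact: cc_compat.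
have e' z : cc_alg Hb (ic z) = cc_fun Hb (to_hat rho b z) by rewrite e.
split.
  exact (@filt_restr_eq Z ZH H Hb tc (cc_fun Hb) ic (cc_alg Hb) N (vgens rho b) k n e).
exact (@filt_restr_eq Z H ZH Hb ic (cc_alg Hb) tc (cc_fun Hb) N (vgens rho b) k n e').
Qed.

End Module.
End CompletedModule.

(** * Completions of modules in category O *)

Section CompletionOfO.
Variables (F : numFieldType) (V : vectType F) (W : finGroupType) (rho : linrep V W).
Variables (c : W -> F) (b : V) (Hb : completed_cherednik rho c b).
Local Notation H := (cherednik rho c).
Local Notation Z := (polyinv rho).
Local Notation m := (@vanish_at _ _ _ rho b).
Local Notation ic := (inv_cher rho c).
Local Notation msP := (@vgensP _ _ _ rho b).
Local Notation nZ := (@noeth_polyinv _ _ _ rho).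
Local Notation NH M := (restr (cc_fun Hb) (completion_functor Hb M)).
Local Notation hat M := (restr (cc_alg Hb) (completion_functor Hb M)).

Definition hunit (M : lmodType H) : {linear M -> hat M} := @eunit _ _ (cc_alg Hb) M.

Section Object.
Variable M : lmodType H.
Hypothesis OM : category_O rho c M.

Lemma hat_dense (n : hat M) k : exists v : M, filt (zops b (hat M)) k (n - hunit M v).
Proof.
have [es esP] := category_O_fg OM.
have [v hv] := @completion_dense _ _ _ msP nZ _ _ (NH M) _
  (@cm_uD _ _ _ _ _ _ Hb M) (@cm_uZ _ _ _ _ _ _ Hb M) (@cm_uP _ _ _ _ _ _ Hb M es esP) n k.
by exists v; apply/cm_zopsE.
Qed.

Lemma hat_unit_inv k v : filt (zops b (hat M)) k (hunit M v) -> filt (zops b M) k v.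
Proof.
have [es esP] := category_O_fg OM => /cm_zopsE h.
exact: (@completion_unit _ _ _ msP (restr ic M) es (NH M) _ esP
  (@cm_uD _ _ _ _ _ _ Hb M) (@cm_uZ _ _ _ _ _ _ Hb M) (@cm_filt_repr _ _ _ _ _ _ Hb M es esP)
  k v h).
Qed.

Lemma hat_separated : separated (zops b (hat M)).
Proof.
have [es esP] := category_O_fg OM => n hn.
apply: (@completion_separated _ _ _ msP nZ (restr ic M) es (NH M) _ esP
  (@cm_uD _ _ _ _ _ _ Hb M) (@cm_uZ _ _ _ _ _ _ Hb M) (@cm_uP _ _ _ _ _ _ Hb M es esP)
  (@cm_filt_repr _ _ _ _ _ _ Hb M es esP) n) => k.
by apply/cm_zopsE.
Qed.

Lemma hat_complete : complete (zops b (hat M)).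
Proof.
have [es esP] := category_O_fg OM => s hs.
have [k|v hv] := @completion_complete _ _ _ msP nZ (restr ic M) es (NH M) _ esP
  (@cm_uD _ _ _ _ _ _ Hb M) (@cm_uZ _ _ _ _ _ _ Hb M) (@cm_uP _ _ _ _ _ _ Hb M es esP)
  (@cm_filt_repr _ _ _ _ _ _ Hb M es esP) s.
  by apply/cm_zopsE.
by exists v => k; apply/cm_zopsE.
Qed.

Lemma hat_filt_unit k v : filt (zops b M) k v -> filt (zops b (hat M)) k (hunit M v).
Proof. exact: zops_filt. Qed.

(** An invariant [z] acts on M / mM by the scalar z(b); generators of [M] over the invariants
    therefore span M / mM over the field. *)
Lemma category_O_fin : exists es : seq (restr (hscal rho c) M),
  forall v : M, exists2 w : M, lspan es (w : restr (hscal rho c) M) & filt (zops b M) 1 (v - w).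
Proof.
have [es esP] := category_O_fg OM; exists es => v.
pose C (v : restr ic M) := exists2 w : M, lspan (es : seq (restr (hscal rho c) M)) w
  & filt (zops b M) 1 (v - w).
apply: (@lspan_sub _ (restr ic M) C es) => // [|e ees]; last first.
  by exists e; [exact: (@mem_lspan _ (restr (hscal rho c) M))|rewrite subrr; exact: filt0].
apply: scalops_submod => [|x y [x' hx xx'] [y' hy yy']|z x [x' hx xx']].
- by exists 0; [exact: lspan0|rewrite subr0; exact: filt0].
- exists (x' + y'); first exact: (@lspanD _ (restr (hscal rho c) M)).
  by rewrite opprD addrACA; exact: filtD.
- pose a := poly_eval b (val z).
  exists (hscal rho c a *: x'); first exact: (@lspanZ _ (restr (hscal rho c) M)).
  have [y yE] : exists y : Z, val y = pscal _ a by apply: inv_ex => w; exact: poly_act_scal.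
  have myz : m (z - y).
    by rewrite /vanish_at rmorphB yE [X in _ - X]poly_eval_scal subrr.
  have -> : hscal rho c a *: x' = (y *: (x' : restr ic M) : restr ic M).
    by rewrite -poly_cher_scal -yE.
  rewrite (_ : _ - _ = (z *: (x - x' : restr ic M) + (z - y) *: (x' : restr ic M) : restr ic M)).
    apply: filtD; first exact: (@pw_scale _ _ _ msP (restr ic M)).
    by apply: (@pw_m _ _ _ msP (restr ic M)) => //; exact: filt_top.
  by rewrite scalerBr scalerBl addrA subrK.
Qed.

Lemma noeth_category_O : noeth (@scalops Z (restr ic M)) (fun=> True).
Proof.
have [es esP] := category_O_fg OM.
have h := noeth_lspan (V := restr ic M) (s := es) nZ.
by apply: (noeth_sub _ _ h).
Qed.

End Object.

Lemma completion_surj (M N : lmodType H) (f : {linear M -> N}) :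
  (forall w, exists v, f v = w) ->
  forall n, exists t, fmap (completion_functor Hb) f t = n.
Proof.
move=> fs; elim/ext_ind => [|t t' [s <-] [s' <-]|h v]; first by exists 0; rewrite raddf0.
  by exists (s + s'); rewrite raddfD.
by have [w <-] := fs v; exists (h *: eunit (cc_alg Hb) w); exact: ext_mapE.
Qed.

Lemma completion_exact (M N K : lmodType H) (f : {linear M -> N}) (g : {linear N -> K}) :
  category_O rho c M -> category_O rho c N -> category_O rho c K ->
  short_exact f g ->
  short_exact (fmap (completion_functor Hb) f) (fmap (completion_functor Hb) g).
Proof.
move=> OM ON OK [f_inj fg g_surj].
set fh := fmap _ f; set gh := fmap _ g.
pose fH : {linear hat M -> hat N} := restr_map fh.
pose gH : {linear hat N -> hat K} := restr_map gh.
have fu v : fH (hunit M v) = hunit N (f v) by exact: ext_map_unit.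
have gu v : gH (hunit N v) = hunit K (g v) by exact: ext_map_unit.
(* Artin-Rees concerns the submodule [f M] of [N]; injectivity of [f] carries the powers m^p (f M)
   back to m^p M. *)
have AR p : exists q, forall v, filt (zops b N) q (f v) -> filt (zops b M) p v.
  pose A v := exists u, f u = v.
  have [|||||q hq] := @artin_rees (restr ic N) (@scalops Z (restr ic N)) (zops b N)
      (fun=> True) _ _ _ (noeth_category_O ON) A _ _ p => //.
  - by move=> x /(mops_In msP)[r _ ->]; exists r.
  - move=> h x [r hr] /(mops_In msP)[t _ ->] w /=.
    by rewrite !hr !scalerA mulrC.
  - apply: scalops_submod => [|_ _ [u <-] [v <-]|r _ [u <-]].
    + by exists 0; rewrite raddf0.
    + by exists (u + v); rewrite raddfD.
    + by exists (ic r *: u); rewrite linearZ.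
  exists q => v hv; have : pw (zops b N) A p (f v) by apply: hq => //; exists v.
  have lift k w : pw (zops b N) A k w -> exists2 u, filt (zops b M) k u & f u = w.
    elim=> {k w}.
    - by move=> w [u <-]; exists u => //; exact: filt_top.
    - by move=> k; exists 0; [exact: filt0|rewrite raddf0].
    - move=> k w w' _ [u hu <-] _ [u' hu' <-]; exists (u + u'); last by rewrite raddfD.
      exact: filtD.
    - move=> k x w hx _ [u hu <-]; move: hx => /In_map[z hz <-].
      exists (ic z *: u); last exact: linearZ.
      by apply: (pw_mul (x := GRing.scale z : {additive restr ic M -> restr ic M})) => //;
         apply/In_map; exists z.
  by move=> /lift[u hu /f_inj <-].
have fhf k n : filt (zops b (hat M)) k n -> filt (zops b (hat N)) k (fH n).
  exact: zops_filt.
have ghf k n : filt (zops b (hat N)) k n -> filt (zops b (hat K)) k (gH n).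
  exact: zops_filt.
have gf0 n : gH (fH n) = 0.
  apply: (hat_separated OK) => k; have [v hv] := hat_dense OM n k.
  have -> : gH (fH n) = gH (fH (n - hunit M v)) + gH (fH (hunit M v)).
    by rewrite -(raddfD gH) -(raddfD fH) subrK.
  rewrite fu gu.
  have -> : g (f v) = 0 by apply/fg; exists v.
  by rewrite raddf0 addr0; apply/ghf/fhf.
split.
- move=> x y /eqP; rewrite -subr_eq0 -raddfB => /eqP E; apply/eqP; rewrite -subr_eq0; apply/eqP.
  apply: (@completion_inj M N (hat M) (hat N) (zops b M) (zops b N) (zops b (hat M))
    (zops b (hat N)) f fH (hunit M) (hunit N) fu fhf) E => //.
  + by move=> k v; exact: hat_filt_unit.
  + by move=> k v; exact: hat_unit_inv.
  + exact: hat_dense.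
  + exact: hat_separated.
- move=> n; split=> [|[t <-]]; last exact: gf0.
  apply: (@completion_ker M N K (hat M) (hat N) (hat K) (zops b M) (zops b N) (zops b K)
    (zops b (hat M)) (zops b (hat N)) (zops b (hat K)) f g fH gH (hunit M) (hunit N) (hunit K)
    fu gu fhf ghf) => //.
  + by move=> k v; exact: hat_filt_unit.
  + by move=> k v; exact: hat_filt_unit.
  + by move=> k v; exact: hat_unit_inv.
  + by move=> k v; exact: hat_unit_inv.
  + exact: zops_lift.
  + exact: hat_dense.
  + exact: hat_separated.
  + exact: hat_complete.
  + by move=> v /fg.
- exact: completion_surj.
Qed.

Lemma completion_id (M : lmodType H) :
  fmap (completion_functor Hb) (idfun : {linear M -> M}) =1 id.
Proof.
elim/ext_ind => [|t t' ht ht'|h v]; first exact: raddf0.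
  exact: etrans (raddfD _ _ _) (congr2 +%R ht ht').
exact: ext_mapE.
Qed.

Lemma completion_comp (M N K : lmodType H) (f : {linear M -> N}) (g : {linear N -> K}) :
  fmap (completion_functor Hb) (g \o f : {linear M -> K}) =1
  fmap (completion_functor Hb) g \o fmap (completion_functor Hb) f.
Proof.
elim/ext_ind => [|t t' ht ht'|h v]; first by rewrite /= !raddf0.
  by apply: etrans (raddfD _ _ _) _; apply: etrans (congr2 +%R ht ht') _; rewrite /= !raddfD.
by rewrite [LHS]ext_mapE; apply/esym; rewrite [LHS]/= ext_mapE; exact: ext_mapE.
Qed.

End CompletionOfO.

(** * The Euler element *)

Section PolynomialEvaluation.
Variables (F : fieldType) (B : pzRingType) (sc : {rmorphism F -> B}).
Hypothesis scC : forall a b, sc a * b = b * sc a.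
Variable a : B.
Implicit Types (p q : {poly F}).

Definition pev (p : {poly F}) : B := \sum_(i < size p) sc p`_i * a ^+ i.

Lemma pev_wide n p : (size p <= n)%N -> pev p = \sum_(i < n) sc p`_i * a ^+ i.
Proof.
move=> /subnKC <-; rewrite big_split_ord /= [X in _ + X]big1 ?addr0 // => i _.
by rewrite nth_default ?leq_addr // rmorph0 mul0r.
Qed.

Lemma pevD p q : pev (p + q) = pev p + pev q.
Proof.
pose n := maxn (size p) (size q).
rewrite (@pev_wide n) ?size_polyD // (@pev_wide n p) ?leq_maxl // (@pev_wide n q) ?leq_maxr //.
by rewrite -big_split; apply: eq_bigr => i _; rewrite coefD rmorphD mulrDl.
Qed.

Lemma pevC c : pev c%:P = sc c.
Proof.
by rewrite (@pev_wide 1) ?size_polyC ?leq_b1 // big_ord1 coefC eqxx expr0 mulr1.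
Qed.

Lemma pev0 : pev 0 = 0. Proof. by rewrite -[0 in LHS]/(0%:P) pevC rmorph0. Qed.
Lemma pev1 : pev 1 = 1. Proof. by rewrite pevC rmorph1. Qed.

Lemma pevMX p : pev (p * 'X) = pev p * a.
Proof.
rewrite (@pev_wide (size p).+1); last first.
  by apply: leq_trans (size_polyMleq _ _) _; rewrite size_polyX addn2.
rewrite big_ord_recl coefMX /= rmorph0 mul0r add0r mulr_suml; apply: eq_bigr => i _.
by rewrite coefMX /= -mulrA -exprSr.
Qed.

Lemma pevX : pev 'X = a.
Proof. by rewrite -['X]mul1r pevMX pev1 mul1r. Qed.

Lemma pev_comm (b : B) p : a * b = b * a -> b * pev p = pev p * b.
Proof.
move=> ab; rewrite mulr_suml mulr_sumr; apply: eq_bigr => i _.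
rewrite mulrA -scC -!mulrA; congr (_ * _).
by elim: (nat_of_ord i) => [|j IH]; rewrite ?expr0 ?mulr1 ?mul1r // exprS mulrA -ab -!mulrA IH.
Qed.

Lemma pevCM c q : pev (c%:P * q) = sc c * pev q.
Proof.
rewrite (@pev_wide (size q)); last by rewrite mul_polyC size_scale_leq.
by rewrite mulr_sumr; apply: eq_bigr => i _; rewrite coefCM rmorphM mulrA.
Qed.

Lemma pevM p q : pev (p * q) = pev p * pev q.
Proof.
elim/poly_ind: p q => [|p c IH] q; first by rewrite mul0r pev0 mul0r.
rewrite mulrDl !pevD pevCM pevMX pevC mulrDl -mulrA ['X * q]mulrC mulrA pevMX IH -!mulrA.
by rewrite (@pev_comm a).
Qed.

Lemma pevB p q : pev (p - q) = pev p - pev q.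
Proof. by apply/eqP; rewrite eq_sym subr_eq -pevD subrK. Qed.

End PolynomialEvaluation.

Lemma pev_shift (F : fieldType) (B : pzRingType) (sc : {rmorphism F -> B})
    (scC : forall a b, sc a * b = b * sc a) (a t : B) (k : F) p :
  a * t = t * (a + sc k) -> pev sc a p * t = t * pev sc a (p \Po ('X + k%:P)).
Proof.
move=> at_; elim/poly_ind: p => [|p c IH]; first by rewrite comp_poly0 pev0 mul0r mulr0.
rewrite comp_polyD comp_polyM comp_polyX comp_polyC !(pevD, pevM scC) !pevC // pevX.
by rewrite mulrDl mulrDr -mulrA at_ mulrA IH -scC !mulrA.
Qed.

Lemma prod_coprime (F : fieldType) (s t : seq F) : (forall a, a \in s -> a \notin t) ->
  exists u v : {poly F}, u * (\prod_(a <- s) ('X - a%:P)) + v * (\prod_(a <- t) ('X - a%:P)) = 1.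
Proof.
move=> st; suff /Bezout_eq1_coprimepP[[u v] /= E] :
    coprimep (\prod_(a <- s) ('X - a%:P)) (\prod_(a <- t) ('X - a%:P)) by exists u, v.
elim: s st => [|a s IH] st; first by rewrite big_nil coprime1p.
rewrite big_cons coprimepMl IH => [|e es]; last by apply: st; rewrite inE es orbT.
rewrite andbT coprimep_sym coprimep_XsubC root_prod_XsubC.
by apply: st; rewrite inE eqxx.
Qed.

Lemma comp_prod_XsubC (F : fieldType) (s : seq F) k :
  (\prod_(a <- s) ('X - a%:P)) \Po ('X - k%:P) = \prod_(a <- [seq a + k | a <- s]) ('X - a%:P).
Proof.
rewrite big_map; elim: s => [|a s IH]; first by rewrite !big_nil comp_polyC.
rewrite !big_cons comp_polyM IH comp_polyB comp_polyX comp_polyC; congr (_ * _).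
by rewrite polyCD opprD addrA addrAC.
Qed.

Section Euler.
Variables (F : numFieldType) (V : vectType F) (W : finGroupType) (rho : linrep V W).
Variable c : W -> F.
Local Notation H := (cherednik rho c).
Local Notation hsc := (hscal rho c).
Local Notation X := (hx rho c).
Local Notation Y := (hy rho c).
Local Notation T := (hw rho c).
Local Notation d := (\dim {:V}).
Implicit Types (x : 'Hom(V, F^o)) (y : V) (w : W).

Lemma hscalC a h : hsc a * h = h * hsc a. Proof. exact: pscalC. Qed.

Lemma hx0 : X 0 = 0.
Proof.
have := hx_lin rho c 1 0 0.
by rewrite scaler0 addr0 rmorph1 mul1r -{1}[X 0]addr0 => /addrI.
Qed.
Lemma hy0 : Y 0 = 0.
Proof.
have := hy_lin rho c 1 0 0.
by rewrite scaler0 addr0 rmorph1 mul1r -{1}[Y 0]addr0 => /addrI.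
Qed.
Lemma hxZ a x : X (a *: x) = hsc a * X x.
Proof. by rewrite -[a *: x]addr0 hx_lin hx0 addr0. Qed.
Lemma hyZ a y : Y (a *: y) = hsc a * Y y.
Proof. by rewrite -[a *: y]addr0 hy_lin hy0 addr0. Qed.
Lemma hxD x x' : X (x + x') = X x + X x'.
Proof. by rewrite -[x]scale1r hx_lin rmorph1 mul1r scale1r. Qed.
Lemma hyD y y' : Y (y + y') = Y y + Y y'.
Proof. by rewrite -[y]scale1r hy_lin rmorph1 mul1r scale1r. Qed.
Lemma hx_sum (I : Type) (r : seq I) (G : I -> 'Hom(V, F^o)) :
  X (\sum_(i <- r) G i) = \sum_(i <- r) X (G i).
Proof. by elim: r => [|i r IH]; rewrite ?big_nil ?hx0 // !big_cons hxD IH. Qed.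
Lemma hy_sum (I : Type) (r : seq I) (G : I -> V) :
  Y (\sum_(i <- r) G i) = \sum_(i <- r) Y (G i).
Proof. by elim: r => [|i r IH]; rewrite ?big_nil ?hy0 // !big_cons hyD IH. Qed.

Lemma hx_coord x : X x = \sum_(i < d) hsc (x (bvec i)) * X (bform i).
Proof. by rewrite {1}(bform_coord x) hx_sum; apply: eq_bigr => i _; rewrite hxZ. Qed.
Lemma hy_coord y : Y y = \sum_(i < d) hsc (bform i y) * Y (bvec i).
Proof. by rewrite {1}(bvec_coord y) hy_sum; apply: eq_bigr => i _; rewrite hyZ. Qed.

(** On the line Im(s - 1) in h the reflection [s] acts by 1 + refl_mu s. *)
Definition refl_mu (s : W) : F :=
  xget 0 (fun mu => forall v, v \in limg (rho s - \1%VF) -> rho s v - v = mu *: v).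

(** [alpha_formE] turns the coefficient of [T s] in [y, x] into a multiple of x(s y - y); the factor
    1 + mu replaces it by x(s^-1 y - y), the form that becomes s x - x when summed over dual
    bases. *)
Definition kap (s : W) : F := c s * (2%:R / refl_mu s) * (1 + refl_mu s).

(* The commutation relation with the eigenvectors of s eliminated. *)
Lemma hyx_kap y x : Y y * X x = X x * Y y + (hsc (x y)
  + \sum_(s in reflections rho) hsc (kap s * ((x (rho s^-1%g y) : F) - x y)) * T s).
Proof.
rewrite hyx -sumrN; congr (_ + (_ + _)); apply: eq_bigr => s sS.
have [mu hmu] := reflection_eigen sS.
have hm v : v \in limg (rho s - \1%VF) -> rho s v - v = refl_mu s *: v.
  by rewrite /refl_mu; case: xgetP => [mu' -> h|h]; [exact: h|case: (h mu)].
rewrite -mulNr -rmorphN; congr (hsc _ * _).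
rewrite -mulrA (alpha_formE x y sS hm) /kap -!mulrA -!mulrN; congr (_ * (_ * (_ * _))).
(* s^-1 y - y = (s - 1)(- s^-1 y) lies in Im(s - 1), where s acts by 1 + mu, and s sends it to y - s
   y. *)
have E : (1 + refl_mu s) *: (rho s^-1%g y - y) = - (rho s y - y).
  have := hm (rho s^-1%g y - y); rewrite linearB /= repVK scalerDl scale1r => <-.
    by rewrite addrC subrK opprB.
  rewrite (_ : _ - y = (rho s - \1%VF) (- rho s^-1%g y)).
    by rewrite memv_img ?memvf.
  by rewrite rep_sub1E linearN /= repVK opprK addrC.
by rewrite -[LHS](linearN x) -E linearZ /= linearB.
Qed.

Definition eps : H := - \sum_(s in reflections rho) hsc (kap s) * T s.
Definition eu : H := \sum_(i < d) X (bform i) * Y (bvec i) + eps.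

(** Summing [hyx_kap] over dual bases, the commutator of sum x_i y_i with x is x plus the sum of
    kap(s) (s x - x) s, and the commutator of [eps] with x cancels the latter. This dictates the
    coefficients of [eps]. *)
Lemma eu_x x : eu * X x = X x * (eu + hsc 1).
Proof.
rewrite rmorph1 mulrDr mulr1 /eu mulrDl mulrDr mulr_suml.
have -> : \sum_(i < d) X (bform i) * Y (bvec i) * X x = X x * (\sum_(i < d) X (bform i) * Y (bvec i))
   + X x + \sum_(s in reflections rho) hsc (kap s) * ((X (dact rho s x) - X x) * T s).
  rewrite (eq_bigr (fun i => X x * (X (bform i) * Y (bvec i)) + (hsc (x (bvec i)) * X (bform i) +
    \sum_(s in reflections rho) hsc (kap s) *
      ((hsc (dact rho s x (bvec i)) * X (bform i) - hsc (x (bvec i)) * X (bform i)) * T s)))).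
    rewrite !big_split /= -mulr_sumr -hx_coord -addrA; congr (_ + (_ + _)).
    rewrite exchange_big; apply: eq_bigr => s _; rewrite -mulr_sumr -mulr_suml sumrB.
    by rewrite -!hx_coord.
  move=> i _; rewrite -mulrA hyx_kap mulrDr mulrA hxx -mulrA; congr (_ + _).
  rewrite mulrDr -hscalC; congr (_ + _); rewrite mulr_sumr; apply: eq_bigr => s _.
  by rewrite dactE rmorphM rmorphB !mulrA -hscalC -!mulrA; congr (_ * _);
     rewrite mulrA mulrBr -!hscalC.
rewrite /eps mulNr mulrN mulr_suml mulr_sumr -!addrA; congr (_ + _).
rewrite [RHS]addrC; congr (_ + _); rewrite mulr_sumr -sumrB -sumrN.
apply: eq_bigr => s _ /=; rewrite -[in LHS]mulrA hwx mulrBl mulrBr addrAC subrr add0r.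
by rewrite mulrA hscalC -mulrA.
Qed.

Lemma eu_y y : eu * Y y = Y y * (eu + hsc (-1)).
Proof.
rewrite rmorphN1 mulrDr mulrN1 /eu mulrDl mulrDr mulr_suml.
have -> : \sum_(i < d) X (bform i) * Y (bvec i) * Y y = Y y * (\sum_(i < d) X (bform i) * Y (bvec i))
   - Y y - \sum_(s in reflections rho) hsc (kap s) * (Y y * T s - T s * Y y).
  rewrite (eq_bigr (fun i => Y y * (X (bform i) * Y (bvec i)) - (hsc (bform i y) * Y (bvec i)) -
    \sum_(s in reflections rho) hsc (kap s) *
      (T s * (hsc (bform i (rho s^-1%g y)) * Y (bvec i)) - T s * (hsc (bform i y) * Y (bvec i))))).
    rewrite !sumrB -mulr_sumr -hy_coord; congr (_ - _ - _).
    rewrite exchange_big; apply: eq_bigr => s _; rewrite -mulr_sumr sumrB -!mulr_sumr.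
    by rewrite -!hy_coord [T s * Y (rho _ y)]hwy repVK.
  move=> i _; rewrite -mulrA hyy mulrA.
  rewrite (_ : X (bform i) * Y y = Y y * X (bform i) - (hsc (bform i y)
     + \sum_(s in reflections rho) hsc (kap s * ((bform i (rho s^-1%g y) : F) - bform i y)) * T s)).
    rewrite mulrBl mulrA mulrDl opprD addrA; congr (_ - _).
    rewrite mulr_suml; apply: eq_bigr => s _.
    rewrite rmorphM rmorphB -!mulrA; congr (_ * _).
    by rewrite mulrBl !mulrA !hscalC.
  by rewrite hyx_kap addrK.
rewrite /eps mulNr mulrN mulr_suml mulr_sumr -!addrA; congr (_ + _).
rewrite [RHS]addrC; congr (_ + _); rewrite mulr_sumr -opprD; congr (- _); rewrite -big_split.
apply: eq_bigr => s _ /=; rewrite -[_ * T s * Y y]mulrA -mulrDr subrK.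
by rewrite mulrA hscalC -mulrA.
Qed.

Local Notation pe := (pev hsc eu).

Lemma peu_x p x : pe p * X x = X x * pe (p \Po ('X + 1%:P)).
Proof. by apply: pev_shift; [exact: hscalC|exact: eu_x]. Qed.
Lemma peu_y p y : pe p * Y y = Y y * pe (p \Po ('X - 1%:P)).
Proof. by rewrite -polyCN; apply: pev_shift; [exact: hscalC|exact: eu_y]. Qed.

(** All powers of [eps] lie in the span of the elements of W. The spans of 1, eps, ..., eps^(n-1)
    form a stationary chain, which yields a monic relation. *)
Lemma eps_annihilated : exists2 f : {poly F}, f \is monic & pev hsc eps f = 0.
Proof.
pose FH : lmodType F := restr hsc (H^o : lmodType H).
pose s : seq FH := [seq (T w : FH) | w <- enum W].
have sT w : lspan s (T w : FH) by apply: mem_lspan; apply: (map_f (T : W -> FH)); rewrite mem_enum.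
have sE h : lspan s (h : FH) -> lspan s (eps * h : FH).
  apply: (@lspan_sub _ FH (fun h => lspan s (eps * h : FH))) => [|_ /mapP[w _ ->]].
    apply: scalops_submod => [|u v|r v]; rewrite ?mulr0 ?mulrDr.
    - exact: lspan0.
    - exact: lspanD.
    - move=> h1; rewrite (_ : _ * _ = (r *: (eps * v : FH) : FH)); first exact: lspanZ.
      by rewrite mulrA -hscalC -mulrA.
  rewrite /eps mulNr mulr_suml; apply: sgN; first by have [] := lspan_submod s.
  apply: sg_sum => [|g _]; first by have [] := lspan_submod s.
  by rewrite -mulrA -hwM; exact: (@lspanZ _ FH).
have sP i : lspan s (eps ^+ i : FH).
  by elim: i => [|i IH]; [rewrite expr0 -(hw1 rho c)|rewrite exprS; exact: sE].
pose C n (h : FH) := exists2 p : {poly F}, (size p <= n)%N & h = pev hsc eps p.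
have [n||n h [p sp ->]|N hN] := @noeth_lspan F FH (@noeth_field F) s C.
- apply: scalops_submod => [|_ _ [p sp ->] [q sq ->]|r _ [p sp ->]].
  + by exists 0; rewrite ?size_poly0 ?pev0.
  + exists (p + q); last by rewrite pevD.
    by apply: leq_trans (size_polyD _ _) _; rewrite geq_max sp.
  + exists (r%:P * p); last by rewrite (pevM hscalC) pevC.
    by rewrite mul_polyC; apply: leq_trans (size_scale_leq _ _) sp.
- move=> n _ [p _ ->]; apply: sg_sum => [|i _]; first by have [] := lspan_submod s.
  exact: (@lspanZ _ FH).
- by exists p => //; exact: leqW.
have [|p sp pE] := hN N.+1 (pev hsc eps 'X^N); first by exists 'X^N; rewrite ?size_polyXn.
exists ('X^N - p); last by rewrite pevB pE subrr.
rewrite monicE lead_coefDl ?lead_coefXn // size_polyXn size_polyN ltnS //.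
Qed.

End Euler.

(** * The filtration by powers of (x) and polynomials in eu *)

Section ActionFiltration.
Variables (F : numFieldType) (V : vectType F) (W : finGroupType) (rho : linrep V W).
Variable c : W -> F.
Local Notation H := (cherednik rho c).
Local Notation hsc := (hscal rho c).
Local Notation X := (hx rho c).
Local Notation Y := (hy rho c).
Local Notation T := (hw rho c).
Local Notation d := (\dim {:V}).
Local Notation pe p := (pev hsc (eu rho c) p).
Implicit Types (x : 'Hom(V, F^o)) (y : V) (w : W) (p : {poly F}).

Section Module.
Variable M : lmodType H.
Implicit Types u v : M.

Definition hact (h : H) (v : restr hsc M) : restr hsc M := h *: (v : M).
Lemma hact_linear h : linear (hact h).
Proof.
move=> a u v; rewrite /hact scalerDr; congr (_ + _).
by rewrite [LHS]scalerA -hscalC -scalerA.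
Qed.
HB.instance Definition _ h :=
  GRing.isLinear.Build F (restr hsc M) (restr hsc M) *:%R (hact h) (hact_linear h).

Definition xops : seq {additive M -> M} :=
  [seq (GRing.scale (X (bform i)) : {additive M -> M}) | i <- enum 'I_d].
Local Notation xf k v := (filt xops k v).

Lemma xops_In f : List.In f xops -> exists x, f = GRing.scale (X x).
Proof. by move=> /In_map[i _ <-]; exists (bform i). Qed.

Lemma xf_sc k a v : xf k v -> xf k (hsc a *: v).
Proof.
apply: (pw_stable (f := GRing.scale (hsc a) : {additive M -> M})) => //.
by move=> f /xops_In[x ->] w /=; rewrite !scalerA hscalC.
Qed.

Lemma xf_x k x v : xf k v -> xf k.+1 (X x *: v).
Proof.
move=> hv; rewrite hx_coord scaler_suml; apply: sg_sum => [|i _]; first exact: filt_sg.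
rewrite -scalerA; apply: xf_sc.
apply: (pw_mul (x := GRing.scale (X (bform i)) : {additive M -> M})) => //.
by apply/In_map; exists i => //; apply/In_mem; rewrite mem_enum.
Qed.

Lemma xf_ind (Q : nat -> M -> Prop) : (forall v, Q 0%N v) -> (forall k, Q k 0) ->
  (forall k u v, xf k u -> xf k v -> Q k u -> Q k v -> Q k (u + v)) ->
  (forall k x v, xf k v -> Q k v -> Q k.+1 (X x *: v)) -> forall k v, xf k v -> Q k v.
Proof.
move=> h0 hz hD hM k v; elim=> {k v}.
- by move=> v _; exact: h0.
- exact: hz.
- by move=> k u v hu Qu hv Qv; exact: hD.
- by move=> k f v /xops_In[x ->]; exact: hM.
Qed.

Lemma xf_w k w v : xf k v -> xf k (T w *: v).
Proof.
move: k v; apply: xf_ind => [v|k|k u v _ _ hu hv|k x v _ hv].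
- exact: filt_top.
- by rewrite scaler0; exact: filt0.
- by rewrite scalerDr; exact: filtD.
- by rewrite scalerA hwx -scalerA; exact: xf_x.
Qed.

(** [y, x] lies in the image of the group algebra, which preserves the filtration, so commuting y
    past k factors costs one of them; [k.-1] includes k = 0. *)
Lemma xf_y k y v : xf k v -> xf k.-1 (Y y *: v).
Proof.
move: k v; apply: xf_ind => [v|k|k u v _ _ hu hv|k x v hv hy] /=.
- exact: filt_top.
- by rewrite scaler0; exact: filt0.
- by rewrite scalerDr; exact: filtD.
rewrite scalerA hyx_kap 2!scalerDl -scalerA; apply: filtD; first last.
  apply: filtD; first exact: xf_sc.
  rewrite scaler_suml; apply: sg_sum => [|s _]; first exact: filt_sg.
  by rewrite -scalerA; apply/xf_sc/xf_w.
by case: k hv hy => [|k] hv hy; [exact: filt_top|exact: xf_x].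
Qed.

Lemma xf_eps k v : xf k v -> xf k (eps rho c *: v).
Proof.
move=> hv; rewrite /eps scaleNr scaler_suml; apply: filtN.
apply: sg_sum => [|s _]; first exact: filt_sg.
by rewrite -scalerA; apply/xf_sc/xf_w.
Qed.

Lemma xf_eu k v : xf k v -> xf k (eu rho c *: v).
Proof.
move=> hv; rewrite /eu scalerDl; apply: filtD; last exact: xf_eps.
rewrite scaler_suml; apply: sg_sum => [|i _]; first exact: filt_sg.
by rewrite -scalerA; apply: filt_leq (leqSpred k) _; apply/xf_x/xf_y.
Qed.

Definition eu_stable (C : M -> Prop) := subgroup C /\ forall p v, C v -> C (pe p *: v).

Lemma eu_stableP (C : M -> Prop) : subgroup C -> (forall a v, C v -> C (hsc a *: v)) ->
  (forall v, C v -> C (eu rho c *: v)) -> eu_stable C.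
Proof.
move=> sC Csc Ceu; split=> // p v Cv; rewrite scaler_suml; apply: sg_sum => // i _.
rewrite -scalerA; apply: Csc; elim: (nat_of_ord i) => [|j IH]; first by rewrite expr0 scale1r.
by rewrite exprS -scalerA; exact: Ceu.
Qed.

Lemma xf_stable k : eu_stable (filt xops k).
Proof.
by apply: eu_stableP => [|a v|v]; [exact: filt_sg|exact: xf_sc|exact: xf_eu].
Qed.

Lemma zero_stable : eu_stable (fun v => v = 0).
Proof.
apply: eu_stableP => [|a v ->|v ->]; rewrite ?scaler0 //.
by split=> // u v -> ->; rewrite subr0.
Qed.

Lemma pe_mul p q v : pe (p * q) *: v = pe p *: (pe q *: v).
Proof. by rewrite (pevM (@hscalC _ _ _ rho c)) scalerA. Qed.

(** A Bezout relation between the two products writes [v] as a sum of two elements of [C]. This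
    replaces decompositions into generalized eigenspaces, which a complete module need not have. *)
Lemma coprime_kill (C : M -> Prop) (s t : seq F) v : eu_stable C ->
  (forall a, a \in s -> a \notin t) ->
  C (pe (\prod_(a <- s) ('X - a%:P)) *: v) -> C (pe (\prod_(a <- t) ('X - a%:P)) *: v) -> C v.
Proof.
move=> sC st hs ht; have [p [q E]] := prod_coprime st.
rewrite -[v]scale1r -(pev1 hsc (eu rho c)) -E pevD scalerDl !pe_mul.
by apply: sgD; [exact: sC.1|apply: sC.2|apply: sC.2].
Qed.

(* A vector whose images under all y lie in (x)^k is moved by eu as by eps modulo
   (x)^(k+1), since eu - eps = sum x_i y_i. *)
Lemma pe_eps k p v : xf k v -> (forall y, xf k (Y y *: v)) ->
  xf k.+1 (pe p *: v - pev hsc (eps rho c) p *: v).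
Proof.
elim/poly_ind: p v => [|p a IH] v hv hyv; first by rewrite !pev0 subrr; exact: filt0.
rewrite !pevD !pevMX !pevC !scalerDl opprD addrACA subrr addr0 -!scalerA.
have hev : xf k.+1 (eu rho c *: v - eps rho c *: v).
  rewrite /eu scalerDl addrK scaler_suml; apply: sg_sum => [|i _]; first exact: filt_sg.
  by rewrite -scalerA; apply: xf_x.
rewrite -(subrKA (pe p *: (eps rho c *: v))) -scalerBr; apply: filtD.
  exact: (xf_stable _).2.
apply: IH; first exact: xf_eps.
move=> y; rewrite /eps scaleNr scalerN scaler_suml scaler_sumr; apply: filtN.
apply: sg_sum => [|s _]; first exact: filt_sg.
rewrite scalerA mulrA -hscalC -mulrA -scalerA; apply: xf_sc.
rewrite -[y](repVK rho s) -hwy -scalerA.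
by apply: xf_w; exact: hyv.
Qed.

Lemma pe_soc p v : (forall y, Y y *: v = 0) -> pe p *: v = pev hsc (eps rho c) p *: v.
Proof.
elim/poly_ind: p v => [|p a IH] v hyv; first by rewrite !pev0.
rewrite !pevD !pevMX !pevC !scalerDl -!scalerA; congr (_ + _).
have -> : eu rho c *: v = eps rho c *: v.
  rewrite /eu scalerDl scaler_suml big1 ?add0r // => i _.
  by rewrite -scalerA hyv scaler0.
apply: IH => y; rewrite /eps scaleNr scalerN scaler_suml scaler_sumr big1 ?oppr0 // => s _.
rewrite scalerA mulrA -hscalC -mulrA -scalerA.
by rewrite -[y](repVK rho s) -hwy -scalerA hyv !scaler0.
Qed.

Fixpoint yact (ys : seq V) (v : M) : M := if ys is y :: ys' then yact ys' (Y y *: v) else v.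

Lemma killedP k v : killed k v <-> forall ys, size ys = k -> yact ys v = 0.
Proof.
elim: k v => [|k IH] v /=.
  by split=> [-> [|//]|/(_ [::]) /= -> //].
split=> [h [|y ys] //= [sk]|h y]; first exact: (IH _).1.
by apply/(IH _).2 => ys sk; apply: (h (y :: ys)); rewrite /= sk.
Qed.

Lemma yact0 ys : yact ys 0 = 0. Proof. by elim: ys => //= y ys; rewrite scaler0. Qed.

Lemma killed_y k y v : killed k v -> killed k (Y y *: v).
Proof. by move=> /killedS; exact. Qed.

Lemma yact_killed k ys v : killed k v -> killed k (yact ys v).
Proof. by elim: ys v => //= y ys IH v hv; apply/IH/killed_y. Qed.

Lemma yact_xf k ys v : xf k v -> xf (k - size ys) (yact ys v).
Proof.
elim: ys k v => [|y ys IH] k v hv /=; first by rewrite subn0.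
have -> : (k - (size ys).+1 = k.-1 - size ys)%N by rewrite -subn1 -subnDA add1n.
exact/IH/xf_y.
Qed.

Lemma yact_pe ys (s : seq F) v :
  pe (\prod_(a <- [seq a - (size ys)%:R | a <- s]) ('X - a%:P)) *: yact ys v =
  yact ys (pe (\prod_(a <- s) ('X - a%:P)) *: v).
Proof.
elim: ys s v => [|y ys IH] s v /=.
  by congr (pe _ *: _); rewrite big_map; apply: eq_bigr => a _; rewrite subr0.
have -> : Y y *: (pe (\prod_(a <- s) ('X - a%:P)) *: v) =
    pe (\prod_(a <- [seq a - 1 | a <- s]) ('X - a%:P)) *: (Y y *: v).
  rewrite !scalerA peu_y; congr (_ * pe _ *: _); rewrite comp_prod_XsubC -map_comp.
  by rewrite big_map; apply: eq_bigr => a _ /=; rewrite subrK.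
rewrite -IH; congr (pe _ *: _); rewrite !big_map; apply: eq_bigr => a _.
by rewrite -addn1 natrD opprD [- _ - 1]addrC addrA.
Qed.

End Module.

Lemma filt_hom (M N : lmodType H) (f : {linear M -> N}) k v :
  filt (xops M) k v -> filt (xops N) k (f v).
Proof.
apply: pw_hom => // x /In_map[i hi <-].
exists (GRing.scale (X (bform i)) : {additive N -> N}); first by apply/In_map; exists i.
by move=> u; exact: linearZ.
Qed.

End ActionFiltration.

(** * Eigenvalues of eu and the gap *)

Section EulerRoots.
Variables (F : numClosedFieldType) (V : vectType F) (W : finGroupType) (rho : linrep V W).
Variable c : W -> F.
Local Notation H := (cherednik rho c).
Local Notation hsc := (hscal rho c).
Local Notation Y := (hy rho c).
Local Notation pe p := (pev hsc (eu rho c) p).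
Local Notation xf k v := (filt (xops _) k v).
Local Notation PX s := (\prod_(a <- s) ('X - a%:P)).

Lemma eps_roots : exists s : seq F, pev hsc (eps rho c) (PX s) = 0.
Proof.
have [f /monicP f1 f0] := eps_annihilated rho c.
have [s fE] := closed_field_poly_normal f.
by exists s; rewrite -[PX s]scale1r -f1 -fE.
Qed.

Definition ert : seq F := sval (cid eps_roots).
Lemma ertP : pev hsc (eps rho c) (PX ert) = 0. Proof. exact: svalP (cid eps_roots). Qed.

(** In characteristic 0 a pair of roots excludes at most one [j], and there are finitely many
    pairs. *)
Lemma gap_ex : exists K, forall a b j, a \in ert -> b \in ert -> (K <= j)%N -> a != b + j%:R.
Proof.
have g (p : F * F) : exists n, forall j, p.1 = p.2 + j%:R -> (j < n)%N.
  case: (pselect (exists j : nat, p.1 = p.2 + j%:R)) => [[j pE]|h]; last first.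
    by exists 0%N => j pj; case: h; exists j.
  exists j.+1 => i; rewrite pE => /addrI/eqP; rewrite eqr_nat => /eqP <-.
  exact: ltnSn.
have [n hn] := choice g.
exists (\max_(p <- [seq (a, b) | a <- ert, b <- ert]) n p) => a b j ha hb Kj.
apply/eqP => ab; have := hn (a, b) j ab; rewrite ltnNge; apply/negP.
rewrite negbK; apply: leq_trans Kj.
apply: (@leq_bigmax_seq _ [seq (a, b) | a <- ert, b <- ert] predT n (a, b)) => //.
by apply/allpairsP; exists (a, b).
Qed.

Definition gap : nat := sval (cid gap_ex).
Lemma gapP a b j : a \in ert -> b \in ert -> (gap <= j)%N -> a != b + j%:R.
Proof. exact: (svalP (cid gap_ex)). Qed.

(** The values a + j with [a] a root for [eps] and j < k: by [killed_FF] and [xf_FF] they contain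
    the eigenvalues of eu on the vectors killed by words of length k, and on the quotient by
    (x)^k. *)
Fixpoint rts k : seq F := if k is k'.+1 then ert ++ [seq a + 1 | a <- rts k'] else [::].

Lemma rtsD k j : rts (k + j) = rts k ++ [seq a + k%:R | a <- rts j].
Proof.
elim: k => [|k IH] /=.
  by rewrite (eq_map (g := id)) ?map_id // => a; rewrite addr0.
rewrite IH map_cat -catA; congr (_ ++ (_ ++ _)); rewrite -map_comp.
by apply: eq_map => a /=; rewrite -addrA natr1.
Qed.

Lemma rts_mem k r : r \in rts k -> exists a j, [/\ a \in ert, (j < k)%N & r = a + j%:R].
Proof.
elim: k r => // k IH r; rewrite mem_cat => /orP[hr|/mapP[r' /IH[a [j [ha jk ->]]] ->]].
  by exists r, 0%N; rewrite addr0.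
by exists a, j.+1; rewrite -addrA natr1.
Qed.

Definition FF k := PX (rts k).

Lemma FF_S k : FF k.+1 = PX ert * (FF k \Po ('X - 1%:P)).
Proof. by rewrite /FF comp_prod_XsubC -big_cat. Qed.

Lemma FF_add k j : FF (k + j) = FF k * (FF j \Po ('X - k%:R%:P)).
Proof. by rewrite /FF comp_prod_XsubC rtsD big_cat. Qed.

Section Module.
Variable M : lmodType H.
Implicit Types v : M.

Lemma kill_soc v : (forall y, Y y *: v = 0) -> pe (PX ert) *: v = 0.
Proof. by move=> hv; rewrite pe_soc // ertP scale0r. Qed.

(** Moving y past [FF k] shifted by 1 gives y FF_k(eu - 1) v = FF_k(eu) y v = 0 by induction. So
    FF_k(eu - 1) v is killed by all y; there eu acts as [eps] and is annihilated by the remaining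
    factor. *)
Lemma killed_FF k v : killed k v -> pe (FF k) *: v = 0.
Proof.
elim: k v => [v /= ->|k IH v hv]; first exact: scaler0.
rewrite FF_S pe_mul; apply: kill_soc => y; by rewrite scalerA -peu_y -scalerA IH.
Qed.

Lemma xf_shift k v : xf k v -> xf k.+1 (pe (PX ert \Po ('X - k%:R%:P)) *: v).
Proof.
move: k v; apply: xf_ind => [v|k|k u v _ _ hu hv|k x v _ hv].
- rewrite subr0 comp_polyXr -[_ *: v]subr0 -(scale0r v) -ertP.
  by apply: (pe_eps (k := 0%N)) => *; exact: filt_top.
- by rewrite scaler0; exact: filt0.
- by rewrite scalerDr; exact: filtD.
- rewrite scalerA peu_x -scalerA; apply: xf_x; rewrite -comp_polyA.
  rewrite (_ : ('X - k.+1%:R%:P) \Po ('X + 1%:P) = 'X - k%:R%:P) //.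
  by rewrite comp_polyB comp_polyX comp_polyC -natr1 polyCD opprD addrACA subrr addr0.
Qed.

Lemma xf_FF k v : xf k (pe (FF k) *: v).
Proof.
elim: k v => [v|k IH v]; first exact: filt_top.
rewrite -addn1 FF_add mulrC pe_mul addn1 (_ : FF 1 = PX ert) ?cats0; last by rewrite /FF /= cats0.
exact: xf_shift.
Qed.

(** Let P be the product over [ert]. Modulo (x)^(k+1), P(eu) kills [v] because P(eps) = 0 and eu
    acts like [eps], while P(eu - k) kills all of (x)^k. From [gap] on P(X) and P(X - k) are
    coprime. *)
Lemma xf_soc k v : (gap <= k)%N -> xf k v -> (forall y, xf k (Y y *: v)) -> xf k.+1 v.
Proof.
move=> gk hv hyv; apply: (@coprime_kill _ _ _ _ _ _ _ ert [seq a + k%:R | a <- ert]).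
- exact: xf_stable.
- by move=> a ha; apply/mapP => -[b hb]; apply/eqP; exact: gapP.
- by have := pe_eps (PX ert) hv hyv; rewrite ertP scale0r subr0.
- by rewrite -comp_prod_XsubC; exact: xf_shift.
Qed.

End Module.

(** For such [r] the number r - Q is no eigenvalue a + j, so the corresponding vectors die after Q
    letters y. *)
Definition low (Q : nat) (r : F) : bool :=
  `[< forall a j, a \in ert -> (Q <= j)%N -> r != a + j%:R >].

Lemma lowP Q r : reflect (forall a j, a \in ert -> (Q <= j)%N -> r != a + j%:R) (low Q r).
Proof. exact: asboolP. Qed.

Lemma low_rts Q k : (k + gap <= Q)%N -> all (low Q) (rts k).
Proof.
move=> kQ; apply/allP => r /rts_mem[a [j [ha jk ->]]]; apply/lowP => b i hb Qi.
have ji : (j + gap <= i)%N by apply: leq_trans (leq_trans _ kQ) Qi; rewrite leq_add2r ltnW.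
have := gapP ha hb (_ : (gap <= i - j)%N); rewrite leq_subRL ?(leq_trans (leq_addr _ _) ji) //.
rewrite ji => /(_ isT); apply: contraNneq => E.
rewrite natrB ?(leq_trans (leq_addr _ _) ji) //; apply/eqP.
by rewrite addrA -E addrK.
Qed.

Definition AA Q k := [seq r <- rts k | low Q r].
Definition BB Q k := [seq r <- rts k | ~~ low Q r].

Lemma AB_coprime Q k l a : a \in AA Q k -> a \notin BB Q l.
Proof. by rewrite !mem_filter => /andP[->]. Qed.

Lemma AB_prod Q k : PX (AA Q k) * PX (BB Q k) = FF k.
Proof. by rewrite /AA /BB !big_filter /FF [RHS](bigID (low Q)). Qed.

Lemma AA_prefix Q k l : (k <= l)%N -> exists t, AA Q l = AA Q k ++ t.
Proof. by move=> /subnKC <-; rewrite /AA rtsD filter_cat; eexists. Qed.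
Lemma BB_prefix Q k l : (k <= l)%N -> exists t, BB Q l = BB Q k ++ t.
Proof. by move=> /subnKC <-; rewrite /BB rtsD filter_cat; eexists. Qed.

Lemma AA_full Q k : (k + gap <= Q)%N -> AA Q k = rts k.
Proof. by move=> /low_rts/all_filterP. Qed.
Lemma BB_full Q k : (k + gap <= Q)%N -> BB Q k = [::].
Proof.
move=> /low_rts/allP h; apply/eqP; rewrite -[_ == _]negbK -has_filter; apply/negP => /hasP[r].
by move=> /h ->.
Qed.

Lemma low_shift Q k a : a \in [seq r - Q%:R | r <- AA Q k] -> forall l, a \notin rts l.
Proof.
move=> /mapP[r]; rewrite mem_filter => /andP[/lowP lr _] -> l; apply/negP => /rts_mem[b [j [hb _ E]]].
have := lr b (j + Q)%N hb (leq_addl _ _); rewrite natrD addrA -E subrK eqxx //.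
Qed.

End EulerRoots.

(** * Category O and complete modules *)

Lemma fdim_kers (F : fieldType) (V V' : lmodType F) (Ts : seq {linear V -> V'})
    (C : V -> Prop) (D : V' -> Prop) :
  submod (@scalops F V) C -> fdim D -> (forall T, List.In T Ts -> forall v, C v -> D (T v)) ->
  fdim (fun v => C v /\ forall T, List.In T Ts -> T v = 0) -> fdim C.
Proof.
move=> + [e he]; elim: Ts C => [|T Ts IH] C sC CD hf.
  by case: hf => s hs; exists s => v Cv; apply: hs; split.
apply: (@fdim_ker F V V' T C (fun v => v = 0) e) => //.
- by apply: scalops_submod => [|u v -> ->|r v ->]; rewrite ?addr0 ?scaler0.
- by move=> v Cv; exists (T v); [apply: he; apply: CD => //; left|rewrite subrr].
apply: IH.
- apply: scalops_submod => [|u v [Cu Tu] [Cv Tv]|r v [Cv Tv]].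
  + by split; [exact: sC.1.1|rewrite raddf0].
  + by split; [apply: sgD => //; exact: sC.1|rewrite raddfD /= Tu Tv addr0].
  + by split; [exact: submodZ|rewrite linearZ /= Tv scaler0].
- by move=> S hS v [Cv _]; apply: CD => //; right.
case: hf => s hs; exists s => v [[Cv Tv] hv]; apply: hs; split=> // S [<- //|].
exact: hv.
Qed.

Lemma fdim_sub (F : fieldType) (V : lmodType F) (C D : V -> Prop) :
  (forall v, C v -> D v) -> fdim D -> fdim C.
Proof. by move=> CD [s hs]; exists s => v /CD; exact: hs. Qed.

Section CategoryO.
Variables (F : numClosedFieldType) (V : vectType F) (W : finGroupType) (rho : linrep V W).
Variable c : W -> F.
Local Notation H := (cherednik rho c).
Local Notation hsc := (hscal rho c).
Local Notation X := (hx rho c).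
Local Notation Y := (hy rho c).
Local Notation d := (\dim {:V}).
Local Notation pe p := (pev hsc (eu rho c) p).
Local Notation xf k v := (filt (xops _) k v).
Local Notation PX s := (\prod_(a <- s) ('X - a%:P)).
Local Notation FF := (FF rho c).
Local Notation gap := (gap rho c).
Local Notation ert := (ert rho c).
Local Notation low := (low rho c).
Local Notation AA := (AA rho c).
Local Notation BB := (BB rho c).

(** * A finiteness criterion for category O *)

Section Criterion.
Variable M : lmodType H.
Implicit Types u v : M.
Local Notation MF := (restr hsc M).
Local Notation MP := (restr (poly_cher rho c) M).
Hypothesis nilM : forall v, h_nilpotent v.
Hypothesis socM : fdim (fun v : MF => killed 1 (v : M)).

Lemma killed_submod k : submod (@scalops F MF) (fun v : MF => killed k (v : M)).
Proof.
apply: scalops_submod; [exact: killed0|exact: killedD|].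
by move=> r v; exact: killed_scal.
Qed.

Lemma killed_fdim k : fdim (fun v : MF => killed k (v : M)).
Proof.
elim: k => [|k IH]; first by exists [::].
pose Ts : seq {linear MF -> MF} := [seq (@hact _ _ _ rho c M (Y (bvec i)) : {linear MF -> MF}) | i <- enum 'I_d].
apply: (@fdim_kers F MF MF Ts _ (fun v : MF => killed k (v : M))) => //.
- exact: killed_submod.
- by move=> T /In_map[i _ <-] v hv; exact: hv.
apply: fdim_sub socM => v [_ hv] y.
rewrite hy_coord scaler_suml /= big1 // => i _; rewrite -scalerA.
have /= := hv (@hact _ _ _ rho c M (Y (bvec i)) : {linear MF -> MF}).
rewrite /hact => ->; first exact: scaler0.
by apply/In_map; exists i => //; apply/In_mem; rewrite mem_enum.
Qed.

(** Words of length Q in the y shift the eigenvalues of [v] by -Q, outside all the sets [rts l],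
    whereas the resulting vector is still h-nilpotent. *)
Lemma killed_low Q k v : pe (PX (AA Q k)) *: v = 0 -> killed Q v.
Proof.
move=> hv; have [l hl] := nilM v; apply/killedP => ys sy.
apply: (@coprime_kill _ _ _ _ _ _ (fun v => v = 0) [seq a - Q%:R | a <- AA Q k] (rts rho c l)).
- exact: zero_stable.
- by move=> a /low_shift; exact.
- by rewrite -sy yact_pe sy hv yact0.
- exact: (killed_FF (yact_killed ys hl)).
Qed.

(** Bezout splits [v]. The component in the image of the product over [ert] lies in (x); the other
    is annihilated by the low part of [FF k], hence by words of length [gap]. *)
Lemma gen_step v : exists2 v', killed gap v' & xf 1 (v - v').
Proof.
have [k hk] := nilM v.
have hdis a : a \in ert -> a \notin BB gap k.
  move=> ha; rewrite mem_filter negb_and negbK; apply/orP; left.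
  by apply/lowP => b j hb; exact: gapP.
have [p [q E]] := prod_coprime hdis.
exists (pe (q * PX (BB gap k)) *: v).
  apply: (@killed_low gap k); rewrite -pe_mul mulrCA AB_prod pe_mul killed_FF // scaler0 //.
have vE : v = pe (p * PX ert) *: v + pe (q * PX (BB gap k)) *: v.
  by rewrite -scalerDl -pevD E pev1 scale1r.
rewrite {1}vE addrK pe_mul; apply: (xf_stable _ _).2.
by have := xf_FF 1 v; rewrite /FF /= cats0.
Qed.

(* Nakayama's lemma for the grading by generalized eigenspaces of eu: M is generated
   over C[V] by the vectors killed by all words of length gap in the y. *)
Lemma category_O_criterion : category_O rho c M.
Proof.
split=> //.
have [es esK esP] := fdim_basis (killed_submod gap) (killed_fdim gap).
pose M' v := lspan (es : seq MP) (v : MP).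
have sM' := lspan_submod (es : seq MP).
have M'x x v : M' v -> M' (X x *: v).
  by move=> hv; rewrite -poly_cher_x; exact: (submodZ (V := MP) (xpoly x) sM').
have M'sc a v : M' v -> M' (hsc a *: v).
  by move=> hv; rewrite -poly_cher_scal; exact: (submodZ (V := MP) (pscal _ a) sM').
have KM' v : killed gap v -> M' v.
  move=> /esP; apply: (@lspan_sub _ MF M') => [|e ees].
    by apply: scalops_submod => [|u w|r w]; [exact: sM'.1.1|apply: sgD; exact: sM'.1|exact: M'sc].
  exact: (@mem_lspan _ MP).
have K_eu v : killed gap v -> killed gap (eu rho c *: v).
  move=> hv; rewrite /eu scalerDl; apply: killedD.
    rewrite scaler_suml; elim/big_rec: _ => [|i w _ hw]; first exact: killed0.
    apply: killedD => //; rewrite -scalerA; case: gap hv => [|g] hv; last exact: killed_x (hv _).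
    by rewrite hv !scaler0; exact: killed0.
  rewrite /eps -mulN1r -scalerA -(rmorphN1 hsc); apply: killed_scal.
  rewrite scaler_suml; elim/big_rec: _ => [|s w _ hw]; first exact: killed0.
  by apply: killedD => //; rewrite -scalerA; apply: killed_scal; exact: killed_w.
have M'eu v : M' v -> M' (eu rho c *: v).
  move=> hv; suff [] : M' v /\ M' (eu rho c *: v) by [].
  apply: (@lspan_sub _ MP (fun v : MP => M' v /\ M' (eu rho c *: (v : M))) es) hv.
    apply: scalops_submod => [|u w [hu1 hu2] [hw1 hw2]|p w].
    - by rewrite scaler0; split; exact: sM'.1.1.
    - by rewrite scalerDr; split; apply: sgD => //; exact: sM'.1.
    - elim/palg_ind: p w => [a|x|p q hp hq|p q hp hq] w hw.
      + rewrite restrZ [poly_cher _ _ _]poly_cher_scal; split; first by apply: M'sc; case: hw.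
        by rewrite scalerA -hscalC -scalerA; apply: M'sc; case: hw.
      + rewrite restrZ [poly_cher _ _ _]poly_cher_x; split; first by apply: M'x; case: hw.
        rewrite scalerA eu_x -scalerA; apply: M'x; rewrite scalerDl.
        by apply: sgD; [exact: sM'.1|case: hw|apply: M'sc; case: hw].
      + have [p1 p2] := hp w hw; have [q1 q2] := hq w hw; rewrite scalerDl.
        by split; [apply: sgD|rewrite scalerDr; apply: sgD] => //; exact: sM'.1.
      + by rewrite -scalerA; apply: hp; exact: hq.
  by move=> e ees; split; apply: KM'; [exact: esK|apply: K_eu; exact: esK].
have M'st : eu_stable M' by apply: eu_stableP => //; exact: sM'.1.
have stepM k r : xf k r -> exists2 m, M' m & xf k.+1 (r - m).
  move: k r; apply: xf_ind => [r|k|k u v _ _ [m hm um] [n hn vn]|k x v _ [m hm vm]].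
  - by have [m /KM' hm hr] := gen_step r; exists m.
  - by exists 0; [exact: sM'.1.1|rewrite subr0; exact: filt0].
  - exists (m + n); first by apply: sgD => //; exact: sM'.1.
    by rewrite opprD addrACA; exact: filtD.
  - by exists (X x *: m); [exact: M'x|rewrite -scalerBr; exact: xf_x].
have denseM k v : exists2 m, M' m & xf k (v - m).
  elim: k v => [|k IH] v; first by exists 0; [exact: sM'.1.1|exact: filt_top].
  have [m hm /stepM[n hn vn]] := IH v; exists (m + n); last by rewrite opprD addrA.
  by apply: sgD => //; exact: sM'.1.
have kill_shift k (r : M) : xf k r -> exists p, pe (FF p \Po ('X - k%:R%:P)) *: r = 0.
  move: k r; apply: xf_ind => [r|k|k u v _ _ [p hp] [q hq]|k x v _ [p hp]].
  - by have [p hp] := nilM r; exists p; rewrite subr0 comp_polyXr killed_FF.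
  - by exists 0%N; rewrite scaler0.
  - have le n m (w : M) : pe (FF n \Po ('X - k%:R%:P)) *: w = 0 ->
        pe (FF (n + m) \Po ('X - k%:R%:P)) *: w = 0.
      by move=> hw; rewrite FF_add comp_polyM mulrC pe_mul hw scaler0.
    by exists (p + q)%N; rewrite scalerDr le // addnC le // addr0.
  - exists p; rewrite scalerA peu_x -scalerA -comp_polyA.
    rewrite (_ : ('X - k.+1%:R%:P) \Po ('X + 1%:P) = 'X - k%:R%:P) ?hp ?scaler0 //.
    by rewrite comp_polyB comp_polyX comp_polyC -natr1 polyCD opprD addrACA subrr addr0.
(* FF_p(eu) kills [v], and v - m in (x)^(p + gap) is killed by a product over values a + j + p +
   gap. These two sets of values are disjoint, and both polynomials send [v] into [M']. *)
have allM' v : M' v.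
  have [p hp] := nilM v; have [m hm hr] := denseM (p + gap)%N v.
  have [q hq] := kill_shift _ _ hr.
  apply: (@coprime_kill _ _ _ _ _ _ M' (rts rho c p) [seq a + (p + gap)%:R | a <- rts rho c q]) => //.
  - move=> r hrp; apply/mapP => -[r' /rts_mem[a [j [ha _ ->]]] rE].
    have /low_rts/allP/(_ r hrp)/lowP/(_ a (j + (p + gap))%N ha (leq_addl _ _)) := leqnn (p + gap).
    by rewrite natrD addrA -rE eqxx.
  - by rewrite killed_FF //; exact: sM'.1.1.
  - rewrite -comp_prod_XsubC -[v](subrK m) scalerDr hq add0r.
    exact: M'st.2.
exists (size es), (fun i => es`_i) => v; have [a ->] := lspan_nth (allM' v).
by exists a.
Qed.

End Criterion.

(** * Spectral projections of eu on complete modules *)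

Section CompleteModules.
Variable N : lmodType H.
Implicit Types n v : N.
Hypothesis sepN : separated (xops N).

(** [n'] is the component of [n] on the low eigenvalues. It is tested modulo each (x)^l, where all
    eigenvalues lie in [rts l] and [AA], [BB] separate low from high. *)
Definition isproj Q n n' := forall l,
  xf l (pe (PX (AA Q l)) *: n') /\ xf l (pe (PX (BB Q l)) *: (n - n')).

Lemma isproj_uniq Q n n1 n2 : isproj Q n n1 -> isproj Q n n2 -> n1 = n2.
Proof.
move=> h1 h2; apply/eqP; rewrite -subr_eq0; apply/eqP/sepN => l.
have [a1 b1] := h1 l; have [a2 b2] := h2 l.
apply: (@coprime_kill _ _ _ _ _ _ (filt (xops N) l) (AA Q l) (BB Q l)).
- exact: xf_stable.
- by move=> a; exact: AB_coprime.
- by rewrite scalerBr; exact: filtB.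
- rewrite (_ : n1 - n2 = (n - n2) - (n - n1)); first by rewrite scalerBr; exact: filtB.
  by rewrite opprB [RHS]addrC addrA subrK.
Qed.

Lemma isproj_killed Q n n' : isproj Q n n' -> killed Q n'.
Proof.
move=> h; apply/killedP => ys sy; apply: sepN => l.
(* Q extra powers of (x) are taken because a word of length Q loses that many. *)
have [ha _] := h (l + Q)%N.
apply: (@coprime_kill _ _ _ _ _ _ (filt (xops N) l)
  [seq a - Q%:R | a <- AA Q (l + Q)] (rts rho c l)).
- exact: xf_stable.
- by move=> a /low_shift; exact.
- by have := yact_xf ys ha; rewrite -yact_pe sy addnK.
- exact: xf_FF.
Qed.

Lemma isproj_close Q k n n' : (k + gap <= Q)%N -> isproj Q n n' -> xf k (n - n').
Proof.
move=> kQ /(_ k)[_]; rewrite BB_full // big_nil pev1 scale1r; exact.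
Qed.

(** The eigenvalues on a vector killed by words of length p lie in [rts p], and these are all low
    once Q >= p + gap. *)
Lemma isproj_nilp Q p n : (p + gap <= Q)%N -> killed p n -> isproj Q n n.
Proof.
move=> pQ hn l; rewrite subrr scaler0; split; last exact: filt0.
have [lp|pl] := leqP l p.
  by rewrite AA_full; [exact: xf_FF|apply: leq_trans pQ; rewrite leq_add2r].
have [t ->] := AA_prefix rho c Q (ltnW pl).
rewrite AA_full // big_cat /= mulrC pe_mul killed_FF // scaler0; exact: filt0.
Qed.

Lemma isproj0 Q : isproj Q 0 0.
Proof. by move=> l; rewrite subr0 !scaler0; split; exact: filt0. Qed.

Lemma isprojD Q m m' n n' : isproj Q m m' -> isproj Q n n' -> isproj Q (m + n) (m' + n').
Proof.
move=> hm hn l; have [a1 b1] := hm l; have [a2 b2] := hn l.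
by split; [rewrite scalerDr; exact: filtD|rewrite opprD addrACA scalerDr; exact: filtD].
Qed.

Lemma low_succ Q r : low Q.+1 (r + 1) = low Q r.
Proof.
apply/lowP/lowP => h a j ha Qj.
  by have := h a j.+1 ha Qj; rewrite -natr1 addrA; apply: contra_neq => ->.
by case: j Qj => // j; rewrite ltnS => /(h a j ha); rewrite -natr1 addrA; apply: contra_neq => /addIr.
Qed.

(** x raises eigenvalues by 1, and [r + 1] is low for Q + 1 exactly when [r] is low for Q. The first
    block of [rts l.+1] only contributes a further polynomial in eu, which preserves the
    filtration. *)
Lemma isproj_x Q x n n' : isproj Q n n' -> isproj Q.+1 (X x *: n) (X x *: n').
Proof.
have key (P Q' : pred F) l v : (forall r, P (r + 1) = Q' r) ->
    xf l (pe (PX [seq r <- rts rho c l | Q' r]) *: v) ->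
    xf l.+1 (pe (PX [seq r <- rts rho c l.+1 | P r]) *: (X x *: v)).
  move=> PQ hv; rewrite /= filter_cat big_cat /= pe_mul; apply: (xf_stable _ _).2.
  rewrite scalerA peu_x -scalerA; apply: xf_x.
  suff -> : PX [seq r <- [seq a + 1 | a <- rts rho c l] | P r] \Po ('X + 1%:P) =
      PX [seq r <- rts rho c l | Q' r] by [].
  have -> : [seq r <- [seq a + 1 | a <- rts rho c l] | P r] =
      [seq a + 1 | a <- [seq r <- rts rho c l | Q' r]].
    by rewrite filter_map; congr map; apply: eq_filter => r; exact: PQ.
  rewrite -[1%:P]opprK -polyCN comp_prod_XsubC !big_map.
  by apply: eq_bigr => r _; rewrite addrK.
move=> h [|l]; first by split; exact: filt_top.
have [ha hb] := h l; rewrite -scalerBr; split; apply: key; try exact: ha; try exact: hb.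
  by move=> r; rewrite low_succ.
by move=> r; rewrite low_succ.
Qed.

(** Projection commutes with x up to a shift of Q, so a sum of words of length k in the x projects
    to words of length k applied to h-nilpotent vectors. For h-nilpotent [n] this gives the
    strictness of the inclusion of these vectors. *)
Lemma isproj_xf Q k n n' : xf k n -> (k <= Q)%N -> isproj Q n n' ->
  (forall Q v, exists v', isproj Q v v') -> pw (xops N) (@h_nilpotent _ _ _ rho c N) k n'.
Proof.
move=> hn kQ hp ex; move: k n hn Q n' kQ hp.
apply: xf_ind => [n|k|k u v _ _ hu hv|k x v _ hv] Q n' kQ hp.
- by apply: pw_top; exists Q; exact: isproj_killed hp.
- by rewrite -(isproj_uniq (isproj0 Q) hp); exact: pw_0.
- have [u' pu] := ex Q u; have [v' pv] := ex Q v.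
  rewrite (isproj_uniq hp (isprojD pu pv)); apply: pw_add; [exact: hu pu|exact: hv pv].
- case: Q kQ hp => // Q kQ hp; have [v' pv] := ex Q v.
  rewrite (isproj_uniq hp (isproj_x x pv)) hx_coord scaler_suml.
  have snil : subgroup (@h_nilpotent _ _ _ rho c N).
    split; first exact: h_nilpotent0.
    move=> s t hs ht; rewrite -[- t]scaleN1r; apply: h_nilpotentD => //; exact: h_nilpotentZ.
  apply: sg_sum => [|i _]; first exact: pw_subgroup.
  rewrite hscalC -scalerA.
  apply: (pw_mul (x := GRing.scale (X (bform i)) : {additive N -> N})).
    by apply/In_map; exists i => //; apply/In_mem; rewrite mem_enum.
  apply: (pw_stable (f := GRing.scale (hsc (x (bvec i))) : {additive N -> N})).
  + by move=> w; exact: h_nilpotentZ.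
  + by move=> f /xops_In[x' ->] w /=; rewrite !scalerA hscalC.
  + exact: hv pv.
Qed.

Hypothesis compN : complete (xops N).

(* n' is the limit of g_l(eu) n with g_l = 1 modulo A_l and g_l = 0 modulo B_l. *)
Lemma isproj_ex Q n : exists n', isproj Q n n'.
Proof.
have /choice[g gP] l : exists g : {poly F}, (exists u, g = 1 - u * PX (AA Q l)) /\
    exists w, g = w * PX (BB Q l).
  have [u [w E]] := prod_coprime (@AB_coprime _ _ _ rho c Q l l).
  by exists (w * PX (BB Q l)); split; [exists u; apply: (canRL (addrK _)); rewrite addrC|exists w].
have AF l u v t : xf l (pe (PX (AA Q l) * (u * (PX (BB Q l) * t))) *: v).
  rewrite (_ : _ * _ = (u * t) * FF l); last by rewrite -(AB_prod rho c Q l); ring.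
  by rewrite pe_mul; apply: (xf_stable _ _).2; exact: xf_FF.
have BF l u v t : xf l (pe (PX (BB Q l) * (u * (PX (AA Q l) * t))) *: v).
  rewrite (_ : _ * _ = (u * t) * FF l); last by rewrite -(AB_prod rho c Q l); ring.
  by rewrite pe_mul; apply: (xf_stable _ _).2; exact: xf_FF.
have gA k l v : (k <= l)%N -> xf k (pe (PX (AA Q k)) *: (pe (g l) *: v)).
  move=> /(BB_prefix rho c Q)[t tE]; have [_ [w ->]] := gP l.
  by rewrite -pe_mul tE big_cat /=; exact: AF.
have gB k l v : (k <= l)%N -> xf k (pe (PX (BB Q k)) *: (v - pe (g l) *: v)).
  move=> /(AA_prefix rho c Q)[t tE]; have [[u ->] _] := gP l.
  rewrite pevB pev1 scalerBl scale1r opprB addrC subrK.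
  by rewrite -pe_mul tE big_cat /=; exact: BF.
have [l|n' hn'] := compN (s := fun l => pe (g l) *: n).
  apply: (@coprime_kill _ _ _ _ _ _ (filt (xops N) l) (AA Q l) (BB Q l)).
  - exact: xf_stable.
  - by move=> a; exact: AB_coprime.
  - by rewrite scalerBr; apply: filtB; exact: gA.
  - rewrite (_ : _ - _ = (n - pe (g l) *: n) - (n - pe (g l.+1) *: n)); last first.
      by rewrite opprB [RHS]addrC addrA subrK.
    by rewrite scalerBr; apply: filtB; exact: gB.
exists n' => l; split.
- rewrite -(subrK (pe (g l) *: n) n') scalerDr; apply: filtD; last exact: gA.
  exact: (xf_stable _ _).2.
- rewrite -(subrKA (pe (g l) *: n)) scalerDr; apply: filtD; first exact: gB.
  by rewrite -opprB scalerN; apply: filtN; exact: (xf_stable _ _).2.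
Qed.

Lemma nilp_dense k n : exists2 v, h_nilpotent v & xf k (n - v).
Proof.
have [v hv] := isproj_ex (k + gap) n; exists v; last exact: isproj_close hv.
by exists (k + gap)%N; exact: isproj_killed hv.
Qed.

Lemma nilp_strict k v : h_nilpotent v -> xf k v ->
  pw (xops N) (@h_nilpotent _ _ _ rho c N) k v.
Proof.
move=> [p hp] hv; apply: (@isproj_xf (maxn (p + gap) k) k v v) => //.
- exact: leq_maxr.
- by apply: isproj_nilp hp; exact: leq_maxl.
- exact: isproj_ex.
Qed.

Local Notation NF := (restr hsc N).

Hypothesis finN : exists es : seq NF,
  forall v : N, exists2 w : N, lspan es (w : NF) & xf 1 (v - w).

Lemma xf_fin k : exists es : seq NF,
  forall v : N, exists2 w : N, lspan es (w : NF) & xf k (v - w).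
Proof.
have [e1 he1] := finN.
have step j : exists es : seq NF, forall v : N, xf j v ->
    exists2 w : N, lspan es (w : NF) & xf j.+1 (v - w).
  elim: j => [|j [es hes]].
    by exists e1 => v _; exact: he1.
  pose es' : seq NF := [seq (X (bform i) *: (e : N) : NF) | i <- enum 'I_d, e <- es].
  exists es'.
  have main i (w : N) : lspan es (w : NF) -> lspan es' (X (bform i) *: w : NF).
    apply: (@lspan_sub _ NF (fun w : NF => lspan es' (X (bform i) *: (w : N) : NF))) => [|e ees].
      apply: scalops_submod => [|u v|r v]; rewrite ?scaler0 ?scalerDr.
      - exact: lspan0.
      - exact: lspanD.
      - move=> h; have := @lspanZ _ NF es' r _ h; congr (lspan _ _).
        by rewrite [LHS]scalerA [RHS]scalerA hscalC.
    by apply: mem_lspan; apply/allpairsP; exists (i, e); rewrite mem_enum.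
  move=> v; move jE : j.+1 => j' hv; elim: hv jE => {j' v} //.
  - by move=> k' _; exists 0; [exact: lspan0|rewrite subr0; exact: filt0].
  - move=> k' u v _ hu _ hv E; have [u' hu' uu] := hu E; have [v' hv' vv] := hv E.
    exists (u' + v'); first exact: (@lspanD _ NF).
    by rewrite opprD addrACA; exact: filtD.
  - move=> k' f v /In_map[i hi <-] hv _ [kE]; rewrite -{}kE in hv *.
    have [w hw vw] := hes v hv; exists (X (bform i) *: w); first exact: main.
    by rewrite -scalerBr; exact: xf_x.
elim: k => [|k [es hes]].
  by exists [::] => v; exists 0 => //; exact: filt_top.
have [es' hes'] := step k; exists (es ++ es') => v.
have [w hw vw] := hes v; have [w' hw' vw'] := hes' _ vw.
exists (w + w'); last by rewrite opprD addrA.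
apply: (@lspanD _ NF).
  by apply: lspan_incl hw => e; rewrite mem_cat => ->.
by apply: lspan_incl hw' => e; rewrite mem_cat orbC => ->.
Qed.

(** A vector of (x)^gap killed by all y lies in every (x)^k by [xf_soc], hence is 0; so the socle
    embeds into N / (x)^gap N, which is finite dimensional. *)
Lemma soc_fdim : fdim (fun v : NF => killed 1 (v : N)).
Proof.
have [es hes] := xf_fin gap.
apply: (@fdim_ker F NF NF idfun _ (fun v : NF => xf gap (v : N)) es).
- exact: killed_submod.
- by apply: scalops_submod => [|u v|r v]; [exact: filt0|exact: filtD|exact: xf_sc].
- by move=> v _; exact: hes.
exists [::] => v [soc_v hv] /=; apply: sepN => k.
suff h j : xf (gap + j) (v : N) by apply: filt_leq (h k); exact: leq_addl.
elim: j => [|j IH]; first by rewrite addn0.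
rewrite addnS; apply: xf_soc => //; first exact: leq_addr.
by move=> y; rewrite [_ *: _](soc_v y); exact: filt0.
Qed.

End CompleteModules.
End CategoryO.

(** * Comparison of filtrations *)

Section Comparison.
Variables (V : zmodType) (xs ys : seq {additive V -> V}).
Hypothesis ys_xs : forall k v, filt ys k v -> filt xs k v.
Hypothesis xs_ys : forall k, exists q, forall v, filt xs q v -> filt ys k v.

Lemma separated_compare : separated ys -> separated xs.
Proof. by move=> sep v hv; apply: sep => k; have [q hq] := xs_ys k; exact: hq. Qed.

Lemma complete_compare : complete ys -> complete xs.
Proof.
move=> comp s hs; have [h hh] := choice xs_ys.
have [|v hv] := @filt_sub_le _ ys s (fun k => maxn k (h k)) (fun k => leq_maxl _ _) _ comp.
  move=> k l kl; apply: hh; apply: (filt_leq (leq_maxr k (h k))).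
  exact: filt_chain.
exists v => k; rewrite -(subrKA (s (maxn k (h k)))); apply: filtD; first exact/ys_xs/hv.
by apply: filt_chain => //; exact: leq_maxl.
Qed.
End Comparison.

(** The condition on powers of [x] is required for every stable [A] so that it can be used with
    [A = (ys)^k V], to pass from k to k + 1. *)
Lemma compare_powers (V : zmodType) (xs ys : seq {additive V -> V}) :
  (forall x y, List.In x xs -> List.In y xs -> forall v, x (y v) = y (x v)) ->
  (forall x y, List.In x xs -> List.In y ys -> forall v, x (y v) = y (x v)) ->
  (forall x, List.In x xs -> exists l, forall A : V -> Prop, subgroup A ->
     (forall f : {additive V -> V}, (forall y, List.In y ys -> forall v, f (y v) = y (f v)) ->
        forall v, A v -> A (f v)) ->
     forall v, A v -> pw ys A 1 (iter l x v)) ->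
  forall k, exists q, forall v, filt xs q v -> filt ys k v.
Proof.
move=> xx xy xl; elim=> [|k [q hq]]; first by exists 0%N => v _; exact: filt_top.
have A1 v : pw ys (filt ys k) 1 v -> filt ys k.+1 v.
  move E : 1%N => j h; elim: h E => {j v} //.
  - by move=> j _; exact: filt0.
  - by move=> j u v _ hu _ hv E; apply: filtD; [exact: hu|exact: hv].
  - move=> j y v hy hv _ [E]; apply: pw_mul => //.
    rewrite -{}E in hv; move: hv; move E' : 0%N => i h; elim: h E' => {i v} //.
    + by move=> i _; exact: filt0.
    + by move=> i u v _ hu _ hv E; apply: filtD; [exact: hu|exact: hv].
have fst (f : {additive V -> V}) : (forall y, List.In y ys -> forall v, f (y v) = y (f v)) ->
    forall v, filt ys k v -> filt ys k (f v).
  by move=> hf; apply: pw_stable.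
have [||||||L hL] := @pw_nil V xs (filt ys k) (filt ys k.+1) => //.
- exact: filt_sg.
- exact: filt_sg.
- by move=> x hx; apply: pw_stable => // y hy v; exact: xy.
- move=> x hx; have [l hl] := xl x hx; exists l => v hv; apply: A1.
  by apply: hl => //; exact: filt_sg.
- by move=> x hx; apply: fst => y hy v; exact: xy.
by exists (L + q)%N => v hv; apply: hL; apply: pw_pw hv => w; exact: hq.
Qed.

(** * Functions near b in coordinates centred at b *)

Section ShiftedPolynomials.
Variables (F : numFieldType) (V : vectType F) (W' : finGroupType) (rho' : linrep V W').
Variables (c' : W' -> F) (b : V).
Local Notation H := (cherednik rho' c').
Local Notation hsc := (hscal rho' c').
Local Notation X := (hx rho' c').
Local Notation P := (polyfun V).
Implicit Types (x : 'Hom(V, F^o)).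

(** The action of the function x in coordinates centred at b, as it occurs in the formula for
    theta. *)
Definition shift_gen x : H := X x + hsc (x b).

Lemma shift_rel t u : poly_rel t u -> peval hsc shift_gen t = peval hsc shift_gen u.
Proof.
case=> [a x x'|x x'] /=; rewrite /shift_gen.
  rewrite hx_lin add_lfunE scale_lfunE rmorphD rmorphM mulrDr.
  by rewrite addrACA.
by rewrite !mulrDl !mulrDr hxx -!rmorphM [x b * x' b]mulrC -!addrA; congr (_ + _);
  rewrite addrCA (hscalC (x b : F) (X x')) -(hscalC (x' b : F) (X x)).
Qed.
Definition shift_cher : {rmorphism P -> H} := plift (@hscalC _ _ _ rho' c') shift_rel.

Lemma shift_scal a : shift_cher (pscal _ a) = hsc a. Proof. exact: plift_scal. Qed.
Lemma shift_x x : shift_cher (xpoly x) = X x + hsc (x b). Proof. exact: plift_gen. Qed.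

Lemma shift_commx p x : shift_cher p * X x = X x * shift_cher p.
Proof.
elim/palg_ind: p => [a|x'|p q hp hq|p q hp hq].
- by rewrite shift_scal hscalC.
- by rewrite -/(xpoly x') shift_x mulrDl mulrDr hxx hscalC.
- by rewrite rmorphD mulrDl mulrDr hp hq.
- by rewrite rmorphM -mulrA hq mulrA hp mulrA.
Qed.

Variable N : lmodType H.
Local Notation xf k v := (filt (xops N) k v).

Lemma xf_shiftp k p (v : N) : xf k v -> xf k (shift_cher p *: v).
Proof.
apply: (pw_stable (f := GRing.scale (shift_cher p) : {additive N -> N})) => //.
by move=> f /xops_In[x ->] w /=; rewrite !scalerA shift_commx.
Qed.

Lemma xf_shift_eval k p (v : N) : xf k v ->
  xf k.+1 (shift_cher p *: v - hsc (poly_eval b p) *: v).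
Proof.
elim/palg_ind: p v => [a|x|p q hp hq|p q hp hq] v hv.
- by rewrite shift_scal poly_eval_scal subrr; exact: filt0.
- by rewrite -/(xpoly x) shift_x poly_eval_x scalerDl addrK; exact: xf_x.
- by rewrite !rmorphD !scalerDl opprD addrACA; apply: filtD; [exact: hp|exact: hq].
- rewrite !rmorphM -!scalerA.
  rewrite -(subrKA (shift_cher p *: (hsc (poly_eval b q) *: v))) -scalerBr.
  apply: filtD; first by apply: xf_shiftp; exact: hq.
  by apply: hp; exact: xf_sc.
Qed.

Variables (W : finGroupType) (rho : linrep V W).
Local Notation Z := (polyinv rho).
Local Notation zval := (val : Z -> P).
Local Notation m := (@vanish_at _ _ _ rho b).
Definition shift_inv : {rmorphism Z -> H} := shift_cher \o zval.
Local Notation NZ := (restr shift_inv N).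
Definition sops : seq {additive N -> N} := mops (vgens rho b) NZ.

Lemma sops_In f : List.In f sops -> exists2 z : Z, m z & forall v : N, f v = shift_inv z *: v.
Proof. by move=> /(mops_In (@vgensP _ _ _ rho b))[z mz ->]; exists z. Qed.

Lemma sops_xops k v : filt sops k v -> xf k v.
Proof.
elim=> {k v}.
- by move=> v _; exact: filt_top.
- by move=> k; exact: filt0.
- by move=> k u v _ hu _ hv; exact: filtD.
- move=> k f v /sops_In[z mz ->] _ hv.
  by have := xf_shift_eval (val z) hv; rewrite [poly_eval b _]mz rmorph0 scale0r subr0.
Qed.

(** [f] inverts x^(b) + t for a nonzero t = x(b) - (w x)(b). It is an operator rather than a scalar
    because [N] is here a module over the uncompleted algebra. *)
Hypothesis unitN : forall x w, (x b : F) - dact rho w x b != 0 ->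
  exists2 f : {additive N -> N}, (forall x' v, f (X x' *: v) = X x' *: f v) &
    ((forall a v, f (hsc a *: v) = hsc a *: f v) /\
     forall v, f (X x *: v + hsc ((x b : F) - dact rho w x b) *: v) = v).

Definition xlinear (f : {additive N -> N}) :=
  (forall x' v, f (X x' *: v) = X x' *: f v) /\ (forall a v, f (hsc a *: v) = hsc a *: f v).

Lemma xlinear_shift f p v : xlinear f -> f (shift_cher p *: v) = shift_cher p *: f v.
Proof.
move=> [fx fs]; elim/palg_ind: p v => [a|x|p q hp hq|p q hp hq] v.
- by rewrite shift_scal.
- by rewrite -/(xpoly x) shift_x !scalerDl raddfD /= fx fs.
- by rewrite rmorphD !scalerDl raddfD /= hp hq.
- by rewrite rmorphM -!scalerA hp hq.
Qed.

(** Factors with (w x)(b) = x(b) act as x^(b) itself and are counted by [j]; the others are units,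
    whose inverses are collected in [f]. *)
Lemma prod_units x (ws : seq W) : exists f : {additive N -> N}, exists j,
  xlinear f /\ forall v : N, iter j (GRing.scale (X x)) v =
    f (shift_cher (\prod_(w <- ws) (xpoly x - pscal _ (dact rho w x b : F))) *: v).
Proof.
elim: ws => [|w ws [f [j [fl fE]]]].
  by exists idfun, 0%N; split=> // v; rewrite big_nil rmorph1 scale1r.
have E v : shift_cher (\prod_(w' <- w :: ws) (xpoly x - pscal _ (dact rho w' x b : F))) *: v =
    X x *: (shift_cher (\prod_(w <- ws) (xpoly x - pscal _ (dact rho w x b : F))) *: v) +
    hsc ((x b : F) - dact rho w x b) *:
      (shift_cher (\prod_(w <- ws) (xpoly x - pscal _ (dact rho w x b : F))) *: v).
  rewrite big_cons rmorphM -scalerA rmorphB shift_x shift_scal -scalerDl; congr (_ *: _).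
  by rewrite rmorphB addrA.
have [t0|t0] := eqVneq ((x b : F) - dact rho w x b) 0.
  exists f, j.+1; split=> // v; rewrite E t0 rmorph0 scale0r addr0 (fl.1 x) -fE.
  by rewrite iterS.
have [g gx [gs gE]] := unitN t0.
exists (f \o g), j; split; first split.
- by move=> x' v /=; rewrite gx fl.1.
- by move=> a v /=; rewrite gs fl.2.
- by move=> v; rewrite E /= gE fE.
Qed.

(* prod_w (x - (w x)(b)) lies in m C[V], and acts on N as a power of x^(b) times a
   unit, since its factors are the x^(b) + (x - w x)(b). *)
Lemma xops_sops k : exists q, forall v, xf q v -> filt sops k v.
Proof.
apply: compare_powers.
- by move=> f g /xops_In[x ->] /xops_In[x' ->] v /=; rewrite !scalerA hxx.
- by move=> f g /xops_In[x ->] /sops_In[z _ gE] v /=; rewrite !gE !scalerA shift_commx.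
- move=> f /In_map[i _ <-]; set x := bform i.
  have [g [j [gl gE]]] := prod_units x (index_enum W).
  exists j => A sA Ast v Av; rewrite gE.
  have [a [aW a0 aE]] := integral_polyinv rho (xpoly x).
  (* The left side is sum_j a_j(b) x^j, while sum_j a_j x^j = 0; the difference has coefficients
     a_j(b) - a_j, which vanish at b. *)
  have -> : \prod_(w : W) (xpoly x - pscal _ (dact rho w x b : F)) =
      \sum_(i < #|W|.+1) (pscal _ (poly_eval b (val (a i))) - val (a i)) * xpoly x ^+ i.
    transitivity (\sum_(j < #|W|.+1) pscal _ (poly_eval b (val (a j))) * xpoly x ^+ j).
      by rewrite aE; apply: eq_bigr => w _; rewrite poly_act_x poly_eval_x.
    rewrite [RHS](eq_bigr (fun l : 'I_#|W|.+1 =>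
      pscal _ (poly_eval b (val (a l))) * xpoly x ^+ l - val (a l) * xpoly x ^+ l)).
      by rewrite sumrB a0 subr0.
    by move=> l _; rewrite mulrBl.
  rewrite rmorph_sum scaler_suml raddf_sum; apply: sg_sum => [|l _].
    exact: pw_subgroup.
  have [y yE] : exists y : Z, val y = pscal _ (poly_eval b (val (a l))).
    by apply: inv_ex => w; exact: poly_act_scal.
  have myz : m (y - a l).
    by rewrite /vanish_at rmorphB yE [X in X - _]poly_eval_scal subrr.
  have -> : g (shift_cher ((pscal _ (poly_eval b (val (a l))) - val (a l)) * xpoly x ^+ l) *: v)
      = (y - a l) *: (g (shift_cher (xpoly x ^+ l) *: v) : NZ).
    by rewrite rmorphM -scalerA (xlinear_shift _ _ gl) -yE -rmorphB.
  apply: (@pw_m _ _ _ (@vgensP _ _ _ rho b) NZ) => //.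
    apply: scalops_submod; first exact: sA.1.
      by move=> u w; exact: sgD.
    move=> z w Aw; apply: (Ast (GRing.scale (shift_inv z) : {additive N -> N})) => //.
    by move=> h /sops_In[z' _ hE] u /=; rewrite !hE !scalerA -!rmorphM mulrC.
  apply: pw_top.
  apply: (Ast (g \o (GRing.scale (shift_cher (xpoly x ^+ l)) : {additive N -> N}))) => //.
  move=> h /sops_In[z' _ hE] u /=; rewrite !hE.
  by rewrite -(xlinear_shift _ _ gl) !scalerA -!rmorphM mulrC.
Qed.

End ShiftedPolynomials.

Lemma shift0 (F : numFieldType) (V : vectType F) (W' : finGroupType) (rho' : linrep V W')
  (c' : W' -> F) p : shift_cher rho' c' 0 p = poly_cher rho' c' p.
Proof.
elim/palg_ind: p => [a|x|p q hp hq|p q hp hq].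
- by rewrite shift_scal poly_cher_scal.
- by rewrite -/(xpoly x) shift_x poly_cher_x linear0 rmorph0 addr0.
- by rewrite !rmorphD hp hq.
- by rewrite !rmorphM hp hq.
Qed.

Lemma zops_sops (F : numFieldType) (V : vectType F) (W : finGroupType) (rho : linrep V W)
  (c : W -> F) (N : lmodType (cherednik rho c)) k v :
  filt (zops 0 N) k v <-> filt (sops 0 N rho) k v.
Proof.
split; apply: (@pw_hom _ _ _ _ idfun) => // f /In_map[z hz <-].
- exists (GRing.scale z : {additive restr (shift_inv rho c 0 rho) N -> restr (shift_inv rho c 0 rho) N}).
    by apply/In_map; exists z.
  by move=> u; rewrite /= [RHS](_ : _ = shift_cher rho c 0 (val z) *: (u : N)) // shift0.
- exists (GRing.scale z : {additive restr (inv_cher rho c) N -> restr (inv_cher rho c) N}).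
    by apply/In_map; exists z.
  by move=> u; rewrite /= [LHS](_ : _ = shift_cher rho c 0 (val z) *: (u : N)) // shift0.
Qed.

(** * Nilpotent vectors *)

Lemma inj_bij_surj (T S : Type) (f : T -> S) : injective f ->
  (forall y, exists x, f x = y) -> bijective f.
Proof.
move=> fi fs; have [g gK] := choice fs.
by exists g => // x; apply: fi; rewrite gK.
Qed.

Section CompletionAtZero.
Variables (F : numClosedFieldType) (V : vectType F) (W : finGroupType) (rho : linrep V W).
Variables (c : W -> F) (H0 : completed_cherednik rho c 0).
Local Notation H := (cherednik rho c).
Local Notation hsc := (hscal rho c).
Local Notation hat M := (restr (cc_alg H0) (completion_functor H0 M)).

Lemma zops_xops (N : lmodType H) k v : filt (zops 0 N) k v -> filt (xops N) k v.
Proof. by move=> /zops_sops; exact: sops_xops. Qed.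

Lemma xops_zops (N : lmodType H) k : exists q, forall v, filt (xops N) q v -> filt (zops 0 N) k v.
Proof.
have [x w|q hq] := @xops_sops _ _ _ _ c 0 N _ rho _ k.
  by move=> /eqP[]; rewrite (linear0 x) (linear0 (dact rho w x)); exact: subr0.
by exists q => v /hq/zops_sops.
Qed.

Variable M : lmodType H.
Hypothesis OM : category_O rho c M.

Lemma hat0_separated : separated (xops (hat M)).
Proof.
by apply: (separated_compare _ (hat_separated (Hb := H0) OM)) => k; exact: xops_zops.
Qed.

Lemma hat0_complete : complete (xops (hat M)).
Proof.
apply: (complete_compare _ _ (hat_complete (Hb := H0) OM)) => k.
  by move=> v; exact: zops_xops.
exact: xops_zops.
Qed.

Lemma hat0_dense (n : hat M) k : exists v : M, filt (xops (hat M)) k (n - hunit H0 M v).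
Proof. by have [v hv] := hat_dense (Hb := H0) OM n k; exists v; exact: zops_xops. Qed.

Lemma hat0_fin : exists es : seq (restr hsc (hat M)), forall v : hat M,
  exists2 w : hat M, lspan es (w : restr hsc (hat M)) & filt (xops (hat M)) 1 (v - w).
Proof.
have [es hes] := category_O_fin 0 OM.
pose u : {linear restr hsc M -> restr hsc (hat M)} := restr_map (hunit H0 M).
exists (map u es) => n; have [v hv] := hat0_dense n 1; have [w hw vw] := hes v.
exists (hunit H0 M w).
  apply: (@lspan_sub _ (restr hsc M) (fun w => lspan (map u es) (u w)) es) hw => [|e ees].
    apply: scalops_submod => [|x y|r x]; rewrite ?raddf0 ?raddfD ?linearZ.
    - exact: lspan0.
    - exact: lspanD.
    - exact: lspanZ.
  by apply: mem_lspan; exact: map_f.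
rewrite -(subrKA (hunit H0 M v)) -raddfB; apply: filtD => //.
by apply: zops_xops; apply: hat_filt_unit.
Qed.

End CompletionAtZero.

Section NilpotentVectors.
Variables (F : numClosedFieldType) (V : vectType F) (W : finGroupType) (rho : linrep V W).
Variable c : W -> F.
Local Notation H := (cherednik rho c).
Local Notation hsc := (hscal rho c).
Local Notation E := (nilp_functor rho c).

Definition nval (N : lmodType H) : {linear E N -> N} := (val : smtype (nilp_submod N) -> N).

Lemma nval_inj (N : lmodType H) : injective (nval N). Proof. exact: val_inj. Qed.

Lemma nval_ex (N : lmodType H) (v : N) : h_nilpotent v -> exists u, nval N u = v.
Proof.
by move=> hv; exists (exist (fun v => v \in sm_pred (nilp_submod N)) v (asboolT hv)).
Qed.

Lemma nval_map (M N : lmodType H) (f : {linear M -> N}) u : nval N (fmap E f u) = f (nval M u).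
Proof. by []. Qed.

Lemma killed_inj (M N : lmodType H) (f : {linear M -> N}) k v : injective f ->
  killed k v <-> killed k (f v).
Proof.
move=> fi; elim: k v => [|k IH] v /=.
  by split=> [->|h]; [exact: raddf0|apply: fi; rewrite h raddf0].
by split=> h y; have := h y; rewrite -linearZ; move/IH.
Qed.

Lemma nval_nilp (N : lmodType H) u : h_nilpotent (nval N u).
Proof. by have /asboolP := valP (u : smtype (nilp_submod N)). Qed.

Lemma E_nilp (N : lmodType H) (u : E N) : h_nilpotent u.
Proof. by have [k /(killed_inj _ _ (@nval_inj N)) hk] := nval_nilp u; exists k. Qed.

Lemma E_category_O (N : lmodType H) :
  fdim (fun v : restr hsc N => killed 1 (v : N)) -> category_O rho c (E N).
Proof.
move=> [e he]; apply: category_O_criterion => [|]; first exact: E_nilp.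
pose T : {linear restr hsc (E N) -> restr hsc N} := restr_map (nval N).
apply: (@fdim_ker F _ _ T _ (fun v => v = 0) e).
- exact: killed_submod.
- by apply: scalops_submod => [|u v -> ->|r v ->]; rewrite ?addr0 ?scaler0.
- move=> v hv; exists (T v); last by rewrite subrr.
  by apply: he; apply/(killed_inj _ _ (@nval_inj N)).
- exists [::] => v [_ Tv] /=; apply: (@nval_inj N); rewrite raddf0; exact: Tv.
Qed.

Lemma E_exact (M N K : lmodType H) (f : {linear M -> N}) (g : {linear N -> K}) :
  (forall w, h_nilpotent w -> exists2 v, h_nilpotent v & g v = w) ->
  short_exact f g -> short_exact (fmap E f) (fmap E g).
Proof.
move=> glift [fi fg gs]; split.
- move=> u v /(congr1 (nval N)); rewrite !nval_map => /fi; exact: nval_inj.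
- move=> v; split=> [/(congr1 (nval K))|[u <-]].
    rewrite nval_map raddf0 => /fg[w wv]; have [k hk] := nval_nilp v.
    have [u uw] : exists u, nval M u = w.
      by apply: nval_ex; exists k; apply/(killed_inj _ _ fi); rewrite wv.
    by exists u; apply: nval_inj; rewrite nval_map uw.
  by apply: nval_inj; rewrite !nval_map raddf0; apply/fg; exists (nval M u).
- move=> w; have [v /nval_ex[u uv] gv] := glift _ (nval_nilp w).
  by exists u; apply: nval_inj; rewrite nval_map uv.
Qed.

(** Take the projection of an arbitrary lift of [w]: linear maps carry projections to projections,
    and by uniqueness the image is [w], which is its own projection. *)
Lemma E_lift (N K : lmodType H) (g : {linear N -> K}) :
  separated (xops N) -> complete (xops N) -> separated (xops K) ->
  (forall w, exists v, g v = w) ->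
  forall w, h_nilpotent w -> exists2 v, h_nilpotent v & g v = w.
Proof.
move=> sN cN sK gs w [p hp]; have [v vw] := gs w.
have [v' hv'] := isproj_ex cN (p + gap rho c) v.
exists v'; first by exists (p + gap rho c)%N; exact: isproj_killed hv'.
apply: (isproj_uniq sK (n := w) (Q := p + gap rho c)); last exact: isproj_nilp hp.
move=> l; have [ha hb] := hv' l; rewrite -vw -raddfB -!linearZ.
by split; exact: filt_hom.
Qed.

Lemma E_pw (N : lmodType H) k v : pw (xops N) (@h_nilpotent _ _ _ rho c N) k v ->
  exists2 u, nval N u = v & filt (xops (E N)) k u.
Proof.
elim=> {k v}.
- by move=> v /nval_ex[u uv]; exists u => //; exact: filt_top.
- by move=> k; exists 0; [exact: raddf0|exact: filt0].
- move=> k u v _ [u' <- hu] _ [v' <- hv]; exists (u' + v'); first exact: raddfD.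
  exact: filtD.
- move=> k f v /In_map[i hi <-] _ [u <- hu]; exists (hx rho c (bform i) *: u).
    exact: linearZ.
  exact: xf_x.
Qed.

Lemma E_id (M : lmodType H) : fmap E (idfun : {linear M -> M}) =1 id.
Proof. by move=> u; exact: nval_inj. Qed.

Lemma E_comp (M N K : lmodType H) (f : {linear M -> N}) (g : {linear N -> K}) :
  fmap E (g \o f : {linear M -> K}) =1 fmap E g \o fmap E f.
Proof. by move=> u; exact: nval_inj. Qed.

End NilpotentVectors.

(** * A complete module as the completion of its nilpotent vectors *)

Section Counit.
Variables (F : numClosedFieldType) (V : vectType F) (W : finGroupType) (rho : linrep V W).
Variables (c : W -> F) (H0 : completed_cherednik rho c 0).
Local Notation hsc := (hscal rho c).
Local Notation rs N := (restr (cc_alg H0) N).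
Local Notation E := (E_functor H0).

Definition counit (N : lmodType H0) : {linear completion_functor H0 (E N) -> N} :=
  sval (cid (ext_lift (nval (rs N)))).
Lemma counitE (N : lmodType H0) h (l : E N) :
  counit N (h *: eunit (cc_alg H0) l) = h *: (nval (rs N) l : N).
Proof. exact: (svalP (cid (ext_lift (nval (rs N))))). Qed.

Lemma counit_natural (M N : lmodType H0) (f : {linear M -> N}) t :
  counit N (fmap (completion_functor H0) (fmap E f) t) = f (counit M t).
Proof.
elim/ext_ind: t => [|t t' ht ht'|h l]; first by rewrite !raddf0.
  by rewrite !raddfD /= ht ht'.
by rewrite ext_mapE !counitE linearZ.
Qed.

Variable N : lmodType H0.
Hypothesis sepN : separated (xops (rs N)).
Hypothesis compN : complete (xops (rs N)).
Hypothesis finN : exists es : seq (restr hsc (rs N)), forall v : rs N,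
  exists2 w : rs N, lspan es (w : restr hsc (rs N)) & filt (xops (rs N)) 1 (v - w).

Lemma E_O : category_O rho c (E N).
Proof. by apply: E_category_O; exact: soc_fdim. Qed.

(** By density and strictness of the h-nilpotent vectors, E(N) / (x)^k and N / (x)^k agree for all
    k, and both the completion of E(N) and N are separated and complete. *)
Lemma counit_bij : bijective (counit N).
Proof.
have OL := E_O; pose L := E N.
pose hatL := restr (cc_alg H0) (completion_functor H0 L).
pose psi : {linear hatL -> rs N} := restr_map (counit N).
have psiu l : psi (hunit H0 L l) = nval (rs N) l.
  have := counitE 1 (l : E N); rewrite !scale1r; exact.
have inj : injective psi.
  move=> x y /eqP; rewrite -subr_eq0 -raddfB => /eqP E0.
  apply/eqP; rewrite -subr_eq0; apply/eqP; apply: (hat0_separated OL) => k.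
  have [l hl] := hat0_dense OL (x - y) k.
  rewrite -(subrK (hunit H0 L l) (x - y)); apply: filtD => //.
  have : filt (xops (rs N)) k (nval (rs N) l).
    rewrite -psiu -[psi (hunit _ _ _)]opprK -[X in - X]add0r -E0 -raddfB.
    by apply: filtN; exact: filt_hom.
  move=> /(nilp_strict sepN compN (nval_nilp l))/E_pw[u /nval_inj -> hu].
  exact: filt_hom.
apply: (inj_bij_surj inj) => n.
have /choice2[l [hl _]] k : exists2 l : L, filt (xops (rs N)) k (n - nval (rs N) l) & True.
  by have [v /nval_ex[u <-] hv] := nilp_dense sepN compN k n; exists u.
have [k|t ht] := hat0_complete OL (s := fun k => hunit H0 L (l k)).
  rewrite -raddfB; apply: filt_hom.
  have : filt (xops (rs N)) k (nval (rs N) (l k.+1 - l k)).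
    rewrite raddfB (_ : _ - _ = (n - nval (rs N) (l k)) - (n - nval (rs N) (l k.+1))); last first.
      by rewrite opprB [RHS]addrC addrA subrK.
    by apply: filtB => //; exact: filt_leq (hl k.+1).
  by move=> /(nilp_strict sepN compN (nval_nilp _))/E_pw[u /nval_inj ->].
exists t; apply/eqP; rewrite -subr_eq0; apply/eqP; apply: sepN => k.
rewrite -(subrKA (nval (rs N) (l k))); apply: filtD.
  by rewrite -psiu -raddfB; exact: filt_hom (ht k).
by rewrite -opprB; apply: filtN.
Qed.

End Counit.

(** * Functions equivariant under a subgroup *)

Section InductionFunctor.
Variables (gT : finGroupType) (K : {group gT}) (A : pzRingType) (iota : subg_of K -> A).
Hypothesis iota1 : iota 1%g = 1.
Hypothesis iotaM : forall h k, iota (h * k)%g = iota h * iota k.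
Local Notation hf := (hfun iota).
Local Notation Z := (centr iota).
Local Notation I := (Ifunctor iota).

Lemma hfun_sumE (J : Type) (r : seq J) (P : pred J) (F : J -> hf) g :
  (\sum_(i <- r | P i) F i) g = \sum_(i <- r | P i) F i g.
Proof. by elim/big_rec2: _ => // i x y _ <-. Qed.

(** Taken over coset representatives [r], these functions form a basis of Fun_K(G, A) as a right
    A-module. *)
Definition hdelta_fun (r g : gT) : A :=
  if (g * r^-1)%g \in K then iota (subg K (g * r^-1)%g) else 0.

Lemma hdelta_subproof r (h : subg_of K) g :
  hdelta_fun r (sgval h * g)%g = iota h * hdelta_fun r g.
Proof.
have hP := subgP h.
rewrite /hdelta_fun -mulgA (groupMl _ hP); case: ifP => hK; last by rewrite mulr0.
by rewrite -iotaM; congr iota; apply: val_inj; rewrite /= !subgK // groupMl.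
Qed.
Definition hdelta r : hf := HFun (hdelta_subproof r).

Lemma hdelta1 r : hdelta r r = 1.
Proof.
rewrite /= /hdelta_fun mulgV group1 (_ : subg K 1%g = 1%g) //.
by apply: val_inj; rewrite /= subgK.
Qed.

Lemma hdelta_out r g : g \notin (K :* r)%g -> hdelta r g = 0.
Proof. by rewrite mem_rcoset /= /hdelta_fun => /negbTE ->. Qed.

Lemma hdeltaE (f : hf) r g : g \in (K :* r)%g -> hdelta r g * f r = f g.
Proof.
rewrite mem_rcoset /= /hdelta_fun => hK; rewrite hK -hfunP subgK //.
by rewrite mulgKV.
Qed.

Definition isrep r := fingroup.repr (K :* r)%g == r.

Lemma isrep_repr g : isrep (fingroup.repr (K :* g)%g).
Proof.
have /rcoset_eqP E := mem_repr_rcoset K g.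
by rewrite /isrep E.
Qed.

Lemma hfun_decomp (f : hf) : f = \sum_(r | isrep r) hfun_act (hdelta r) (f r).
Proof.
apply: hfun_ext => g; rewrite hfun_sumE (bigD1 (fingroup.repr (K :* g)%g)) ?isrep_repr //=.
rewrite -[hdelta_fun _ g]/(hdelta (fingroup.repr (K :* g)%g) g) hdeltaE; last first.
  have /rcoset_eqP E := mem_repr_rcoset K g.
  by rewrite E rcoset_refl.
rewrite big1 ?addr0 // => r /andP[rr rg]; rewrite -[hdelta_fun _ g]/(hdelta r g) hdelta_out ?mul0r //.
apply: contra rg => /rcoset_eqP E; rewrite -(eqP rr); apply/eqP; congr fingroup.repr.
by rewrite E.
Qed.

Section Object.
Variable N : lmodType A.
Local Notation tn := (@tens Z A hf (fun (u : Z) f => u f) (@hfun_act _ _ _ iota) N).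

Lemma ev_ex w : exists e : {additive I N -> N}, forall f n, e (tn f n) = f w *: n.
Proof.
apply: tens_universal => //.
- by move=> b p q; exact: centrD.
- by move=> b p a; exact: centrA.
- by move=> p q n; rewrite hfunDE scalerDl.
- by move=> p n m; rewrite scalerDr.
- by move=> p a n /=; rewrite scalerA.
Qed.
(** Evaluation at [w] under the identification of the tensor product with Fun_K(G, N); by
    [ev_decomp] an element is recovered from its values at coset representatives. *)
Definition ev w : {additive I N -> N} := sval (cid (ev_ex w)).
Lemma evE w f n : ev w (tn f n) = f w *: n. Proof. exact: (svalP (cid (ev_ex w))). Qed.

Definition dten r (n : N) : I N := tn (hdelta r) n.

Lemma dtenD r n m : dten r (n + m) = dten r n + dten r m. Proof. exact: tensDr. Qed.
Lemma dten_zmod r : zmod_morphism (dten r).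
Proof. by move=> n m; apply/(canRL (addrK _)); rewrite -dtenD subrK. Qed.
HB.instance Definition _ r := GRing.isZmodMorphism.Build N (I N) (dten r) (dten_zmod r).
Lemma dten0 r : dten r 0 = 0. Proof. exact: raddf0. Qed.

Lemma ev_decomp t : t = \sum_(r | isrep r) dten r (ev r t).
Proof.
elim/tens_ind: t => [|t t' ht ht'|f n].
- by rewrite big1 // => r _; rewrite raddf0 dten0.
- rewrite {1}ht {1}ht' -big_split; apply: eq_bigr => r _.
  by rewrite raddfD dtenD.
- rewrite {1}(hfun_decomp f).
  transitivity (\sum_(r | isrep r) tn (hfun_act (hdelta r) (f r)) n).
    by elim/big_rec2: _ => [|r x y _ <-]; [exact: tens0l|exact: tensDl].
  by apply: eq_bigr => r _; rewrite evE /dten tensA.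
Qed.

Lemma ev_inj t : (forall w, ev w t = 0) -> t = 0.
Proof. by move=> h; rewrite (ev_decomp t) big1 // => r _; rewrite h dten0. Qed.

Lemma ev_dten w r n : ev w (dten r n) = hdelta r w *: n. Proof. exact: evE. Qed.

Lemma ev_dten1 r n : ev r (dten r n) = n.
Proof. by rewrite ev_dten hdelta1 scale1r. Qed.

End Object.
Arguments ev {N} w.

Lemma I_mapE (M N : lmodType A) (f : {linear M -> N}) r m :
  fmap I f (dten r m) = dten r (f m).
Proof. exact: tensor_mapE. Qed.

Lemma ev_natural (M N : lmodType A) (f : {linear M -> N}) (w : gT) t : ev w (fmap I f t) = f (ev w t).
Proof.
elim/tens_ind: t => [|t t' ht ht'|g m].
- by rewrite !raddf0.
- by rewrite !raddfD /= ht ht'.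
- by rewrite [fmap I f _](tensor_mapE (fun (u : Z) f => u f) (@hfun_act _ _ _ iota) f) !evE linearZ.
Qed.

Lemma I_id (M : lmodType A) : fmap I (idfun : {linear M -> M}) =1 id.
Proof. by move=> t; rewrite [LHS](ev_decomp) [RHS](ev_decomp t); apply: eq_bigr => r _; rewrite ev_natural. Qed.

Lemma I_comp (M N L : lmodType A) (f : {linear M -> N}) (g : {linear N -> L}) :
  fmap I (g \o f : {linear M -> L}) =1 fmap I g \o fmap I f.
Proof.
by move=> t; rewrite [LHS]ev_decomp [RHS]ev_decomp; apply: eq_bigr => r _; rewrite !ev_natural.
Qed.

Lemma I_exact (M N L : lmodType A) (f : {linear M -> N}) (g : {linear N -> L}) :
  short_exact f g -> short_exact (fmap I f) (fmap I g).
Proof.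
move=> [fi fg gs]; split.
- move=> s t st; rewrite (ev_decomp s) (ev_decomp t); apply: eq_bigr => r _; congr dten.
  by apply: fi; rewrite -!ev_natural st.
- move=> t; split=> [t0|[s <-]]; last first.
    apply: ev_inj => w; rewrite !ev_natural; apply/fg; by exists (ev w s).
  have /choice[a aE] w : exists a, f a = ev w t.
    by apply/fg; rewrite -ev_natural t0 raddf0.
  exists (\sum_(r | isrep r) dten r (a r)); rewrite raddf_sum [RHS]ev_decomp.
  by apply: eq_bigr => r _; rewrite /= I_mapE aE.
- move=> t; have /choice[a aE] w : exists a, g a = ev w t by exact: gs.
  exists (\sum_(r | isrep r) dten r (a r)); rewrite raddf_sum [RHS]ev_decomp.
  by apply: eq_bigr => r _; rewrite /= I_mapE aE.
Qed.

Lemma I_reflects (M N L : lmodType A) (f : {linear M -> N}) (g : {linear N -> L}) :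
  short_exact (fmap I f) (fmap I g) -> short_exact f g.
Proof.
move=> [fi fg gs]; split.
- move=> a a' aa'; rewrite -(ev_dten1 1%g a) -(ev_dten1 1%g a'); congr (ev _ _).
  by apply: fi; rewrite !I_mapE aa'.
- move=> n; split=> [n0|[a <-]].
    have /fg[t tE] : fmap I g (dten 1%g n) = 0 by rewrite I_mapE n0 dten0.
    by exists (ev 1%g t); rewrite -ev_natural tE ev_dten1.
  have /fg : exists t, fmap I f t = fmap I f (dten 1%g a) by eexists.
  by rewrite !I_mapE => /(congr1 (ev 1%g)); rewrite ev_dten1 raddf0.
- by move=> n; have [t tE] := gs (dten 1%g n); exists (ev 1%g t); rewrite -ev_natural tE ev_dten1.
Qed.

End InductionFunctor.
Arguments ev {gT K A} iota {N} w.

Lemma iso_exact (A : pzRingType) (M N K M' N' K' : lmodType A)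
    (f : {linear M -> N}) (g : {linear N -> K}) (f' : {linear M' -> N'}) (g' : {linear N' -> K'})
    (a : {linear M -> M'}) (b : {linear N -> N'}) (d : {linear K -> K'}) :
  bijective a -> bijective b -> bijective d ->
  (forall v, b (f v) = f' (a v)) -> (forall v, d (g v) = g' (b v)) ->
  short_exact f' g' -> short_exact f g.
Proof.
move=> [a' aK a'K] [b' bK b'K] [d' dK d'K] bf dg [fi fg gs]; split.
- by move=> u v uv; apply/(can_inj aK)/fi; rewrite -!bf uv.
- move=> v; split=> [v0|[u <-]].
    have /fg[u uE] : g' (b v) = 0 by rewrite -dg v0 raddf0.
    by exists (a' u); apply: (can_inj bK); rewrite bf a'K.
  apply: (can_inj dK); rewrite dg bf raddf0; apply/fg; by exists (a u).
- by move=> w; have [v vE] := gs (d w); exists (b' v); apply: (can_inj dK); rewrite dg b'K.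
Qed.

Lemma repr_stab_one (gT : finGroupType) (K : {group gT}) : isrep K 1%g.
Proof. by rewrite /isrep mulg1 repr_group. Qed.

(* z^-1 = s (1 + a + a^2 + ...) *)
Lemma completion_inverse (Z : comPzRingType) (m : Z -> Prop) (a s : Z) :
  m a -> forall z, z * s = 1 - a -> exists zi, to_completion m z * zi = 1.
Proof.
move=> ma z zs.
have hd k : idealX m k (a ^+ k).
  by elim: k => [|k IH]; [exact: idealX_top|rewrite exprS; exact: idealX_mul].
exists (to_completion m s * cpi (cseries hd)).
rewrite mulrA -rmorphM zs -[LHS]/(cmul (cpi (cseq_cst m (1 - a))) (cpi (cseries hd))) cmulE.
apply/cpiP => k /=.
suff -> : (1 - a) * \sum_(j < k) a ^+ j - 1 = - a ^+ k by apply: idealX_opp.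
elim: k => [|k IH]; first by rewrite big_ord0 expr0 mulr0 sub0r.
rewrite big_ord_recr /= mulrDr addrAC IH exprS mulrBl mul1r; ring.
Qed.

(** * Invertible functions on the formal neighbourhood of 0 *)

Section UnitsOfCompletion.
Variables (F : numFieldType) (V : vectType F) (W : finGroupType) (rho : linrep V W).
Variables (c : W -> F) (H0 : completed_cherednik rho c 0).
Local Notation hsc := (hscal rho c).
Local Notation X := (hx rho c).
Local Notation rs N := (restr (cc_alg H0) N).
Local Notation sc := (pscal (@poly_rel F V)).

(** The norm prod_w w(x + t) is invariant with value t^|W| at 0, hence invertible in the completed
    invariants. The inverse of x + t is the product over w <> 1 times the inverse of the norm. *)
Lemma completed_unit (N : lmodType H0) (x : 'Hom(V, F^o)) (t : F) : t != 0 ->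
  exists2 f : {additive rs N -> rs N},
    (forall x' (v : rs N), f (X x' *: v) = X x' *: f v) &
    ((forall a (v : rs N), f (hsc a *: v) = hsc a *: f v) /\
     forall v : rs N, f (X x *: v + hsc t *: v) = v).
Proof.
move=> t0; pose P w := poly_act rho w (xpoly x + sc t).
have [z zE] : exists z : polyinv rho, val z = \prod_w P w.
  apply: inv_ex => w; rewrite rmorph_prod [RHS](reindex_inj (mulgI w)) /=.
  by apply: eq_bigr => w' _; rewrite /P poly_actM.
pose q := \prod_(w | w != 1%g) P w.
have zq : val z = q * (xpoly x + sc t).
  by rewrite zE (bigD1 1%g) //= mulrC; congr (_ * _); exact: poly_act1.
have [s sE] : exists s : polyinv rho, val s = sc (t ^- #|W|).
  by apply: inv_ex => w; rewrite poly_act_scal.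
have ev0 : poly_eval 0 (val z) = t ^+ #|W|.
  rewrite zE rmorph_prod /= (eq_bigr (fun=> t)) ?prodr_const ?cardT //= => w _.
  rewrite /P rmorphD /= poly_act_scal poly_act_x rmorphD /= poly_eval_scal poly_eval_x.
  by rewrite linear0 add0r.
have ma : vanish_at 0 (1 - z * s).
  rewrite /vanish_at !rmorphB !rmorphM !rmorph1 /= ev0 sE poly_eval_scal.
  by rewrite divff ?subrr // expf_neq0.
have [zi ziE] : exists zi, to_hat rho 0 z * zi = 1.
  have zs : z * s = 1 - (1 - z * s) by rewrite opprB addrC subrK.
  exact: (completion_inverse ma zs).
have l1 : cc_alg H0 (inv_cher rho c z) * cc_fun H0 zi = 1 by rewrite -cc_compat -rmorphM ziE rmorph1.
have l2 : cc_fun H0 zi * cc_alg H0 (inv_cher rho c z) = 1.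
  by rewrite -cc_compat -rmorphM mulrC ziE rmorph1.
have comm p : cc_alg H0 (poly_cher rho c p) * cc_fun H0 zi = cc_fun H0 zi * cc_alg H0 (poly_cher rho c p).
  rewrite -[LHS]mul1r -l2 -!mulrA; congr (_ * _); rewrite mulrA -rmorphM /= -[poly_cher rho c (val z) * _]rmorphM.
  by rewrite [val z * p]mulrC !rmorphM -mulrA l1 mulr1.
pose u : H0 := cc_alg H0 (poly_cher rho c q) * cc_fun H0 zi.
exists (GRing.scale u : {additive N -> N}).
- move=> x' v; transitivity ((u * cc_alg H0 (X x')) *: (v : N)); first by rewrite -scalerA.
  transitivity ((cc_alg H0 (X x') * u) *: (v : N)); last by rewrite -scalerA.
  congr (@GRing.scale H0 N _ _); rewrite /u -poly_cher_x -mulrA -comm !mulrA -!rmorphM; congr (cc_alg H0 (poly_cher _ _ _) * _).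
  exact: mulrC.
- split=> [a v|v].
    transitivity ((u * cc_alg H0 (hsc a)) *: (v : N)); first by rewrite -scalerA.
    transitivity ((cc_alg H0 (hsc a) * u) *: (v : N)); last by rewrite -scalerA.
    congr (@GRing.scale H0 N _ _); rewrite /u -poly_cher_scal -mulrA -comm !mulrA -!rmorphM; congr (cc_alg H0 (poly_cher _ _ _) * _).
    exact: mulrC.
  rewrite -scalerDl -poly_cher_scal -poly_cher_x -rmorphD.
  transitivity ((u * cc_alg H0 (poly_cher rho c (xpoly x + sc t))) *: (v : N)); first by rewrite -scalerA.
  rewrite /u comm -mulrA -!rmorphM -zq.
  by rewrite [X in X *: _]l2 scale1r.
Qed.
End UnitsOfCompletion.

(** * Modules transported along theta *)

Lemma lspan_map (R : pzRingType) (M N : lmodType R) (f : M -> N) s v : f 0 = 0 ->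
  (forall u v, f (u + v) = f u + f v) -> (forall a v, f (a *: v) = a *: f v) ->
  lspan s v -> lspan (map f s) (f v).
Proof.
move=> f0 fD fZ; elim: s v => [|e s IH] v /=; first by move=> ->.
by case=> a [u /IH hu ->]; exists a; exists (f u); rewrite // fD fZ.
Qed.

Lemma finite_quotient_map (R : pzRingType) (M N : lmodType R) (f : M -> N) (P : M -> Prop)
    (Q : N -> Prop) : f 0 = 0 ->
  (forall u v, f (u + v) = f u + f v) -> (forall u v, f (u - v) = f u - f v) ->
  (forall a v, f (a *: v) = a *: f v) ->
  (forall v, exists u, f u = v) -> (forall u, P u -> Q (f u)) ->
  (exists es : seq M, forall v, exists2 w, lspan es w & P (v - w)) ->
  exists es : seq N, forall v, exists2 w, lspan es w & Q (v - w).
Proof.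
move=> f0 fD fB fZ fs PQ [es esP]; exists (map f es) => v.
have [u <-] := fs v; have [w hw uw] := esP u.
by exists (f w); [exact: lspan_map|rewrite -fB; exact: PQ].
Qed.

Section Theta.
Variables (F : numClosedFieldType) (V : vectType F) (W : finGroupType) (rho : linrep V W).
Variables (c : W -> F) (b : V).
Variables (Hb : completed_cherednik rho c b)
  (H0 : completed_cherednik (par_rep rho b) (par_c rho c b) 0) (th : theta_iso Hb H0).
Local Notation rho' := (par_rep rho b).
Local Notation c' := (par_c rho c b).
Local Notation K := (stab rho b).
Local Notation H := (cherednik rho c).
Local Notation I := (Ifunctor (par_iota H0)).
Local Notation rs N := (restr (cc_alg H0) N).
Local Notation hsc := (hscal rho c).
Local Notation hsc' := (hscal rho' c').
Local Notation shift := (shift_cher rho' c' b).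

Lemma par_iota1 : par_iota H0 1%g = 1.
Proof. by rewrite /par_iota hw1 rmorph1. Qed.

Lemma par_iotaM h k : par_iota H0 (h * k)%g = par_iota H0 h * par_iota H0 k.
Proof. by rewrite /par_iota hwM rmorphM. Qed.

Lemma theta_scal (a : F) (f : hfun (par_iota H0)) (w : W) :
  th (cc_alg Hb (hsc a)) f w = cc_alg H0 (hsc' a) * f w.
Proof. by have [h _ _ _] := thetaE th; exact: h. Qed.

Lemma theta_x x (f : hfun (par_iota H0)) (w : W) :
  th (cc_alg Hb (hx rho c x)) f w = cc_alg H0 (shift_gen rho' c' b (dact rho w x)) * f w.
Proof. by have [_ _ h _] := thetaE th; exact: h. Qed.

Lemma theta_poly p (f : hfun (par_iota H0)) (w : W) :
  th (cc_alg Hb (poly_cher rho c p)) f w = cc_alg H0 (shift (poly_act rho w p)) * f w.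
Proof.
elim/palg_ind: p f => [a|x|p q hp hq|p q hp hq] f.
- by rewrite [poly_cher _ _ _]poly_cher_scal theta_scal [poly_act _ _ _]poly_act_scal shift_scal.
- by rewrite [poly_cher _ _ _]poly_cher_x theta_x [poly_act _ _ _]poly_act_x shift_x.
- by rewrite !rmorphD mulrDl -hp -hq.
- by rewrite !rmorphM -mulrA -hq -hp.
Qed.

Section IObject.
Variable N : lmodType H0.
Definition IH : lmodType H := restr (cc_alg Hb) (restr th (I N)).
Local Notation evw w t := (ev (par_iota H0) w (t : I N)).

Lemma ev_act (u : Hb) w (a : H0) (t : I N) :
  (forall f, th u f w = a * f w) -> evw w (th u *: t) = a *: evw w t.
Proof.
move=> h; elim/tens_ind: t => [|t t' ht ht'|f n].
- have e0 := raddf0 (ev (par_iota H0) w : {additive I N -> N}).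
  exact: etrans (congr1 _ (scaler0 (I N) (th u))) (etrans e0 (esym (etrans (congr1 _ e0) (scaler0 _ a)))).
- have eD := raddfD (ev (par_iota H0) w : {additive I N -> N}).
  apply: etrans (congr1 _ (scalerDr (th u) (t : I N) t')) _; apply: etrans (eD _ _) _.
  by apply: etrans (congr2 +%R ht ht') _; rewrite -scalerDr; congr (_ *: _); apply/esym/eD.
- have -> : th u *: tens (fun (u : centr (par_iota H0)) f => u f) (@hfun_act _ _ _ (par_iota H0)) f n
    = tens _ (@hfun_act _ _ _ (par_iota H0)) (th u f) n := tensZ _ _ _ _ _.
  by rewrite !evE h scalerA.
Qed.

Lemma ev_poly p w (t : IH) :
  evw w (poly_cher rho c p *: t) = shift (poly_act rho w p) *: (evw w t : rs N).
Proof. by apply: ev_act => f; exact: theta_poly. Qed.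

(** Theta makes [p] act on the value at [w] through w p; an invariant acts by the same element at
    every [w], so the filtration by m passes between functions and values. *)
Lemma ev_inv z w (t : IH) :
  evw w (inv_cher rho c z *: t) = shift_inv rho' c' b rho z *: (evw w t : rs N).
Proof. by rewrite [LHS]ev_poly /= invP. Qed.

Lemma ev_scal a w (t : IH) : evw w (hsc a *: t) = hsc' a *: (evw w t : rs N).
Proof. by apply: ev_act => f; exact: theta_scal. Qed.

Lemma dten_inv z r (n : rs N) : isrep K r ->
  inv_cher rho c z *: (dten par_iotaM r n : IH) = dten par_iotaM r (shift_inv rho' c' b rho z *: n).
Proof.
move=> hr; apply/eqP; rewrite -subr_eq0; apply/eqP.
apply: etrans (ev_decomp par_iotaM _) _; rewrite big1 // => r' hr'.
suff -> : evw r' (inv_cher rho c z *: (dten par_iotaM r n : IH) - (dten par_iotaM r (shift_inv rho' c' b rho z *: n) : IH)) = 0 by exact: dten0.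
apply: etrans (raddfB (ev (par_iota H0) r' : {additive I N -> N}) _ _) _; rewrite [X in X - _]ev_inv; have [->|rr'] := eqVneq r' r.
  by rewrite !(ev_dten1 par_iota1 par_iotaM) subrr.
have out m : evw r' (dten par_iotaM r m) = 0.
  rewrite ev_dten hdelta_out ?scale0r //; apply: contra rr' => /rcoset_eqP E.
  by rewrite -(eqP hr) -(eqP hr') E.
by rewrite !out scaler0 subr0.
Qed.

Lemma filt_ev w k (t : IH) : filt (zops b IH) k t ->
  filt (sops b (rs N) rho) k (evw w t : rs N).
Proof.
apply: (@pw_hom _ _ _ _ (ev (par_iota H0) w : {additive I N -> N})) => // x.
case/In_map=> z hz <-.
exists (GRing.scale z : {additive restr (shift_inv rho' c' b rho) (rs N) -> restr (shift_inv rho' c' b rho) (rs N)}).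
  by apply/In_map; exists z.
by move=> t'; exact: ev_inv.
Qed.

Lemma filt_dten r k (n : rs N) : isrep K r -> filt (sops b (rs N) rho) k n ->
  filt (zops b IH) k (dten par_iotaM r n : IH).
Proof.
move=> hr; apply: (@pw_hom _ _ _ _ (dten par_iotaM r : {additive N -> I N})) => // x.
case/In_map=> z hz <-.
exists (GRing.scale z : {additive restr (inv_cher rho c) IH -> restr (inv_cher rho c) IH}).
  by apply/In_map; exists z.
by move=> n'; apply/esym; exact: dten_inv.
Qed.

End IObject.
Lemma ev1_dten N (n : rs N) : ev (par_iota H0) 1%g (dten par_iotaM 1%g (n : N)) = n.
Proof. exact: (ev_dten1 par_iota1). Qed.

Section Transport.
Variables (L : lmodType H) (N : lmodType H0) (e : {additive L -> rs N}) (d : {additive rs N -> L}).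
Hypothesis ed : forall n, e (d n) = n.
Hypothesis eZ : forall a t, e (hsc a *: t) = hsc' a *: e t.
Hypothesis e_filt : forall k t, filt (zops b L) k t -> filt (sops b (rs N) rho) k (e t).
Hypothesis d_filt : forall k n, filt (sops b (rs N) rho) k n -> filt (zops b L) k (d n).

Lemma unit_shift (x : 'Hom(V, F^o)) w : (x b : F) - dact rho w x b != 0 ->
  exists2 f : {additive rs N -> rs N},
    (forall x' v, f (hx rho' c' x' *: v) = hx rho' c' x' *: f v) &
    ((forall a v, f (hsc' a *: v) = hsc' a *: f v) /\
     forall v, f (hx rho' c' x *: v + hsc' ((x b : F) - dact rho w x b) *: v) = v).
Proof. by move=> t0; exact: completed_unit. Qed.

Hypothesis sepL : separated (zops b L).
Hypothesis compL : complete (zops b L).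
Hypothesis finL : exists es : seq (restr hsc L), forall v : L,
  exists2 w : L, lspan es (w : restr hsc L) & filt (zops b L) 1 (v - w).

(** As a retract of [L], the module [N] is separated for the powers of m, and by [xops_sops] some
    power of (x) lies in each of these. *)
Lemma transport_separated : separated (xops (rs N)).
Proof.
apply: (@separated_compare _ (xops (rs N)) (sops b (rs N) rho)) (xops_sops unit_shift) _ => v hv.
rewrite -[v]ed (_ : d v = 0) ?raddf0 //; apply: sepL => k; exact: d_filt.
Qed.

Lemma transport_complete : complete (xops (rs N)).
Proof.
apply: (@complete_compare _ (xops (rs N)) (sops b (rs N) rho)).
- by move=> k v; exact: sops_xops.
- exact: (xops_sops unit_shift).
move=> s hs; have [|t ht] := compL (s := fun k => d (s k)).
  by move=> k; rewrite -raddfB; exact: d_filt.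
by exists (e t) => k; have := e_filt (ht k); rewrite raddfB ed.
Qed.

Lemma transport_fin : exists es : seq (restr hsc' (rs N)), forall v : rs N,
  exists2 w : rs N, lspan es (w : restr hsc' (rs N)) & filt (xops (rs N)) 1 (v - w).
Proof.
have e0 : e 0 = 0 by exact: raddf0.
have eD u v : e (u + v) = e u + e v by exact: raddfD.
have eB u v : e (u - v) = e u - e v by exact: raddfB.
have es v : exists u, e u = v by exists (d v); exact: ed.
have ef (u : restr hsc L) : filt (zops b L) 1 (u : L) -> filt (xops (rs N)) 1 (e u : rs N).
  by move=> hu; apply: sops_xops; exact: e_filt hu.
exact: (@finite_quotient_map F (restr hsc L) (restr hsc' (rs N)) e _ _ e0 eD eB eZ es ef finL).
Qed.
End Transport.

Section TransportIH.
Variable N : lmodType H0.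
Hypothesis sepL : separated (zops b (IH N)).
Hypothesis compL : complete (zops b (IH N)).
Hypothesis finL : exists es : seq (restr hsc (IH N)), forall v : IH N,
  exists2 w : IH N, lspan es (w : restr hsc (IH N)) & filt (zops b (IH N)) 1 (v - w).

Lemma IH_transport : [/\ separated (xops (rs N)), complete (xops (rs N)) &
  exists es : seq (restr hsc' (rs N)), forall v : rs N,
    exists2 w : rs N, lspan es (w : restr hsc' (rs N)) & filt (xops (rs N)) 1 (v - w)].
Proof.
pose e : {additive IH N -> rs N} := ev (par_iota H0) 1%g : {additive I N -> N}.
pose d : {additive rs N -> IH N} := dten par_iotaM 1%g : {additive N -> I N}.
have ed n : e (d n) = n by exact: ev1_dten.
have eZ a t : e (hsc a *: t) = hsc' a *: e t by exact: ev_scal.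
have ef k t : filt (zops b (IH N)) k t -> filt (sops b (rs N) rho) k (e t) by exact: filt_ev.
have df k n : filt (sops b (rs N) rho) k n -> filt (zops b (IH N)) k (d n).
  by move=> hn; apply: filt_dten; [exact: repr_stab_one|exact: hn].
split.
- exact: (transport_separated ed df sepL).
- exact: (transport_complete ed ef df compL).
- exact: (transport_fin ed eZ ef finL).
Qed.
End TransportIH.

End Theta.

Lemma linear_inverse (A : pzRingType) (M N : lmodType A) (f : {linear M -> N}) : bijective f ->
  exists2 g : {linear N -> M}, cancel f g & cancel g f.
Proof.
move=> [g fK gK]; have gl : linear g := can2_linear fK gK.
pose gL := GRing.isLinear.Build A N M *:%R g gl.
by exists (HB.pack_for {linear N -> M} g gL).
Qed.

Section HatAtB.
Variables (F : numClosedFieldType) (V : vectType F) (W : finGroupType) (rho : linrep V W).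
Variables (c : W -> F) (b : V) (Hb : completed_cherednik rho c b).
Local Notation H := (cherednik rho c).
Local Notation hsc := (hscal rho c).
Local Notation hat M := (restr (cc_alg Hb) (completion_functor Hb M)).

Lemma hat_fin (M : lmodType H) : category_O rho c M ->
  exists es : seq (restr hsc (hat M)), forall v : hat M,
    exists2 w : hat M, lspan es (w : restr hsc (hat M)) & filt (zops b (hat M)) 1 (v - w).
Proof.
move=> OM; have [es hes] := category_O_fin b OM.
pose u : {linear restr hsc M -> restr hsc (hat M)} := restr_map (hunit Hb M).
exists (map u es) => n; have [v hv] := hat_dense OM n 1; have [w hw vw] := hes v.
exists (hunit Hb M w).
  apply: (@lspan_map F (restr hsc M) (restr hsc (hat M)) u es w) hw.
  - exact: raddf0.
  - exact: raddfD.
  - by move=> a v'; rewrite linearZ.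
rewrite -(subrKA (hunit Hb M v)) -raddfB; apply: filtD => //.
exact: hat_filt_unit.
Qed.

Lemma separated_iso (M N : lmodType H) (f : {linear M -> N}) : bijective f ->
  separated (zops b N) -> separated (zops b M).
Proof.
move=> [g fK _] sepN v hv; apply: (can_inj fK); rewrite raddf0.
by apply: sepN => k; exact: zops_filt (hv k).
Qed.

Lemma complete_iso (M N : lmodType H) (f : {linear M -> N}) : bijective f ->
  complete (zops b N) -> complete (zops b M).
Proof.
move=> /linear_inverse[g fK gK] compN s hs; have [|v hv] := compN (fun k => f (s k)).
  by move=> k; rewrite -raddfB; exact: zops_filt.
exists (g v) => k; have := zops_filt g (hv k).
by have -> : g (v - f (s k)) = g v - s k by rewrite raddfB; congr (_ - _); exact: fK.
Qed.

Lemma fin_iso (M N : lmodType H) (f : {linear M -> N}) : bijective f ->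
  (exists es : seq (restr hsc N), forall v : N,
    exists2 w : N, lspan es (w : restr hsc N) & filt (zops b N) 1 (v - w)) ->
  exists es : seq (restr hsc M), forall v : M,
    exists2 w : M, lspan es (w : restr hsc M) & filt (zops b M) 1 (v - w).
Proof.
move=> /linear_inverse[g fK gK] finN.
apply: (@finite_quotient_map F (restr hsc N) (restr hsc M) (restr_map g)
  (filt (zops b N) 1) (filt (zops b M) 1)) finN.
- exact: raddf0.
- exact: raddfD.
- exact: raddfB.
- by move=> a v; rewrite linearZ.
- by move=> v; exists (f v); exact: fK.
- by move=> u; exact: zops_filt.
Qed.
End HatAtB.

(** * The quasi-inverse of I *)

Section Restriction.
Variables (F : numClosedFieldType) (V : vectType F) (W : finGroupType) (rho : linrep V W).
Variables (c : W -> F) (b : V).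
Variables (Hb : completed_cherednik rho c b)
  (H0 : completed_cherednik (par_rep rho b) (par_c rho c b) 0) (th : theta_iso Hb H0).
Local Notation rho' := (par_rep rho b).
Local Notation c' := (par_c rho c b).
Local Notation H := (cherednik rho c).
Local Notation I := (Ifunctor (par_iota H0)).
Local Notation rs N := (restr (cc_alg H0) N).
Local Notation hsc' := (hscal rho' c').
Variable Iinv : prefunctor (par_centr H0) H0.
Hypothesis Iinv_spec :
  quasi_inverse (fun=> True) (fun=> True) (Ifunctor (par_iota H0)) Iinv.

Lemma Iinv_counit_ex : exists eta : forall X : lmodType (par_centr H0), {linear I (Iinv X) -> X},
  (forall X, bijective (eta X)) /\
  forall (X Y : lmodType (par_centr H0)) (f : {linear X -> Y}) t,
    eta Y (fmap I (fmap Iinv f) t) = f (eta X t).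
Proof.
destruct Iinv_spec as [_ _ _ [eta [etab etan]]].
exists eta; split; first by move=> X; exact: (etab X Logic.I).
by move=> X Y f t; exact: (etan X Y f Logic.I Logic.I t).
Qed.

Definition Iinv_counit := sval (cid Iinv_counit_ex).
Lemma Iinv_counit_bij X : bijective (Iinv_counit X).
Proof. exact (proj1 (svalP (cid Iinv_counit_ex)) X). Qed.
Lemma Iinv_counit_natural (X Y : lmodType (par_centr H0)) (f : {linear X -> Y}) t :
  Iinv_counit Y (fmap I (fmap Iinv f) t) = f (Iinv_counit X t).
Proof. exact (proj2 (svalP (cid Iinv_counit_ex)) X Y f t). Qed.

(** I reflects exactness, and I composed with its quasi-inverse is isomorphic to the identity. *)
Lemma Iinv_exact (X Y Z : lmodType (par_centr H0)) (f : {linear X -> Y}) (g : {linear Y -> Z}) :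
  short_exact f g -> short_exact (fmap Iinv f) (fmap Iinv g).
Proof.
move=> fg; apply: (I_reflects (@par_iota1 _ _ _ _ _ _ H0) (@par_iotaM _ _ _ _ _ _ H0)).
apply: (iso_exact (Iinv_counit_bij X) (Iinv_counit_bij Y) (Iinv_counit_bij Z) _ _ fg);
  exact: Iinv_counit_natural.
Qed.

Section Object.
Variable N : lmodType Hb.
Local Notation N0 := (Iinv (restr (theta_inv th) N)).

(* Pulling N back along theta^-1 and then along theta gives N again, by thetaK. *)
Definition Iinv_iso_fun (t : restr th (I N0)) : N := Iinv_counit (restr (theta_inv th) N) t.
Lemma Iinv_iso_linear : linear Iinv_iso_fun.
Proof.
move=> h t t'; apply: etrans (linearP (Iinv_counit (restr (theta_inv th) N)) (th h) _ _) _.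
by rewrite restrZ thetaK.
Qed.
HB.instance Definition _ := GRing.isLinear.Build Hb (restr th (I N0)) N *:%R
  Iinv_iso_fun Iinv_iso_linear.
Definition Iinv_iso : {linear restr th (I N0) -> N} := Iinv_iso_fun.

Lemma Iinv_iso_bij : bijective Iinv_iso.
Proof. exact: (Iinv_counit_bij (restr (theta_inv th) N)). Qed.
End Object.

Lemma Iinv_transport (M : lmodType H) : category_O rho c M ->
  let N := Iinv (restr (theta_inv th) (completion_functor Hb M)) in
  [/\ separated (xops (rs N)), complete (xops (rs N)) &
  exists es : seq (restr hsc' (rs N)), forall v : rs N,
    exists2 w : rs N, lspan es (w : restr hsc' (rs N)) & filt (xops (rs N)) 1 (v - w)].
Proof.
move=> OM N.
pose f : {linear IH th N -> restr (cc_alg Hb) (completion_functor Hb M)} :=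
  restr_map (Iinv_iso (completion_functor Hb M)).
have fb : bijective f := Iinv_iso_bij _.
apply: (@IH_transport _ _ _ _ _ _ _ _ th).
- exact: separated_iso fb (hat_separated (Hb := Hb) OM).
- exact: complete_iso fb (hat_complete (Hb := Hb) OM).
- exact: fin_iso fb (hat_fin Hb OM).
Qed.

End Restriction.

(** * Vectors killed by the fixed space *)

Definition hsubmod (A : pzRingType) (M : lmodType A) (C : M -> Prop) :=
  [/\ C 0, forall u v, C u -> C v -> C (u - v) & forall (a : A) v, C v -> C (a *: v)].

Lemma hsubmodD (A : pzRingType) (M : lmodType A) (C : M -> Prop) u v :
  hsubmod C -> C u -> C v -> C (u + v).
Proof.
case=> C0 CB _ hu hv; rewrite -[v]opprK; apply: (CB) => //.
by rewrite -sub0r; exact: CB.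
Qed.

Lemma hsubmod_ker (A : pzRingType) (M N : lmodType A) (f : {linear M -> N}) :
  hsubmod (fun v => f v = 0).
Proof.
split=> [|u v fu fv|a v fv]; first exact: raddf0.
  by have -> : f (u - v) = f u - f v by [exact: raddfB]; rewrite fu fv subrr.
by have -> : f (a *: v) = a *: f v by [exact: linearZ]; rewrite fv scaler0.
Qed.

Lemma hsubmod_im (A : pzRingType) (M N : lmodType A) (f : {linear M -> N}) :
  hsubmod (fun v => exists u, f u = v).
Proof.
split=> [|_ _ [u <-] [v <-]|a _ [v <-]]; first by exists 0; exact: raddf0.
  by exists (u - v); exact: raddfB.
by exists (a *: v); exact: linearZ.
Qed.

Section WeylStep.
Variables (A : pzRingType) (M : lmodType A) (x y : A).
Hypothesis yx : y * x = x * y + 1.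
Implicit Type v : M.

Lemma weyl_y_xk k v : y *: v = 0 -> y *: (x ^+ k.+1 *: v) = k.+1%:R *: (x ^+ k *: v).
Proof.
move=> yv; elim: k => [|k IH].
  by rewrite expr1 expr0 !scale1r scalerA yx scalerDl -scalerA yv scaler0 add0r scale1r.
rewrite exprS -scalerA scalerA yx scalerDl -scalerA IH scale1r.
rewrite [x *: _]scalerA [x * _]commr_nat -scalerA [x *: _]scalerA -exprS.
by rewrite -[X in _ + X]scale1r -scalerDl natr1.
Qed.

Lemma weyl_yk_xk n v : y *: v = 0 -> y ^+ n *: (x ^+ n *: v) = (n`!)%:R *: v.
Proof.
move=> yv; elim: n => [|n IH]; first by rewrite !expr0 fact0 !scale1r.
rewrite exprSr -scalerA weyl_y_xk // [_ *: (_ *: _)]scalerA commr_nat -scalerA IH.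
by rewrite scalerA -natrM factS.
Qed.

End WeylStep.

Section FixedVectors.
Variables (F : numFieldType) (V : vectType F) (W : finGroupType) (rho : linrep V W).
Variables (c : W -> F).
Local Notation H := (cherednik rho c).
Local Notation hsc := (hscal rho c).
Local Notation X := (hx rho c).
Local Notation Y := (hy rho c).
Implicit Types (x : 'Hom(V, F^o)) (y : V).

Lemma hyx_fixed y x : fixed_by_W rho y -> Y y * X x = X x * Y y + hsc (x y).
Proof.
move=> fy; rewrite hyx big1 ?subr0 // => s _.
by rewrite alpha_fixed // mulr0 mul0r rmorph0 mul0r.
Qed.

Section Object.
Variable M : lmodType H.
Hypothesis nilM : forall v : M, h_nilpotent v.
Implicit Types (u v : M) (C Q : M -> Prop).

Lemma killed_power k y v : killed k v -> Y y ^+ k *: v = 0.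
Proof.
elim: k v => [v /= ->|k IH v hk]; first exact: scaler0.
by rewrite exprSr -scalerA; apply: IH; exact: hk.
Qed.

(* u - x^n y^n u / n! is killed by one power of y less than u. *)
Lemma weyl_lift C Q y x u : fixed_by_W rho y -> (x y : F) = 1 -> hsubmod C ->
  (forall u v, Q u -> Q v -> Q (u - v)) -> (forall v, Q v -> Q (X x *: v)) ->
  (forall v, Q v -> Q (Y y *: v)) -> (forall a v, Q v -> Q (hsc a *: v)) ->
  C (Y y *: u) -> Q u -> exists u', [/\ Y y *: u' = 0, C (u - u') & Q u'].
Proof.
move=> fy xy1 hC QB Qx Qy Qs; have [C0 CB CZ] := hC.
have yx : Y y * X x = X x * Y y + 1 by rewrite hyx_fixed // xy1 rmorph1.
have [k hk] := nilM u; have {hk} := killed_power y hk.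
elim: k u => [|k IH] u.
  by rewrite expr0 scale1r => -> Cu Qu; exists 0; rewrite scaler0 subrr.
case: k IH => [|k] IH; first by rewrite expr1 => yu Cu Qu; exists u; rewrite subrr.
move=> yu Cu Qu; pose n := k.+1.
pose r := hsc (n`!%:R^-1); pose d := r *: (X x ^+ n *: (Y y ^+ n *: u)).
have Cd : C d.
  by do 2!apply: (CZ); rewrite /n exprSr -scalerA; apply: (CZ).
have Qxn m v : Q v -> Q (X x ^+ m *: v).
  by elim: m => [|m IHm] Qv; rewrite ?expr0 ?scale1r // exprS -scalerA; apply: (Qx); exact: IHm.
have Qyn m v : Q v -> Q (Y y ^+ m *: v).
  by elim: m => [|m IHm] Qv; rewrite ?expr0 ?scale1r // exprS -scalerA; apply: (Qy); exact: IHm.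
have Qd : Q d by apply: (Qs); apply: (Qxn); exact: Qyn.
have [|||u' [yu' Cu' Qu']] := IH (u - d).
- have dE : Y y ^+ n *: d = r *: (Y y ^+ n *: (X x ^+ n *: (Y y ^+ n *: u))).
    by rewrite /d [LHS]scalerA -hscalC -scalerA.
  rewrite scalerBr -/n dE weyl_yk_xk //; last by rewrite scalerA -exprS.
  rewrite -[n`!%:R](rmorph_nat hsc) scalerA -rmorphM mulVf ?rmorph1 ?scale1r ?subrr //.
  by rewrite pnatr_eq0 -lt0n fact_gt0.
- by rewrite scalerBr; apply: (CB) => //; exact: CZ.
- exact: QB.
- exists u'; split=> //; rewrite -(subrK d u) -addrA [d - u']addrC addrA.
  exact: hsubmodD.
Qed.

Local Notation U := (limg (avg rho)).
Definition fvec (i : 'I_(\dim U)) : V := (vbasis U)`_i.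
Definition fform (i : 'I_(\dim U)) : 'Hom(V, F^o) :=
  (linfun (coord (vbasis U) i : V -> F^o) \o avg rho)%VF.

Lemma fvec_mem i : fvec i \in U. Proof. by apply: vbasis_mem; rewrite mem_nth // size_tuple. Qed.

Lemma limg_avg_fixed y : y \in U -> fixed_by_W rho y.
Proof. by case/memv_imgP=> v _ -> w; exact: rep_avg. Qed.

Lemma fform_fvec i j : (fform i (fvec j) : F) = (i == j)%:R.
Proof.
rewrite comp_lfunE avg_fixed; last exact: limg_avg_fixed (fvec_mem j).
rewrite lfunE /= coord_free ?(basis_free (vbasisP _)) //.
by rewrite eq_sym.
Qed.

Lemma fvec_coord y : fixed_by_W rho y -> y = \sum_i (fform i y : F) *: fvec i.
Proof.
move=> fy; have yU : y \in U by rewrite -(avg_fixed fy) memv_img ?memvf.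
rewrite {1}(coord_vbasis yU); apply: eq_bigr => i _; congr (_ *: _).
by rewrite comp_lfunE avg_fixed // lfunE.
Qed.

(** [u] is corrected for one basis vector of h^W at a time. The property [Q] passed to [weyl_lift]
    keeps the vanishing already obtained; multiplication by [fform i] respects it since this form
    vanishes on the other basis vectors. *)
Lemma fixed_lift C u : hsubmod C -> (forall y, fixed_by_W rho y -> C (Y y *: u)) ->
  exists2 u', (forall y, fixed_by_W rho y -> Y y *: u' = 0) & C (u - u').
Proof.
move=> hC hu; have [C0 CB CZ] := hC.
have main m : (m <= \dim U)%N ->
    exists2 u', (forall j : 'I_(\dim U), (j < m)%N -> Y (fvec j) *: u' = 0) & C (u - u').
  elim: m => [|m IH] lem.
    by exists u => //; rewrite subrr.
  have [u1 hu1 Cu1] := IH (ltnW lem); pose i : 'I_(\dim U) := Ordinal lem.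
  have fi : fixed_by_W rho (fvec i) := limg_avg_fixed (fvec_mem i).
  have [||||||||u2 [yu2 Cu2 Qu2]] := @weyl_lift C
    (fun v => forall j : 'I_(\dim U), (j < m)%N -> Y (fvec j) *: v = 0) (fvec i) (fform i) u1 fi.
  - by rewrite fform_fvec eqxx.
  - exact: hC.
  - by move=> v v' hv hv' j jm; rewrite scalerBr hv // hv' // subrr.
  - move=> v hv j jm; rewrite scalerA hyx_fixed; last exact: limg_avg_fixed (fvec_mem j).
    rewrite scalerDl -scalerA hv // scaler0 add0r fform_fvec.
    by rewrite -val_eqE /= gtn_eqF // rmorph0 scale0r.
  - by move=> v hv j jm; rewrite scalerA hyy -scalerA hv // scaler0.
  - by move=> a v hv j jm; rewrite scalerA -hscalC -scalerA hv // scaler0.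
  - have -> : u1 = u - (u - u1) by rewrite opprB addrC subrK.
    by rewrite scalerBr; apply: (CB); [exact: hu|exact: CZ].
  - exact: hu1.
  exists u2; last by rewrite -(subrKA u1); exact: hsubmodD.
  move=> j; rewrite ltnS leq_eqVlt => /orP[/eqP jm|]; last exact: Qu2.
  by have -> : j = i by apply: val_inj.
have [u' hu' Cu] := main _ (leqnn _).
exists u' => // y /fvec_coord ->; rewrite hy_sum scaler_suml big1 // => i _.
by rewrite hyZ -scalerA hu' // scaler0.
Qed.

(** Apply letters y as long as the result stays outside [C]; nilpotency ends this. *)
Lemma socle_mod C v : hsubmod C -> ~ C v ->
  exists h : H, ~ C (h *: v) /\ forall y, C (Y y *: (h *: v)).
Proof.
move=> [C0 CB CZ]; have [k] := nilM v; elim: k v => [v -> //|k IH v hk nC].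
have [hC|/existsNP[y nCy]] := pselect (forall y, C (Y y *: v)).
  by exists 1; rewrite scale1r.
have [h [hh hhy]] := IH _ (hk y) nCy; exists (h * Y y); rewrite -scalerA; split=> //.
Qed.

(** A vector of [D] outside [C] is moved by the algebra to one killed by all y modulo [C], and then
    corrected within [C] to be killed by h^W. *)
Lemma fixed_detect C D : hsubmod C -> hsubmod D -> (forall v, C v -> D v) ->
  (forall v, D v -> (forall y, fixed_by_W rho y -> Y y *: v = 0) -> C v) ->
  forall v, D v -> C v.
Proof.
move=> hC hD CD hdet v Dv; apply: contrapT => /(socle_mod hC)[h [nC hy]].
have [D0 DB DZ] := hD; have [w fw Cw] := fixed_lift hC (fun y _ => hy y).
apply: nC; have -> : h *: v = w + (h *: v - w) by rewrite addrC subrK.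
apply: hsubmodD => //; apply: (hdet) => //.
have -> : w = h *: v - (h *: v - w) by rewrite opprB addrC subrK.
by apply: (DB); [exact: DZ|exact: CD].
Qed.
End Object.

Local Notation O := (category_O rho c).
Local Notation OU := (category_O (repU rho) c).
Local Notation zeta := (zeta_functor rho c).

Definition zval (M : lmodType H) (u : zeta M) : M := val u.
Lemma zval_inj (M : lmodType H) : injective (@zval M). Proof. exact: val_inj. Qed.
Lemma zval_killed (M : lmodType H) (u : zeta M) y : fixed_by_W rho y -> Y y *: zval u = 0.
Proof. by move=> fy; have /sm_predP h := valP u; exact: h. Qed.
Lemma zval_ex (M : lmodType H) (v : M) : (forall y, fixed_by_W rho y -> Y y *: v = 0) ->
  exists u : zeta M, zval u = v.
Proof.
move=> hv; have hm : (v : restr (zeta_hom rho c) M) \in sm_pred (zeta_submod M) by apply/sm_predP.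
by exists (exist (fun v => v \in sm_pred (zeta_submod M)) v hm : smtype (zeta_submod M)).
Qed.
Lemma zval_map (M N : lmodType H) (f : {linear M -> N}) u : zval (fmap zeta f u) = f (zval u).
Proof. by []. Qed.
Lemma zval0 (M : lmodType H) : @zval M 0 = 0. Proof. by []. Qed.

(** Only surjectivity needs an argument: a preimage of a vector killed by h^W is killed by h^W
    modulo [ker g], so [fixed_lift] corrects it. *)
Lemma zeta_exact (M N K : lmodType H) (f : {linear M -> N}) (g : {linear N -> K}) :
  (forall v : N, h_nilpotent v) -> short_exact f g -> short_exact (fmap zeta f) (fmap zeta g).
Proof.
move=> nilN [fi fg gs]; split.
- by move=> u v uv; apply: zval_inj; apply: fi; rewrite -!zval_map uv.
- move=> v; split=> [v0|[u <-]].
    have /fg[u uE] : g (zval v) = 0 by rewrite -zval_map v0.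
    have [y fy|u' u'E] := @zval_ex _ u.
      apply: fi; have -> : f (Y y *: u) = Y y *: f u by exact: linearZ.
      by rewrite uE zval_killed // raddf0.
    by exists u'; apply: zval_inj; rewrite zval_map u'E.
  by apply: zval_inj; rewrite !zval_map zval0; apply/fg; exists (zval u).
- move=> w; have [v vE] := gs (zval w).
  have [y fy|v' hv' Cv'] := fixed_lift nilN (u := v) (hsubmod_ker g).
    have -> : g (Y y *: v) = Y y *: g v by exact: linearZ.
    by rewrite vE zval_killed.
  have [u uE] := zval_ex hv'; exists u; apply: zval_inj; rewrite zval_map uE -vE.
  by apply/esym/eqP; rewrite -subr_eq0; apply/eqP; rewrite -Cv'; exact: esym (raddfB g _ _).
Qed.

Lemma zeta_reflects (M N K : lmodType H) (f : {linear M -> N}) (g : {linear N -> K}) :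
  (forall v : M, h_nilpotent v) -> (forall v : N, h_nilpotent v) ->
  (forall v : K, h_nilpotent v) ->
  short_exact (fmap zeta f) (fmap zeta g) -> short_exact f g.
Proof.
move=> nilM nilN nilK [fi fg gs].
have gf u : g (f u) = 0.
  have hT : hsubmod (fun _ : M => True) by [].
  apply: (fixed_detect nilM (hsubmod_ker (g \o f : {linear M -> K})) hT) => // v _ hv /=.
  have [v' <-] := zval_ex hv; rewrite -!zval_map.
  by have -> : fmap zeta g (fmap zeta f v') = 0 by [apply/fg; exists v'].
split.
- move=> u u' uu'; apply/eqP; rewrite -subr_eq0; apply/eqP.
  have h0 : hsubmod (fun v : M => v = 0).
    by split=> [//|v v' -> ->|a v ->]; rewrite ?subrr ?scaler0.
  apply: (fixed_detect nilM h0 (hsubmod_ker f)) => [v ->|v fv hv|]; first exact: raddf0.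
    have [v' v'E] := zval_ex hv; rewrite -v'E (_ : v' = 0) //; apply: fi; apply: zval_inj.
    by rewrite zval_map v'E fv; exact: esym (raddf0 f).
  by apply: etrans (raddfB f u u') _; apply/eqP; rewrite subr_eq0; apply/eqP.
- move=> v; split=> [v0|[u <-]]; last exact: gf.
  apply: (fixed_detect nilN (hsubmod_im f) (hsubmod_ker g)) v0 => [_ [u <-]|{}v v0 hv].
    exact: gf.
  have [v' v'E] := zval_ex hv; have /fg[u uE] : fmap zeta g v' = 0.
    by apply: zval_inj; rewrite zval_map v'E.
  by exists (zval u); rewrite -v'E -uE.
- move=> w; have hT : hsubmod (fun _ : K => True) by [].
  apply: (fixed_detect nilK (hsubmod_im g) hT) => // v _ hv.
  have [v' v'E] := zval_ex hv; have [u uE] := gs v'.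
  by exists (zval u); rewrite -v'E -uE.
Qed.

Variable zinv : prefunctor (cherednik (repU rho) c) H.
Hypothesis zinv_spec : quasi_inverse O OU zeta zinv.

Lemma zinv_exact (M N K : lmodType (cherednik (repU rho) c)) (f : {linear M -> N})
    (g : {linear N -> K}) : OU M -> OU N -> OU K ->
  short_exact f g -> short_exact (fmap zinv f) (fmap zinv g).
Proof.
move=> OM ON OK fg; have [_ [zO _ _] _ [eta [etab etan]]] := zinv_spec.
have nil L : OU L -> forall v : zinv L, h_nilpotent v by move=> /zO[].
apply: zeta_reflects; try exact: nil.
apply: (iso_exact (etab M OM) (etab N ON) (etab K OK) _ _ fg).
- exact: (etan M N f OM ON).
- exact: (etan N K g ON OK).
Qed.

End FixedVectors.

(** * Continuous duals and lifting of nilpotent vectors *)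

Section ExtendFunctional.
Variables (F : fieldType) (V V' : lmodType F).

(** The hypothesis says that [psi] is well defined on T D modulo K, i.e. that (0, 1) is not in the
    space spanned by its graph and K x 0. A functional separating (0, 1) from this space is, up to
    sign, the extension. *)
Lemma extend_functional (T : {linear V -> V'}) (psi : {linear V -> F^o}) (D : V -> Prop)
    (K : V' -> Prop) : submod (@scalops F V) D -> submod (@scalops F V') K ->
  (forall t, D t -> K (T t) -> psi t = 0) ->
  exists phi : {linear V' -> F^o}, (forall v, K v -> phi v = 0) /\
    forall t, D t -> phi (T t) = psi t.
Proof.
move=> sD sK h.
pose G (p : V' * F^o) := exists2 t, D t & exists2 v, K v & p = (T t + v, psi t).
have sG : submod (@scalops F (V' * F^o)%type) G.
  apply: scalops_submod.
  - exists 0; first by case: sD => -[].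
    exists 0; first by case: sK => -[].
    by congr pair; rewrite !raddf0 // addr0.
  - move=> _ _ [t Dt [v Kv ->]] [t' Dt' [v' Kv' ->]].
    exists (t + t'); first exact: sgD (proj1 sD) Dt Dt'.
    exists (v + v'); first exact: sgD (proj1 sK) Kv Kv'.
    by congr pair; rewrite raddfD // addrACA.
  - move=> a _ [t Dt [v Kv ->]].
    exists (a *: t); first exact: submodZ.
    exists (a *: v); first exact: submodZ.
    by congr pair; rewrite linearZ // scalerDr.
have nG : ~ G (0, 1).
  case=> t Dt [v Kv [Tv psi1]].
  have KT : K (T t) by rewrite -[T t](addrK v) -Tv sub0r; exact: sgN (proj1 sK) Kv.
  by have /eqP := h t Dt KT; rewrite -psi1 oner_eq0.
have [phi [phiG phi1]] := separation sG nG.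
have phiE v a : phi (v, a) = phi (v, 0) + a.
  have -> : (v, a) = a *: ((0, 1) : V' * F^o) + (v, 0).
    by congr pair; rewrite /= ?scaler0 ?add0r // addr0 /GRing.scale /= mulr1.
  apply: etrans (linearP phi a _ _) _; rewrite phi1 addrC; congr (_ + _).
  exact: mulr1.
have philin : linear (fun v => - phi (v, 0) : F^o).
  move=> a u v; have -> : (a *: u + v, 0) = a *: ((u, 0) : V' * F^o) + (v, 0).
    by congr pair; rewrite /= scaler0 addr0.
  by apply: etrans (congr1 -%R (linearP phi a _ _)) _; rewrite opprD scalerN.
pose L := GRing.isLinear.Build F V' F^o *:%R (fun v => - phi (v, 0) : F^o) philin.
exists (HB.pack_for {linear V' -> F^o} (fun v => - phi (v, 0) : F^o) L); split=> [v Kv|t Dt] /=.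
  have : phi (v, 0) = 0.
    apply: phiG; exists 0; first by case: sD => -[].
    by exists v => //; rewrite !raddf0 add0r.
  by move=> ->; rewrite oppr0.
have : phi (T t, psi t) = 0.
  apply: phiG; exists t => //; exists 0; first by case: sK => -[].
  by rewrite addr0.
by rewrite phiE => /eqP; rewrite addr_eq0 => /eqP ->; rewrite opprK.
Qed.
End ExtendFunctional.

Section Represent.
Variables (F : fieldType) (L : lmodType F).
Local Notation V := (L -> F^o).
(** Linearity is a predicate on the space of all functions, so that transposed operators and the
    chains of subspaces they preserve live on one ambient type. *)
Definition lin (psi : V) := forall a u v, psi (a *: u + v) = a *: psi u + psi v.

Lemma linZ psi a u : lin psi -> psi 0 = 0 -> psi (a *: u) = a *: psi u.
Proof. by move=> h h0; rewrite -[a *: u]addr0 h h0 addr0. Qed.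
Lemma linD psi u v : lin psi -> psi (u + v) = psi u + psi v.
Proof. by move=> h; rewrite -[u]scale1r h !scale1r. Qed.
Lemma lin0 psi : lin psi -> psi 0 = 0.
Proof. by move=> h; apply: (addIr (psi 0)); rewrite -linD // !add0r. Qed.
Lemma linB psi u v : lin psi -> psi (u - v) = psi u - psi v.
Proof. by move=> h; apply/(canRL (addrK _)); rewrite -linD // subrK. Qed.

Lemma lin_submod : submod (@scalops F V) lin.
Proof.
apply: scalops_submod => [a u v|f g hf hg a u v|b f hf a u v].
- by rewrite scaler0 addr0.
- by rewrite /GRing.add /= hf hg scalerDr addrACA.
- change (b * f (a *: u + v) = a * (b * f u) + b * f v :> F).
  by rewrite hf /GRing.scale /=; ring.
Qed.

Lemma lin_linear psi : lin psi -> exists f : {linear L -> F^o}, f =1 psi.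
Proof.
move=> h; pose m := GRing.isLinear.Build F L F^o *:%R psi h.
by exists (HB.pack_for {linear L -> F^o} psi m).
Qed.

(** Induction on [es]. If some [psi0] in [P] is nonzero at [e], subtracting a multiple of it from
    [psi] reduces to functionals vanishing at [e], and the value at [psi0] determines the multiple
    of [e] to add. *)
Lemma represent (Lam : {linear V -> F^o}) (P : V -> Prop) (es : seq L) :
  submod (@scalops F V) P -> (forall psi, P psi -> lin psi) ->
  (forall psi, P psi -> (forall e, e \in es -> psi e = 0) -> Lam psi = 0) ->
  exists t, forall psi, P psi -> Lam psi = psi t.
Proof.
elim: es P => [|e es IH] P sP Pl h.
  by exists 0 => psi Ppsi; rewrite h ?lin0 //; exact: Pl.
have P0 : P 0 by case: sP => -[].
pose P' psi := P psi /\ psi e = 0.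
have sP' : submod (@scalops F V) P'.
  apply: scalops_submod => [|f g [Pf fe] [Pg ge]|a f [Pf fe]]; split=> //.
  - exact: sgD (proj1 sP) Pf Pg.
  - by rewrite /GRing.add /= fe ge addr0.
  - exact: submodZ.
  - by change (a * f e = 0 :> F); rewrite fe mulr0.
have [||t ht] := IH P' sP'.
- by move=> psi [/Pl].
- move=> psi [Ppsi psie] he; apply: h => // e'; rewrite inE => /orP[/eqP -> //|]; exact: he.
have [[psi0 [Ppsi0 psi0e]]|all0] := pselect (exists psi0, P psi0 /\ psi0 e != 0); last first.
  exists t => psi Ppsi; apply: ht; split=> //; apply/eqP/negPn/negP => ne.
  by apply: all0; exists psi.
exists (t + ((Lam psi0 - psi0 t) / psi0 e : F) *: e) => psi Ppsi.
have lpsi := Pl _ Ppsi.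
have /ht : P' (psi - (psi e / psi0 e : F) *: psi0).
  split; first by case: (sP) => -[_ sB] _; apply: sB => //; exact: submodZ.
  change (psi e - psi e / psi0 e * psi0 e = 0 :> F).
  by rewrite divfK // subrr.
have -> : Lam (psi - (psi e / psi0 e : F) *: psi0) = Lam psi - (psi e / psi0 e) * Lam psi0.
  apply: etrans (raddfB Lam _ _) _; congr (_ - _); exact: (linearZ_LR Lam).
move=> /eqP; rewrite subr_eq => /eqP ->; rewrite linD // linZ ?lin0 //.
change (psi t - psi e / psi0 e * psi0 t + psi e / psi0 e * Lam psi0 =
  psi t + (Lam psi0 - psi0 t) / psi0 e * psi e :> F).
by field.
Qed.
End Represent.

(** * Noetherianity of the continuous dual over C[y] *)

Section ContinuousDual.
Variables (F : fieldType) (L : lmodType F) (d : nat) (y : 'I_d -> {linear L -> L}).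
Variables (G : nat -> L -> Prop) (K0 : nat).
Local Notation V := (L -> F^o).
Hypothesis yC : forall i j t, y i (y j t) = y j (y i t).
Hypothesis sG : forall k, submod (@scalops F L) (G k).
Hypothesis GS : forall k t, G k.+1 t -> G k t.
Hypothesis Gy : forall k i t, G k.+1 t -> G k (y i t).
Hypothesis Gsoc : forall k t, (K0 <= k)%N -> G k t -> (forall i, G k (y i t)) -> G k.+1 t.
Hypothesis Gfin : forall k, exists es : seq L, forall v, exists2 w, lspan es w & G k (v - w).

Definition yop_fun i (psi : V) : V := fun t => psi (y i t).
Lemma yop_zmod i : zmod_morphism (yop_fun i). Proof. by []. Qed.
HB.instance Definition _ i := GRing.isZmodMorphism.Build V V (yop_fun i) (yop_zmod i).
Definition yop i : {additive V -> V} := yop_fun i.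
Definition yopl : seq {additive V -> V} := [seq yop i | i <- enum 'I_d].

Lemma yopl_In f : List.In f yopl -> exists i, f = yop i.
Proof. by move=> /In_map[i _ <-]; exists i. Qed.
Lemma In_yopl i : List.In (yop i) yopl.
Proof. by apply/In_map; exists i => //; apply/In_mem; rewrite mem_enum. Qed.

Definition dual_at k (psi : V) := lin psi /\ forall t, G k t -> psi t = 0.
Definition dual (psi : V) := exists k, dual_at k psi.

Lemma G_leq k l t : (k <= l)%N -> G l t -> G k t.
Proof. by move=> /subnK <-; elim: (l - k)%N => // n IH; rewrite addSn => /GS. Qed.

Lemma dual_at_leq k l psi : (k <= l)%N -> dual_at k psi -> dual_at l psi.
Proof. by move=> kl [lp h]; split=> // t /(G_leq kl); exact: h. Qed.

Lemma dual_at_submod k : submod (@scalops F V) (dual_at k).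
Proof.
have [[l0 lB] lZ] := @lin_submod F L; split; first split.
- by split.
- move=> u v [lu hu] [lv hv]; split; first exact: lB.
  by move=> t Gt; change (u t - v t = 0 :> F); rewrite hu // hv // subrr.
- move=> f hf v [lv hv]; split; first exact: lZ hf _ lv.
  case: hf => a fa t Gt; rewrite fa; change (a * v t = 0 :> F); by rewrite hv // mulr0.
Qed.

Lemma dual_y k i psi : dual_at k psi -> dual_at k.+1 (yop i psi).
Proof.
move=> [lp h]; split; first by move=> a u v; rewrite /= /yop_fun linearP lp.
by move=> t Gt; apply: h; exact: Gy.
Qed.

Local Notation ops := (adj_ops (@scalops F V) yopl).

Lemma ops_stable (C : V -> Prop) : submod (@scalops F V) C ->
  (forall i psi, C psi -> C (yop i psi)) -> submod ops C.
Proof.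
move=> [sgC hC] hy; split=> // f [|]; first exact: hC.
move=> /List.Exists_exists[g [/yopl_In[i ->] fg]] v Cv; rewrite fg; exact: hy.
Qed.

Lemma ops_y (C : V -> Prop) i psi : submod ops C -> C psi -> C (yop i psi).
Proof.
move=> [_ h] Cp; apply: h Cp; right; apply/List.Exists_exists; exists (yop i).
by split=> //; exact: In_yopl.
Qed.

Lemma ops_scal (C : V -> Prop) : submod ops C -> submod (@scalops F V) C.
Proof. by move=> [sgC h]; split=> // f hf; apply: h; left. Qed.

Lemma dual_submod : submod ops dual.
Proof.
apply: ops_stable; last by move=> i psi [k hk]; exists k.+1; exact: dual_y.
split; first split.
- by exists 0%N; case: (dual_at_submod 0) => -[].
- move=> u v [k hk] [l hl]; exists (maxn k l).
  case: (dual_at_submod (maxn k l)) => -[_ h] _; apply: h.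
    exact: dual_at_leq (leq_maxl _ _) hk.
  exact: dual_at_leq (leq_maxr _ _) hl.
- by move=> f hf v [k hk]; exists k; case: (dual_at_submod k) => _ h; exact: h.
Qed.

Lemma scal_linear (C : V -> Prop) (a : F) (u : V) : submod (@scalops F V) C -> C u -> C (a *: u).
Proof. by move=> h; exact: submodZ. Qed.

Lemma dual_at_fdim k : fdim (dual_at k).
Proof.
have [es esP] := Gfin k.
have evl e : exists f : {linear V -> F^o}, forall psi, f psi = psi e.
  have h : linear (fun psi : V => psi e) by [].
  pose m := GRing.isLinear.Build F V F^o *:%R (fun psi : V => psi e) h.
  by exists (HB.pack_for {linear V -> F^o} (fun psi : V => psi e) m).
have [ev evE] := choice evl.
apply: (@fdim_kers F V F^o [seq ev e | e <- es] (dual_at k) (fun=> True)).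
- exact: dual_at_submod.
- exists [:: (1 : F^o)] => v _; exists v, 0 => //.
  by rewrite addr0; apply/esym; exact: mulr1.
- by [].
exists [::] => psi [[lp hp] h] /=; apply/funext => v.
have [w hw Gw] := esP v; rewrite -(subrK w v) linD // hp // add0r.
apply: (@lspan_sub F L (fun w => psi w = 0) es) hw => [|e ees].
  apply: scalops_submod; first exact: lin0.
    by move=> u u' hu hu'; rewrite linD // hu hu' addr0.
  by move=> a u hu; rewrite linZ ?lin0 // hu; exact: mulr0.
rewrite -evE; apply: h; apply/In_map; exists e => //; exact/In_mem.
Qed.

(* Dual to Gsoc: psi is a functional of (t, y_i t) in L x L^d, which extends to one
   killing (G k)^(1+d). *)
Lemma dual_step k (C : V -> Prop) : (K0 <= k)%N -> submod ops C ->
  (forall psi, dual_at k psi -> C psi) -> forall psi, dual_at k.+1 psi -> C psi.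
Proof.
move=> Kk sC hC psi [lp hp]; have [psil psilE] := lin_linear lp.
pose T t : L * ('I_d -> L) := (t, fun i => y i t).
have Tl : linear T.
  by move=> a u v; congr pair; apply/funext => i; rewrite linearP.
pose Tm := GRing.isLinear.Build F L (L * ('I_d -> L))%type *:%R T Tl.
pose TL := HB.pack_for {linear L -> (L * ('I_d -> L))%type} T Tm.
pose K (p : L * ('I_d -> L)) := G k p.1 /\ forall i, G k (p.2 i).
have [[G0 GB] _] := sG k.
have sK : submod (@scalops F (L * ('I_d -> L))%type) K.
  apply: scalops_submod.
  - by split=> // i; exact: G0.
  - move=> u v [u1 u2] [v1 v2]; split; first exact: sgD (proj1 (sG k)) u1 v1.
    by move=> i; exact: sgD (proj1 (sG k)) (u2 i) (v2 i).
  - move=> a u [u1 u2]; split; first exact: submodZ.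
    by move=> i; apply: submodZ.
have sT : submod (@scalops F L) (fun _ => True) by [].
have [|phi [phiK phiT]] := @extend_functional F L _ TL psil _ K sT sK.
  by move=> t _ [Gt Gyt]; rewrite psilE; apply: hp; exact: Gsoc.
pose psi0 (t : L) : F^o := phi (t, 0).
pose e i (t : L) : 'I_d -> L := fun j => if j == i then t else 0.
pose psi_ i (t : L) : F^o := phi (0, e i t).
have C0 : C psi0.
  apply: hC; split=> [a u v|t Gt]; last by apply: phiK; split=> // i; exact: G0.
  rewrite /psi0 -(linearP phi a ((u, 0) : L * ('I_d -> L)) (v, 0)); congr (phi _).
  by congr pair; rewrite /= scaler0 addr0.
have Ci i : C (yop i (psi_ i)).
  apply: ops_y => //; apply: hC; split=> [a u v|t Gt].
    rewrite /psi_ -(linearP phi a ((0, e i u) : L * ('I_d -> L)) (0, e i v)); congr (phi _).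
    congr pair; first by rewrite /= scaler0 addr0.
    apply/funext => j; change (e i (a *: u + v) j = a *: e i u j + e i v j).
    by rewrite /e; case: eqP => // _; rewrite scaler0 addr0.
  by apply: phiK; split=> //= j; rewrite /e; case: eqP.
have -> : psi = psi0 + \sum_i yop i (psi_ i).
  apply/funext => t; rewrite -psilE -phiT //.
  have -> : (psi0 + \sum_i yop i (psi_ i)) t = psi0 t + \sum_i psi_ i (y i t).
    by congr (_ + _); elim/big_rec2: _ => // i u v _ <-.
  rewrite /psi0 /psi_ -raddf_sum -raddfD; congr (phi _).
  have sE : \sum_i ((0, e i (y i t)) : L * ('I_d -> L)) = (0, fun i => y i t).
    have -> : \sum_i ((0, e i (y i t)) : L * ('I_d -> L)) = (\sum_(i < d) 0, \sum_i e i (y i t)).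
      by elim/big_rec3: _ => // i u v w _ ->.
    congr pair; first by rewrite big1.
    apply/funext => j; have -> : (\sum_i e i (y i t)) j = \sum_i e i (y i t) j.
      by elim/big_rec2: _ => // i u v _ <-.
    by rewrite (bigD1 j) //= /e eqxx big1 ?addr0 // => i ij; rewrite eq_sym (negbTE ij).
  by rewrite sE; congr pair; rewrite /= ?addr0 ?add0r.
apply: sgD (proj1 sC) C0 _; apply: sg_sum; first exact: proj1 sC.
by move=> i _; exact: Ci.
Qed.

(** By [dual_step] the functionals killing G_K0 generate the dual under the transposed y. They form
    a finite dimensional space, so the basis theorem applies. *)
Lemma noeth_dual : noeth ops dual.
Proof.
apply: (@noeth_gen V (@scalops F V) (dual_at K0) dual yopl).
- move=> f x [a fa] /yopl_In[i ->] v; rewrite !fa.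
  by apply/funext.
- move=> x x' /yopl_In[i ->] /yopl_In[j ->] v; apply/funext => t.
  by change (v (y j (y i t)) = v (y i (y j t))); rewrite yC.
- exact: dual_at_submod.
- by have := fdim_noeth (dual_at_fdim K0).
- move=> C sC h psi [k hk].
  have {}hk : dual_at (K0 + k) psi by apply: dual_at_leq hk; exact: leq_addl.
  elim: k psi hk => [|k IH] psi; first by rewrite addn0; exact: h.
  by rewrite addnS; apply: dual_step => //; exact: leq_addr.
Qed.

End ContinuousDual.

(** * Lifting nilpotent vectors by duality *)

Section LiftNilpotents.
Variables (F : fieldType) (L M : lmodType F) (d : nat).
Variables (y : 'I_d -> {linear L -> L}) (z : 'I_d -> {linear M -> M}) (g : {linear L -> M}).
Variables (G : nat -> L -> Prop) (G' : nat -> M -> Prop) (K0 : nat).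
Hypothesis yC : forall i j t, y i (y j t) = y j (y i t).
Hypothesis sG : forall k, submod (@scalops F L) (G k).
Hypothesis GS : forall k t, G k.+1 t -> G k t.
Hypothesis Gy : forall k i t, G k.+1 t -> G k (y i t).
Hypothesis Gsoc : forall k t, (K0 <= k)%N -> G k t -> (forall i, G k (y i t)) -> G k.+1 t.
Hypothesis Gfin : forall k, exists es : seq L, forall v, exists2 w, lspan es w & G k (v - w).
Hypothesis Gsep : forall t, (forall k, G k t) -> t = 0.
Hypothesis Gcomp : forall s : nat -> L, (forall k, G k (s k.+1 - s k)) ->
  exists t, forall k, G k (t - s k).
Hypothesis sG' : forall k, submod (@scalops F M) (G' k).
Hypothesis G'S : forall k t, G' k.+1 t -> G' k t.
Hypothesis G'y : forall k i t, G' k.+1 t -> G' k (z i t).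
Hypothesis G'sep : forall t, (forall k, G' k t) -> t = 0.
Hypothesis gy : forall i t, g (y i t) = z i (g t).
Hypothesis gG : forall k t, G k t -> G' k (g t).
Hypothesis gsurj : forall m, exists t, g t = m.

Fixpoint wkilled (N : lmodType F) (x : 'I_d -> {linear N -> N}) k (t : N) : Prop :=
  if k is k'.+1 then forall i, wkilled x k' (x i t) else t = 0.

Lemma dual_separates_points (N : lmodType F) (Gs : nat -> N -> Prop) t :
  (forall k, submod (@scalops F N) (Gs k)) -> (forall t, (forall k, Gs k t) -> t = 0) ->
  (forall psi, dual Gs psi -> psi t = 0) -> t = 0.
Proof.
move=> sGs sep h; apply: sep => k; apply: contrapT => nG.
have [phi [phiG phi1]] := separation (sGs k) nG.
have : phi t = 0 by apply: (h phi); exists k; split=> // a u v; exact: linearP.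
by move/eqP; rewrite phi1 oner_eq0.
Qed.

Local Notation V := (L -> F^o).
Local Notation V' := (M -> F^o).
Local Notation ops := (adj_ops (@scalops F V) (yopl y)).

Definition pullback (psi : V') : V := fun t => psi (g t).
Lemma pullback_linear : linear pullback. Proof. by []. Qed.
HB.instance Definition _ := GRing.isLinear.Build F V' V *:%R pullback pullback_linear.

Lemma pullback_inj psi psi' : pullback psi = pullback psi' -> psi = psi'.
Proof.
by move=> h; apply/funext => m; have [t <-] := gsurj m; exact: (congr1 (@^~ t) h).
Qed.

Lemma pullback_dual psi : dual G' psi -> dual G (pullback psi).
Proof.
move=> [k [lp h]]; exists k; split; last by move=> t Gt; apply: h; exact: gG.
by move=> a u v; rewrite /pullback linearP lp.
Qed.

Definition pulled (chi : V) := exists2 psi, dual G' psi & chi = pullback psi.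

Lemma pulled_submod : submod ops pulled.
Proof.
have sD := dual_submod G'S G'y.
apply: ops_stable.
  apply: scalops_submod.
  - by exists 0 => //; case: sD => -[].
  - move=> _ _ [psi hp ->] [psi' hp' ->]; exists (psi + psi') => //.
    exact: sgD (proj1 sD) hp hp'.
  - move=> a _ [psi hp ->]; exists (a *: psi) => //.
    exact: scal_linear (ops_scal sD) hp.
move=> i _ [psi hp ->]; exists (yop z i psi); first exact: ops_y.
by apply/funext => t; change (psi (g (y i t)) = psi (z i (g t))); rewrite gy.
Qed.

(** A word of length k in the transposed operators, evaluated at [t], is a functional evaluated at a
    word of length k applied to [t]. *)
Lemma pulled_pw k chi : pw (yopl y) pulled k chi ->
  exists psi, [/\ dual G' psi, chi = pullback psi & forall t, wkilled z k t -> psi t = 0].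
Proof.
have sD := dual_submod G'S G'y.
elim=> {k chi}.
- move=> _ [psi hp ->]; exists psi; split=> // _ ->.
  by case: hp => k [lp _]; exact: lin0.
- by move=> k; exists 0; split=> //; case: sD => -[].
- move=> k _ _ _ [psi [hp -> h]] _ [psi' [hp' -> h']].
  exists (psi + psi'); split=> //; first exact: sgD (proj1 sD) hp hp'.
  by move=> t kt; change (psi t + psi' t = 0 :> F); rewrite h // h' // addr0.
- move=> k _ _ /yopl_In[i ->] _ [psi [hp -> h]].
  exists (yop z i psi); split; first exact: ops_y.
    by apply/funext => t; change (psi (g (y i t)) = psi (z i (g t))); rewrite gy.
  by move=> t kt; apply: h; exact: kt.
Qed.

(* If m is killed by words of length p, evaluation at m is a functional on the
   pullbacks of dual G' which kills y^p (pulled), hence, by Artin-Rees, extends to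
   a functional killing y^q (dual G); the latter is evaluation at the lift of m. *)
Lemma lift_nilpotent p m : wkilled z p m -> exists t, g t = m /\ exists q, wkilled y q t.
Proof.
move=> hm.
have sD := dual_submod GS Gy; have sD' := dual_submod G'S G'y.
have nD := noeth_dual yC sG GS Gsoc Gfin.
have [q hq] : exists q, forall chi, pw (yopl y) (dual G) q chi -> pulled chi ->
    pw (yopl y) pulled p chi.
  apply: (@artin_rees V ops (yopl y) (dual G)) => //.
  - by move=> x /yopl_In[i ->]; right; apply/List.Exists_exists; exists (yop y i); split=> //; exact: In_yopl.
  - move=> f x [[a fa]|/List.Exists_exists[_ [/yopl_In[j ->] fE]]] /yopl_In[i ->] v.
      by rewrite !fa; apply/funext.
    rewrite !fE; apply/funext => t.
    by change (v (y i (y j t)) = v (y j (y i t))); rewrite yC.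
  - exact: pulled_submod.
  - by move=> _ [psi hp ->]; exact: pullback_dual.
have evm : linear (fun psi : V' => psi m) by [].
pose evmm := GRing.isLinear.Build F V' F^o *:%R (fun psi : V' => psi m) evm.
pose ev_m := HB.pack_for {linear V' -> F^o} (fun psi : V' => psi m) evmm.
have spw : submod (@scalops F V) (pw (yopl y) (dual G) q).
  split; first by apply: pw_subgroup; exact: proj1 sD.
  move=> f [a fa]; apply: pw_stable; first by move=> v Dv; rewrite fa; exact: scal_linear (ops_scal sD) Dv.
  by move=> x /yopl_In[i ->] v; rewrite !fa; apply/funext.
have [|Lam [LamK LamT]] := @extend_functional F V' V pullback ev_m (dual G') _ (ops_scal sD') spw.
  move=> psi hp hchi; have [|psi' [hp' e h']] := pulled_pw (hq _ hchi _); first by exists psi.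
  by rewrite (pullback_inj e); exact: h'.
(* A functional killing G_k is determined by finitely many values, so there [Lam] is evaluation at
   some point [s k], unique modulo G_k; hence the [s k] converge. *)
have /choice[s sE] k : exists t, forall psi, dual_at G k psi -> Lam psi = psi t.
  have [es esP] := Gfin k.
  apply: (@represent F L Lam (dual_at G k) es (dual_at_submod G k)) => [psi []//|psi [lp hp] he].
  have -> : psi = 0; last exact: raddf0.
  apply/funext => v; have [w hw Gw] := esP v; rewrite -(subrK w v) linD // hp // add0r.
  apply: (@lspan_sub F L (fun w => psi w = 0) es) hw => [|e ees]; last exact: he.
  apply: scalops_submod; first exact: lin0.
    by move=> u u' hu hu'; rewrite linD // hu hu' addr0.
  by move=> a u hu; rewrite linZ ?lin0 // hu; exact: mulr0.
have [t ht] : exists t, forall k, G k (t - s k).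
  apply: Gcomp => k; apply: contrapT => nG.
  have [phi [phiG phi1]] := separation (sG k) nG.
  have hk : dual_at G k phi by split=> // a u v; exact: linearP.
  have hk1 : dual_at G k.+1 phi by exact: dual_at_leq hk.
  have : phi (s k.+1 - s k) = 0 by apply: etrans (raddfB phi _ _) _; rewrite -!sE // subrr.
  by move/eqP; rewrite phi1 oner_eq0.
have tE psi : dual G psi -> psi t = Lam psi.
  move=> [k [lp hp]]; have := hp _ (ht k); rewrite linB // (sE k psi) // => /eqP.
  by rewrite subr_eq0 => /eqP.
exists t; split.
  apply/eqP; rewrite -subr_eq0; apply/eqP; apply: (dual_separates_points sG' G'sep) => psi hp.
  have lp : lin psi by case: hp => k [].
  rewrite linB // -[psi (g t)]/(pullback psi t) tE; last exact: pullback_dual.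
  by rewrite LamT // subrr.
exists q; suff kill j u : (forall chi, pw (yopl y) (dual G) j chi -> chi u = 0) -> wkilled y j u.
  apply: kill => chi hchi; rewrite tE ?LamK //.
  apply: (pw_sub (proj1 sD)) hchi => x /yopl_In[i ->] psi hp.
  exact: ops_y.
elim: j u => [|j IH] u hu.
  by apply: (dual_separates_points sG Gsep) => psi hp; apply: hu; exact: pw_top.
move=> i; apply: IH => chi hchi.
by apply: (hu (yop y i chi)); apply: pw_mul => //; exact: In_yopl.
Qed.

End LiftNilpotents.

(** * Modules of functions with values in a complete module *)

Section EvaluationData.
Variables (F : numClosedFieldType) (V : vectType F) (W W' : finGroupType).
Variables (rho : linrep V W) (c : W -> F) (rho' : linrep V W') (c' : W' -> F).
Local Notation H := (cherednik rho c).
Local Notation H' := (cherednik rho' c').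
Local Notation hsc := (hscal rho c).
Local Notation hsc' := (hscal rho' c').
Local Notation xf k v := (filt (xops _) k v).

Definition formal (N : lmodType H') := [/\ separated (xops N), complete (xops N) &
  exists es : seq (restr hsc' N), forall v : N,
    exists2 w : N, lspan es (w : restr hsc' N) & filt (xops N) 1 (v - w)].

(* What is used of the H_c(W, V)-module Fun_{W_b}(W, N), whose elements are
   determined by their values ev w. *)
Record evaluations (L : lmodType H) (N : lmodType H') := Evaluations {
  ed_ev :> W -> {additive L -> N};
  ed_dt : W -> {additive N -> L};
  ed_rep : pred W;
  ed_scal : forall w a t, ed_ev w (hsc a *: t) = hsc' a *: ed_ev w t;
  ed_dt_scal : forall r a n, ed_rep r -> ed_dt r (hsc' a *: n) = hsc a *: ed_dt r n;
  ed_decomp : forall t, t = \sum_(r | ed_rep r) ed_dt r (ed_ev r t);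
  ed_dt_filt : forall k r w n, xf k n -> xf k (ed_ev w (ed_dt r n));
  ed_y : forall k y w t, (forall w', xf k (ed_ev w' t)) ->
    xf k (ed_ev w (hy rho c y *: t) - hy rho' c' (rho w y) *: ed_ev w t) }.

Section Object.
Variables (L : lmodType H) (N : lmodType H') (ev : evaluations L N).
Hypothesis fN : formal N.

(** The powers of (x) are those of the algebra of the values, where [gap] and [xf_soc] are
    available. *)
Definition evfilt k (t : L) := forall w, xf k (ev w t).
Local Notation LF := (restr hsc L).
Local Notation y i := (hact (M := L) (hy rho c (bvec i)) : {linear LF -> LF}).

Lemma evfilt_submod k : submod (@scalops F LF) (evfilt k : LF -> Prop).
Proof.
apply: (@scalops_submod F LF) => [w|u v hu hv w|a v hv w].
- rewrite raddf0; exact: filt0.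
- rewrite raddfD; exact: filtD.
- by rewrite ed_scal; apply: xf_sc.
Qed.

Lemma evfiltS k t : evfilt k.+1 t -> evfilt k t.
Proof. by move=> h w; apply: filt_leq (h w). Qed.

Lemma evfilt_y k v t : evfilt k.+1 t -> evfilt k (hy rho c v *: t).
Proof.
move=> h w; rewrite -(subrK (hy rho' c' (rho w v) *: ev w t) (ev w _)).
apply: filtD; first by apply: ed_y; exact: evfiltS.
exact: (xf_y (k := k.+1)) (h w).
Qed.

(** By [ed_y] a letter y acts on the value at [w] as the letter w y up to (x)^k; so if [t] and all
    [y t] have depth k, [xf_soc] applies to each value of [t]. *)
Lemma evfilt_soc k t : (gap rho' c' <= k)%N -> evfilt k t ->
  (forall i, evfilt k (hy rho c (bvec i) *: t)) -> evfilt k.+1 t.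
Proof.
move=> gk ht hyt w; apply: xf_soc => // v.
have hv v' : evfilt k (hy rho c v' *: t).
  move=> w'; rewrite hy_coord scaler_suml raddf_sum.
  apply: sg_sum => [|i _]; first exact: filt_sg.
  rewrite -scalerA ed_scal; apply: xf_sc; exact: hyt.
have := filtB (hv (rho w^-1%g v) w) (ed_y (rho w^-1%g v) w ht).
by rewrite opprB addrCA subrr addr0 repVK.
Qed.

Lemma evfilt_fin k : exists es : seq LF, forall v : LF,
  exists2 w : LF, lspan es w & evfilt k (v - w : L).
Proof.
have [sepN compN finN] := fN; have [es esP] := xf_fin finN k.
have /choice[f fP] : forall n : N, exists w : N, lspan es (w : restr hsc' N) /\ xf k (n - w).
  by move=> n; have [w hw nw] := esP n; exists w.
exists (flatten [seq [seq (ed_dt ev r e : LF) | e <- es] | r <- enum (ed_rep ev)]) => t.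
exists (\sum_(r | ed_rep ev r) ed_dt ev r (f (ev r t))).
  apply: sg_sum => [|r rr]; first exact: (proj1 (lspan_submod _)).
  apply: (@lspan_incl F LF [seq (ed_dt ev r e : LF) | e <- es]).
    move=> e he; apply/flattenP; exists [seq (ed_dt ev r e : LF) | e <- es] => //.
    by apply: map_f; rewrite mem_enum.
  have [hw _] := fP (ev r t).
  apply: (@lspan_map F (restr hsc' N) LF (ed_dt ev r)) hw.
  - exact: raddf0.
  - exact: raddfD.
  - by move=> a n; exact: ed_dt_scal.
move=> w; rewrite [t in t - _](ed_decomp ev) -sumrB raddf_sum.
apply: sg_sum => [|r _]; first exact: filt_sg.
  rewrite -raddfB; apply: ed_dt_filt.
by have [_] := fP (ev r t).
Qed.

Lemma evfilt_sep t : (forall k, evfilt k t) -> t = 0.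
Proof.
have [sepN _ _] := fN; move=> h; rewrite (ed_decomp ev t) big1 // => r _.
by rewrite (sepN (ev r t)) ?raddf0 // => k; exact: h.
Qed.

Lemma evfilt_complete (s : nat -> L) : (forall k, evfilt k (s k.+1 - s k)) ->
  exists t, forall k, evfilt k (t - s k).
Proof.
have [_ compN _] := fN; move=> h.
have /choice[n nP] : forall r, exists n, forall k, xf k (n - ev r (s k)).
  by move=> r; apply: compN => k; rewrite -raddfB; exact: h.
exists (\sum_(r | ed_rep ev r) ed_dt ev r (n r)) => k w.
rewrite [s k](ed_decomp ev) -sumrB raddf_sum; apply: sg_sum => [|r _]; first exact: filt_sg.
  by rewrite -raddfB; apply: ed_dt_filt; exact: nP.
Qed.

Lemma evaluations_soc_fdim : fdim (fun v : LF => killed 1 (v : L)).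
Proof.
have [es esP] := evfilt_fin (gap rho' c').
have sid : linear (idfun : LF -> LF) by [].
apply: (@fdim_ker F LF LF (idfun : {linear LF -> LF}) _ (evfilt (gap rho' c') : LF -> Prop) es).
- exact: killed_submod.
- exact: evfilt_submod.
- by move=> v _; have [w hw vw] := esP v; exists w.
exists [::] => t [kt ht] /=; apply: evfilt_sep => k.
have hk : evfilt (gap rho' c' + k) t.
  elim: k => [|k IH]; first by rewrite addn0.
  rewrite addnS; apply: evfilt_soc => //; first exact: leq_addr.
  by move=> i w; have /= -> := kt (bvec i); rewrite raddf0; exact: filt0.
by move=> w; apply: filt_leq (hk w); exact: leq_addl.
Qed.

Lemma evaluations_E_O : category_O rho c (nilp_functor rho c L).
Proof. by apply: E_category_O; exact: evaluations_soc_fdim. Qed.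

Lemma wkilled_killed k (t : L) : wkilled (fun i => y i) k (t : LF) <-> killed k t.
Proof.
elim: k t => [//|k IH] t; split=> h.
  move=> v; rewrite hy_coord scaler_suml; elim/big_rec: _ => [|i u _ hu]; first exact: killed0.
  apply: killedD => //; rewrite -scalerA; apply: killed_scal; apply/IH; exact: h.
by move=> i; apply/IH; exact: h.
Qed.
End Object.

Lemma evaluations_lift (L M : lmodType H) (N K : lmodType H') (ev : evaluations L N)
    (ev' : evaluations M K) (g : {linear L -> M}) (f : {linear N -> K}) :
  formal N -> formal K -> (forall w t, ev' w (g t) = f (ev w t)) ->
  (forall m, exists t, g t = m) ->
  forall m, h_nilpotent m -> exists2 t, h_nilpotent t & g t = m.
Proof.
move=> fN fK gf gs m [p /wkilled_killed hm].
have [|||||||||||||||t [gt [q /wkilled_killed hq]]] := @lift_nilpotent F (restr hsc L) (restr hsc M) _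
  (fun i => hact (M := L) (hy rho c (bvec i)) : {linear restr hsc L -> restr hsc L})
  (fun i => hact (M := M) (hy rho c (bvec i)) : {linear restr hsc M -> restr hsc M})
  (restr_map g) (evfilt ev) (evfilt ev') (gap rho' c') _ _ _ _ _ _ _ _ _ _ _ _ _ _ _ p m hm.
- by move=> i j t; apply: etrans (scalerA _ _ (t : L)) _; rewrite hyy; exact: esym (scalerA _ _ (t : L)).
- exact: evfilt_submod.
- exact: evfiltS.
- by move=> k i t; exact: evfilt_y.
- exact: evfilt_soc.
- exact: evfilt_fin.
- exact: evfilt_sep.
- exact: evfilt_complete.
- exact: evfilt_submod.
- exact: evfiltS.
- by move=> k i t; exact: evfilt_y.
- exact: evfilt_sep.
- by move=> i t; change (g (hy rho c (bvec i) *: (t : L)) = hy rho c (bvec i) *: g t); exact: linearZ.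
- by move=> k t ht w; rewrite [ev' w _]gf; exact: filt_hom (ht w).
- exact: gs.
by exists t => //; exists q.
Qed.
End EvaluationData.

(** * Evaluations of equivariant functions *)

(** Both cases of the definition are covered: an inverse commutes with whatever [u] commutes with,
    and so does the default value 0. *)
Lemma ring_inv_comm (A : pzRingType) (u a : A) : a * u = u * a -> a * ring_inv u = ring_inv u * a.
Proof.
move=> au; rewrite /ring_inv; case: xgetP => [r _ [ur ru]|_]; last by rewrite mulr0 mul0r.
by rewrite -[LHS]mul1r -ru -!mulrA [u * _]mulrA -au -mulrA ur mulr1.
Qed.

Section ThetaEvaluations.
Variables (F : numClosedFieldType) (V : vectType F) (W : finGroupType) (rho : linrep V W).
Variables (c : W -> F) (b : V).
Variables (Hb : completed_cherednik rho c b)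
  (H0 : completed_cherednik (par_rep rho b) (par_c rho c b) 0) (th : theta_iso Hb H0).
Local Notation rho' := (par_rep rho b).
Local Notation c' := (par_c rho c b).
Local Notation K := (stab rho b).
Local Notation I := (Ifunctor (par_iota H0)).
Local Notation rs N := (restr (cc_alg H0) N).
Local Notation hsc := (hscal rho c).
Local Notation hsc' := (hscal rho' c').
Variable N : lmodType H0.
Local Notation evw w t := (ev (par_iota H0) w (t : I N)).
Local Notation xf k v := (filt (xops (rs N)) k v).

Definition theta_coef (y : V) (w s : W) : H0 :=
  cc_alg H0 (hsc' (2%:R * c s / (1 - lambda rho s) * alpha rho s (rho w y)))
  * ring_inv (cc_alg H0 (hx rho' c' (alpha rho s) + hsc' (alpha rho s b))).

Lemma ev_y y w (t : IH th N) :
  evw w (hy rho c y *: t) = hy rho' c' (rho w y) *: (evw w t : rs N) +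
    \sum_(s in reflections rho | s \notin K) theta_coef y w s *: (evw (s * w)%g t - evw w t).
Proof.
have [_ _ _ thy] := thetaE th.
elim/tens_ind: t => [|t t' ht ht'|f n].
- have e0 w' : evw w' 0 = 0 := raddf0 (ev (par_iota H0) w' : {additive I N -> N}).
  apply: etrans (congr1 _ (scaler0 (I N) (th (cc_alg Hb (hy rho c y))))) _.
  rewrite e0 scaler0 add0r big1 // => s _; rewrite !e0 subrr; exact: scaler0.
- have eD w' u v : evw w' (u + v) = evw w' u + evw w' v.
    exact: (raddfD (ev (par_iota H0) w' : {additive I N -> N})).
  apply: etrans (congr1 _ (scalerDr (th (cc_alg Hb (hy rho c y))) (t : I N) t')) _.
  apply: etrans (eD _ _ _) _; apply: etrans (congr2 +%R ht ht') _.
  rewrite eD scalerDr addrACA; congr (_ + _); rewrite -big_split; apply: eq_bigr => s _.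
  rewrite /= -scalerDr; congr (_ *: _); rewrite !eD opprD; exact: addrACA.
- apply: etrans (congr1 _ (tensZ _ _ _ _ _)) _.
  rewrite !evE thy scalerDl scaler_suml; congr (_ + _); first exact: esym (scalerA _ _ _).
  apply: eq_bigr => s _; rewrite -scalerA; congr (_ *: _).
  by rewrite scalerBl !evE.
Qed.

(** The denominator commutes with every x, hence so does [ring_inv] of it, and an operator commuting
    with the x preserves each (x)^k. This is why the reflection terms of theta(y) preserve the
    filtration. *)
Lemma xf_ring_inv k (x : 'Hom(V, F^o)) a (v : rs N) : xf k v ->
  xf k (ring_inv (cc_alg H0 (hx rho' c' x + hsc' a)) *: (v : N)).
Proof.
pose u := ring_inv (cc_alg H0 (hx rho' c' x + hsc' a)).
apply: (@pw_stable _ (xops (rs N)) (fun=> True) k (GRing.scale u : {additive N -> N})) => // f.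
move=> /xops_In[x' ->] n; apply: etrans (scalerA u _ (n : N)) _.
apply: etrans _ (esym (scalerA _ u (n : N))); congr (@GRing.scale H0 N _ _).
apply/esym/ring_inv_comm; rewrite -!rmorphM; congr (cc_alg H0 _).
by rewrite mulrDl mulrDr hxx hscalC.
Qed.

Lemma xf_theta_coef k y w s (v : rs N) : xf k v -> xf k (theta_coef y w s *: (v : N)).
Proof.
move=> hv; rewrite /theta_coef -scalerA; apply: (@xf_sc _ _ _ _ _ (rs N)).
exact: xf_ring_inv.
Qed.

Lemma dten_scal r a (n : rs N) : isrep K r ->
  (dten (@par_iotaM _ _ _ _ _ _ H0) r (hsc' a *: n : N) : IH th N) =
  hsc a *: (dten (@par_iotaM _ _ _ _ _ _ H0) r (n : N) : IH th N).
Proof.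
have [z zE] : exists z : polyinv rho, val z = pscal _ a by apply: inv_ex => w; exact: poly_act_scal.
have zE1 : inv_cher rho c z = hsc a by rewrite /= zE poly_cher_scal.
have zE2 : shift_inv rho' c' b rho z = hsc' a by rewrite /= zE shift_scal.
by rewrite -zE1 -zE2 => hr; exact: esym (dten_inv _ _ _ hr).
Qed.

Lemma filt_dten_x k r w (n : rs N) : xf k n ->
  xf k (evw w (dten (@par_iotaM _ _ _ _ _ _ H0) r (n : N))).
Proof.
move=> hn; rewrite ev_dten /= /hdelta_fun; case: ifP => _.
  by apply: (@xf_w _ _ _ _ _ (rs N)).
rewrite scale0r; exact: filt0.
Qed.

Lemma ev_y_filt k y w (t : IH th N) : (forall w', xf k (evw w' t : rs N)) ->
  xf k ((evw w (hy rho c y *: t) : rs N) - hy rho' c' (rho w y) *: (evw w t : rs N)).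
Proof.
move=> ht; rewrite ev_y addrC addKr; apply: sg_sum => [|s _]; first exact: filt_sg.
by apply: xf_theta_coef; apply: filtB.
Qed.

Definition theta_evaluations : evaluations (IH th N) (rs N).
Proof.
exact: (@Evaluations F V W _ rho c rho' c' (IH th N) (rs N)
  (fun w => ev (par_iota H0) w : {additive I N -> N})
  (fun r => dten (@par_iotaM _ _ _ _ _ _ H0) r : {additive N -> I N}) (isrep K)
  (fun w a t => ev_scal a w t) (fun r a n hr => dten_scal a n hr)
  (fun t => ev_decomp _ t) (fun k r w n hn => filt_dten_x r w hn)
  (fun k y w t ht => ev_y_filt y w ht)).
Defined.

End ThetaEvaluations.

(** * Exactness of induction and restriction *)

Lemma linear_ext (A : pzRingType) (M N : lmodType A) (f g : {linear M -> N}) : f =1 g -> f = g.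
Proof.
case: f g => f cf [g cg] /= /funext E; move: cf cg; rewrite -E => {g E} cf cg.
destruct cf as [a s]; destruct cg as [a' s']; destruct a as [a], a' as [a'], s as [s], s' as [s'].
by rewrite (Prop_irrelevance a a') (Prop_irrelevance s s').
Qed.

Lemma fmap_bij (A B : pzRingType) (T : prefunctor A B) :
  (forall M : lmodType A, fmap T (idfun : {linear M -> M}) =1 id) ->
  (forall (M N K : lmodType A) (f : {linear M -> N}) (g : {linear N -> K}),
     fmap T (g \o f : {linear M -> K}) =1 fmap T g \o fmap T f) ->
  forall (M N : lmodType A) (f : {linear M -> N}), bijective f -> bijective (fmap T f).
Proof.
move=> Tid Tcomp M N f /linear_inverse[g fK gK]; exists (fmap T g) => v.
  have /= <- := Tcomp _ _ _ f g v.
  by rewrite (@linear_ext _ _ _ (g \o f) idfun) ?Tid // => u; exact: fK.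
have /= <- := Tcomp _ _ _ g f v.
by rewrite (@linear_ext _ _ _ (f \o g) idfun) ?Tid // => u; exact: gK.
Qed.

Lemma functor_compA (A B C D : pzRingType) (T : prefunctor A B) (S : prefunctor B C)
    (U : prefunctor C D) :
  functor_comp U (functor_comp S T) = functor_comp (functor_comp U S) T.
Proof. by []. Qed.

Section ExactComposition.
Variables (A B D : pzRingType) (P : lmodType A -> Prop) (Q : lmodType B -> Prop)
  (R : lmodType D -> Prop) (T : prefunctor A B) (S : prefunctor B D).

Lemma is_functor_comp : is_functor P Q T -> is_functor Q R S -> is_functor P R (functor_comp S T).
Proof.
move=> [TO Tid Tcomp] [SO Sid Scomp]; split.
- by move=> M /TO/SO.
- move=> M PM v /=.
  have -> : fmap T (idfun : {linear M -> M}) = (idfun : {linear T M -> T M}).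
    by apply: linear_ext; exact: Tid.
  by apply: Sid; exact: TO.
- move=> M N K f g PM PN PK v /=.
  have -> : fmap T (g \o f : {linear M -> K}) = (fmap T g \o fmap T f : {linear T M -> T K}).
    by apply: linear_ext; exact: Tcomp.
  by apply: Scomp; exact: TO.
Qed.

Lemma exact_functor_comp : exact_functor P Q T -> exact_functor Q R S ->
  exact_functor P R (functor_comp S T).
Proof.
move=> [fT eT] [fS eS]; split; first exact: is_functor_comp.
have [TO _ _] := fT; move=> M N K f g PM PN PK fg.
by apply: eS; [exact: TO|exact: TO|exact: TO|exact: eT].
Qed.
End ExactComposition.

Section NilpotentComposition.
Variables (F : numClosedFieldType) (V : vectType F) (W : finGroupType) (rho : linrep V W).
Variables (c : W -> F) (B : pzRingType) (P : lmodType B -> Prop).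
Variable T : prefunctor B (cherednik rho c).
Local Notation E := (nilp_functor rho c).
Local Notation O := (category_O rho c).

(** Taking h-nilpotent vectors is left exact; the second hypothesis supplies surjectivity on the
    modules that occur, by spectral projection for restriction and by duality for induction. *)
Lemma nilp_comp_exact : exact_functor P (fun N => O (E N)) T ->
  (forall (M N : lmodType B) (g : {linear M -> N}), P M -> P N ->
    (forall n, exists m, fmap T g m = n) ->
    forall n, h_nilpotent n -> exists2 m, h_nilpotent m & fmap T g m = n) ->
  exact_functor P O (functor_comp E T).
Proof.
move=> [fT eT] lift; split.
  apply: is_functor_comp fT _; split=> //; first by move=> M _; exact: E_id.
  by move=> M N K f g _ _ _; exact: E_comp.
move=> M N K f g PM PN PK fg; have hT := eT M N K f g PM PN PK fg.
by apply: E_exact => //; apply: lift => //; case: hT.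
Qed.
End NilpotentComposition.

(** * Assembling restriction and induction *)

Section Functors.
Variables (F : numClosedFieldType) (V : vectType F) (W : finGroupType) (rho : linrep V W).
Variables (c : W -> F) (b : V).
Variables (Hb : completed_cherednik rho c b)
  (H0 : completed_cherednik (par_rep rho b) (par_c rho c b) 0) (th : theta_iso Hb H0).
Local Notation rho' := (par_rep rho b).
Local Notation c' := (par_c rho c b).
Local Notation H := (cherednik rho c).
Local Notation I := (Ifunctor (par_iota H0)).
Local Notation rs N := (restr (cc_alg H0) N).
Variable Iinv : prefunctor (par_centr H0) H0.
Hypothesis Iinv_spec :
  quasi_inverse (fun=> True) (fun=> True) (Ifunctor (par_iota H0)) Iinv.
Variable zinv : prefunctor (cherednik (repU rho') c') (cherednik rho' c').
Hypothesis zinv_spec : quasi_inverse (category_O rho' c') (category_O (repU rho') c')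
  (zeta_functor rho' c') zinv.
Local Notation O_W := (category_O rho c).
Local Notation O_W' := (category_O (repU rho') c').
Local Notation Res_b := (Res_functor th Iinv).
Local Notation Ind_b := (Ind_functor th zinv).
Local Notation iM := (@par_iotaM _ _ _ _ _ _ H0).

Lemma formal_completion M : category_O rho' c' M -> formal (rs (completion_functor H0 M)).
Proof.
by move=> OM; split; [exact: hat0_separated|exact: hat0_complete|exact: hat0_fin].
Qed.

Lemma formal_Iinv M : O_W M ->
  formal (rs (Iinv (restr (theta_inv th) (completion_functor Hb M)))).
Proof. by move=> OM; exact: (Iinv_transport th Iinv_spec OM). Qed.

Local Notation formal0 := (fun N : lmodType H0 => formal (rs N)).

Lemma zinv_exact_functor : exact_functor O_W' (category_O rho' c') zinv.
Proof.
have [_ hz _ _] := zinv_spec; split; first exact: hz.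
by move=> M N K f g OM ON OK; exact: (zinv_exact zinv_spec OM ON OK).
Qed.

Lemma completion_exact_functor :
  exact_functor (category_O rho' c') formal0 (completion_functor H0).
Proof.
split; last by move=> M N K f g; exact: completion_exact.
split.
- exact: formal_completion.
- by move=> M _; exact: completion_id.
- by move=> M N K f g _ _ _; exact: completion_comp.
Qed.

Definition IH_functor : prefunctor H0 H :=
  functor_comp (restr_functor (cc_alg Hb)) (functor_comp (restr_functor th) I).

Lemma IH_exact_functor :
  exact_functor formal0 (fun N => O_W (nilp_functor rho c N)) IH_functor.
Proof.
split; last by move=> M N K f g _ _ _ fg; exact: (I_exact iM fg).
split.
- by move=> M fM; exact: (evaluations_E_O (theta_evaluations th M) fM).
- by move=> M _; exact: (I_id iM).
- by move=> M N K f g _ _ _; exact: (I_comp iM f g).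
Qed.

Lemma J_exact_functor : exact_functor formal0 O_W (functor_comp (nilp_functor rho c) IH_functor).
Proof.
apply: nilp_comp_exact; first exact: IH_exact_functor.
move=> M N g fM fN gs.
apply: (@evaluations_lift F V W _ rho c rho' c' (IH th M) (IH th N) (rs M) (rs N)
  (theta_evaluations th M) (theta_evaluations th N) (fmap IH_functor g) (restr_map g) fM fN _ gs).
by move=> w t; exact: (ev_natural (iota := par_iota H0) g w t).
Qed.

Lemma Ind_functorE : Ind_b = functor_comp (functor_comp (nilp_functor rho c) IH_functor)
  (functor_comp (completion_functor H0) zinv).
Proof. by rewrite /Ind_functor /IH_functor /E_functor !functor_compA. Qed.

Lemma Ind_exact : exact_functor O_W' O_W Ind_b.
Proof.
rewrite Ind_functorE; apply: exact_functor_comp J_exact_functor.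
exact: exact_functor_comp zinv_exact_functor completion_exact_functor.
Qed.

Lemma Iinv_exact_functor : exact_functor O_W formal0
  (functor_comp Iinv (functor_comp (restr_functor (theta_inv th)) (completion_functor Hb))).
Proof.
have hI : exact_functor (fun=> True) (fun=> True) Iinv.
  split; first by have [_ h _ _] := Iinv_spec.
  by move=> M N K f g _ _ _; exact: (Iinv_exact Iinv_spec).
have hC : exact_functor O_W (fun=> True) (completion_functor Hb).
  split; last by move=> M N K f g; exact: completion_exact.
  split=> //; first by move=> M _; exact: completion_id.
  by move=> M N K f g _ _ _; exact: completion_comp.
have hr : exact_functor (fun=> True) (fun=> True) (restr_functor (theta_inv th)) by [].
have [[_ h1 h2] h3] := exact_functor_comp (exact_functor_comp hC hr) hI.
by split=> //; split=> //; exact: formal_Iinv.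
Qed.

Lemma E_exact_functor : exact_functor formal0 (category_O rho' c') (E_functor H0).
Proof.
apply: nilp_comp_exact.
  split=> //; split=> // M [sM cM fM]; exact: E_O.
by move=> M N g [sM cM _] [sN _ _] gs; exact: E_lift.
Qed.

Lemma zeta_exact_functor : exact_functor (category_O rho' c') O_W' (zeta_functor rho' c').
Proof.
have [hz _ _ _] := zinv_spec; split; first exact: hz.
by move=> M N K f g _ [_ nN] _; exact: zeta_exact.
Qed.

Lemma Res_exact : exact_functor O_W O_W' Res_b.
Proof.
rewrite /Res_functor; apply: exact_functor_comp zeta_exact_functor.
exact: exact_functor_comp Iinv_exact_functor E_exact_functor.
Qed.

End Functors.

(** * Induction after restriction *)

Section NaturalIsomorphisms.
Variables (A B D : pzRingType) (P : lmodType A -> Prop).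

Lemma nat_isomorphic_trans (T T' T'' : prefunctor A B) :
  nat_isomorphic P T T' -> nat_isomorphic P T' T'' -> nat_isomorphic P T T''.
Proof.
move=> [e [eb en]] [e' [eb' en']].
exists (fun M => e' M \o e M : {linear T M -> T'' M}); split.
  by move=> M PM; apply: bij_comp; [exact: eb'|exact: eb].
move=> M N f PM PN v; apply: etrans (en' M N f PM PN (e M v)).
exact: congr1 (en M N f PM PN v).
Qed.

Lemma nat_isomorphic_compl (T T' : prefunctor A B) (S : prefunctor B D) :
  is_functor (fun=> True) (fun=> True) S ->
  nat_isomorphic P T T' -> nat_isomorphic P (functor_comp S T) (functor_comp S T').
Proof.
move=> [_ Sid Scomp] [eta [etab etan]]; exists (fun M => fmap S (eta M)); split.
  move=> M PM; apply: (@fmap_bij _ _ S _ _ _ _ _ (etab M PM)).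
    by move=> L; exact: Sid.
  by move=> L L' L'' f g; exact: Scomp.
move=> M N f PM PN v /=.
have e : (eta N \o fmap T f : {linear T M -> T' N}) = (fmap T' f \o eta M : {linear T M -> T' N}).
  by apply: linear_ext => u; exact: etan.
have c1 := Scomp _ _ _ (fmap T f) (eta N) Logic.I Logic.I Logic.I v.
have c2 := Scomp _ _ _ (eta M) (fmap T' f) Logic.I Logic.I Logic.I v.
by rewrite e in c1; exact: etrans (esym c1) c2.
Qed.

Lemma nat_isomorphic_compr (Q : lmodType B -> Prop) (R : prefunctor A B) (T T' : prefunctor B D) :
  (forall M, P M -> Q (R M)) -> nat_isomorphic Q T T' ->
  nat_isomorphic P (functor_comp T R) (functor_comp T' R).
Proof.
move=> PQ [eta [etab etan]]; exists (fun M => eta (R M)); split.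
  by move=> M /PQ; exact: etab.
by move=> M N f /PQ QM /PQ QN; exact: etan.
Qed.

End NaturalIsomorphisms.

Section AbstractComparison.
Variables (A B Z B0 A' U : pzRingType).
Variables (C : prefunctor A B) (r' : prefunctor B Z) (Iinv : prefunctor Z B0)
  (E0 : prefunctor B0 A') (zeta : prefunctor A' U) (zinv : prefunctor U A')
  (C0 : prefunctor A' B0) (I : prefunctor B0 Z) (r : prefunctor Z B) (E : prefunctor B A).
Variables (P : lmodType A -> Prop) (Q : lmodType B0 -> Prop) (P' : lmodType A' -> Prop).
Local Notation isf T := (is_functor (fun=> True) (fun=> True) T).
Hypotheses (fE : isf E) (fr : isf r) (fI : isf I) (fC0 : isf C0).
Hypothesis h1 : nat_isomorphic P' (functor_comp zinv zeta) (functor_id A').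
Hypothesis h2 : forall N, Q N -> P' (E0 N).
Hypothesis h3 : nat_isomorphic Q (functor_comp C0 E0) (functor_id B0).
Hypothesis h4 : forall M, P M -> Q (Iinv (r' (C M))).
Hypothesis h5 : nat_isomorphic (fun=> True) (functor_comp I Iinv) (functor_id Z).
Hypothesis h6 : nat_isomorphic (fun=> True) (functor_comp r r') (functor_id B).

(** Adjacent pairs cancel from the inside outwards: zeta, then nilpotent vectors against completion
    at 0 on the modules satisfying [Q], then I, then the two pullbacks along theta. *)
Lemma composite_nat_iso : nat_isomorphic P
  (functor_comp (functor_comp E (functor_comp r (functor_comp I (functor_comp C0 zinv))))
     (functor_comp zeta (functor_comp E0 (functor_comp Iinv (functor_comp r' C)))))
  (functor_comp E C).
Proof.
pose R := functor_comp Iinv (functor_comp r' C).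
have n1 : nat_isomorphic Q (functor_comp C0 (functor_comp (functor_comp zinv zeta) E0)) (functor_id B0).
  apply: nat_isomorphic_trans h3; apply: (nat_isomorphic_compl fC0).
  exact: (nat_isomorphic_compr (T' := functor_id A') h2 h1).
have n2 := nat_isomorphic_compr (R := R) h4 n1.
have n3 := nat_isomorphic_compl fE (nat_isomorphic_compl fr (nat_isomorphic_compl fI n2)).
apply: nat_isomorphic_trans n3 _; apply: (nat_isomorphic_compl fE).
have n4 := nat_isomorphic_compr (P := P) (R := functor_comp r' C) (fun _ _ => Logic.I) h5.
apply: nat_isomorphic_trans (nat_isomorphic_compl fr n4) _.
exact: (nat_isomorphic_compr (P := P) (R := C) (fun _ _ => Logic.I) h6).
Qed.
End AbstractComparison.

Section NaturalIsomorphism.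
Variables (F : numClosedFieldType) (V : vectType F) (W : finGroupType) (rho : linrep V W).
Variables (c : W -> F) (b : V).
Variables (Hb : completed_cherednik rho c b)
  (H0 : completed_cherednik (par_rep rho b) (par_c rho c b) 0) (th : theta_iso Hb H0).
Local Notation rho' := (par_rep rho b).
Local Notation c' := (par_c rho c b).
Local Notation I := (Ifunctor (par_iota H0)).
Variable Iinv : prefunctor (par_centr H0) H0.
Hypothesis Iinv_spec :
  quasi_inverse (fun=> True) (fun=> True) (Ifunctor (par_iota H0)) Iinv.
Variable zinv : prefunctor (cherednik (repU rho') c') (cherednik rho' c').
Hypothesis zinv_spec : quasi_inverse (category_O rho' c') (category_O (repU rho') c')
  (zeta_functor rho' c') zinv.
Local Notation O_W := (category_O rho c).
Local Notation O' := (category_O rho' c').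

Lemma E_is_functor : is_functor (fun=> True) (fun=> True) (E_functor Hb).
Proof.
apply: (@is_functor_comp _ _ _ (fun=> True) (fun=> True)); split=> //.
- by move=> M _; exact: E_id.
- by move=> M N K f g _ _ _; exact: E_comp.
Qed.

Lemma I_is_functor : is_functor (fun=> True) (fun=> True) I.
Proof.
split=> //; first by move=> M _; exact: (I_id (@par_iotaM _ _ _ _ _ _ H0)).
by move=> M N K f g _ _ _; exact: (I_comp (@par_iotaM _ _ _ _ _ _ H0)).
Qed.

Lemma completion_is_functor : is_functor (fun=> True) (fun=> True) (completion_functor H0).
Proof.
split=> //; first by move=> M _; exact: completion_id.
by move=> M N K f g _ _ _; exact: completion_comp.
Qed.

Lemma counit_nat_iso : nat_isomorphic (fun N : lmodType H0 => formal (restr (cc_alg H0) N))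
  (functor_comp (completion_functor H0) (E_functor H0)) (functor_id H0).
Proof.
exists (@counit _ _ _ _ _ H0); split; first by move=> N [sN cN fN]; exact: counit_bij.
by move=> M N f _ _ t; exact: counit_natural.
Qed.

Section ThetaRestriction.
Variable M : lmodType Hb.
Definition theta_restr_fun (v : restr th (restr (theta_inv th) M)) : M := v.
Lemma theta_restr_linear : linear theta_restr_fun.
Proof. by move=> h u v; rewrite /theta_restr_fun !restrZ thetaK. Qed.
HB.instance Definition _ := GRing.isLinear.Build Hb (restr th (restr (theta_inv th) M)) M *:%R
  theta_restr_fun theta_restr_linear.
End ThetaRestriction.

Lemma theta_nat_iso : nat_isomorphic (fun=> True)
  (functor_comp (restr_functor th) (restr_functor (theta_inv th))) (functor_id Hb).
Proof.
exists (fun M => theta_restr_fun (M := M) : {linear restr th (restr (theta_inv th) M) -> M}).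
by split=> // M _; exists id.
Qed.

Lemma Ind_Res_nat_iso : nat_isomorphic O_W (functor_comp (Ind_functor th zinv) (Res_functor th Iinv))
  (functor_comp (E_functor Hb) (completion_functor Hb)).
Proof.
apply: (composite_nat_iso E_is_functor _ I_is_functor completion_is_functor
  (P' := O') (Q := fun N : lmodType H0 => formal (restr (cc_alg H0) N))).
- by [].
- by have [_ _ h _] := zinv_spec.
- by move=> N [sN cN fN]; exact: E_O.
- exact: counit_nat_iso.
- by move=> M OM; exact: (formal_Iinv th Iinv_spec OM).
- by have [_ _ _ h] := Iinv_spec.
- exact: theta_nat_iso.
Qed.

End NaturalIsomorphism.

Theorem proposition3p9 (R : realType) (h : vectType (complex R))
    (W : finGroupType) (rho : linrep h W) (rho_faithful : injective rho)
    (c : W -> complex R)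
    (c_invariant : forall s g : W, s \in reflections rho -> c (s ^ g)%g = c s)
    (b : h)
    (Hb : completed_cherednik rho c b)
    (H0 : completed_cherednik (par_rep rho b) (par_c rho c b) 0)
    (th : theta_iso Hb H0)
    (Iinv : prefunctor (par_centr H0) H0)
    (Iinv_spec :
       quasi_inverse (fun=> True) (fun=> True) (Ifunctor (par_iota H0)) Iinv)
    (zinv : prefunctor (cherednik (repU (par_rep rho b)) (par_c rho c b))
                       (cherednik (par_rep rho b) (par_c rho c b)))
    (zinv_spec :
       quasi_inverse (category_O (par_rep rho b) (par_c rho c b))
                     (category_O (repU (par_rep rho b)) (par_c rho c b))
                     (zeta_functor (par_rep rho b) (par_c rho c b)) zinv) :
  let O_W := category_O rho c in
  let O_W' := category_O (repU (par_rep rho b)) (par_c rho c b) in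
  let Res_b := Res_functor th Iinv in
  let Ind_b := Ind_functor th zinv in
  (exact_functor O_W' O_W Ind_b /\ exact_functor O_W O_W' Res_b) /\
  nat_isomorphic O_W (functor_comp Ind_b Res_b)
    (functor_comp (E_functor Hb) (completion_functor Hb)).
Proof.
split; last exact: (Ind_Res_nat_iso th Iinv_spec zinv_spec).
by split; [exact: (Ind_exact th zinv_spec)|exact: (Res_exact th Iinv_spec zinv_spec)].
Qed.
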